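(* Let $S$ be a smooth complex projective rational surface and let $\eta$ be a zero-free meromorphic two-form on $S$ (i.e. $-\mathrm{Div}(\eta)$ is effective). Then there is a birational map $\psi:\mathbf{P}^2\dashrightarrow S$ such that one of the following holds: (1) (smooth case) the divisor $-\mathrm{Div}(\psi^*\eta)$ is a smooth cubic curve (taken with multiplicity one); (2) (toric case) $\psi^*\eta=\frac{dx\wedge dy}{xy}$; (3) (Euclidean case) $\psi^*\eta=dx\wedge dy$.
   Context: Here $(x,y)$ are affine coordinates on $\mathbf{C}^2\subset\mathbf{P}^2=\mathbf{P}^2(\mathbf{C})$, and $\mathrm{Div}(\eta)$ denotes the divisor (zeros minus poles) of a nonzero meromorphic two-form $\eta$. A rational surface is one birationally equivalent to $\mathbf{P}^2$.
   Formalization: In the toric case (2) the formal statement has ψ*η = c·dx∧dy/(xy) for some nonzero constant c; with c = 1 the claim fails, e.g. for η = 2 dx∧dy/(xy) on P², since birational maps preserve iterated residues up to sign. *)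

(* Defs.v *)
From mathcomp Require Import all_boot all_order all_algebra.
From mathcomp Require Export mpoly.
From mathcomp Require Export reals.
From mathcomp Require Export complex.

Set Implicit Arguments.
Unset Strict Implicit.
Unset Printing Implicit Defensive.

Import GRing.Theory.
Local Open Scope ring_scope.

(* Classical projective geometry over a field K (algebraically closed in all
   uses).  A point of P^n is handled through any of its homogeneous coordinate
   vectors v != 0; every notion below is invariant under rescaling v. *)

Record projset (K : fieldType) (n : nat) := ProjSet {
  eqns : seq {mpoly K[n.+1]};
  eqns_homog : all (fun p => p \is ishomog mdeg) eqns }.

Definition projspace (K : fieldType) (n : nat) : projset K n :=
  @ProjSet K n [::] isT.

Section Varieties.
Variables (K : fieldType) (n : nat).
Implicit Types (X : projset K n) (p q : {mpoly K[n.+1]}).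
Implicit Types (v w : 'rV[K]_n.+1).

Definition on X v : Prop :=
  v != 0 /\ forall p, p \in eqns X -> p.@[v 0] = 0.

Definition vanishes X p : Prop := forall v, on X v -> p.@[v 0] = 0.

(* Irreducibility in the Zariski topology: X is nonempty and is not covered by
   two closed subsets unless one of them is already everything. *)
Definition irreducible X : Prop :=
  (exists v, on X v) /\
  forall p q, p \is ishomog mdeg -> q \is ishomog mdeg ->
    vanishes X (p * q) -> vanishes X p \/ vanishes X q.

Definition differential p v w : K := \sum_i (p^`M(i)).@[v 0] * w 0 i.

(* Tangent space at v of the affine cone over X; its quotient by the line <v>
   is the tangent space of X at the point [v]. *)
Definition tangent X v w : Prop :=
  forall p, p \is ishomog mdeg -> vanishes X p -> differential p v w = 0.

(* dim T_[v] X = d, i.e. the cone has a (d+1)-dimensional tangent space. *)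
Definition tangent_dim X v (d : nat) : Prop :=
  exists B : 'M[K]_(d.+1, n.+1),
    row_free B /\ forall w, tangent X v w <-> (w <= B)%MS.

(* On an irreducible X the tangent dimension is >= dim X everywhere, with
   equality exactly at the smooth points, so this also forces dim X = 2. *)
Definition smooth_projective_surface X : Prop :=
  irreducible X /\ forall v, on X v -> tangent_dim X v 2.

(* (p, q) stands for p / q. *)
Definition ratfun : Type := ({mpoly K[n.+1]} * {mpoly K[n.+1]})%type.
Implicit Types f g u : ratfun.

Definition ratfun_on X f : Prop :=
  [/\ exists d : nat, f.1 \is d.-homog /\ f.2 \is d.-homog
    & ~ vanishes X f.2].

Definition ratfun_eq X f g : Prop := vanishes X (f.1 * g.2 - g.1 * f.2).

Definition rmul f g : ratfun := (f.1 * g.1, f.2 * g.2).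
Definition rinv f : ratfun := (f.2, f.1).

Definition rval f v : K := f.1.@[v 0] / f.2.@[v 0].

Definition rdiff f v w : K :=
  (f.2.@[v 0] * differential f.1 v w - f.1.@[v 0] * differential f.2 v w)
  / f.2.@[v 0] ^+ 2.

(* f lies in the local ring of X at v, resp. is a unit of that ring. *)
Definition regular_at X v f : Prop :=
  ratfun_on X f /\
  exists g, [/\ ratfun_on X g, ratfun_eq X f g & g.2.@[v 0] != 0].

Definition unit_at X v f : Prop :=
  ratfun_on X f /\
  exists g, [/\ ratfun_on X g, ratfun_eq X f g,
                g.1.@[v 0] != 0 & g.2.@[v 0] != 0].

(* A rational two-form: the list of the (h, a, b) stands for the sum of the
   h da /\ db.  Every element of the second exterior power of the Kaehler
   differentials of the function field is such a sum. *)
Definition twoform : Type := seq (ratfun * ratfun * ratfun).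
Implicit Types e : twoform.

Definition twoform_on X e : Prop :=
  forall h a b, (h, a, b) \in e ->
    [/\ ratfun_on X h, ratfun_on X a & ratfun_on X b].

Definition twoform_val e v w1 w2 : K :=
  \sum_(t <- e) rval t.1.1 v *
    (rdiff t.1.2 v w1 * rdiff t.2 v w2 - rdiff t.1.2 v w2 * rdiff t.2 v w1).

(* Two rational two-forms are equal when they agree, as alternating forms on
   tangent spaces, over a nonempty Zariski-open subset. *)
Definition twoform_eq X e1 e2 : Prop :=
  exists p, [/\ p \is ishomog mdeg, ~ vanishes X p &
    forall v, on X v -> p.@[v 0] != 0 ->
    forall w1 w2, tangent X v w1 -> tangent X v w2 ->
      twoform_val e1 v w1 w2 = twoform_val e2 v w1 w2].

(* Local coordinates at a smooth point of a surface: two functions regular at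
   v whose differentials are independent there. *)
Definition local_coords X v a b : Prop :=
  [/\ ratfun_on X a /\ ratfun_on X b, a.2.@[v 0] != 0, b.2.@[v 0] != 0 &
    exists w1 w2, [/\ tangent X v w1, tangent X v w2 &
      rdiff a v w1 * rdiff b v w2 - rdiff a v w2 * rdiff b v w1 != 0]].

(* A divisor on a smooth variety is given by its local equations:  D v f means
   that f is a local equation (f = 0 on zeros, f = oo on poles) of D at v. *)
Definition divisor : Type := 'rV[K]_n.+1 -> ratfun -> Prop.
Implicit Types D : divisor.

Definition divisor_eq X D1 D2 : Prop :=
  forall v, on X v -> forall f, ratfun_on X f -> (D1 v f <-> D2 v f).

Definition divisor_opp D : divisor := fun v f => D v (rinv f).

Definition effective X D : Prop :=
  forall v, on X v -> exists f, D v f /\ regular_at X v f.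

(* In local coordinates (a, b) at v the form is f u da /\ db with u a unit;
   Div e is then given near v by f. *)
Definition Div X e : divisor := fun v f =>
  ratfun_on X f /\
  exists a b u, [/\ local_coords X v a b, unit_at X v u
                  & twoform_eq X e [:: (rmul f u, a, b)]].

(* Divisor cut out by a form p of degree d, multiplicities included: near v it
   is given by p / q for any form q of degree d with q(v) != 0. *)
Definition form_divisor X (d : nat) p : divisor := fun v f =>
  ratfun_on X f /\
  exists q u, [/\ q \is d.-homog, q.@[v 0] != 0, unit_at X v u
                & ratfun_eq X f (rmul (p, q) u)].

(* p = 0 defines a smooth hypersurface, with its reduced structure. *)
Definition smooth_form p : Prop :=
  forall v, v != 0 -> p.@[v 0] = 0 -> exists i, (p^`M(i)).@[v 0] != 0.

End Varieties.

Section RationalMaps.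
Variable K : fieldType.

(* The rational map P^n --> P^m with homogeneous coordinate functions psi_j. *)
Definition homtuple (n m : nat) : Type := m.+1.-tuple {mpoly K[n.+1]}.

Definition ratmap n m (X : projset K n) (Y : projset K m)
    (psi : homtuple n m) : Prop :=
  [/\ exists d : nat, forall j, tnth psi j \is d.-homog,
      exists j, ~ vanishes X (tnth psi j) &
      forall p, p \in eqns Y -> vanishes X (p \mPo psi)].

Definition ratmap_comp n m k (chi : homtuple m k) (psi : homtuple n m) :
    homtuple n k :=
  [tuple tnth chi j \mPo psi | j < k.+1].

(* psi is defined at the generic point of X and is the identity of X there. *)
Definition is_identity n (X : projset K n) (psi : homtuple n n) : Prop :=
  (exists j, ~ vanishes X (tnth psi j)) /\
  forall i j, vanishes X (tnth psi i * 'X_j - tnth psi j * 'X_i).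

Definition birational n m (X : projset K n) (Y : projset K m)
    (psi : homtuple n m) : Prop :=
  ratmap X Y psi /\
  exists chi : homtuple m n,
    [/\ ratmap Y X chi, is_identity X (ratmap_comp chi psi)
      & is_identity Y (ratmap_comp psi chi)].

Definition rational_surface n (X : projset K n) : Prop :=
  exists psi, birational (projspace K 2) X psi.

Definition ratfun_pullback n m (psi : homtuple n m) (f : ratfun K m) :
    ratfun K n :=
  (f.1 \mPo psi, f.2 \mPo psi).

Definition twoform_pullback n m (psi : homtuple n m) (e : twoform K m) :
    twoform K n :=
  [seq (ratfun_pullback psi t.1.1, ratfun_pullback psi t.1.2,
        ratfun_pullback psi t.2) | t <- e].

(* Affine coordinates x = X_1 / X_0 and y = X_2 / X_0 on C^2 in P^2. *)
Definition aff_x : ratfun K 2 := ('X_(inord 1), 'X_0).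
Definition aff_y : ratfun K 2 := ('X_(inord 2), 'X_0).
Definition aff_const (c : K) : ratfun K 2 := (c%:MP, 1).

Definition dxdy : twoform K 2 := [:: (aff_const 1, aff_x, aff_y)].

(* c dx /\ dy / (x y).  The constant cannot be normalized away: up to sign it is
   the iterated residue at the corners, which birational maps preserve. *)
Definition dxdy_over_xy (c : K) : twoform K 2 :=
  [:: (rmul (aff_const c) (rinv (rmul aff_x aff_y)), aff_x, aff_y)].

End RationalMaps.

Arguments dxdy {K}.

(* Main.v *)
(** Pull everything back to the function field K of the plane, with the bracket
    {f, g} = f_x g_y - f_y g_x: in coordinates (x, y) of K the form is dx /\ dy
    divided by P = {x, y} / Q.  Among all birational maps from a Hirzebruch surface
    (or the plane) to S choose one of minimal degree along the rulings, then of
    minimal class.  Elementary transformations show that its base points have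
    multiplicity at most half that degree, so that blowing them up and comparing
    with S, where the form has no zeros, bounds P against the map on every divisor;
    Hartogs' theorem on S then bounds it on every valuation ring.  So P is an
    anticanonical section: a polynomial with deg_y P <= 2 of bounded weight, or a
    plane cubic.  Completing the square and moving roots of the discriminant to
    infinity leaves P = y^2 - h(x) with h a squarefree cubic, P = b x y, or P = 1. *)

From HB Require Import structures.
Require Import Defs.
From mathcomp Require Import all_boot all_order all_algebra.
From mathcomp Require Import boolp classical_sets.
From mathcomp Require Import generic_quotient ring zify.

Set Implicit Arguments.
Unset Strict Implicit.
Unset Printing Implicit Defensive.

Import Order.TTheory GRing.Theory Num.Theory.
Local Open Scope ring_scope.

(** * Valuation rings *)

(** No surface is ever blown up. A prime divisor over [S] is a valuation ring V of K, and the effect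
    of blowing up is read from the bracket {x', y'} of coordinates adapted to V. The obstacle is
    that a map to [S] may have infinitely near base points, where nothing is known about the form.
    It is met by an inequality of Noether-Fano type: if the map is given by polynomials [P k] in (x,
    y) and its base points have multiplicity at most N / M, then M v([P k]) <= N v({x, y} / {x',
    y'}) for the [P k] of least value. The zero-free form supplies v({x', y'} / Q) >= 0 when V maps
    onto a curve of [S], and the two combine to M v([P k]) <= N v({x, y} / Q), in which (x', y') no
    longer occurs. The pair (N, M) is (mu, 2) for degree mu on the rulings and (e, 3) for plane
    curves of degree e, because the anticanonical degree is 2 on a ruling and 3 on a line. If V maps
    to a point of [S], it is not compared with [S] directly: a finite projection of [S] to a plane
    reduces this case to integrality over C[z1, z2]. *)

Definition subring (K : fieldType) (R : K -> Prop) : Prop :=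
  [/\ R 1, forall a b, R a -> R b -> R (a - b)
    & forall a b, R a -> R b -> R (a * b)].

Definition valring (K : fieldType) (V : K -> Prop) : Prop :=
  subring V /\ forall f, V f \/ V f^-1.

(* The maximal ideal of a valuation ring V. *)
Definition mx (K : fieldType) (V : K -> Prop) (f : K) : Prop :=
  f = 0 \/ ~ V f^-1.

Definition integral (K : fieldType) (R : K -> Prop) (t : K) : Prop :=
  exists q : {poly K}, [/\ q \is monic, forall i, R q`_i & root q t].

Section Subring.
Variables (K : fieldType) (R : K -> Prop).
Hypothesis sR : subring R.

Lemma sr1 : R 1. Proof. by case: sR. Qed.
Lemma srB a b : R a -> R b -> R (a - b). Proof. by case: sR => _ + _; apply. Qed.
Lemma srM a b : R a -> R b -> R (a * b). Proof. by case: sR => _ _; apply. Qed.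
Lemma sr0 : R 0. Proof. by rewrite -(subrr 1); apply: srB; exact: sr1. Qed.
Lemma srN a : R a -> R (- a).
Proof. by rewrite -sub0r => Ra; apply: srB => //; exact: sr0. Qed.
Lemma srD a b : R a -> R b -> R (a + b).
Proof. by move=> Ra Rb; rewrite -[b]opprK; apply: srB => //; exact: srN. Qed.
Lemma srX a n : R a -> R (a ^+ n).
Proof.
by move=> Ra; elim: n => [|n IH]; rewrite ?expr0 ?exprS; [exact: sr1|exact: srM].
Qed.
Lemma sr_sum I (r : seq I) (P : pred I) F :
  (forall i, P i -> R (F i)) -> R (\sum_(i <- r | P i) F i).
Proof. by move=> H; apply: big_ind => //; [exact: sr0|exact: srD]. Qed.
Lemma sr_prod I (r : seq I) (P : pred I) F :
  (forall i, P i -> R (F i)) -> R (\prod_(i <- r | P i) F i).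
Proof. by move=> H; apply: big_ind => //; [exact: sr1|exact: srM]. Qed.
End Subring.

Section Valring.
Variables (K : fieldType) (V : K -> Prop).
Hypothesis vV : valring V.
Let sV : subring V := proj1 vV.

Lemma vr_tot f : V f \/ V f^-1. Proof. exact: (proj2 vV). Qed.

Lemma mx_V f : mx V f -> V f.
Proof. by case=> [->|nf]; [exact: sr0|case: (vr_tot f)]. Qed.

Lemma mx0 : mx V 0. Proof. by left. Qed.

Lemma mx1 : ~ mx V 1.
Proof. by case=> [/eqP|]; [rewrite oner_eq0|rewrite invr1; apply; exact: sr1]. Qed.

Lemma unitV f : V f -> ~ mx V f -> V f^-1.
Proof. by move=> Vf nf; apply/not_notP => nV; apply: nf; right. Qed.

Lemma mx_neq0 f : ~ mx V f -> f != 0.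
Proof. by move=> nf; apply/eqP => f0; apply: nf; left. Qed.

Lemma mxP f : f != 0 -> mx V f <-> ~ V f^-1.
Proof.
by move=> /eqP f0; split; [case|right].
Qed.

Lemma mxMl f g : V f -> mx V g -> mx V (f * g).
Proof.
move=> Vf [->|ng]; first by rewrite mulr0; left.
have [->|f0] := eqVneq f 0; first by rewrite mul0r; left.
right; rewrite invfM => H; apply: ng.
by rewrite -[g^-1](mulVKf f0); apply: srM; rewrite // mulrC.
Qed.

Lemma mxMr f g : mx V f -> V g -> mx V (f * g).
Proof. by move=> *; rewrite mulrC; apply: mxMl. Qed.

Lemma mxN f : mx V f -> mx V (- f).
Proof.
move=> mf; rewrite -mulN1r; apply: mxMl => //.
by apply: (srN sV); exact: (sr1 sV).
Qed.

Lemma mxD f g : mx V f -> mx V g -> mx V (f + g).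
Proof.
have aux f1 g1 : mx V f1 -> mx V g1 -> f1 != 0 -> V (g1 / f1) -> mx V (f1 + g1).
  move=> mf mg f0 H; have -> : f1 + g1 = (1 + g1 / f1) * f1.
    by rewrite mulrDl mul1r divfK.
  by apply: mxMl => //; apply: (srD sV) => //; exact: sr1.
move=> mf mg; have [->|f0] := eqVneq f 0; first by rewrite add0r.
have [->|g0] := eqVneq g 0; first by rewrite addr0.
case: (vr_tot (g / f)) => H; first exact: aux.
by rewrite addrC; apply: aux => //; rewrite invf_div in H.
Qed.

Lemma mxB f g : mx V f -> mx V g -> mx V (f - g).
Proof. by move=> mf mg; apply: mxD => //; exact: mxN. Qed.

Lemma mx_sum I (r : seq I) (P : pred I) F :
  (forall i, P i -> mx V (F i)) -> mx V (\sum_(i <- r | P i) F i).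
Proof. by move=> H; apply: big_ind => //; [exact: mx0|exact: mxD]. Qed.

Lemma mx_prime f g : V f -> V g -> mx V (f * g) -> mx V f \/ mx V g.
Proof.
move=> Vf Vg H; case: (EM (mx V f)) => nf; [by left|right].
have f0 := mx_neq0 nf.
by rewrite -[g](mulKf f0); apply: mxMl => //; exact: unitV.
Qed.

Lemma nmxM f g : V f -> V g -> ~ mx V f -> ~ mx V g -> ~ mx V (f * g).
Proof. by move=> Vf Vg nf ng /(mx_prime Vf Vg) []. Qed.

Lemma nmxX f n : V f -> ~ mx V f -> ~ mx V (f ^+ n).
Proof.
move=> Vf nf; elim: n => [|n IH]; rewrite ?expr0 ?exprS; first exact: mx1.
by apply: nmxM => //; exact: srX.
Qed.

Lemma mx_exp f n : V f -> mx V (f ^+ n) -> mx V f.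
Proof. by move=> Vf H; apply/not_notP => nf; exact: (nmxX Vf nf H). Qed.

Lemma mxX f n : mx V f -> (0 < n)%N -> mx V (f ^+ n).
Proof.
case: n => // n mf _; rewrite exprS; apply: mxMr => //.
by apply: (srX sV); exact: mx_V.
Qed.

Lemma vr_min (I : finType) (g : I -> K) i0 : g i0 != 0 ->
  exists i, g i != 0 /\ forall j, V (g j / g i).
Proof.
move=> gi0.
suff H (s : seq I) : exists i, g i != 0 /\ forall j, j \in s -> V (g j / g i).
  have [i [gi Hi]] := H (enum I); exists i; split=> // j.
  by apply: Hi; rewrite mem_enum.
elim: s => [|a s [i [gi Hi]]]; first by exists i0.
have [ga|ga] := eqVneq (g a) 0.
  exists i; split=> // j; rewrite inE => /predU1P[->|]; last exact: Hi.
  by rewrite ga mul0r; exact: sr0.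
case: (vr_tot (g a / g i)) => H.
  by exists i; split=> // j; rewrite inE => /predU1P[->|]; last exact: Hi.
exists a; split=> // j; rewrite inE => /predU1P[->|/Hi Hj].
  by rewrite divff //; exact: sr1.
rewrite invf_div in H.
by have -> : g j / g a = (g j / g i) * (g i / g a);
  [field; rewrite ga gi | exact: srM].
Qed.

(** If no other term had the value of the least one, dividing by it would write 1 as a sum of
    elements of the maximal ideal. *)
Lemma vr_sum0 (I : finType) (g : I -> K) i0 : g i0 != 0 -> \sum_i g i = 0 ->
  exists i j, [/\ i != j, g i != 0, g j != 0, V (g i / g j) & V (g j / g i)].
Proof.
move=> /vr_min [i [gi Hi]] s0.
apply/not_notP => H; apply: mx1.
have E : 1 = - \sum_(j | j != i) g j / g i.
  have -> : 1 = g i / g i by rewrite divff.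
  rewrite -mulr_suml -mulNr; congr (_ / _).
  by apply/eqP; rewrite -addr_eq0; move: s0; rewrite (bigD1 i) //= => ->.
rewrite E; apply: mxN; apply: mx_sum => j ji.
have [gj|gj] := eqVneq (g j) 0; first by rewrite gj mul0r; left.
apply/mxP; first by rewrite mulf_neq0 // invr_eq0.
rewrite invf_div => H2; apply: H; exists i, j; split=> //.
by rewrite eq_sym.
Qed.

Lemma integral_V t : integral V t -> V t.
Proof.
case=> q [mq Vq /rootP qt].
apply/not_notP => nVt; have t0 : t != 0.
  by apply/eqP => t0; apply: nVt; rewrite t0; exact: sr0.
have mt : mx V t^-1 by right; rewrite invrK.
have Vt : V t^-1 by exact: mx_V.
apply: mx1.
have sq : (0 < size q)%N by rewrite size_poly_gt0 monic_neq0.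
have E : q = \poly_(i < (size q).-1) q`_i + 'X^((size q).-1).
  apply/polyP => i; rewrite coefD coefXn coef_poly.
  case: (ltngtP i (size q).-1) => [h|h|->].
  - by rewrite addr0.
  - by rewrite addr0 nth_default //; move: h; rewrite -ltnS prednK.
  - by rewrite add0r -/(lead_coef q) (monicP mq).
have E2 : t ^+ (size q).-1 = - (\poly_(i < (size q).-1) q`_i).[t].
  apply/eqP; rewrite -addr_eq0 addrC; apply/eqP.
  by rewrite -[X in _ + X]hornerXn -hornerD -E.
have -> : 1 = t^-1 ^+ (size q).-1 * t ^+ (size q).-1.
  by rewrite -exprMn mulVf // expr1n.
rewrite E2 mulrN; apply: mxN; rewrite horner_poly mulr_sumr.
apply: mx_sum => i _.
have -> : t^-1 ^+ (size q).-1 * (q`_i * t ^+ i) = q`_i * t^-1 ^+ ((size q).-1 - i).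
  rewrite mulrCA; congr (_ * _).
  rewrite -{1}(subnK (ltnW (ltn_ord i))) exprD -mulrA -exprMn mulVf //.
  by rewrite expr1n mulr1.
by apply: mxMl => //; apply: mxX => //; rewrite subn_gt0.
Qed.

(** Gauss's lemma. In each factor take the first coefficient of least value: the product of the two
    has the value of a coefficient of [q], hence lies in V, and both have inverses in V because the
    leading coefficients are 1. *)
Lemma gauss_val (q w s : {poly K}) : w \is monic -> s \is monic -> q = w * s ->
  (forall i, V q`_i) -> forall i, V w`_i.
Proof.
move=> mw ms qE Vq.
have minc (p : {poly K}) : p \is monic -> exists n,
    [/\ p`_n != 0, V (p`_n)^-1, (forall j, V (p`_j / p`_n))
      & forall j, (j < n)%N -> mx V (p`_j / p`_n)].
  move=> mp; have p0 := monic_neq0 mp.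
  have sp : (0 < size p)%N by rewrite size_poly_gt0.
  pose g (i : 'I_(size p)) := p`_i.
  have gl : g (Ordinal (ltac:(by rewrite prednK) : ((size p).-1 < size p)%N)) != 0.
    by rewrite /g /= -/(lead_coef p) lead_coef_eq0.
  have [i [gi Hi]] := vr_min gl.
  have Hj j : V (p`_j / g i).
    case: (ltnP j (size p)) => h; first exact: (Hi (Ordinal h)).
    by rewrite nth_default // mul0r; exact: sr0.
  have EX : exists n, `[< p`_n != 0 /\ ~ mx V (p`_n / g i) >].
    by exists i; apply/asboolP; split=> //; rewrite divff //; exact: mx1.
  case: (ex_minnP EX) => n /asboolP [pn nmn] nmin.
  have gn : V (g i / p`_n) by rewrite -[_ / _]invf_div; apply: unitV.
  exists n; split=> //.
  - have := Hj (size p).-1; rewrite -/(lead_coef p) (monicP mp) mul1r => H.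
    have -> : (p`_n)^-1 = (g i)^-1 * (g i / p`_n) by rewrite mulKf.
    exact: srM.
  - move=> j; have -> : p`_j / p`_n = (p`_j / g i) * (g i / p`_n) by rewrite mulrA divfK.
    exact: srM.
  - move=> j jn; have -> : p`_j / p`_n = (p`_j / g i) * (g i / p`_n) by rewrite mulrA divfK.
    apply: mxMr => //; apply/not_notP => H.
    have [pj|pj] := eqVneq p`_j 0; first by apply: H; rewrite pj mul0r; left.
    by have := nmin j; rewrite leqNgt jn => /(_ _) H2; apply/negP: isT; apply: H2; apply/asboolP.
have [a [wa Va Ha Ha']] := minc w mw.
have [b [sb Vb Hb Hb']] := minc s ms.
have Vq' : V (q`_(a + b)%N * (w`_a)^-1 * (s`_b)^-1) by do !apply: srM => //.
have nq : ~ mx V (q`_(a + b)%N * (w`_a)^-1 * (s`_b)^-1).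
  move=> H; apply: mx1.
  have ab : (a < (a + b).+1)%N by lia.
  have E : 1 = q`_(a + b)%N * (w`_a)^-1 * (s`_b)^-1 -
      \sum_(j < (a + b).+1 | j != Ordinal ab) (w`_j / w`_a) * (s`_(a + b - j)%N / s`_b).
    apply/eqP; rewrite eq_sym subr_eq eq_sym; apply/eqP.
    have -> : q`_(a + b)%N * (w`_a)^-1 * (s`_b)^-1 =
       \sum_(j < (a + b).+1) (w`_j / w`_a) * (s`_(a + b - j)%N / s`_b).
      rewrite qE coefM !mulr_suml; apply: eq_bigr => j _.
      by rewrite mulrACA -!mulrA.
    rewrite [X in _ = X](bigD1 (Ordinal ab)) //=; have -> : (a + b - a = b)%N by lia.
    by rewrite !divff // mulr1.
  rewrite E; apply: mxB => //; apply: mx_sum => j ja.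
  case: (ltngtP j a) => h.
  - by apply: mxMr; [exact: Ha'|exact: Hb].
  - by apply: mxMl; [exact: Ha|apply: Hb'; have := ltn_ord j; lia].
  - by case/eqP: ja; apply: val_inj.
have Vws : V ((w`_a) * (s`_b)).
  have q0 : q`_(a + b)%N != 0.
    by apply/eqP => q0; apply: nq; rewrite q0 !mul0r; left.
  have -> : w`_a * s`_b = q`_(a + b)%N * (q`_(a + b)%N * (w`_a)^-1 * (s`_b)^-1)^-1.
    by field; rewrite wa sb.
  by apply: srM => //; exact: unitV.
have Vwa : V w`_a.
  have -> : w`_a = w`_a * s`_b * (s`_b)^-1 by rewrite mulfK.
  exact: srM.
by move=> i; rewrite -[w`_i](divfK wa); apply: srM.
Qed.

End Valring.

(** * Maximal subrings that avoid an element *)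

Section Chevalley.
Variables (K : fieldType) (A : K -> Prop) (t : K).
Hypotheses (sA : subring A) (At : A t^-1) (nAt : ~ A t).
Hypothesis Amax : forall B, subring B -> (forall f, A f -> B f) -> ~ B t ->
  forall f, B f -> A f.

Lemma max_t_neq0 : t != 0.
Proof. by apply/eqP => t0; apply: nAt; rewrite t0; exact: sr0. Qed.

(** Inverting [u] enlarges the ring without adding [t]: since [u ^+ k] is congruent to 1 modulo the
    multiples of [t^-1], [t * u ^+ k] in A would put [t] in A. *)
Lemma max_local a : A a -> A (1 - t^-1 * a)^-1.
Proof.
move=> Aa; set u := 1 - t^-1 * a.
have Au : A u by apply: srB => //; [exact: sr1|exact: srM].
have t0 := max_t_neq0.
have u0 : u != 0.
  apply/eqP => /eqP; rewrite subr_eq0 => /eqP H; apply: nAt.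
  by have -> : t = a by rewrite -[a](mulVKf t0) -H mulr1.
have Auk k : exists2 b, A b & u ^+ k = 1 - t^-1 * b.
  elim: k => [|k [b Ab E]]; first by exists 0; [exact: sr0|rewrite expr0 mulr0 subr0].
  exists (b + a - t^-1 * a * b).
    by apply: srB => //; [apply: srD|do !apply: srM].
  by rewrite exprS E /u; ring.
apply: (Amax (B := fun f => exists k, A (f * u ^+ k))).
- split.
  + by exists 0%N; rewrite mul1r expr0; exact: sr1.
  + move=> f g [k Hf] [l Hg]; exists (k + l)%N.
    rewrite mulrBl exprD; apply: srB => //.
      by rewrite mulrA; apply: srM => //; exact: srX.
    by rewrite mulrCA; apply: srM => //; exact: srX.
  + move=> f g [k Hf] [l Hg]; exists (k + l)%N.
    by rewrite exprD mulrACA; apply: srM.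
- by move=> f Af; exists 0%N; rewrite expr0 mulr1.
- case=> k H; have [b Ab E] := Auk k; apply: nAt.
  have -> : t = t * u ^+ k + b by rewrite E mulrBr mulr1 mulVKf // subrK.
  exact: srD.
- by exists 1%N; rewrite expr1 mulVf //; exact: sr1.
Qed.

Let uA (f : K) := exists2 a, A a & f = t^-1 * a.

Lemma uAD f g : uA f -> uA g -> uA (f + g).
Proof. by case=> a Aa -> [b Ab ->]; exists (a + b); [exact: srD|rewrite mulrDr]. Qed.
Lemma uAM f g : uA f -> A g -> uA (f * g).
Proof. by case=> a Aa -> Ag; exists (a * g); [exact: srM|rewrite mulrA]. Qed.
Lemma uAA f : uA f -> A f.
Proof. by case=> a Aa ->; exact: srM. Qed.

(** Chevalley's descent. In the shorter relation [1 - q 0] is a unit, so the top power of x is a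
    combination of lower ones with coefficients in the ideal of [t^-1]; substituting it in the
    longer relation lowers n + m. *)
Lemma max_descent x n m (p q : nat -> K) : x != 0 ->
  (forall i, uA (p i)) -> (forall i, uA (q i)) ->
  1 = \sum_(i < n.+1) p i * x ^+ i -> 1 = \sum_(i < m.+1) q i * x^-1 ^+ i -> False.
Proof.
have [N] := ubnP (n + m); elim: N => // N IH in x n m p q *.
move=> hN x0 up uq Ep Eq.
wlog nm : x n m p q hN x0 up uq Ep Eq / (m <= n)%N.
  move=> W; case/orP: (leq_total m n) => h; first exact: (W x n m p q).
  by apply: (W x^-1 m n q p) => //; rewrite ?invrK ?invr_eq0 // addnC.
have not1 f : uA f -> 1 = f -> False.
  case=> a Aa -> E; apply: nAt; have t0 := max_t_neq0.
  by have -> : t = a by rewrite -[a](mulVKf t0) -E mulr1.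
case: m Eq nm hN => [|m] Eq nm hN.
  by apply: (not1 _ (uq 0%N)); rewrite Eq big_ord1 expr0 mulr1.
have [w Aw Ew] : exists2 w, A w & w * (1 - q 0%N) = 1.
  have [a Aa E] := uq 0%N; exists (1 - q 0%N)^-1; first by rewrite E; apply: max_local.
  rewrite mulVf //; apply/eqP => /eqP; rewrite subr_eq0 => /eqP E1.
  exact: (not1 _ (uq 0%N)).
case: n nm hN Ep => // n nm hN Ep.
have E1 : x ^+ n.+1 = \sum_(j < m.+1) w * q j.+1 * x ^+ (n - j).
  have : 1 - q 0%N = \sum_(j < m.+1) q j.+1 * x^-1 ^+ j.+1.
    by rewrite {1}Eq big_ord_recl expr0 mulr1 addrC addKr.
  move/(congr1 (fun z => w * z * x ^+ n.+1)); rewrite Ew mul1r => ->.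
  rewrite mulr_sumr mulr_suml; apply: eq_bigr => j _.
  rewrite -!mulrA; congr (_ * (_ * _)).
  have jn : (j <= n)%N by have := ltn_ord j; lia.
  have -> : (n.+1 = j.+1 + (n - j))%N by lia.
  by rewrite exprD mulrA -exprMn mulVf // expr1n mul1r; congr (x ^+ _); lia.
(* The power x^i receives the term j = n - i of [E1]; the guard [i <= n] excludes truncated
   differences. *)
pose p' i := p i + p n.+1 * (if ((n - i) < m.+1)%N && (i <= n)%N then w * q (n - i).+1 else 0).
apply: (IH x n m.+1 p' q) => //.
- move=> i; apply: uAD => //; apply: uAM => //; case: ifP => _; last exact: sr0.
  by apply: srM => //; exact: uAA.
rewrite Ep big_ord_recr /= E1 /p'.
under [in RHS]eq_bigr do rewrite mulrDl.
rewrite big_split /=; congr (_ + _).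
rewrite mulr_sumr (reindex_inj rev_ord_inj) /=.
transitivity (\sum_(i < n.+1 | (n - i < m.+1)%N) p n.+1 * (w * q (n - i).+1 * x ^+ i)); last first.
  rewrite big_mkcond /=; apply: eq_bigr => i _.
  have -> : (i <= n)%N by have := ltn_ord i; lia.
  by rewrite andbT; case: ifP => _; rewrite ?mulr0 ?mul0r // mulrA.
rewrite -(big_mkord (fun i => (n - i < m.+1)%N) (fun i => p n.+1 * (w * q (n - i).+1 * x ^+ i))).
rewrite (@big_cat_nat _ _ _ (n - m)) //=; last by lia.
rewrite [X in _ = X + _]big_nat_cond [X in _ = X + _]big_pred0 ?add0r; last first.
  by move=> i; apply/negP; lia.
rewrite -{1}[(n - m)%N]add0n big_addn.
have -> : (n.+1 - (n - m) = m.+1)%N by lia.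
rewrite big_mkord; symmetry; rewrite big_mkcond /=; apply: eq_bigr => i _.
have im := ltn_ord i.
have -> : (n - (i + (n - m)) = m.+1 - i.+1)%N by lia.
have -> : (m.+1 - i.+1 < m.+1)%N by lia.
by congr (_ * (_ * x ^+ _)); lia.
Qed.

Lemma max_valring : valring A.
Proof.
split=> // x.
have [->|x0] := eqVneq x 0; first by left; exact: sr0.
apply/not_notP => H.
have t0 := max_t_neq0.
have ext y : ~ A y -> exists n (p : nat -> K), (forall i, uA (p i)) /\
    1 = \sum_(i < n.+1) p i * y ^+ i.
  move=> nAy.
  pose B f := exists p : {poly K}, (forall i, A p`_i) /\ f = p.[y].
  have sB : subring B.
    split.
    - exists 1; split; last by rewrite hornerC.
      by move=> i; rewrite coef1; case: (i == 0%N); [exact: sr1|exact: sr0].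
    - move=> _ _ [p [Ap ->]] [q [Aq ->]]; exists (p - q); split; last by rewrite hornerD hornerN.
      by move=> i; rewrite coefB; exact: srB.
    - move=> _ _ [p [Ap ->]] [q [Aq ->]]; exists (p * q); split; last by rewrite hornerM.
      by move=> i; rewrite coefM; apply: sr_sum => // j _; exact: srM.
  have AB f : A f -> B f.
    move=> Af; exists f%:P; split; last by rewrite hornerC.
    by move=> i; rewrite coefC; case: (i == 0%N) => //; exact: sr0.
  have : B t.
    apply/not_notP => nBt; apply: nAy; apply: (Amax sB AB nBt).
    exists 'X; split; last by rewrite hornerX.
    by move=> i; rewrite coefX; case: (i == 1%N); [exact: sr1|exact: sr0].
  case=> p [Ap E]; exists (size p), (fun i => t^-1 * p`_i); split.
    by move=> i; exists p`_i.
  under eq_bigr do rewrite -mulrA.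
  by rewrite -mulr_sumr -(horner_coef_wide y (leqnSn _)) -E mulVf.
have [n [p [up Ep]]] := ext x (fun h => H (or_introl h)).
have [m [q [uq Eq]]] := ext x^-1 (fun h => H (or_intror h)).
exact: (max_descent x0 up uq Ep Eq).
Qed.

End Chevalley.

(* If t is not integral over R, a maximal subring that contains R[t^-1] but not t
   is a valuation ring. *)
Lemma integral_valrings (K : fieldType) (R : K -> Prop) (t : K) : subring R ->
  (forall V, valring V -> (forall f, R f -> V f) -> V t) -> integral R t.
Proof.
move=> sR H.
have [t0|t0] := eqVneq t 0.
  exists 'X; split; [exact: monicX| |by rewrite t0 rootX].
  by move=> i; rewrite coefX; case: (i == 1%N); [exact: sr1|exact: sr0].
pose S f := exists p : {poly K}, (forall i, R p`_i) /\ f = p.[t^-1].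
have sS : subring S.
  split.
  - exists 1; split; last by rewrite hornerC.
    by move=> i; rewrite coef1; case: (i == 0%N); [exact: sr1|exact: sr0].
  - move=> _ _ [p [Ap ->]] [q [Aq ->]]; exists (p - q); split; last by rewrite hornerD hornerN.
    by move=> i; rewrite coefB; exact: srB.
  - move=> _ _ [p [Ap ->]] [q [Aq ->]]; exists (p * q); split; last by rewrite hornerM.
    by move=> i; rewrite coefM; apply: sr_sum => // j _; exact: srM.
have RS f : R f -> S f.
  move=> Af; exists f%:P; split; last by rewrite hornerC.
  by move=> i; rewrite coefC; case: (i == 0%N) => //; exact: sr0.
have St : S t^-1.
  exists 'X; split; last by rewrite hornerX.
  by move=> i; rewrite coefX; case: (i == 1%N); [exact: sr1|exact: sr0].
case: (EM (S t)) => [[p [Rp E]]|nS].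
  (* Multiplying t = p(1 / t) by the power [size p] of t gives a monic equation. *)
  exists ('X^((size p).+1) - \poly_(i < (size p).+1) p`_(size p - i)%N); split.
  - rewrite monicE lead_coefDl ?lead_coefXn // size_polyN size_polyXn ltnS.
    exact: size_poly.
  - move=> i; rewrite coefB coefXn coef_poly; apply: srB => //.
      by case: (i == _); [exact: sr1|exact: sr0].
    by case: ifP => _ //; exact: sr0.
  - apply/rootP; rewrite hornerD hornerN hornerXn horner_poly.
    apply/eqP; rewrite subr_eq0; apply/eqP.
    rewrite exprS {1}E (horner_coef_wide _ (leqnSn _)) mulr_suml.
    rewrite (reindex_inj rev_ord_inj) /=; apply: eq_bigr => i _.
    have := ltn_ord i; rewrite ltnS => ip.
    have -> : ((size p).+1 - i.+1 = size p - i)%N by lia.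
    rewrite -mulrA; congr (_ * _).
    have -> : t ^+ size p = t ^+ (size p - i) * t ^+ i by rewrite -exprD subnK.
    by rewrite mulrA -exprMn mulVf // expr1n mul1r.
pose P (A : set K) := (forall f, ~ A f) \/ [/\ subring A, forall f, S f -> A f & ~ A t].
have [F FP tot|A [PA Amax]] := @Zorn_bigcup K P.
  case: (EM (exists2 X, F X & exists f, X f)) => [[X0 FX0 [f0 Xf0]]|nE]; last first.
    by left=> f [X FX Xf]; apply: nE; exists X => //; exists f.
  have gF X f : F X -> X f -> [/\ subring X, forall f, S f -> X f & ~ X t].
    by move=> FX Xf; case: (FP _ FX) => // /(_ _ Xf).
  have join X Y a b : F X -> F Y -> X a -> Y b ->
      exists Z, [/\ F Z, Z a, Z b & [/\ subring Z, forall f, S f -> Z f & ~ Z t]].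
    move=> FX FY Xa Yb; case: (tot X Y FX FY) => h.
      by exists Y; split=> //; [exact: h|exact: (gF _ b)].
    by exists X; split=> //; [exact: h|exact: (gF _ a)].
  right; split.
  - split.
    + by exists X0 => //; have [sX _ _] := gF _ _ FX0 Xf0; exact: sr1.
    + move=> a b [X FX Xa] [Y FY Yb]; have [Z [FZ Za Zb [sZ _ _]]] := join X Y a b FX FY Xa Yb.
      by exists Z => //; exact: srB.
    + move=> a b [X FX Xa] [Y FY Yb]; have [Z [FZ Za Zb [sZ _ _]]] := join X Y a b FX FY Xa Yb.
      by exists Z => //; exact: srM.
  - by move=> f Sf; exists X0 => //; have [_ + _] := gF _ _ FX0 Xf0; apply.
  - by case=> X FX Xt; have [_ _] := gF _ _ FX Xt; apply.
case: PA => [A0|[sA SA nAt]].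
  exfalso; apply: (Amax S); last by right; split.
  split; first by move=> f /A0.
  by move=> /(_ 1 (sr1 sS)) /A0.
exfalso; apply: (nAt); apply: H; last by move=> f Rf; apply: SA; exact: RS.
apply: (@max_valring _ _ t) => //; first exact: SA.
move=> B sB AB nBt f Bf; apply/not_notP => nAf; apply: (Amax B).
  by split=> // BA; apply: nAf; exact: BA.
by right; split=> // g Sg; apply: AB; exact: SA.
Qed.

(** * Two-variable polynomials evaluated in an extension field *)

Lemma poly2P (C : nzRingType) (p q : {poly {poly C}}) :
  (forall l i, p`_l`_i = q`_l`_i) -> p = q.
Proof. by move=> H; apply/polyP => l; apply/polyP => i. Qed.

Section Eval.
Variables (C : numClosedFieldType) (K : fieldType) (iota : {rmorphism C -> K}).

Definition ev1 (x : K) : {poly C} -> K := horner_eval x \o map_poly iota.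
HB.instance Definition _ x := GRing.RMorphism.copy (ev1 x) (horner_eval x \o map_poly iota).

(** The inner variable goes to x and the outer one to y, so the coefficient of x^k y^l has the index
    l first. *)
Definition ev (x y : K) : {poly {poly C}} -> K := horner_eval y \o map_poly (ev1 x).
HB.instance Definition _ x y := GRing.RMorphism.copy (ev x y) (horner_eval y \o map_poly (ev1 x)).

Implicit Types p q : {poly {poly C}}.

Lemma ev1C x c : ev1 x c%:P = iota c.
Proof. by rewrite /ev1 /= /horner_eval map_polyC hornerC. Qed.
Lemma ev1X x : ev1 x 'X = x.
Proof. by rewrite /ev1 /= /horner_eval map_polyX hornerX. Qed.
Lemma evC x y c : ev x y c%:P = ev1 x c.
Proof. by rewrite /ev /= /horner_eval map_polyC hornerC. Qed.
Lemma evCC x y c : ev x y c%:P%:P = iota c.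
Proof. by rewrite evC ev1C. Qed.
Lemma evX x y : ev x y 'X%:P = x.
Proof. by rewrite evC ev1X. Qed.
Lemma evY x y : ev x y 'X = y.
Proof. by rewrite /ev /= /horner_eval map_polyX hornerX. Qed.

Definition evE := (evCC, evX, evY).

Lemma ev1D x (a b : {poly C}) : ev1 x (a + b) = ev1 x a + ev1 x b. Proof. exact: rmorphD. Qed.
Lemma ev1N x (a : {poly C}) : ev1 x (- a) = - ev1 x a. Proof. exact: rmorphN. Qed.
Lemma ev1B x (a b : {poly C}) : ev1 x (a - b) = ev1 x a - ev1 x b. Proof. exact: rmorphB. Qed.
Lemma ev1M x (a b : {poly C}) : ev1 x (a * b) = ev1 x a * ev1 x b. Proof. exact: rmorphM. Qed.
Lemma ev10 x : ev1 x 0 = 0. Proof. exact: rmorph0. Qed.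
Lemma ev11 x : ev1 x 1 = 1. Proof. exact: rmorph1. Qed.
Lemma ev1Xn x (a : {poly C}) n : ev1 x (a ^+ n) = ev1 x a ^+ n. Proof. exact: rmorphXn. Qed.
Lemma ev1Z x c (a : {poly C}) : ev1 x (c *: a) = iota c * ev1 x a.
Proof. by rewrite -mul_polyC ev1M ev1C. Qed.
Lemma evD x y p q : ev x y (p + q) = ev x y p + ev x y q. Proof. exact: rmorphD. Qed.
Lemma evN x y p : ev x y (- p) = - ev x y p. Proof. exact: rmorphN. Qed.
Lemma evB x y p q : ev x y (p - q) = ev x y p - ev x y q. Proof. exact: rmorphB. Qed.
Lemma evM x y p q : ev x y (p * q) = ev x y p * ev x y q. Proof. exact: rmorphM. Qed.
Lemma ev0 x y : ev x y 0 = 0. Proof. exact: rmorph0. Qed.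
Lemma ev_1 x y : ev x y 1 = 1. Proof. exact: rmorph1. Qed.
Lemma evXn x y p n : ev x y (p ^+ n) = ev x y p ^+ n. Proof. exact: rmorphXn. Qed.
Lemma evZ x y c p : ev x y (c *: p) = ev1 x c * ev x y p.
Proof. by rewrite -mul_polyC evM evC. Qed.

Definition ev1E := (ev1D, ev1B, ev1N, ev1M, ev1Xn, ev1Z, ev1C, ev1X, ev10, ev11).
Definition evE' := (evD, evB, evN, evM, evXn, evZ, evY, evC, ev0, ev_1, ev1E).

Lemma ev1_sum x (c : {poly C}) : ev1 x c = \sum_(i < size c) iota c`_i * x ^+ i.
Proof.
rewrite /ev1 /= /horner_eval horner_coef size_map_poly.
by apply: eq_bigr => i _; rewrite coef_map.
Qed.

Lemma ev1_sum_wide x (c : {poly C}) n : (size c <= n)%N ->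
  ev1 x c = \sum_(i < n) iota c`_i * x ^+ i.
Proof.
move=> h; rewrite /ev1 /= /horner_eval (@horner_coef_wide _ n) ?size_map_poly //.
by apply: eq_bigr => i _; rewrite coef_map.
Qed.

Lemma ev_sum x y p : ev x y p = \sum_(l < size p) ev1 x p`_l * y ^+ l.
Proof.
rewrite /ev /= /horner_eval (@horner_coef_wide _ (size p)) ?size_poly //.
by apply: eq_bigr => i _; rewrite coef_map.
Qed.

Lemma ev_sum_wide x y p n : (size p <= n)%N ->
  ev x y p = \sum_(l < n) ev1 x p`_l * y ^+ l.
Proof.
move=> h; rewrite /ev /= /horner_eval (@horner_coef_wide _ n); last first.
  exact: leq_trans (size_poly _ _) h.
by apply: eq_bigr => i _; rewrite coef_map.
Qed.

Definition boxed (D : nat) p := (size p <= D)%N /\ forall l, (size (p`_l)%R <= D)%N.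

Lemma boxedW D E p : (D <= E)%N -> boxed D p -> boxed E p.
Proof. by move=> h [h1 h2]; split=> [|l]; [|move: (h2 l)]; lia. Qed.

Lemma boxed_ex p : exists D, boxed D p.
Proof.
exists (maxn (size p) (\max_(l < size p) size (p`_l)%R)); split; first exact: leq_maxl.
move=> l; case: (ltnP l (size p)) => h; last by rewrite nth_default // size_poly0.
rewrite leq_max; apply/orP; right.
exact: (leq_bigmax (F := fun l : 'I_(size p) => size (p`_l)%R) (Ordinal h)).
Qed.

Lemma boxedM D E p q : boxed D p -> boxed E q -> boxed (D + E) (p * q).
Proof.
case=> h1 h2 [h3 h4]; split; first by have := size_polyMleq p q; lia.
move=> l; rewrite coefM; apply: leq_trans (size_sum _ _ _) _.
apply/bigmax_leqP => i _; apply: leq_trans (size_polyMleq _ _) _.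
have := h2 i; have := h4 (l - i)%N. lia.
Qed.

Lemma boxedX D p n : boxed D p -> boxed (n * D).+1 (p ^+ n).
Proof.
move=> h; elim: n => [|n IH].
  rewrite expr0; split; first by rewrite size_poly1.
  by move=> l; rewrite coef1; case: (l == 0%N); rewrite ?size_poly1 ?size_poly0.
by rewrite exprS; apply: boxedW (boxedM h IH); lia.
Qed.

(** The polynomials in the box form a space of dimension D^2. *)
Lemma boxed_dep (T : finType) (g : T -> {poly {poly C}}) D :
  (forall t, boxed D (g t)) -> (D ^ 2 < #|T|)%N ->
  exists a : T -> C, (exists t, a t != 0) /\ \sum_t (a t)%:P%:P * g t = 0.
Proof.
move=> gD lt.
pose U : finType := ('I_D * 'I_D)%type.
pose M : 'M[C]_(#|T|, #|U|) := \matrix_(i, j)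
  (g (@enum_val T T i))`_((@enum_val U U j).1)`_((@enum_val U U j).2).
have cU : (#|U| = D ^ 2)%N by rewrite card_prod card_ord -mulnn.
have kn : kermx M != 0.
  rewrite -mxrank_eq0 mxrank_ker subn_eq0 -ltnNge.
  by apply: leq_ltn_trans (rank_leq_col M) _; rewrite cU.
have /rowV0Pn [v /sub_kermxP vM v0] := kn.
have [j vj] : exists j, v 0 j != 0.
  apply/existsP; apply: contraR v0; rewrite negb_exists => /forallP H.
  by apply/eqP/rowP => j; rewrite mxE; apply/eqP; rewrite -[_ == _]negbK.
exists (fun t => v 0 (enum_rank t)); split; first by exists (enum_val j); rewrite enum_valK.
apply: poly2P => l k; rewrite !coef0 !coef_sum.
have E : (\sum_t (v 0 (enum_rank t))%:P%:P * g t)`_l`_k =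
    \sum_t v 0 (enum_rank t) * (g t)`_l`_k.
  by rewrite !coef_sum; apply: eq_bigr => t _; rewrite !coefCM.
rewrite -!coef_sum E.
case: (ltnP l D) => lD; last first.
  apply: big1 => t _; rewrite [(g t)`_l]nth_default ?coef0 ?mulr0 //.
  by case: (gD t) => h _; exact: leq_trans h lD.
case: (ltnP k D) => kD; last first.
  apply: big1 => t _; rewrite [(g t)`_l`_k]nth_default ?mulr0 //.
  by case: (gD t) => _ h; exact: leq_trans (h l) kD.
have := congr1 (fun A : 'rV_#|U| => A 0 (enum_rank (Ordinal lD, Ordinal kD))) vM.
rewrite mxE [RHS]mxE => E0; rewrite -[RHS]E0 (reindex (@enum_val T T)) /=; last first.
  by apply: onW_bij; exact: enum_val_bij.
by apply: eq_bigr => t _; rewrite !mxE enum_rankK enum_valK.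
Qed.

Definition gens (x y : K) := forall f, exists p q, ev x y q != 0 /\ f = ev x y p / ev x y q.

(** For independent z1 and z2 this says that K has finite degree over C(z1, z2). Over one
    denominator, the products of the d + 1 elements with the monomials z1^j z2^k, j, k <= D', become
    (d + 1)(D' + 1)^2 polynomials in a box of side at most (2 dl + 1)(D' + 1), so d = (2 dl + 1)^2
    makes them dependent however large D' has to be. *)
Lemma dep x y z1 z2 : gens x y -> exists d, forall f : 'I_d.+1 -> K,
  exists P : 'I_d.+1 -> {poly {poly C}}, (exists i, P i != 0) /\
    \sum_i ev z1 z2 (P i) * f i = 0.
Proof.
move=> gen.
have [a1 [b1 [nb1 ->]]] := gen z1; have [a2 [b2 [nb2 ->]]] := gen z2.
pose A1 := a1 * b2; pose A2 := a2 * b1; pose B := b1 * b2.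
have evB : ev x y B != 0 by rewrite rmorphM mulf_neq0.
have -> : ev x y a1 / ev x y b1 = ev x y A1 / ev x y B.
  by rewrite !rmorphM; field; rewrite nb1 nb2.
have -> : ev x y a2 / ev x y b2 = ev x y A2 / ev x y B.
  by rewrite !rmorphM; field; rewrite nb1 nb2.
clearbody A1 A2 B.
have [D1 bA1] := boxed_ex A1; have [D2 bA2] := boxed_ex A2; have [D3 bB] := boxed_ex B.
pose dl := (D1 + D2 + D3).+1.
have {}bA1 : boxed dl A1 by apply: boxedW bA1; rewrite /dl; lia.
have {}bA2 : boxed dl A2 by apply: boxedW bA2; rewrite /dl; lia.
have {}bB : boxed dl B by apply: boxedW bB; rewrite /dl; lia.
exists ((2 * dl + 1) ^ 2)%N; set d := (_ ^ 2)%N => f.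
have [F [G [nG EF]]] : exists (F : 'I_d.+1 -> {poly {poly C}}) G,
    ev x y G != 0 /\ forall i, f i = ev x y (F i) / ev x y G.
  have /choice [pq Hpq] : forall i, exists pq : {poly {poly C}} * {poly {poly C}},
     ev x y pq.2 != 0 /\ f i = ev x y pq.1 / ev x y pq.2.
    by move=> i; have [p [q H]] := gen (f i); exists (p, q).
  exists (fun i => (pq i).1 * \prod_(j | j != i) (pq j).2), (\prod_j (pq j).2).
  have n0 (P : pred _) : ev x y (\prod_(j | P j) (pq j).2) != 0.
    rewrite rmorph_prod; apply/prodf_neq0 => j _; exact: (Hpq j).1.
  split=> // i; rewrite (Hpq i).2 [X in _ = _ / ev x y X](bigD1 i) //= !rmorphM.
  by field; rewrite n0 (Hpq i).1.
have [D' bF] : exists D', forall i, boxed D' (F i).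
  have /choice [E HE] := fun i => boxed_ex (F i).
  exists (\max_i E i) => i; apply: boxedW (HE i); exact: leq_bigmax.
pose z1' := ev x y A1 / ev x y B; pose z2' := ev x y A2 / ev x y B.
pose T : finType := ('I_d.+1 * ('I_D'.+1 * 'I_D'.+1))%type.
pose g (t : T) := A1 ^+ t.2.1 * A2 ^+ t.2.2 * B ^+ (2 * D' - (t.2.1 + t.2.2)) * F t.1.
have [||a [[t0 at0] a0]] := @boxed_dep T g ((2 * D') * dl + 3 + D').
- move=> [i [j k]]; rewrite /g /=.
  apply: boxedW (boxedM (boxedM (boxedM (boxedX j bA1) (boxedX k bA2)) (boxedX _ bB)) (bF i)).
  have := ltn_ord j; have := ltn_ord k => hk hj.
  have : (j * dl + k * dl + (2 * D' - (j + k)) * dl = 2 * D' * dl)%N.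
    by rewrite -!mulnDl; congr (_ * _)%N; lia.
  by lia.
- rewrite !card_prod !card_ord /d.
  have : (2 * D' * dl + 3 + D' <= (2 * dl + 1) * D'.+1)%N by rewrite /dl; nia.
  move=> h; have := leq_mul h h; rewrite !expnS !expn0 !muln1; nia.
pose P i : {poly {poly C}} := \poly_(k < D'.+1) \poly_(j < D'.+1) a (i, (inord j, inord k)).
exists P; split.
  case: t0 at0 => i [j k] a0'; exists i; apply/eqP => /(congr1 (fun p => p`_k`_j)).
  rewrite !coef0 /P !coef_poly !ltn_ord !inord_val => /eqP.
  by rewrite coef_poly ltn_ord inord_val (negPf a0').
have evP i : ev z1' z2' (P i) = \sum_j \sum_k iota (a (i, (j, k))) * z1' ^+ j * z2' ^+ k.
  rewrite (ev_sum_wide _ _ (size_poly _ _)) exchange_big /=; apply: eq_bigr => k _.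
  rewrite coef_poly ltn_ord (ev1_sum_wide _ (size_poly _ _)) mulr_suml.
  by apply: eq_bigr => j _; rewrite coef_poly ltn_ord !inord_val.
under eq_bigr do rewrite evP.
have /(congr1 (fun p => ev x y p / (ev x y B ^+ (2 * D') * ev x y G))) := a0.
rewrite rmorph0 mul0r => E0.
pose h i jk := ev x y ((a (i, jk))%:P%:P * g (i, jk)) / (ev x y B ^+ (2 * D') * ev x y G).
have {}E0 : \sum_(t : T) h t.1 t.2 = 0.
  rewrite -[RHS]E0 rmorph_sum mulr_suml; by apply: eq_bigr => -[i [j k]] _.
rewrite -[RHS]E0 -(pair_bigA _ h) /=; apply: eq_bigr => i _.
pose h2 j k := h i (j, k).
have -> : \sum_j h i j = \sum_jk h2 jk.1 jk.2 by apply: eq_bigr => -[].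
rewrite -(pair_bigA _ h2) /= /h2 /h.
rewrite mulr_suml; apply: eq_bigr => j _.
rewrite mulr_suml; apply: eq_bigr => k _.
rewrite EF /g /= !rmorphM !rmorphXn /= !evE.
have hj := ltn_ord j; have hk := ltn_ord k.
have -> : ev x y B ^+ (2 * D') = ev x y B ^+ j * ev x y B ^+ k * ev x y B ^+ (2 * D' - (j + k)).
  by rewrite -!exprD; congr (_ ^+ _); lia.
by rewrite /z1' /z2' !expr_div_n; field; rewrite nG !expf_neq0.
Qed.

End Eval.

(** * Derivations, brackets, and discrete valuation rings *)

Section Der.
Variables (C : numClosedFieldType) (K : fieldType) (iota : {rmorphism C -> K}).
Local Notation ev := (ev iota).
Local Notation ev1 := (ev1 iota).
Implicit Types (V : K -> Prop) (p q : {poly {poly C}}).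

Lemma iota_eq0 c : (iota c == 0) = (c == 0). Proof. exact: fmorph_eq0. Qed.

Lemma char0 n : n.+1%:R != 0 :> K.
Proof. by rewrite -(rmorph_nat iota) iota_eq0 pnatr_eq0. Qed.

Definition cval V := valring V /\ forall c, V (iota c).

Lemma cval_sub V : cval V -> subring V. Proof. by case=> -[]. Qed.

Lemma cval_ev1 V x c : cval V -> V x -> V (ev1 x c).
Proof.
move=> [[sV _] cV] Vx; rewrite ev1_sum; apply: (sr_sum sV) => i _.
by apply: (srM sV) => //; exact: (srX sV).
Qed.

Lemma cval_ev V x y p : cval V -> V x -> V y -> V (ev x y p).
Proof.
move=> hV Vx Vy; have sV := cval_sub hV; rewrite ev_sum; apply: (sr_sum sV) => i _.
by apply: (srM sV); [exact: cval_ev1|exact: (srX sV)].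
Qed.

Lemma cval_unit V c : cval V -> c != 0 -> ~ mx V (iota c).
Proof.
move=> [vV cV] c0 /mxP; rewrite iota_eq0 c0 -fmorphV => /(_ isT); apply; exact: cV.
Qed.

(* The residue of x is transcendental over C. *)
Definition trans V x := V x /\ forall c : {poly C}, c != 0 -> ~ mx V (ev1 x c).

Lemma poly_split (c : {poly C}) : c != 0 -> exists a (s : seq C),
  a != 0 /\ forall x, ev1 x c = iota a * \prod_(r <- s) (x - iota r).
Proof.
move=> c0; have [s E] := closed_field_poly_normal c.
exists (lead_coef c), s; split; first by rewrite lead_coef_eq0.
move=> x; rewrite {1}E ev1Z rmorph_prod; congr (_ * _).
by apply: eq_bigr => r _ /=; rewrite !ev1E.
Qed.

(** As C is algebraically closed, a residue that is algebraic over C is a constant. *)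
Lemma ntrans V x : cval V -> V x -> ~ trans V x -> exists r, mx V (x - iota r).
Proof.
move=> hV Vx nt; apply/not_notP => H; apply: nt; split=> // c c0.
have [a [s [a0 ->]]] := poly_split c0 => /(mx_prime hV.1).
have sV := cval_sub hV.
have Vr r : V (x - iota r) by apply: (srB sV) => //; exact: hV.2.
case=> //; first exact: hV.2.
- by apply: (sr_prod sV).
- exact: cval_unit.
elim: s => [|r s IH]; rewrite ?big_nil ?big_cons; first exact: (mx1 hV.1).
case/(mx_prime hV.1) => //; first exact: (sr_prod sV).
by move=> h; apply: H; exists r.
Qed.

Definition indep x y := forall p, ev x y p = 0 -> p = 0.
Definition coord x y := indep x y /\ gens iota x y.
Definition uV V u := [/\ u != 0, V u & V u^-1].

Lemma uVP V u : valring V -> V u -> ~ mx V u -> uV V u.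
Proof. by move=> vV Vu nu; split=> //; [exact: mx_neq0 nu|exact: unitV]. Qed.
Lemma uV_nmx V u : uV V u -> ~ mx V u.
Proof. by case=> u0 _ Vu /(mxP _ u0); apply. Qed.
Lemma uVM V u w : valring V -> uV V u -> uV V w -> uV V (u * w).
Proof.
move=> [sV _] [u0 Vu Vu'] [w0 Vw Vw']; split; first exact: mulf_neq0.
  exact: (srM sV).
by rewrite invfM; exact: (srM sV).
Qed.
Lemma uVV V u : uV V u -> uV V u^-1.
Proof. by case=> u0 Vu Vu'; split; rewrite ?invr_eq0 ?invrK. Qed.
Lemma uVX V u n : valring V -> uV V u -> uV V (u ^+ n).
Proof.
move=> [sV _] [u0 Vu Vu']; split; [exact: expf_neq0|exact: (srX sV)|].
by rewrite -exprVn; exact: (srX sV).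
Qed.

(** The trace of V on C(z1, z2) is the localization of C(z1)[z2] at a prime [rho], found as a
    polynomial of least degree in z2 with value in the maximal ideal. Pseudo-division can replace
    division because its multipliers lie in C[z1] and are units of V. *)
Lemma unif V z1 z2 : cval V -> indep z1 z2 -> trans V z1 -> V z2 ->
  (exists p, p != 0 /\ mx V (ev z1 z2 p)) ->
  exists rho : {poly {poly C}}, [/\ (1 < size rho)%N, mx V (ev z1 z2 rho),
     forall p, p != 0 -> (size p < size rho)%N -> ~ mx V (ev z1 z2 p),
     forall p, mx V (ev z1 z2 p) -> exists k q, (lead_coef rho) ^+ k *: p = q * rho
   & forall p, p != 0 -> exists s c q,
     [/\ c != 0, c *: p = q * rho ^+ s & ~ mx V (ev z1 z2 q)]].
Proof.
move=> hV ind [V1 t1] V2 ex.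
have sV := cval_sub hV.
have exn : exists n, `[< exists p, [/\ p != 0, mx V (ev z1 z2 p) & size p = n] >].
  by case: ex => p [p0 mp]; exists (size p); apply/asboolP; exists p.
case: (ex_minnP exn) => n /asboolP [rho [r0 mr sr]] nmin.
have small p : p != 0 -> (size p < size rho)%N -> ~ mx V (ev z1 z2 p).
  move=> p0 sp mp; have := nmin (size p); rewrite leqNgt -sr sp => H.
  by have /H : `[< exists p0, [/\ p0 != 0, mx V (ev z1 z2 p0) & size p0 = size p] >];
    first by apply/asboolP; exists p.
have sr1 : (1 < size rho)%N.
  rewrite ltnNge; apply/negP => h; have := mr.
  rewrite (size1_polyC h) evC; apply: t1; apply: contraNneq r0 => E.
  by rewrite (size1_polyC h) E.
have divr p : mx V (ev z1 z2 p) -> exists k q, (lead_coef rho) ^+ k *: p = q * rho.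
  move=> mp; exists (scalp p rho), (p %/ rho); have E := Pdiv.Idomain.divp_eq p rho.
  suff : p %% rho = 0 by move=> h; rewrite {1}E h addr0.
  apply/eqP; apply/not_notP => /negP m0.
  have sm : (size (modp p rho) < size rho)%N by rewrite ltn_modp.
  apply: (small _ m0 sm).
  have -> : p %% rho = lead_coef rho ^+ scalp p rho *: p - p %/ rho * rho.
    by rewrite E addrC addKr.
  rewrite evB evZ evM ev1Xn; apply: (mxB hV.1); apply: (mxMl hV.1) => //.
    by apply: (srX sV); exact: cval_ev1.
  exact: cval_ev.
exists rho; split=> // p.
have [m] := ubnP (size p); elim: m p => // m IH p sp p0.
case: (EM (mx V (ev z1 z2 p))) => mp; last first.
  by exists 0%N, 1, p; rewrite oner_neq0 scale1r expr0 mulr1.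
have [k [q E]] := divr p mp.
have lr0 : lead_coef rho ^+ k != 0 by rewrite expf_neq0 // lead_coef_eq0.
have q0 : q != 0.
  apply: contraNneq p0 => q0; move/eqP: E; rewrite q0 mul0r.
  by rewrite scale_poly_eq0 (negPf lr0).
have sE : size p = (size q + size rho).-1.
  by rewrite -(size_mul q0 r0) -E size_scale.
have [|//|s [c [q' [c0 Eq nq]]]] := IH q.
  have : (0 < size q)%N by rewrite size_poly_gt0.
  by lia.
exists s.+1, (c * lead_coef rho ^+ k), q'; split=> //; first exact: mulf_neq0.
by rewrite -scalerA E scalerAl Eq -mulrA -exprSr.
Qed.

Lemma unif_ev V z1 z2 rho s c q p : cval V -> trans V z1 -> V z2 -> indep z1 z2 ->
  c != 0 -> c *: p = q * rho ^+ s -> ~ mx V (ev z1 z2 q) ->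
  exists2 u, uV V u & ev z1 z2 p = u * ev z1 z2 rho ^+ s.
Proof.
move=> hV [V1 t1] V2 ind c0 E nq; exists (ev z1 z2 q / ev1 z1 c).
  apply: (uVM hV.1); first by apply: (uVP hV.1) => //; exact: cval_ev.
  by apply/uVV/(uVP hV.1); [exact: cval_ev1|exact: t1].
have := congr1 (ev z1 z2) E; rewrite evZ evM evXn.
have h := mx_neq0 (t1 _ c0).
by move=> E'; apply: (mulfI h); rewrite E'; field.
Qed.

Lemma pi_int V pi l : valring V -> mx V pi -> pi != 0 -> uV V (pi ^ l) -> l = 0.
Proof.
move=> vV mp p0; case: l => [[|n]|n] // h; exfalso.
  by apply: (uV_nmx h); apply: (mxX vV).
by have /uV_nmx := uVV h; rewrite /exprz invrK; apply; apply: (mxX vV).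
Qed.

(* Discreteness of V: h counts how often an element can be divided by non-units. *)
Lemma val_measure V x y z1 z2 : cval V -> gens iota x y -> indep z1 z2 ->
  trans V z1 -> V z2 -> (exists f, ~ V f) ->
  exists h : K -> nat, forall f g, V f -> f != 0 -> mx V g -> g != 0 ->
    V (f / g) -> (h (f / g) < h f)%N.
Proof.
move=> hV gen ind t1 V2 [f0 nf0]; have vV := hV.1; have sV := cval_sub hV.
have [d Hd] := dep z1 z2 gen; have V1 := t1.1.
have f00 : f0 != 0 by apply/eqP => E; apply: nf0; rewrite E; exact: (sr0 sV).
have ex : exists p, p != 0 /\ mx V (ev z1 z2 p).
  have mf : mx V f0^-1 by right; rewrite invrK.
  have [P [[i0 Pi0] sP]] := Hd (fun i => f0^-1 ^+ i).
  have exn : exists n, `[< exists i : 'I_d.+1, P i != 0 /\ i = n :> nat >].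
    by exists i0; apply/asboolP; exists i0.
  case: (ex_minnP exn) => n /asboolP [i [Pi ni]] nmin.
  (* Dividing the relation by the lowest power of 1 / f0 that occurs leaves this coefficient in the
     maximal ideal. *)
  exists (P i); split=> //.
  have E : ev z1 z2 (P i) = - \sum_(j | j != i) ev z1 z2 (P j) * (f0^-1 ^+ j / f0^-1 ^+ i).
    apply: (mulIf (expf_neq0 i (invr_neq0 f00))); rewrite mulNr mulr_suml.
    apply/eqP; rewrite -addr_eq0; apply/eqP; rewrite -[RHS]sP [RHS](bigD1 i) //=.
    congr (_ + _); apply: eq_bigr => j _.
    by rewrite -mulrA divfK // expf_neq0 // invr_eq0.
  rewrite E; apply: (mxN vV); apply: (mx_sum vV) => j ji.
  have [->|Pj] := eqVneq (P j) 0; first by rewrite ev0 mul0r; left.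
  have ij : (i < j)%N.
    rewrite ltn_neqAle eq_sym (inj_eq val_inj) ji /= ni; apply: nmin.
    by apply/asboolP; exists j.
  apply: (mxMl vV); first exact: cval_ev.
  rewrite -expfB //; apply: (mxX vV) => //; by rewrite subn_gt0.
have [rho [sr mr _ _ Hr]] := unif hV ind t1 V2 ex.
set pi := ev z1 z2 rho in mr.
have r0 : rho != 0 by rewrite -size_poly_gt0; lia.
have p0 : pi != 0 by apply: contra_neq r0 => /ind.
have evpi p : p != 0 -> exists u s, uV V u /\ ev z1 z2 p = u * pi ^+ s.
  move=> /Hr [s [c [q [c0 E nq]]]].
  by have [u uu Eu] := unif_ev hV t1 V2 ind c0 E nq; exists u, s.
(* A dependence among the powers of g has two terms of equal value; their quotient is a power of g,
   up to a power of pi and a unit. *)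
have L1 g : g != 0 -> exists k l, [/\ (0 < k <= d)%N & uV V (g ^+ k / pi ^ l)].
  move=> g0; have [P [[i0 Pi0] sP]] := Hd (fun i => g ^+ i).
  have n0 i : P i != 0 -> ev z1 z2 (P i) * g ^+ i != 0.
    by move=> Pi; rewrite mulf_neq0 ?expf_neq0 //; apply: contra_neq Pi => /ind.
  have [i [j [ij gi gj Vij Vji]]] := vr_sum0 vV (n0 _ Pi0) sP.
  wlog lt : i j ij gi gj Vij Vji / (j < i)%N.
    move=> W; case: (ltngtP j i) => h; first exact: (W i j).
      by apply: (W j i) => //; rewrite eq_sym.
    by case/eqP: ij; apply: val_inj.
  have Pi : P i != 0 by apply: contraNneq gi => ->; rewrite ev0 mul0r.
  have Pj : P j != 0 by apply: contraNneq gj => ->; rewrite ev0 mul0r.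
  have [u [s [uu Eu]]] := evpi _ Pi; have [w [r [uw Ew]]] := evpi _ Pj.
  exists (i - j)%N, (r%:Z - s%:Z); split; first by have := ltn_ord i; lia.
  have [u0 _ _] := uu; have [w0 _ _] := uw.
  have -> : g ^+ (i - j) / pi ^ (r%:Z - s%:Z) =
      (ev z1 z2 (P i) * g ^+ i / (ev z1 z2 (P j) * g ^+ j)) * (w / u).
    rewrite Eu Ew (expfB _ lt) expfzDr // -invr_expz -!exprnP.
    by field; rewrite !expf_neq0 ?u0 ?w0.
  apply: (uVM vV); last by apply: (uVM vV) => //; exact: uVV.
  split=> //; first by rewrite mulf_neq0 ?invr_eq0.
  by rewrite invf_div.
(* The factorial is a multiple of every exponent k <= d, so one normalization serves all g and the
   order becomes additive. *)
have L2 g : g != 0 -> exists l, uV V (g ^+ d`! / pi ^ l).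
  move=> /L1 [k [l [/andP [k0 kd] H]]].
  have /dvdnP [e E] : (k %| d`!)%N by apply: dvdn_fact; rewrite k0.
  exists (l * e%:Z); have := uVX e vV H.
  have -> : pi ^ (l * e%:Z) = (pi ^ l) ^+ e by rewrite exprnP exprz_exp.
  by rewrite expr_div_n -exprM mulnC -E.
have /choice [L HL] : forall g, exists l, g != 0 -> uV V (g ^+ d`! / pi ^ l).
  move=> g; have [->|g0] := eqVneq g 0; first by exists 0.
  by have [l Hl] := L2 g g0; exists l.
have pn (l : int) : (0 < l) -> mx V (pi ^ l).
  by case: l => [[|n]|n] // _; apply: (mxX vV).
have pl (l : int) : pi ^ l != 0 by rewrite expfz_neq0.
have Lge g : V g -> g != 0 -> 0 <= L g.
  move=> Vg g0; rewrite leNgt; apply/negP => lt.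
  apply: (uV_nmx (HL g g0)); rewrite invr_expz; apply: (mxMl vV); first exact: (srX sV).
  by apply: pn; rewrite oppr_gt0.
have Lgt g : mx V g -> g != 0 -> 0 < L g.
  move=> mg g0; rewrite ltNge; apply/negP => le.
  apply: (uV_nmx (HL g g0)); apply: (mxMr vV); first by apply: (mxX vV) => //; exact: fact_gt0.
  rewrite invr_expz; case: (ltP (L g) 0) => h.
    by apply: (mx_V vV); apply: pn; rewrite oppr_gt0.
  have -> : L g = 0 by lia.
  by rewrite oppr0 expr0z; exact: (sr1 sV).
exists (fun f => `|L f|%N) => f g Vf fn mg gn Vfg.
have fgn : f / g != 0 by rewrite mulf_neq0 ?invr_eq0.
have E : L f = L (f / g) + L g.
  suff : L f - L g - L (f / g) = 0 by lia.
  apply: (pi_int vV mr p0).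
  have -> : pi ^ (L f - L g - L (f / g)) = (f ^+ d`! / pi ^ L f)^-1 *
      (g ^+ d`! / pi ^ L g) * ((f / g) ^+ d`! / pi ^ L (f / g)).
    rewrite expr_div_n !expfzDr // -!invr_expz.
    by field; rewrite !pl !expf_neq0.
  apply: (uVM vV); last exact: HL.
  by apply: (uVM vV); [apply/uVV; exact: HL|exact: HL].
have := Lge _ Vfg fgn; have := Lgt _ mg gn; have := Lge _ Vf fn; lia.
Qed.

End Der.

(** * Brackets of functions, and coordinates adapted to a divisor *)

Section Bracket.
Variables (C : numClosedFieldType) (K : fieldType) (iota : {rmorphism C -> K}).
Local Notation ev := (ev iota).
Local Notation ev1 := (ev1 iota).
Local Notation cval := (cval iota).
Local Notation trans := (trans iota).
Local Notation indep := (indep iota).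
Local Notation gens := (gens iota).
Local Notation coord := (coord iota).
Implicit Types (V : K -> Prop) (p q : {poly {poly C}}).

Definition deriv_of (d : K -> K) := [/\ forall f g, d (f + g) = d f + d g,
  forall f g, d (f * g) = d f * g + f * d g & forall c, d (iota c) = 0].

Definition dX p : {poly {poly C}} := \poly_(i < size p) (p`_i)^`().

Section OneDerivation.
Variable (d : K -> K).
Hypothesis hd : deriv_of d.

Lemma dD f g : d (f + g) = d f + d g. Proof. by case: hd. Qed.
Lemma dM f g : d (f * g) = d f * g + f * d g. Proof. by case: hd. Qed.
Lemma dC c : d (iota c) = 0. Proof. by case: hd. Qed.
Lemma d0 : d 0 = 0. Proof. by rewrite -{1}(rmorph0 iota) dC. Qed.
Lemma d1 : d 1 = 0. Proof. by rewrite -{1}(rmorph1 iota) dC. Qed.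
Lemma dN f : d (- f) = - d f.
Proof. by apply/eqP; rewrite -addr_eq0 -dD addNr d0. Qed.
Lemma dB f g : d (f - g) = d f - d g. Proof. by rewrite dD dN. Qed.
Lemma dV f : f != 0 -> d f^-1 = - d f / f ^+ 2.
Proof.
move=> f0; have : d (f * f^-1) = 0 by rewrite divff // d1.
rewrite dM => /eqP; rewrite addr_eq0 => /eqP E.
apply: (mulfI f0); rewrite -[f * d _]opprK -E; field; exact: f0.
Qed.
Lemma ddiv f g : g != 0 -> d (f / g) = (d f * g - f * d g) / g ^+ 2.
Proof. by move=> g0; rewrite dM dV //; field. Qed.
Lemma dX_ f n : d (f ^+ n) = n%:R * f ^+ n.-1 * d f.
Proof.
elim: n => [|n IH]; first by rewrite expr0 d1 !mul0r.
rewrite exprS dM IH /= -[in RHS]natr1; case: n {IH} => [|n].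
  by rewrite expr0; ring.
by rewrite /= exprS -!natr1; ring.
Qed.

Lemma d_ev1 x (c : {poly C}) : d (ev1 x c) = ev1 x c^`() * d x.
Proof.
elim/poly_ind: c => [|c a IH]; first by rewrite linear0 !ev10 d0 mul0r.
by rewrite derivD derivM derivX derivC !ev1E dD dM IH dC; ring.
Qed.

Lemma d_ev x y p : d (ev x y p) = ev x y (dX p) * d x + ev x y p^`() * d y.
Proof.
elim/poly_ind: p => [|p c IH].
  by rewrite linear0 /dX size_poly0 !ev0 d0 poly_def big_ord0 ev0 !mul0r addr0.
have -> : dX (p * 'X + c%:P) = dX p * 'X + (c^`())%:P.
  have cdX q i : (dX q)`_i = (q`_i)^`().
    rewrite coef_poly; case: ltnP => // h.
    by rewrite nth_default // linear0.
  apply/polyP => i; rewrite cdX !coefD !coefMX !coefC cdX.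
  by case: (i == 0%N); rewrite derivD ?linear0.
by rewrite derivD derivM derivX derivC !evE' dD dM IH d_ev1; ring.
Qed.

End OneDerivation.

Definition bracket (br : K -> K -> K) :=
  (forall f, deriv_of (br f)) /\ forall f g, br g f = - br f g.

Variable br : K -> K -> K.
Hypothesis hbr : bracket br.

Lemma br_deriv f : deriv_of (br f). Proof. exact: hbr.1. Qed.
Lemma brN f g : br g f = - br f g. Proof. exact: hbr.2. Qed.
Lemma brff f : br f f = 0.
Proof.
apply/eqP; have /eqP := brN f f; rewrite -addr_eq0 -mulr2n -mulr_natl mulf_eq0.
by rewrite (negPf (char0 iota 1)).
Qed.

Lemma gens_deriv x y f : gens x y ->
  exists f1 f2, forall d, deriv_of d -> d f = f1 * d x + f2 * d y.
Proof.
move=> /(_ f) [p [q [q0 ->]]].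
exists ((ev x y (dX p) * ev x y q - ev x y p * ev x y (dX q)) / ev x y q ^+ 2).
exists ((ev x y p^`() * ev x y q - ev x y p * ev x y q^`()) / ev x y q ^+ 2).
move=> d hd; rewrite ddiv // !(d_ev hd); move: q0.
move: (ev x y (dX p)) (ev x y (dX q)) (ev x y p^`()) (ev x y q^`()) (ev x y p) (ev x y q) => ? ? ? ? ? u u0.
by field.
Qed.

(** A derivation of K is determined by its values on x and y, so the bracket is a Jacobian
    determinant times {x, y}. *)
Lemma br_det x y : gens x y -> exists c1 c2 : K -> K,
  forall u v, br u v = (c1 u * c2 v - c2 u * c1 v) * br x y.
Proof.
move=> gen.
have /choice [c Hc] : forall f, exists c : K * K,
    forall d, deriv_of d -> d f = c.1 * d x + c.2 * d y.
  by move=> f; have [f1 [f2 H]] := gens_deriv f gen; exists (f1, f2).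
exists (fun f => (c f).1), (fun f => (c f).2) => u v.
rewrite (Hc v _ (br_deriv u)) (brN x u) (brN y u).
rewrite (Hc u _ (br_deriv x)) (Hc u _ (br_deriv y)) !brff (brN x y); ring.
Qed.

Lemma br_plucker x y t f a b : gens x y ->
  br t f * br a b = br t a * br f b - br t b * br f a.
Proof.
by move=> /br_det [c1 [c2 H]]; rewrite !(H _ a) !(H _ b) !(H _ f); ring.
Qed.

Lemma br_neq0 x y u v : gens x y -> br u v != 0 -> br x y != 0.
Proof.
move=> /br_det [c1 [c2 H]]; rewrite (H u v).
by apply: contra_neq => ->; rewrite mulr0.
Qed.

Lemma br_trans z g (c : {poly C}) : br z g != 0 -> c != 0 -> ev1 z c != 0.
Proof.
move=> zg /(poly_split iota) [a [s [a0 ->]]].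
rewrite mulf_neq0 ?iota_eq0 //; elim: s => [|r s IH].
  by rewrite big_nil oner_neq0.
rewrite big_cons mulf_neq0 // subr_eq0.
apply: contra_neq zg => ->.
by rewrite brN dC ?oppr0 //; exact: br_deriv.
Qed.

Lemma deriv_neq0 (R : idomainType) (p : {poly R}) :
  (forall n, n.+1%:R != 0 :> R) -> (1 < size p)%N ->
  p^`() != 0 /\ (size p^`() < size p)%N.
Proof.
move=> ch sp; split; last by apply: lt_size_deriv; rewrite -size_poly_gt0; lia.
apply/eqP => /(congr1 (fun q : {poly R} => q`_(size p).-2)).
rewrite coef_deriv coef0 => /eqP.
have -> : (size p).-2.+1 = (size p).-1 by lia.
rewrite -mulr_natr mulf_eq0 -/(lead_coef p) lead_coef_eq0.
have -> : (size p).-1 = (size p).-2.+1 by lia.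
by rewrite (negPf (ch _)) orbF => /eqP p0; move: sp; rewrite p0 size_poly0.
Qed.

Lemma char0_poly n : n.+1%:R != 0 :> {poly C}.
Proof. by rewrite -polyC_natr polyC_eq0 pnatr_eq0. Qed.

(** Applying {z1, .} to a relation gives one of lower degree in z2, which in characteristic 0 is
    nontrivial unless z2 did not occur. *)
Lemma br_indep z1 z2 : br z1 z2 != 0 -> indep z1 z2.
Proof.
move=> nz p; have [n] := ubnP (size p); elim: n p => // n IH p sp E.
apply/eqP; apply/not_notP => /negP p0.
case: (leqP (size p) 1) => s1.
  have Ep := size1_polyC s1; rewrite Ep evC in E.
  have c0 : p`_0 != 0 by apply: contraNneq p0 => c0; rewrite Ep c0.
  by have := br_trans nz c0; rewrite E eqxx.
have [d0' sd] := deriv_neq0 char0_poly s1.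
have := d_ev (br_deriv z1) z1 z2 p; rewrite E d0 ?brff ?mulr0 ?add0r; last exact: br_deriv.
move/esym/eqP; rewrite mulf_eq0 (negPf nz) orbF => /eqP E2.
have H : p^`() = 0 by apply: IH => //; apply: leq_trans sd _; rewrite -ltnS.
by rewrite H eqxx in d0'.
Qed.

(** When V is not all of K, it is the local ring of a curve of the (x, y)-plane other than a line x
    = constant. *)
Definition good V x y := [/\ coord x y, trans V x & V y].

Section Good.
Variables (V : K -> Prop).
Hypotheses (hV : cval V) (nt : exists f, ~ V f).
Let vV := hV.1.
Let sV := cval_sub hV.

Lemma good_ex x y : gens x y -> V x -> V y -> exists p, p != 0 /\ mx V (ev x y p).
Proof.
move=> gen Vx Vy; case: nt => f nf.
have f0 : f != 0 by apply/eqP => E; apply: nf; rewrite E; exact: (sr0 sV).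
have mf : mx V f^-1 by right; rewrite invrK.
have [p [q [q0 E]]] := gen f^-1; exists p; split.
  apply/eqP => p0; move: (invr_neq0 f0); rewrite E p0 ev0 mul0r eqxx //.
have -> : ev x y p = f^-1 * ev x y q by rewrite E divfK.
by apply: (mxMr vV) => //; exact: cval_ev.
Qed.

Lemma good_pi x y : good V x y -> exists rho : {poly {poly C}}, [/\ (1 < size rho)%N,
   mx V (ev x y rho), ev x y rho != 0,
   forall p, p != 0 -> (size p < size rho)%N -> ~ mx V (ev x y p)
   & (forall p, mx V (ev x y p) -> exists k q, (lead_coef rho) ^+ k *: p = q * rho) /\
   forall f, f != 0 -> exists p q (s : int), [/\ ~ mx V (ev x y p), ~ mx V (ev x y q)
      & f = ev x y p / ev x y q * ev x y rho ^ s]].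
Proof.
move=> [[ind gen] tx Vy].
have Vx := tx.1.
have [rho [sr mr small divr Hr]] := unif hV ind tx Vy (good_ex gen Vx Vy).
have r0 : rho != 0 by rewrite -size_poly_gt0; lia.
have p0 : ev x y rho != 0 by apply: contra_neq r0 => /ind.
exists rho; split=> //; split=> // f f0.
have [p [q [q0 E]]] := gen f.
have pn : p != 0 by apply: contraNneq f0 => p0'; rewrite E p0' ev0 mul0r.
have qn : q != 0 by apply: contraNneq q0 => ->; rewrite ev0.
have [s [c [p' [c0 Ep np]]]] := Hr p pn; have [r [e [q' [e0 Eq nq]]]] := Hr q qn.
have nce c1 : c1 != 0 -> ~ mx V (ev x y c1%:P) by rewrite evC; apply: tx.2.
exists (p' * e%:P), (q' * c%:P), (s%:Z - r%:Z); split.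
- by rewrite evM; apply: (nmxM vV) => //; try exact: cval_ev; apply: nce.
- by rewrite evM; apply: (nmxM vV) => //; try exact: cval_ev; apply: nce.
have := congr1 (ev x y) Ep; have := congr1 (ev x y) Eq; rewrite !evE' => Eq' Ep'.
have c0' : ev1 x c != 0 by have := mx_neq0 (nce _ c0); rewrite evC.
have e0' : ev1 x e != 0 by have := mx_neq0 (nce _ e0); rewrite evC.
have q0' := mx_neq0 nq.
rewrite E expfzDr // -invr_expz -!exprnP.
have -> : ev x y p = ev x y p' * ev x y rho ^+ s / ev1 x c.
  by apply: (mulfI c0'); rewrite Ep'; field.
have -> : ev x y q = ev x y q' * ev x y rho ^+ r / ev1 x e.
  by apply: (mulfI e0'); rewrite Eq'; field.
by field; rewrite !expf_neq0 ?p0 ?c0' ?e0' ?q0'.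
Qed.

Lemma good_frac x y f : good V x y -> V f ->
  exists p q, ~ mx V (ev x y q) /\ f = ev x y p / ev x y q.
Proof.
move=> hg Vf; have [[ind gen] tx Vy] := hg.
have [->|f0] := eqVneq f 0.
  by exists 0, 1; rewrite ev_1 ev0 mul0r; split=> //; exact: (mx1 vV).
have [rho [sr mr p0 _ [_ H]]] := good_pi hg.
have [p [q [s [np nq E]]]] := H f f0.
case: s E => s E.
  by exists (p * rho ^+ s), q; split=> //; rewrite E evM evXn -exprnP; ring.
exfalso; have : mx V f^-1.
  have np0 := mx_neq0 np; have nq0 := mx_neq0 nq.
  have -> : f^-1 = ev x y q / ev x y p * ev x y rho ^+ s.+1.
    by rewrite E NegzE -invr_expz -exprnP; field; rewrite !expf_neq0 ?np0 ?nq0.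
  apply: (mxMl vV); last exact: (mxX vV).
  by apply: (srM sV); [exact: cval_ev tx.1 Vy|apply: unitV => //; exact: cval_ev tx.1 Vy].
by case=> [/eqP|]; rewrite ?invr_eq0 ?invrK // (negPf f0).
Qed.

Lemma good_deriv x y d : good V x y -> deriv_of d -> V (d x) -> V (d y) ->
  forall f, V f -> V (d f).
Proof.
move=> hg hd dx dy f Vf; have [_ [Vx _] Vy] := hg.
have [p [q [nq ->]]] := good_frac hg Vf.
have q0 := mx_neq0 nq; have Vev r : V (ev x y r) by exact: cval_ev.
have Vd r : V (d (ev x y r)) by rewrite d_ev //; apply: (srD sV); apply: (srM sV).
rewrite ddiv // -exprVn; apply: (srM sV); last by apply: (srX sV); exact: unitV.
by apply: (srB sV); apply: (srM sV).
Qed.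

Lemma deriv_scale d c : deriv_of d -> deriv_of (fun f => d f / c).
Proof.
case=> h1 h2 h3; split=> [f g|f g|a]; rewrite ?h1 ?h2 ?h3; ring.
Qed.

(** The quotient is the Jacobian of f and g in (x, y), and V is a localization of C[x, y], on which
    both partial derivatives act. *)
Lemma good_br x y f g : good V x y -> V f -> V g -> V (br f g / br x y).
Proof.
move=> hg Vf Vg; have [[ind gen] [Vx _] Vy] := hg.
have [J0|J0] := eqVneq (br x y) 0; first by rewrite J0 invr0 mulr0; exact: (sr0 sV).
have hd u := deriv_scale (br x y) (br_deriv u).
have V1 : V 1 := sr1 sV.
have Vx' u : V u -> V (br x u / br x y).
  apply: (good_deriv hg (hd x)); first by rewrite brff mul0r; exact: (sr0 sV).
  by rewrite divff.
have Vy' u : V u -> V (br y u / br x y).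
  apply: (good_deriv hg (hd y)); last by rewrite brff mul0r; exact: (sr0 sV).
  by rewrite brN mulNr divff //; exact: (srN sV).
apply: (good_deriv hg (hd f)) Vg.
  by rewrite brN mulNr; apply: (srN sV); exact: Vx'.
by rewrite brN mulNr; apply: (srN sV); exact: Vy'.
Qed.

End Good.

(** The derivation induced on the residue field kills z and hence everything algebraic over C(z):
    differentiate an equation of f of least degree. *)
Lemma alg_deriv V d z f : cval V -> deriv_of d -> (forall g, V g -> V (d g)) ->
  (forall g, mx V g -> mx V (d g)) -> trans V z -> mx V (d z) -> V f ->
  (exists p, p != 0 /\ mx V (ev z f p)) -> mx V (d f).
Proof.
move=> hV hd dV' dm [Vz tz] dz Vf ex; have vV := hV.1.
have exn : exists n, `[< exists p, [/\ p != 0, mx V (ev z f p) & size p = n] >].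
  by case: ex => p [p0 mp]; exists (size p); apply/asboolP; exists p.
case: (ex_minnP exn) => n /asboolP [p [p0 mp sp]] nmin.
have s1 : (1 < size p)%N.
  rewrite ltnNge; apply/negP => h; have := mp.
  rewrite (size1_polyC h) evC; apply: tz; apply: contraNneq p0 => E.
  by rewrite (size1_polyC h) E.
have [d0' sd] := deriv_neq0 char0_poly s1.
have : mx V (ev z f p^`() * d f).
  have -> : ev z f p^`() * d f = d (ev z f p) - ev z f (dX p) * d z.
    by rewrite (d_ev hd) addrC addKr.
  by apply: (mxB vV); [exact: dm|apply: (mxMl vV) => //; exact: cval_ev].
case/(mx_prime vV) => //; [exact: cval_ev|exact: dV'|] => m'.
have := nmin (size p^`()); rewrite -sp leqNgt sd => H.
by have /H : `[< exists q, [/\ q != 0, mx V (ev z f q) & size q = size p^`()] >];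
  first by apply/asboolP; exists p^`().
Qed.

(** Take a dependence of the powers of f over C[t, pi], cancel the highest common power of pi and
    reduce modulo the maximal ideal. *)
Lemma alg_mod V x y t pi f : cval V -> gens x y -> V t -> mx V pi -> pi != 0 ->
  V f -> exists p, p != 0 /\ mx V (ev t f p).
Proof.
move=> hV gen Vt mpi pi0 Vf; have vV := hV.1; have sV := cval_sub hV.
have [d Hd] := dep t pi gen; have [P [[i0 Pi0] E]] := Hd (fun i => f ^+ i).
have exn : exists n, `[< exists i, (P i)`_n != 0 >].
  by exists (size (P i0)).-1; apply/asboolP; exists i0; rewrite -/(lead_coef _) lead_coef_eq0.
case: (ex_minnP exn) => k /asboolP [i Pik] kmin.
have PE j : P j = drop_poly k (P j) * 'X^k.
  rewrite -{1}(poly_take_drop k (P j)) -[RHS]add0r; congr (_ + _).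
  apply/polyP => l; rewrite coef_take_poly coef0; case: ltnP => // lk.
  apply/eqP; apply/not_notP => /negP h.
  by have := kmin l; rewrite leqNgt lk => H; have /H : `[< exists i, (P i)`_l != 0 >]
    by apply/asboolP; exists j.
have Vpi := mx_V vV mpi.
pose w j := ev t pi (drop_poly 1 (drop_poly k (P j))).
have wE j : ev t pi (P j) = pi ^+ k * (ev1 t (P j)`_k + pi * w j).
  rewrite {1}PE evM evXn evY mulrC /w; congr (_ * _).
  have <- : (drop_poly k (P j))`_0 = (P j)`_k by rewrite coef_drop_poly.
  move: (drop_poly k (P j)) => D.
  have DE : D = (D`_0)%:P + drop_poly 1 D * 'X.
    rewrite -{1}(poly_take_drop 1 D) expr1; congr (_ + _).
    by apply/polyP => l; rewrite coef_take_poly coefC; case: l.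
  by rewrite {1}DE evD evM evY evC mulrC.
exists (\poly_(j < d.+1) (P (inord j))`_k); split.
  apply/eqP => /(congr1 (fun q : {poly {poly C}} => q`_i)).
  by rewrite coef_poly ltn_ord inord_val coef0 => /eqP; rewrite (negPf Pik).
rewrite (ev_sum_wide _ _ _ (size_poly _ _)).
have -> : \sum_(l < d.+1) ev1 t (\poly_(j < d.+1) (P (inord j))`_k)`_l * f ^+ l =
    - (pi * \sum_(l < d.+1) w l * f ^+ l).
  apply/eqP; rewrite -addr_eq0 mulr_sumr -big_split /=.
  apply/eqP; apply: (mulfI (expf_neq0 k pi0)); rewrite mulr0 -[RHS]E mulr_sumr.
  apply: eq_bigr => l _; rewrite wE coef_poly ltn_ord inord_val; ring.
apply: (mxN vV); apply: (mxMr vV) => //; apply: (sr_sum sV) => l _.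
by apply: (srM sV); [exact: cval_ev|exact: (srX sV)].
Qed.

(* The local ring O is unramified in V: its derivation f |-> {t, f} / {a, b}
   lowers the order of vanishing by 1 + v({a, b} / {x, y}) and never creates
   poles, while fractions of O attain order 1. *)
Lemma unramified V x y t a b (O : K -> Prop) : cval V -> (exists f, ~ V f) ->
  good V x y -> trans V t -> subring O -> (forall f, O f -> V f) ->
  (forall f, exists g h, [/\ O g, O h, h != 0 & f = g / h]) ->
  O t -> O a -> O b -> br a b != 0 ->
  (forall f, O f -> O (br f a / br a b) /\ O (br f b / br a b)) ->
  V (br x y / br a b).
Proof.
move=> hV nt hg tt sO OV frO Ot Oa Ob A0 dO; have vV := hV.1; have sV := cval_sub hV.
have [[ind gen] tx Vy] := hg.
set A := br a b in A0 dO *.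
have J0 := br_neq0 gen A0; set J := br x y in J0 *.
have [rho [sr mr pi0 small [_ ord]]] := good_pi hV nt hg.
set pi := ev x y rho in mr pi0 ord.
have {}ord f : f != 0 -> exists u (s : int), uV V u /\ f = u * pi ^ s.
  move=> /ord [p [q [s [np nq E]]]]; exists (ev x y p / ev x y q), s; split=> //.
  have [Vp Vq] : V (ev x y p) /\ V (ev x y q) by split; exact: cval_ev tx.1 Vy.
  by apply: (uVM vV); [exact: uVP|apply: uVV; exact: uVP].
have Vbr f g : V f -> V g -> V (br f g / J) by exact: good_br.
pose dl f := br t f / J.
have hdl : deriv_of dl by exact: deriv_scale (br_deriv t).
have Vt := tt.1; have Vpi := mx_V vV mr.
have pil (l : int) : 0 < l -> mx V (pi ^ l).
  by case: l => [[|n]|n] // _; apply: (mxX vV).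
have piS (l : int) : pi ^ l = pi * pi ^ (l - 1).
  have {1}-> : l = 1 + (l - 1) by ring.
  by rewrite (expfzDr 1 _ pi0) expr1z.
(* Otherwise {pi, .} / J, which preserves the maximal ideal, induces a derivation of the residue
   field that kills t and so everything, x included; but {pi, x} / J is minus the derivative of
   [rho] in y, whose degree is too small to lie in the maximal ideal. *)
have dpi : ~ mx V (dl pi).
  move=> h.
  pose d' f := br pi f / J.
  have hd' : deriv_of d' by exact: deriv_scale (br_deriv pi).
  have d'V f : V f -> V (d' f) by exact: Vbr.
  have d'm f : mx V f -> mx V (d' f).
    move=> mf; have [->|f0] := eqVneq f 0; first by rewrite d0 //; left.
    have [u [s [uu E]]] := ord f f0.
    have s0 : 0 < s.
      rewrite ltNge; apply/negP => s0; apply: (uV_nmx uu).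
      have -> : u = f * pi ^ (- s) by rewrite E -mulrA -expfzDr // subrr expr0z mulr1.
      apply: (mxMr vV) => //; case: (ltP s 0) => h'.
        by apply: (mx_V vV); apply: pil; rewrite oppr_gt0.
      have -> : s = 0 by lia.
      by rewrite oppr0 expr0z; exact: (sr1 sV).
    have -> : f = pi * (u * pi ^ (s - 1)).
      by rewrite E mulrCA -piS.
    rewrite (dM hd') /d' brff mul0r mul0r add0r; apply: (mxMr vV) => //; apply: d'V.
    apply: (srM sV); first by case: uu.
    case: (ltP 0 (s - 1)) => h'; first by apply: (mx_V vV); exact: pil.
    have -> : s - 1 = 0 by lia.
    by rewrite expr0z; exact: (sr1 sV).
  have d't : mx V (d' t).
    have -> : d' t = - dl pi by rewrite /d' /dl brN mulNr.
    exact: mxN.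
  have kill f : V f -> mx V (d' f).
    move=> Vf; apply: (alg_deriv hV hd' d'V d'm tt d't Vf).
    exact: (alg_mod hV gen Vt mr pi0 Vf).
  have := kill x tx.1; rewrite /d' brN (d_ev (br_deriv x)) brff mulr0 add0r mulNr -mulrA divff // mulr1.
  move=> /(mxN vV); rewrite opprK.
  have [r0 sd] := deriv_neq0 char0_poly sr.
  exact: small.
have VAJ : V (A / J) by apply: Vbr; exact: OV.
apply/not_notP => nV.
have mAJ : mx V (A / J) by right; rewrite invf_div.
have AJ0 : A / J != 0 by rewrite mulf_neq0 ?invr_eq0.
have [w [e [uw Ew]]] := ord _ AJ0.
have e0 : 0 < e.
  rewrite ltNge; apply/negP => e0; apply: (uV_nmx uw).
  have -> : w = A / J * pi ^ (- e) by rewrite Ew -mulrA -expfzDr // subrr expr0z mulr1.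
  apply: (mxMr vV) => //; case: (ltP e 0) => h'.
    by apply: (mx_V vV); apply: pil; rewrite oppr_gt0.
  have -> : e = 0 by lia.
  by rewrite oppr0 expr0z; exact: (sr1 sV).
have ord_ge0 u (s : int) : uV V u -> V (u * pi ^ s) -> 0 <= s.
  move=> uu Vu; rewrite leNgt; apply/negP => s0; apply: (uV_nmx uu).
  have -> : u = u * pi ^ s * pi ^ (- s) by rewrite -mulrA -expfzDr // subrr expr0z mulr1.
  by apply: (mxMl vV) => //; apply: pil; rewrite oppr_gt0.
have D1 f : O f -> O (br t f / A).
  move=> Of; have -> : br t f / A = (br t a / A) * (br f b / A) - (br t b / A) * (br f a / A).
    by apply: (mulIf A0); apply: (mulIf A0); rewrite divfK // (br_plucker t f a b gen); field.
  by have [h1 h2] := dO _ Of; have [h3 h4] := dO _ Ot; apply: (srB sO); apply: (srM sO).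
have step u (s : int) : uV V u -> s != 0 -> exists2 u', uV V u' &
    br t (u * pi ^ s) / A = u' * pi ^ (s - 1 - e).
  move=> uu s0.
  have [u0 Vu _] := uu; have [w0 Vw Vw'] := uw.
  exists ((pi * dl u + s%:~R * u * dl pi) / w).
    apply: (uVM vV); last exact: uVV.
    apply: (uVP vV).
      apply: (srD sV); first by apply: (srM sV) => //; exact: Vbr.
      apply: (srM sV); last exact: Vbr.
      apply: (srM sV) => //; rewrite -(rmorph_int iota); exact: hV.2.
    move=> h; have : mx V (s%:~R * u * dl pi).
      have -> : s%:~R * u * dl pi = pi * dl u + s%:~R * u * dl pi - pi * dl u by ring.
      by apply: (mxB vV) => //; apply: (mxMr vV) => //; exact: Vbr.
    have Vs : V s%:~R by rewrite -(rmorph_int iota); exact: hV.2.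
    apply: (nmxM vV) => //; [exact: (srM sV)|exact: Vbr|].
    apply: (nmxM vV) => //; last exact: uV_nmx.
    by rewrite -(rmorph_int iota); apply: cval_unit => //; rewrite intr_eq0.
  have dpis : dl (pi ^ s) = s%:~R * pi ^ (s - 1) * dl pi.
    case: s s0 => n; first case: n => // n _.
      rewrite -exprnP dX_ // /= -[_ - 1]/(n.+1%:Z - 1).
      have -> : n.+1%:Z - 1 = n%:Z by lia.
      by rewrite -exprnP pmulrn.
    move=> _; rewrite NegzE -invr_expz -exprnP dV ?expf_neq0 // dX_ //.
    have -> : - n.+1%:Z - 1 = - n.+2%:Z by lia.
    rewrite -invr_expz -exprnP mulrNz -pmulrn /= !exprS; field.
    by rewrite pi0 expf_neq0.
  have -> : br t (u * pi ^ s) / A = dl (u * pi ^ s) * (A / J)^-1.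
    by rewrite /dl; field; rewrite A0 J0.
  rewrite (dM hdl) dpis Ew invfM invr_expz.
  rewrite (piS s).
  rewrite (expfzDr (s - 1) _ pi0); ring.
(* By [step], {t, .} / A lowers a nonzero order by exactly e + 1 and stays in O. So all orders on O
   are multiples of e + 1, and fractions of O could not attain the order 1 of pi. *)
have div f u (s : int) : O f -> uV V u -> f = u * pi ^ s -> (e + 1 %| s)%Z.
  have [n] := ubnP `|s|%N; elim: n f u s => // n IH f u s sn Of uu E.
  have [->|s0] := eqVneq s 0; first exact: dvdz0.
  have sge : 0 <= s by apply: (ord_ge0 u) => //; rewrite -E; exact: OV.
  have [u' uu' E'] := step u s uu s0.
  have Of' := D1 _ Of; rewrite E E' in Of'.
  have s'ge : 0 <= s - 1 - e by apply: (ord_ge0 u') => //; exact: OV.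
  have -> : s = (s - 1 - e) + (e + 1) by ring.
  apply: rpredD; last exact: dvdzz.
  by apply: (IH _ u' _ _ Of') => //; lia.
have [g [h [Og Oh h0 Epi]]] := frO pi.
have g0 : g != 0 by apply: contraNneq pi0 => g0; rewrite Epi g0 mul0r.
have [u1 [s1 [uu1 E1]]] := ord g g0; have [u2 [s2 [uu2 E2]]] := ord h h0.
have : s1 - s2 - 1 = 0.
  apply: (pi_int vV mr pi0).
  have [u10 _ _] := uu1; have [u20 _ _] := uu2.
  have -> : pi ^ (s1 - s2 - 1) = u2 / u1.
    rewrite !expfzDr // -!invr_expz expr1z.
    have {3}-> : pi = u1 * pi ^ s1 / (u2 * pi ^ s2) by rewrite -E1 -E2.
    by field; rewrite u10 u20 !expfz_neq0.
  by apply: (uVM vV) => //; exact: uVV.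
have d1 := div g u1 s1 Og uu1 E1; have d2 := div h u2 s2 Oh uu2 E2.
move=> Es; have := rpredB d1 d2; have -> : s1 - s2 = 1 by lia.
by rewrite dvdz1; lia.
Qed.

End Bracket.

(** * Infinitely near points *)

Lemma drop1E (R : nzRingType) (c : {poly R}) : c = (c`_0)%:P + drop_poly 1 c * 'X.
Proof.
rewrite -[LHS](poly_take_drop 1 c) expr1; congr (_ + _).
by apply/polyP => i; rewrite coef_take_poly coefC; case: i.
Qed.

Section Coord.
Variables (C : numClosedFieldType) (K : fieldType) (iota : {rmorphism C -> K}).
Variable br : K -> K -> K.
Hypothesis hbr : bracket iota br.
Local Notation ev := (ev iota).
Local Notation ev1 := (ev1 iota).
Implicit Types (V : K -> Prop) (p q : {poly {poly C}}).

Definition frac x y f := exists p q, ev x y q != 0 /\ f = ev x y p / ev x y q.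
Definition cd x y := gens iota x y /\ br x y != 0.

Lemma cd_coord x y : cd x y -> coord iota x y.
Proof. by case=> gen nz; split=> //; exact: br_indep hbr _ _ nz. Qed.

Lemma frac_ev x y p : frac x y (ev x y p).
Proof. by exists p, 1; rewrite ev_1 oner_neq0 divr1. Qed.
Lemma fracC x y c : frac x y (iota c).
Proof. by rewrite -(evCC iota x y); exact: frac_ev. Qed.
Lemma fracx x y : frac x y x.
Proof. by rewrite -{2}(evX iota x y); exact: frac_ev. Qed.
Lemma fracy x y : frac x y y.
Proof. by rewrite -{2}(evY iota x y); exact: frac_ev. Qed.
Lemma fracD x y f g : frac x y f -> frac x y g -> frac x y (f + g).
Proof.
move=> [p [q [q0 ->]]] [r [s [s0 ->]]]; exists (p * s + r * q), (q * s).
by rewrite !evE' mulf_neq0 //; split=> //; field; rewrite q0 s0.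
Qed.
Lemma fracM x y f g : frac x y f -> frac x y g -> frac x y (f * g).
Proof.
move=> [p [q [q0 ->]]] [r [s [s0 ->]]]; exists (p * r), (q * s).
by rewrite !evE' mulf_neq0 //; split=> //; field; rewrite q0 s0.
Qed.
Lemma fracV x y f : frac x y f -> frac x y f^-1.
Proof.
move=> [p [q [q0 ->]]]; have [p0|p0] := eqVneq (ev x y p) 0.
  by rewrite p0 mul0r invr0 -(ev0 iota x y); exact: frac_ev.
by exists q, p; rewrite invf_div.
Qed.
Lemma fracN x y f : frac x y f -> frac x y (- f).
Proof.
by move=> h; rewrite -mulN1r; apply: fracM => //; rewrite -(rmorphN1 iota); exact: fracC.
Qed.
Lemma fracB x y f g : frac x y f -> frac x y g -> frac x y (f - g).
Proof. by move=> hf hg; apply: fracD => //; exact: fracN. Qed.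
Lemma fracX x y f n : frac x y f -> frac x y (f ^+ n).
Proof.
move=> hf; elim: n => [|n IH]; rewrite ?expr0 ?exprS; last exact: fracM.
by rewrite -(rmorph1 iota); exact: fracC.
Qed.
Lemma frac_div x y f g : frac x y f -> frac x y g -> frac x y (f / g).
Proof. by move=> hf hg; apply: fracM => //; exact: fracV. Qed.
Lemma frac_sum x y I (r : seq I) (P : pred I) F :
  (forall i, P i -> frac x y (F i)) -> frac x y (\sum_(i <- r | P i) F i).
Proof.
move=> H; apply: big_ind => //; last exact: fracD.
by rewrite -(rmorph0 iota); exact: fracC.
Qed.
Lemma frac_ev1 x y z (c : {poly C}) : frac x y z -> frac x y (ev1 z c).
Proof.
move=> hz; rewrite ev1_sum; apply: frac_sum => i _; apply: fracM; last exact: fracX.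
exact: fracC.
Qed.
Lemma frac_ev2 x y z w p : frac x y z -> frac x y w -> frac x y (ev z w p).
Proof.
move=> hz hw; rewrite ev_sum; apply: frac_sum => i _; apply: fracM; last exact: fracX.
exact: frac_ev1.
Qed.

Lemma gens_trans x y x' y' : gens iota x y -> frac x' y' x -> frac x' y' y ->
  gens iota x' y'.
Proof. by move=> gen hx hy f; have [p [q [_ ->]]] := gen f; apply: frac_div; apply: frac_ev2. Qed.

Lemma cd_trans x y x' y' : cd x y -> frac x' y' x -> frac x' y' y -> cd x' y'.
Proof.
move=> [gen nz] hx hy; have gen' := gens_trans gen hx hy.
by split=> //; exact: (br_neq0 hbr gen' nz).
Qed.

Lemma cd_swap x y : cd x y -> cd y x.
Proof. by move=> h; apply: (cd_trans h); [exact: fracy|exact: fracx]. Qed.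

Lemma cd_neq0 x y : cd x y -> x != 0.
Proof.
by case=> _; apply: contra_neq => ->; rewrite (brN hbr) (d0 (br_deriv hbr _)) oppr0.
Qed.

Lemma ev_swap x y p : ev y x (swapXY p) = ev x y p.
Proof.
have [D [h1 h2]] := boxed_ex p.
rewrite (ev_sum_wide _ _ _ (n := D)); last first.
  apply/leq_sizeP => j jD; apply/polyP => i; rewrite coef_swapXY coef0.
  by rewrite nth_default // (leq_trans (h2 i)).
rewrite (ev_sum_wide _ _ _ h1).
under eq_bigr => l _.
  rewrite (@ev1_sum_wide _ _ _ _ _ D); last first.
    apply/leq_sizeP => j jD; rewrite coef_swapXY.
    by rewrite [p`_j]nth_default ?coef0 // (leq_trans h1).
  over.
under [RHS]eq_bigr => l _ do rewrite (ev1_sum_wide _ _ (h2 l)) mulr_suml.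
rewrite exchange_big /=; apply: eq_bigr => i _; rewrite mulr_suml.
by apply: eq_bigr => j _; rewrite coef_swapXY mulrAC.
Qed.

Lemma cd_shift x y r : cd x y -> cd x (y - iota r).
Proof.
move=> h; apply: (cd_trans h); first exact: fracx.
by rewrite -[X in frac _ _ X](subrK (iota r)); apply: fracD; [exact: fracy|exact: fracC].
Qed.

Lemma cd_div x y : cd x y -> cd x (y / x).
Proof.
move=> h; have x0 := cd_neq0 h; apply: (cd_trans h); first exact: fracx.
by rewrite -[X in frac _ _ X](divfK x0); apply: fracM; [exact: fracy|exact: fracx].
Qed.

Definition shY (r : C) p : {poly {poly C}} := p \Po ('X + r%:P%:P).

Lemma ev_shY x y r p : ev x (y - iota r) (shY r p) = ev x y p.
Proof.
rewrite /shY /ev /= /horner_eval map_comp_poly horner_comp.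
by rewrite rmorphD /= map_polyX map_polyC /= ev1C !hornerE subrK.
Qed.

(* The restriction of p to the line x = 0. *)
Definition z0 p : {poly C} := map_poly (fun c : {poly C} => c`_0) p.

Lemma coef_z0 p l : (z0 p)`_l = p`_l`_0.
Proof. by rewrite /z0 coef_map_id0 ?coef0. Qed.

Lemma z0E p : z0 p = map_poly (horner_eval 0) p.
Proof. by apply/polyP => l; rewrite coef_z0 coef_map /= /horner_eval horner_coef0. Qed.

Lemma z0_shY r p : z0 (shY r p) = z0 p \Po ('X + r%:P).
Proof.
rewrite !z0E /shY map_comp_poly rmorphD /= map_polyX map_polyC /=.
by rewrite /horner_eval hornerC.
Qed.

Lemma size_shift (c : {poly C}) r : size (c \Po ('X + r%:P)) = size c.
Proof. by rewrite size_comp_poly2 // size_XaddC. Qed.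

Lemma ev_z0 V x y p : cval iota V -> V x -> V y ->
  exists2 w, V w & ev x y p = ev1 y (z0 p) + x * w.
Proof.
move=> hV Vx Vy; have sV := cval_sub hV.
exists (\sum_(l < size p) ev1 x (drop_poly 1 p`_l) * y ^+ l).
  apply: (sr_sum sV) => l _; apply: (srM sV); first exact: cval_ev1.
  exact: (srX sV).
rewrite ev_sum (@ev1_sum_wide _ _ _ _ _ (size p)); last first.
  by apply/leq_sizeP => j jp; rewrite coef_z0 [p`_j]nth_default ?coef0.
rewrite mulr_sumr -big_split /=; apply: eq_bigr => l _.
rewrite coef_z0 mulrA -mulrDl; congr (_ * _).
by rewrite {1}(drop1E p`_l) !ev1E mulrC.
Qed.

(* Strict transform under y = x y1 of a polynomial of multiplicity >= m. *)
Definition bl m p : {poly {poly C}} := \poly_(l < size p) drop_poly m (p`_l * 'X^l).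

Lemma coef_bl m p l i :
  (bl m p)`_l`_i = if (i + m < l)%N then 0 else p`_l`_(i + m - l)%N.
Proof.
rewrite coef_poly; case: ltnP => h.
  by rewrite coef_drop_poly coefMXn.
by rewrite [p`_l]nth_default // !coef0; case: ifP.
Qed.

Definition mult_ge m p := forall l i, (i + l < m)%N -> p`_l`_i = 0.

Lemma ev_bl m p x y1 : mult_ge m p -> ev x (x * y1) p = x ^+ m * ev x y1 (bl m p).
Proof.
move=> mg; rewrite ev_sum (ev_sum_wide _ _ _ (size_poly _ _)) mulr_sumr.
apply: eq_bigr => l _; rewrite coef_poly ltn_ord exprMn !mulrA; congr (_ * _).
have E : p`_l * 'X^l = drop_poly m (p`_l * 'X^l) * 'X^m.
  rewrite -{1}(poly_take_drop m (p`_l * 'X^l)) -[RHS]add0r; congr (_ + _).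
  apply/polyP => i; rewrite coef_take_poly coef0; case: ltnP => // im.
  rewrite coefMXn; case: ltnP => // li; apply: mg; lia.
by have := congr1 (ev1 x) E; rewrite !ev1E [RHS]mulrC.
Qed.

Lemma size_z0_bl m p : (size (z0 (bl m p)) <= m.+1)%N.
Proof.
apply/leq_sizeP => j jm; rewrite coef_z0 coef_bl add0n; case: ltnP => //; lia.
Qed.

Lemma mult_ge1 p : p`_0`_0 = 0 -> mult_ge 1 p.
Proof. by move=> h [|l] [|i]. Qed.

Section Blow.
Variables (I : finType) (N M : nat) (V : K -> Prop) (t : K) (h : K -> nat).
Hypotheses (hV : cval iota V) (nt : exists f, ~ V f) (tt : trans iota V t).
Hypothesis hh : forall f g, V f -> f != 0 -> mx V g -> g != 0 ->
    V (f / g) -> (h (f / g) < h f)%N.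
Let vV := hV.1.
Let sV := cval_sub hV.
Implicit Types P : I -> {poly {poly C}}.

(** The [P] are homogeneous coordinates of the map to [S]. The last clause bounds M times their
    least value by N times the order of the Jacobian {x, y} / {x', y'}, which is the discrepancy of
    V over the (x, y)-plane. *)
Definition good_chart x y P := exists x' y', cd x' y' /\ good iota V x' y' /\
  exists k, [/\ ev x y (P k) != 0, forall l, V (ev x y (P l) / ev x y (P k))
    & V ((br x y / br x' y') ^+ N / ev x y (P k) ^+ M)].

Lemma good_chart_eq x y P x1 y1 P1 : (forall k, ev x y (P k) = ev x1 y1 (P1 k)) ->
  (exists2 e, e \in [:: 1; -1] & br x y = e * br x1 y1) ->
  good_chart x1 y1 P1 -> good_chart x y P.
Proof.
move=> HP [e he Hb] [x' [y' [c' [g' [k [n0 H1 H2]]]]]].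
exists x', y'; split=> //; split=> //; exists k; rewrite HP; split=> // [l|].
  by rewrite HP.
rewrite Hb -mulrA exprMn -mulrA; apply: (srM sV) => //; apply: (srX sV).
by move: he; rewrite !inE => /orP[] /eqP ->; [exact: (sr1 sV)|apply: (srN sV); exact: (sr1 sV)].
Qed.

(** V is the line x = 0 itself, so (y, x) is adapted to it and a [P j] that does not vanish on the
    line is a unit. *)
Lemma good_chart_stop x y P j : cd x y -> mx V x -> trans iota V y ->
  z0 (P j) != 0 -> good_chart x y P.
Proof.
move=> hc mxx ty zj; have Vx := mx_V vV mxx; have Vy := ty.1.
have hc' := cd_swap hc.
exists y, x; split=> //; split; first by split=> //; exact: cd_coord.
have [w Vw E] := ev_z0 (P j) hV Vx Vy.
have nm : ~ mx V (ev x y (P j)).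
  rewrite E => H; apply: (ty.2 _ zj); rewrite -[ev1 y _](addrK (x * w)).
  by apply: (mxB vV) => //; exact: (mxMr vV).
have n0 := mx_neq0 nm.
have VP l : V (ev x y (P l)) by exact: cval_ev.
have Vi : V (ev x y (P j))^-1 by exact: unitV.
exists j; split=> // [l|]; first exact: (srM sV).
rewrite (brN hbr y x) mulNr divff ?hc'.2 // -exprVn.
apply: (srM sV); apply: (srX sV) => //; apply: (srN sV); exact: (sr1 sV).
Qed.

Lemma ev_mx0 x y p : mx V x -> mx V y -> mx V (ev x y p - iota p`_0`_0).
Proof.
move=> mxx mxy; have Vx := mx_V vV mxx; have Vy := mx_V vV mxy.
have [w Vw ->] := ev_z0 p hV Vx Vy.
have -> : ev1 y (z0 p) = iota p`_0`_0 + y * ev1 y (drop_poly 1 (z0 p)).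
  by rewrite {1}(drop1E (z0 p)) !ev1E coef_z0 mulrC.
have -> : iota p`_0`_0 + y * ev1 y (drop_poly 1 (z0 p)) + x * w - iota p`_0`_0 =
   y * ev1 y (drop_poly 1 (z0 p)) + x * w by ring.
by apply: (mxD vV); apply: (mxMr vV) => //; exact: cval_ev1.
Qed.

(** With y = x y1 the bracket becomes x {x, y1} and [P] becomes x^m times its strict transform, so
    the bound survives as long as M m <= N. The process ends because of [t] = n / d: its residue is
    not constant, so n and d both vanish at the origin, both lose a factor x, and the measure [h] of
    d drops. *)
Lemma blow_step x y P m n d : cd x y -> mx V x -> mx V y -> V (y / x) ->
  (forall j, mult_ge m (P j)) -> (exists j l i, (i + l = m)%N /\ (P j)`_l`_i != 0) ->
  (M * m <= N)%N -> ev x y d != 0 -> t = ev x y n / ev x y d ->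
  (forall y1 P1, cd x y1 -> V y1 ->
    (exists j, z0 (P1 j) != 0 /\ (size (z0 (P1 j)) <= m.+1)%N) ->
    (exists n1 d1, [/\ ev x y1 d1 != 0, t = ev x y1 n1 / ev x y1 d1
       & (h (ev x y1 d1) < h (ev x y d))%N]) -> good_chart x y1 P1) ->
  good_chart x y P.
Proof.
move=> hc mxx mxy Vyx mg [j [l [i [il nz]]]] MN d0' tE IH.
have Vx := mx_V vV mxx; have Vy := mx_V vV mxy.
have x0 := cd_neq0 hc; pose y1 := y / x.
have yE : y = x * y1 by rewrite mulrC divfK.
have hc1 : cd x y1 by exact: cd_div.
have cunit p : p`_0`_0 != 0 -> ~ mx V (ev x y p).
  move=> c0 H; apply: (cval_unit hV c0).
  have -> : iota p`_0`_0 = ev x y p - (ev x y p - iota p`_0`_0) by ring.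
  by apply: (mxB vV) => //; exact: ev_mx0.
have d00 : d`_0`_0 = 0.
  apply/eqP; apply/not_notP => /negP dn.
  have nm := cunit _ dn.
  pose c : {poly C} := 'X - (n`_0`_0 / d`_0`_0)%:P.
  have cn : c != 0 by rewrite polyXsubC_eq0.
  apply: (tt.2 _ cn); rewrite /c !ev1E tE rmorphM fmorphV.
  have iD : iota d`_0`_0 != 0 by rewrite fmorph_eq0.
  have -> : ev x y n / ev x y d - iota n`_0`_0 / iota d`_0`_0 =
     (ev x y d)^-1 * ((ev x y n - iota n`_0`_0) -
      (iota n`_0`_0 / iota d`_0`_0) * (ev x y d - iota d`_0`_0)).
    by field; rewrite d0' iD.
  apply: (mxMl vV); first by apply: unitV => //; exact: cval_ev.
  apply: (mxB vV); first exact: ev_mx0.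
  apply: (mxMl vV); last exact: ev_mx0.
  by rewrite -fmorphV -rmorphM; exact: hV.2.
have mxd : mx V (ev x y d).
  by have := ev_mx0 d mxx mxy; rewrite d00 rmorph0 subr0.
have n00 : n`_0`_0 = 0.
  apply/eqP; apply/not_notP => /negP /cunit; apply.
  have -> : ev x y n = t * ev x y d by rewrite tE divfK.
  by apply: (mxMl vV) => //; exact: tt.1.
have En := ev_bl x y1 (mult_ge1 n00); have Ed := ev_bl x y1 (mult_ge1 d00).
rewrite -yE expr1 in En Ed.
have d1n : ev x y1 (bl 1 d) != 0.
  by apply: contraNneq d0' => z; rewrite Ed z mulr0.
have Vy1 : V y1 by [].
have := IH y1 (fun k => bl m (P k)) hc1 Vy1; case.
- exists j; split; last exact: size_z0_bl.
  apply/eqP => /(congr1 (fun c : {poly C} => c`_l)); rewrite coef0 coef_z0 coef_bl add0n.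
  have -> : (m < l)%N = false by lia.
  have -> : (m - l = i)%N by lia. by move=> /= /eqP; rewrite (negPf nz).
- exists (bl 1 n), (bl 1 d); split=> //.
    by rewrite tE En Ed; field; rewrite d1n x0.
  have -> : ev x y1 (bl 1 d) = ev x y d / x by rewrite Ed mulrC mulKf.
  apply: hh => //; first exact: cval_ev.
  by rewrite Ed mulrC mulKf //; exact: cval_ev.
move=> x' [y' [c' [g' [k [n0 H1 H2]]]]].
have EP k' : ev x y (P k') = x ^+ m * ev x y1 (bl m (P k')) by rewrite {1}yE (ev_bl _ _ (mg k')).
exists x', y'; split=> //; split=> //; exists k; split.
- by rewrite EP mulf_neq0 // expf_neq0.
- move=> l'; rewrite !EP; have -> : x ^+ m * ev x y1 (bl m (P l')) / (x ^+ m * ev x y1 (bl m (P k))) =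
    ev x y1 (bl m (P l')) / ev x y1 (bl m (P k)); last exact: H1.
  by field; rewrite n0 expf_neq0.
- have -> : br x y = x * br x y1.
    by rewrite {1}yE (dM (br_deriv hbr x)) (brff hbr) mul0r add0r.
  have J0 := c'.2.
  have -> : (x * br x y1 / br x' y') ^+ N / ev x y (P k) ^+ M =
      x ^+ (N - M * m) * ((br x y1 / br x' y') ^+ N / ev x y1 (bl m (P k)) ^+ M).
    have Ex : x ^+ N = x ^+ (N - M * m) * (x ^+ m) ^+ M.
      by rewrite -exprM (mulnC m) -exprD subnK.
    rewrite EP -mulrA exprMn Ex (exprMn M (x ^+ m)).
    have := expf_neq0 M (expf_neq0 m x0); have := expf_neq0 M n0.
    move: (ev x y1 (bl m (P k)) ^+ M) ((x ^+ m) ^+ M) (x ^+ (N - M * m)) ((br x y1 / br x' y') ^+ N) => e b c u e0 b0.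
    by field; rewrite e0 b0.
  by apply: (srM sV) => //; exact: (srX sV).
Qed.

Lemma mult_min P n : (exists j l i, (P j)`_l`_i != 0 /\ (i + l <= n)%N) ->
  exists m, [/\ (m <= n)%N, forall j, mult_ge m (P j)
     & exists j l i, (i + l = m)%N /\ (P j)`_l`_i != 0].
Proof.
move=> [j0 [l0 [i0 [nz le]]]].
have ex : exists m, `[< exists j l i, (i + l = m)%N /\ (P j)`_l`_i != 0 >].
  by exists (i0 + l0)%N; apply/asboolP; exists j0, l0, i0.
case: (ex_minnP ex) => m /asboolP H mmin; exists m; split=> //.
  by apply: leq_trans le; apply: mmin; apply/asboolP; exists j0, l0, i0.
move=> j l i lt; apply/eqP; apply/not_notP => /negP h1.
by have := mmin (i + l)%N; rewrite leqNgt lt => H1; have : false;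
  [apply: H1; apply/asboolP; exists j, l, i|].
Qed.

Lemma blow_step2 x y P m n d : cd x y -> mx V x -> mx V y ->
  (forall j, mult_ge m (P j)) -> (exists j l i, (i + l = m)%N /\ (P j)`_l`_i != 0) ->
  (M * m <= N)%N -> ev x y d != 0 -> t = ev x y n / ev x y d ->
  (forall x1 y1 P1, cd x1 y1 -> mx V x1 -> V y1 ->
    (exists j, z0 (P1 j) != 0 /\ (size (z0 (P1 j)) <= m.+1)%N) ->
    (exists n1 d1, [/\ ev x1 y1 d1 != 0, t = ev x1 y1 n1 / ev x1 y1 d1
       & (h (ev x1 y1 d1) < h (ev x y d))%N]) -> good_chart x1 y1 P1) ->
  good_chart x y P.
Proof.
move=> hc mxx mxy mg nz MN d0' tE IH.
case: (vr_tot vV (y / x)) => Vq.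
  by apply: (blow_step hc mxx mxy Vq mg nz MN d0' tE) => y1 P1 *; apply: IH.
rewrite invf_div in Vq.
apply: (@good_chart_eq _ _ _ y x (fun k => swapXY (P k))).
- by move=> k; rewrite ev_swap.
- by exists (-1); rewrite ?inE ?eqxx ?orbT // (brN hbr y x) mulN1r.
apply: (@blow_step y x _ m (swapXY n) (swapXY d)) => //.
- exact: cd_swap.
- by move=> j l i lt; rewrite coef_swapXY; apply: mg; rewrite addnC.
- case: nz => j [l [i [E nz]]]; exists j, i, l; split; first by rewrite addnC.
  by rewrite coef_swapXY.
- by rewrite ev_swap.
- by rewrite !ev_swap.
- by move=> y1 P1 *; apply: IH => //; rewrite -?(ev_swap x y d).
Qed.

(** The invariant of the induction: on the exceptional line x = 0 some strict transform is a nonzero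
    polynomial of degree at most m0, so the next centre again has multiplicity at most m0. Only the
    first multiplicity has to be bounded from outside. *)
Lemma blow_inv x y P m0 : cd x y -> mx V x -> V y ->
  (exists j, z0 (P j) != 0 /\ (size (z0 (P j)) <= m0.+1)%N) -> (M * m0 <= N)%N ->
  good_chart x y P.
Proof.
move=> hc mxx Vy hz MN.
have [n [d [d0' tE]]] := hc.1 t.
have [B] := ubnP (h (ev x y d)).
elim: B x y P m0 hc mxx Vy hz MN n d d0' tE => // B IH x y P m0 hc mxx Vy [j [zj sj]] MN n d d0' tE hB.
case: (EM (trans iota V y)) => ty; first exact: (good_chart_stop hc mxx ty zj).
have [r mr] := ntrans hV Vy ty.
apply: (@good_chart_eq _ _ _ x (y - iota r) (fun k => shY r (P k))).
- by move=> k; rewrite ev_shY.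
- by exists 1; rewrite ?inE ?eqxx // mul1r (dB (br_deriv hbr x)) (dC (br_deriv hbr x)) subr0.
have zs : z0 (shY r (P j)) != 0.
  by rewrite z0_shY -size_poly_eq0 size_shift size_poly_eq0.
have [|m [mm0 mg nz]] := @mult_min (fun k => shY r (P k)) m0.
  exists j, (size (z0 (shY r (P j)))).-1, 0%N; split.
    by rewrite -coef_z0 -/(lead_coef _) lead_coef_eq0.
  by rewrite z0_shY size_shift add0n; lia.
apply: (@blow_step2 _ _ _ m (shY r n) (shY r d)) => //.
- exact: cd_shift.
- by apply: leq_trans MN; rewrite leq_mul2l mm0 orbT.
- by rewrite ev_shY.
- by rewrite !ev_shY.
- move=> x1 y1 P1 hc1 mx1 Vy1 hz1 [n1 [d1' [d10 tE1 lt]]].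
  apply: (IH _ _ _ m hc1 mx1 Vy1 hz1 _ n1 d1') => //.
    by apply: leq_trans MN; rewrite leq_mul2l mm0 orbT.
  by rewrite ev_shY in lt; apply: leq_trans lt _; rewrite -ltnS.
Qed.

Lemma blow_chart x y P : cd x y -> mx V x -> V y -> (exists j, z0 (P j) != 0) ->
  (forall r, mx V (y - iota r) -> exists j l i,
      (shY r (P j))`_l`_i != 0 /\ (M * (i + l) <= N)%N) ->
  good_chart x y P.
Proof.
move=> hc mxx Vy [j zj] hm.
case: (EM (trans iota V y)) => ty; first exact: (good_chart_stop hc mxx ty zj).
have [r mr] := ntrans hV Vy ty; have [j1 [l1 [i1 [nz1 MN1]]]] := hm r mr.
apply: (@good_chart_eq _ _ _ x (y - iota r) (fun k => shY r (P k))).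
- by move=> k; rewrite ev_shY.
- by exists 1; rewrite ?inE ?eqxx // mul1r (dB (br_deriv hbr x)) (dC (br_deriv hbr x)) subr0.
have [|m [mm0 mg nz]] := @mult_min (fun k => shY r (P k)) (i1 + l1).
  by exists j1, l1, i1.
have MN : (M * m <= N)%N by apply: leq_trans MN1; rewrite leq_mul2l mm0 orbT.
have [n [d [d0' tE]]] := (cd_shift r hc).1 t.
apply: (@blow_step2 _ _ _ m n d) => //; first exact: cd_shift.
by move=> x1 y1 P1 hc1 mx1 Vy1 hz1 _; exact: (blow_inv hc1 mx1 Vy1 hz1).
Qed.

End Blow.

End Coord.

(** * Hartogs extension over a plane *)

Section Hartogs.
Variables (C : numClosedFieldType) (K : fieldType) (iota : {rmorphism C -> K}).
Local Notation ev := (ev iota).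
Local Notation ev1 := (ev1 iota).
Local Notation cval := (cval iota).
Local Notation trans := (trans iota).
Local Notation indep := (indep iota).
Implicit Types (V : K -> Prop) (p q : {poly {poly C}}).

(* The ring C(z1)[z2]. *)
Definition semiloc z1 z2 f := exists p (c : {poly C}),
  c != 0 /\ f = ev z1 z2 p / ev1 z1 c.

Lemma indep1 z1 z2 (c : {poly C}) : indep z1 z2 -> c != 0 -> ev1 z1 c != 0.
Proof.
move=> ind; apply: contra_neq => E; apply/eqP; rewrite -polyC_eq0; apply/eqP.
by apply: ind; rewrite evC.
Qed.

Lemma semiloc_sub z1 z2 : indep z1 z2 -> subring (semiloc z1 z2).
Proof.
move=> ind; split.
- by exists 1, 1; rewrite oner_neq0 ev_1 ev11 divr1.
- move=> _ _ [p [c [c0 ->]]] [q [e [e0 ->]]]; exists (e *: p - c *: q), (c * e).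
  rewrite mulf_neq0 //; split=> //; rewrite !evE'.
  by field; rewrite !(indep1 ind).
- move=> _ _ [p [c [c0 ->]]] [q [e [e0 ->]]]; exists (p * q), (c * e).
  rewrite mulf_neq0 //; split=> //; rewrite !evE'.
  by field; rewrite !(indep1 ind).
Qed.

Lemma semiloc_ev z1 z2 p : semiloc z1 z2 (ev z1 z2 p).
Proof. by exists p, 1; rewrite oner_neq0 ev11 divr1. Qed.

Lemma semiloc_val z1 z2 V : indep z1 z2 -> valring V ->
  (forall f, semiloc z1 z2 f -> V f) -> [/\ cval V, trans V z1 & V z2].
Proof.
move=> ind vV SV; split.
- by split=> // c; apply: SV; rewrite -(evCC iota z1 z2); exact: semiloc_ev.
- split; first by apply: SV; rewrite -{2}(evX iota z1 z2); exact: semiloc_ev.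
  move=> c c0 /mxP; apply; first exact: indep1 ind c0.
  by apply: SV; exists 1, c; rewrite ev_1 mul1r.
- by apply: SV; rewrite -{2}(evY iota z1 z2); exact: semiloc_ev.
Qed.

Lemma semiloc_integral z1 z2 t : indep z1 z2 ->
  (forall V, cval V -> trans V z1 -> V z2 -> V t) -> integral (semiloc z1 z2) t.
Proof.
move=> ind H; apply: integral_valrings; first exact: semiloc_sub.
by move=> V vV SV; have [h1 h2 h3] := semiloc_val ind vV SV; exact: H.
Qed.

Lemma common_denom z1 z2 (q : {poly K}) : indep z1 z2 ->
  (forall i, semiloc z1 z2 q`_i) -> exists (c : {poly C}) (G : {poly {poly {poly C}}}),
    c != 0 /\ map_poly (ev z1 z2) G = (ev1 z1 c) *: q.
Proof.
move=> ind H.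
have /choice [pc Hpc] : forall i, exists pc : {poly {poly C}} * {poly C},
   pc.2 != 0 /\ q`_i = ev z1 z2 pc.1 / ev1 z1 pc.2.
  by move=> i; have [p [c E]] := H i; exists (p, c).
pose c := \prod_(i < size q) (pc i).2.
exists c, (\poly_(i < size q) ((c %/ (pc i).2) *: (pc i).1)); split.
  by apply/prodf_neq0 => i _; exact: (Hpc i).1.
apply/polyP => i; rewrite coef_map /= coef_poly coefZ.
case: ltnP => h; last by rewrite nth_default // ev0 mulr0.
have [n0 ->] := Hpc i; have Ec : c = (c %/ (pc i).2) * (pc i).2.
  by rewrite divpK // /c (bigD1 (Ordinal h)) //= dvdp_mulr // dvdpp.
rewrite evZ [in RHS]Ec ev1M; field; exact: indep1 ind n0.
Qed.

(** After cancelling the gcd, B divides the leading term c A^m of an integral equation and is prime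
    to A, so it is constant in z2. *)
Lemma semiloc_normal z1 z2 A B : indep z1 z2 -> ev z1 z2 B != 0 ->
  integral (semiloc z1 z2) (ev z1 z2 A / ev z1 z2 B) ->
  semiloc z1 z2 (ev z1 z2 A / ev z1 z2 B).
Proof.
move=> ind; have [n] := ubnP (size B); elim: n A B => // n IH A B sB hB0 hint.
have B0 : B != 0 by apply: contraNneq hB0 => ->; rewrite ev0.
case: (leqP (size B) 1) => s1.
  have E := size1_polyC s1; exists A, B`_0; split; last by rewrite {1}E evC.
  by apply: contraNneq B0 => E0; rewrite E E0.
case: (eqVneq (size (gcdp B A)) 1%N) => sg; last first.
  have /Pdiv.Idomain.dvdpP [[c1 B1] /= c10 EB] := Pdiv.CommonIdomain.dvdp_gcdl B A.
  have /Pdiv.Idomain.dvdpP [[c2 A1] /= c20 EA] := Pdiv.CommonIdomain.dvdp_gcdr B A.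
  have g0 : gcdp B A != 0 by rewrite Pdiv.CommonIdomain.gcdp_eq0 (negPf B0).
  have sg1 : (1 < size (gcdp B A))%N.
    by move: g0; rewrite -size_poly_gt0; move: sg; lia.
  have eg : ev z1 z2 (gcdp B A) != 0 by apply: contra_neq g0 => /ind.
  have B10 : B1 != 0.
    by apply: contraNneq B0 => E; move/eqP: EB; rewrite E mul0r scale_poly_eq0 (negPf c10).
  have eB1 : ev z1 z2 B1 != 0 by apply: contra_neq B10 => /ind.
  have := congr1 (ev z1 z2) EB; have := congr1 (ev z1 z2) EA; rewrite !evZ !evM => eA eB.
  have n1 := indep1 ind c10; have n2 := indep1 ind c20.
  have E : ev z1 z2 A / ev z1 z2 B = ev z1 z2 (c1 *: A1) / ev z1 z2 (c2 *: B1).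
    rewrite !evZ; apply: (mulfI n2); rewrite mulrA eA.
    apply: (mulfI (invr_neq0 n1)).
    have -> : ev z1 z2 B = ev z1 z2 B1 * ev z1 z2 (gcdp B A) / ev1 z1 c1.
      by rewrite -eB mulrC mulKf.
    by field; rewrite n1 n2 eg eB1.
  rewrite E; apply: IH; rewrite -?E //.
    have sm : size B = (size B1 + size (gcdp B A)).-1 by rewrite -size_mul // -EB size_scale.
    rewrite size_scale //; move: sB sg1; rewrite sm.
    by case: (size (gcdp B A)) => [|[|k]] //; rewrite !addnS /= => h _; lia.
  by rewrite evZ mulf_neq0.
have cop : coprimep B A by rewrite Pdiv.CommonIdomain.coprimep_def sg.
case: hint => q [mq Rq /rootP qr].
have [c [G [c0 EG]]] := common_denom ind Rq.
pose m := (size q).-1.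
have sq : (0 < size q)%N by rewrite size_poly_gt0 monic_neq0.
have sqE : size q = m.+1 by rewrite prednK.
have rel : \sum_(i < m.+1) G`_i * A ^+ i * B ^+ (m - i) = 0.
  apply: ind; rewrite rmorph_sum /=.
  have Z : ev1 z1 c * ev z1 z2 B ^+ m * q.[ev z1 z2 A / ev z1 z2 B] = 0 by rewrite qr mulr0.
  rewrite -[RHS]Z horner_coef sqE mulr_sumr; apply: eq_bigr => i _.
  have := congr1 (fun z : {poly K} => z`_i) EG; rewrite coef_map coefZ /= => Gi.
  have im : (i <= m)%N by rewrite -ltnS.
  have Eb : ev z1 z2 B ^+ m = ev z1 z2 B ^+ (m - i) * ev z1 z2 B ^+ i by rewrite -exprD subnK.
  by rewrite !evM !evXn Gi Eb expr_div_n; field; rewrite expf_neq0.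
have Gm : G`_m = c%:P.
  apply/eqP; rewrite -subr_eq0; apply/eqP/ind; rewrite evB evC.
  have := congr1 (fun z : {poly K} => z`_m) EG; rewrite coef_map coefZ /= => ->.
  by rewrite /m -/(lead_coef q) (monicP mq) mulr1 subrr.
have dv : B %| c *: A ^+ m.
  rewrite big_ord_recr /= Gm subnn expr0 mulr1 in rel.
  have -> : c *: A ^+ m = (- \sum_(i < m) G`_i * A ^+ i * B ^+ (m - i).-1) * B.
    rewrite -mul_polyC; apply/eqP; rewrite mulNr -addr_eq0 addrC mulr_suml; apply/eqP.
    rewrite -[RHS]rel; congr (_ + _); apply: eq_bigr => i _.
    by rewrite -[LHS]mulrA -[_ * B]exprSr prednK // subn_gt0.
  exact: Pdiv.CommonIdomain.dvdp_mulIr.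
rewrite Pdiv.CommonIdomain.dvdpZr // in dv.
have : B %| 1.
  rewrite -(@Pdiv.CommonIdomain.Gauss_dvdpl _ 1 (A ^+ m) B) ?mul1r //.
  exact: Pdiv.CommonIdomain.coprimep_expr.
by rewrite Pdiv.CommonIdomain.dvdp1; move: s1; case: (size B) => [|[|]].
Qed.

Lemma indep_swap z1 z2 : indep z1 z2 -> indep z2 z1.
Proof.
move=> ind g; rewrite -(ev_swap iota) => /ind.
by move/(congr1 (@swapXY _)); rewrite swapXYK rmorph0.
Qed.

(** The denominator c(z1) loses its roots one at a time: at a root r the relation p e(z2) = c(z1) q
    makes p vanish, so z1 - r divides both p and c. *)
Lemma semiloc_cap z1 z2 f : indep z1 z2 -> semiloc z1 z2 f -> semiloc z2 z1 f ->
  exists p, f = ev z1 z2 p.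
Proof.
move=> ind [p [c [c0 E]]] [q [e [e0 E']]].
have [n] := ubnP (size c); elim: n p c c0 E => // n IH p c c0 E sc.
case: (leqP (size c) 1) => s1.
  have Ec := size1_polyC s1; have c00 : c`_0 != 0.
    by apply: contraNneq c0 => z; rewrite Ec z.
  exists ((c`_0)^-1%:P *: p); rewrite E {1}Ec evZ !ev1C fmorphV mulrC //.
have [r /rootP cr] : exists r, root c r.
  by apply/closed_rootP; move: s1; case: (size c) => [|[|]].
have /factor_theorem [c1 Ec1] : root c r by exact/rootP.
have c10 : c1 != 0 by apply: contraNneq c0 => z; rewrite Ec1 z mul0r.
have n1 := indep1 ind c0.
have indS := indep_swap ind.
have n2 := indep1 indS e0.
have rel : p * (map_poly polyC e) = c *: swapXY q.
  apply/eqP; rewrite -subr_eq0; apply/eqP/ind; rewrite evB evM evZ ev_swap.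
  have -> : ev z1 z2 (map_poly polyC e) = ev1 z2 e.
    by rewrite -swapXY_polyC ev_swap evC.
  by apply/eqP; rewrite subr_eq0 [_ * ev z2 z1 q]mulrC -eqr_div // -E -E'.
have p0 : map_poly (horner_eval r) p = 0.
  have := congr1 (map_poly (horner_eval r)) rel.
  rewrite rmorphM -[c *: _]mul_polyC rmorphM /= map_polyC /= (_ : horner_eval r c = 0) // mul0r.
  move/eqP; rewrite mulf_eq0 => /orP [/eqP //|].
  have -> : map_poly (horner_eval r) (map_poly polyC e) = e.
    by apply/polyP => i; rewrite !coef_map /= /horner_eval hornerC.
  by rewrite (negPf e0).
pose p1 : {poly {poly C}} := map_poly (fun a : {poly C} => a %/ ('X - r%:P)) p.
have Ep : p = ('X - r%:P) *: p1.
  apply/polyP => i; rewrite coefZ coef_map_id0 ?div0p //.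
  rewrite mulrC divpK // dvdp_XsubCl.
  by have := congr1 (fun z : {poly C} => z`_i) p0; rewrite coef_map coef0 => /eqP.
apply: (IH p1 c1 c10); last first.
  move: sc; rewrite Ec1 size_Mmonic ?monicXsubC // size_XsubC; lia.
have h1 : ev1 z1 c1 != 0 := indep1 ind c10.
have h2 : ev1 z1 ('X - r%:P) != 0 by apply: indep1 ind _; rewrite polyXsubC_eq0.
rewrite E Ep Ec1 evZ ev1M; move: h2; move: (ev1 z1 _) => u h2.
by field; rewrite h1 h2.
Qed.

Lemma frac_semiloc z1 z2 f : indep z1 z2 -> frac iota z1 z2 f ->
  (forall V, cval V -> trans V z1 -> V z2 -> V f) -> semiloc z1 z2 f.
Proof.
move=> ind [p [q [q0 E]]] H; rewrite E; apply: semiloc_normal => //.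
by rewrite -E; exact: semiloc_integral.
Qed.

Lemma frac_poly z1 z2 f : indep z1 z2 -> frac iota z1 z2 f ->
  (forall V, cval V -> trans V z1 -> V z2 -> V f) ->
  (forall V, cval V -> trans V z2 -> V z1 -> V f) -> exists p, f = ev z1 z2 p.
Proof.
move=> ind hf H1 H2; apply: semiloc_cap => //; first exact: frac_semiloc.
apply: frac_semiloc => //; first exact: indep_swap.
by case: hf => p [q [q0 E]]; exists (swapXY p), (swapXY q); rewrite !ev_swap.
Qed.

Lemma frac_denom z1 z2 (q : {poly K}) : (forall i, frac iota z1 z2 q`_i) ->
  exists c (G : {poly {poly {poly C}}}),
    ev z1 z2 c != 0 /\ map_poly (ev z1 z2) G = (ev z1 z2 c) *: q.
Proof.
move=> H.
have /choice [pc Hpc] : forall i, exists pc : {poly {poly C}} * {poly {poly C}},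
   ev z1 z2 pc.2 != 0 /\ q`_i = ev z1 z2 pc.1 / ev z1 z2 pc.2.
  by move=> i; have [p [c E]] := H i; exists (p, c).
exists (\prod_(i < size q) (pc i).2).
exists (\poly_(i < size q) ((pc i).1 * \prod_(j < size q | j != i :> nat) (pc j).2)); split.
  by rewrite rmorph_prod; apply/prodf_neq0 => i _; exact: (Hpc i).1.
apply/polyP => i; rewrite coef_map /= coef_poly coefZ.
case: ltnP => h; last by rewrite nth_default // ev0 mulr0.
have [n0 ->] := Hpc i; rewrite [in RHS](bigD1 (Ordinal h)) //= !evM; field.
exact: n0.
Qed.

Lemma minpoly_frac x y z1 z2 t : gens iota x y -> indep z1 z2 ->
  exists w : {poly K}, [/\ w \is monic, root w t, forall i, frac iota z1 z2 w`_i &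
    forall q : {poly K}, q \is monic -> (forall i, frac iota z1 z2 q`_i) -> root q t ->
      exists2 s, s \is monic & q = w * s].
Proof.
move=> gen ind.
pose evT (W : {poly {poly {poly C}}}) := (map_poly (ev z1 z2) W).[t].
have exn : exists n, `[< exists W, [/\ W != 0, evT W = 0 & size W = n] >].
  have [d Hd] := dep z1 z2 gen; have [P [[i0 Pi0] E]] := Hd (fun i => t ^+ i).
  pose W : {poly {poly {poly C}}} := \poly_(i < d.+1) P (inord i).
  exists (size W); apply/asboolP; exists W; split=> //.
    apply/eqP => /(congr1 (fun z : {poly {poly {poly C}}} => z`_i0)).
    by rewrite coef_poly ltn_ord inord_val coef0; exact/eqP.
  rewrite /evT (@horner_coef_wide _ d.+1); last first.
    by apply: leq_trans (size_poly _ _) _; exact: size_poly.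
  rewrite -[RHS]E; apply: eq_bigr => i _.
  by rewrite coef_map coef_poly ltn_ord inord_val.
case: (ex_minnP exn) => n /asboolP [W [W0 WT sW]] nmin.
pose lc := lead_coef W.
have lc0 : lc != 0 by rewrite lead_coef_eq0.
have elc : ev z1 z2 lc != 0 by apply: contra_neq lc0 => /ind.
pose w := (ev z1 z2 lc)^-1 *: map_poly (ev z1 z2) W.
have Emap : map_poly (ev z1 z2) W = ev z1 z2 lc *: w by rewrite scalerA divff // scale1r.
have mw : w \is monic.
  by rewrite monicE lead_coefZ lead_coef_map_eq // mulVf.
exists w; split=> //.
- by rewrite rootE hornerZ -/(evT W) WT mulr0.
- move=> i; rewrite coefZ coef_map /=; apply: fracM; last exact: frac_ev.
  by apply: fracV; exact: frac_ev.
move=> q mq Rq qr.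
have [c [G [n1 EG]]] := frac_denom Rq.
have E := Pdiv.Idomain.divp_eq G W; set k := scalp G W in E; set Q := G %/ W in E.
have r0 : G %% W = 0.
  apply/eqP; apply/not_notP => /negP m0.
  have := nmin (size (modp G W)); rewrite leqNgt -sW Pdiv.CommonIdomain.ltn_modp W0 => H.
  have : false; last by []; apply: H; apply/asboolP; exists (modp G W); split=> //.
  have : evT (G %% W) = evT (lc ^+ k *: G) - evT (Q * W).
    by rewrite E /evT !rmorphD /= hornerD addrC addKr.
  rewrite /evT rmorphM hornerM -/(evT W) WT mulr0 subr0 -mul_polyC rmorphM hornerM /=.
  by rewrite EG hornerZ (rootP qr) !mulr0.
have ck : ev z1 z2 (lc ^+ k) * ev z1 z2 c != 0 by rewrite mulf_neq0 // evXn expf_neq0.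
pose s := ((ev z1 z2 (lc ^+ k) * ev z1 z2 c)^-1 * ev z1 z2 lc) *: map_poly (ev z1 z2) Q.
have Eq : q = w * s.
  have := congr1 (map_poly (ev z1 z2)) E.
  rewrite r0 addr0 -mul_polyC !rmorphM /= map_polyC /= mul_polyC EG scalerA Emap.
  move=> E2; apply: (scalerI ck); rewrite E2 /s -!scalerAr !scalerA.
  by rewrite divff // scale1r mulrA mulfV // mul1r /w -scalerAl scalerA divff // scale1r mulrC.
exists s => //.
by have := lead_coefM w s; rewrite -Eq (monicP mq) (monicP mw) mul1r monicE => <-.
Qed.

(** By Gauss's lemma the coefficients of the minimal polynomial of t over C(z1, z2) belong to every
    V of the two hypotheses. So they are polynomials in z1 and z2, and t is integral over
    C[z1, z2]. *)
Lemma hartogs x y z1 z2 t : gens iota x y -> indep z1 z2 ->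
  (forall V, cval V -> trans V z1 -> V z2 -> V t) ->
  (forall V, cval V -> trans V z2 -> V z1 -> V t) ->
  forall W, cval W -> W z1 -> W z2 -> W t.
Proof.
move=> gen ind H1 H2 W hW W1 W2.
have indS := indep_swap ind.
have [w [mw wt fw Hw]] := minpoly_frac t gen ind.
have fsw f : frac iota z2 z1 f -> frac iota z1 z2 f.
  by case=> p [q [q0 E]]; exists (swapXY p), (swapXY q); rewrite !ev_swap.
have sl V a b f : cval V -> trans V a -> V b -> semiloc a b f -> V f.
  move=> hV ta Vb [p [c [c0 ->]]]; apply: (srM (cval_sub hV)); first exact: cval_ev ta.1 Vb.
  have Vc := cval_ev1 c hV ta.1; exact: (unitV Vc (ta.2 _ c0)).
have slf a b f : semiloc a b f -> frac iota a b f.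
  case=> p [c [c0 ->]]; apply: frac_div; first exact: frac_ev.
  by rewrite -(evC iota a b); exact: frac_ev.
have /choice [G HG] : forall i, exists p, w`_i = ev z1 z2 p.
  move=> i; apply: frac_poly => //.
    move=> V hV t1 V2; have [q [mq Rq qr]] := semiloc_integral ind H1.
    have [s ms E] := Hw q mq (fun i => slf _ _ _ (Rq i)) qr.
    by apply: (gauss_val hV.1 mw ms E) => j; exact: sl (Rq j).
  move=> V hV t1 V2; have [q [mq Rq qr]] := semiloc_integral indS H2.
  have [s ms E] := Hw q mq (fun i => fsw _ (slf _ _ _ (Rq i))) qr.
  by apply: (gauss_val hV.1 mw ms E) => j; exact: sl (Rq j).
apply: (integral_V hW.1); exists w; split=> // i.
by rewrite HG; exact: cval_ev.
Qed.

End Hartogs.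

(** * Zero-free forms on smooth projective surfaces *)

Section Surface.
Variables (C : numClosedFieldType) (K : fieldType) (iota : {rmorphism C -> K}).
Variable br : K -> K -> K.
Hypothesis hbr : bracket iota br.
Local Notation ev := (ev iota).
Local Notation ev1 := (ev1 iota).
Local Notation cval := (cval iota).
Local Notation trans := (trans iota).
Local Notation good := (good iota).
Local Notation cd := (cd iota br).
Local Notation frac := (frac iota).
Implicit Types (V : K -> Prop) (p q : {poly {poly C}}).

Definition eval2 (c1 c2 : C) p : C := (p.[c2%:P]).[c1].

Lemma eval2D c1 c2 p q : eval2 c1 c2 (p + q) = eval2 c1 c2 p + eval2 c1 c2 q.
Proof. by rewrite /eval2 !hornerD. Qed.
Lemma eval2M c1 c2 p q : eval2 c1 c2 (p * q) = eval2 c1 c2 p * eval2 c1 c2 q.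
Proof. by rewrite /eval2 !hornerM. Qed.
Lemma eval2Z c1 c2 c p : eval2 c1 c2 (c *: p) = c.[c1] * eval2 c1 c2 p.
Proof. by rewrite /eval2 hornerZ hornerM. Qed.
Lemma eval2Xn c1 c2 p n : eval2 c1 c2 (p ^+ n) = eval2 c1 c2 p ^+ n.
Proof. by rewrite /eval2 !horner_exp. Qed.

Lemma eval2E c1 c2 p : eval2 c1 c2 p = (map_poly (horner_eval c1) p).[c2].
Proof.
have := horner_map (horner_eval c1) p c2%:P.
by rewrite /= {2}/horner_eval hornerC /eval2 => ->.
Qed.

Lemma ev_subst x y p q : ev x y (map_poly polyC q).[p] = ev x (ev x y p) q.
Proof.
rewrite (@horner_coef_wide _ (size q)) ?size_poly // rmorph_sum /= ev_sum.
by apply: eq_bigr => i _; rewrite coef_map evM evC evXn.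
Qed.

Lemma eval2C c1 c2 c : eval2 c1 c2 c%:P = c.[c1].
Proof. by rewrite /eval2 hornerC. Qed.
Lemma eval20 c1 c2 : eval2 c1 c2 0 = 0.
Proof. by rewrite /eval2 !horner0. Qed.

Lemma eval2_subst c1 c2 p q :
  eval2 c1 c2 (map_poly polyC q).[p] = (map_poly (horner_eval c1) q).[eval2 c1 c2 p].
Proof.
rewrite (@horner_coef_wide _ (size q)) ?size_poly //.
rewrite [RHS](@horner_coef_wide _ (size q)) ?size_poly //.
rewrite (big_morph (eval2 c1 c2) (eval2D c1 c2) (eval20 c1 c2)).
by apply: eq_bigr => i _; rewrite !coef_map eval2M eval2Xn eval2C.
Qed.

Lemma mx_congM V f g f' g' : cval V -> V f -> V g' -> mx V (f - f') -> mx V (g - g') ->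
  mx V (f * g - f' * g').
Proof.
move=> hV Vf Vg' mf mg.
have -> : f * g - f' * g' = f * (g - g') + (f - f') * g' by ring.
by apply: (mxD hV.1); [apply: (mxMl hV.1)|apply: (mxMr hV.1)].
Qed.

Lemma ev1_cong V z r (c : {poly C}) : cval V -> mx V (z - iota r) ->
  mx V (ev1 z c - iota c.[r]).
Proof.
move=> hV mz; have sV := cval_sub hV.
have Vz : V z.
  by rewrite -[z](subrK (iota r)); apply: (srD sV); [exact: (mx_V hV.1)|exact: hV.2].
elim/poly_ind: c => [|c a IH]; first by rewrite ev10 horner0 rmorph0 subrr; left.
rewrite !ev1E !hornerE rmorphD rmorphM opprD addrACA subrr addr0.
by apply: mx_congM => //; [exact: cval_ev1|exact: hV.2].
Qed.

Lemma ev_cong V z1 z2 r1 r2 p : cval V -> mx V (z1 - iota r1) -> mx V (z2 - iota r2) ->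
  mx V (ev z1 z2 p - iota (eval2 r1 r2 p)).
Proof.
move=> hV m1 m2; have sV := cval_sub hV.
have Vz z r : mx V (z - iota r) -> V z.
  by move=> m; rewrite -[z](subrK (iota r)); apply: (srD sV); [exact: (mx_V hV.1)|exact: hV.2].
have V1 := Vz _ _ m1; have V2 := Vz _ _ m2.
elim/poly_ind: p => [|p c IH]; first by rewrite ev0 /eval2 !horner0 rmorph0 subrr; left.
have -> : eval2 r1 r2 (p * 'X + c%:P) = eval2 r1 r2 p * r2 + c.[r1].
  by rewrite /eval2 !hornerE.
rewrite !evE' rmorphD rmorphM opprD addrACA; apply: (mxD hV.1).
  by apply: mx_congM => //; [exact: cval_ev|exact: hV.2].
exact: ev1_cong.
Qed.

Lemma poly2_nz p : p != 0 -> exists c1 c2, eval2 c1 c2 p != 0.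
Proof.
move=> p0; have /closed_nonrootP [c1 h1] : lead_coef p != 0 by rewrite lead_coef_eq0.
have /closed_nonrootP [c2 h2] : map_poly (horner_eval c1) p != 0.
  apply/eqP => /(congr1 (fun q : {poly C} => q`_(size p).-1)).
  by rewrite coef_map coef0 => /eqP H; case/negP: h1; rewrite rootE.
by exists c1, c2; rewrite eval2E -rootE.
Qed.

Section Normalization.
Variables (x0 y0 : K) (I : finType) (psi : I -> K).
Hypothesis gen0 : gens iota x0 y0.

(** Finiteness of the projection with coordinates [Z], in valuative form: at no place do all the [Z]
    have larger value than the least of the [psi]. *)
Definition dominates m (Z : 'I_m -> K) := forall W g, cval W -> g != 0 ->
  (forall i, W (Z i / g)) -> forall j, W (psi j / g).
Definition spanned (f : K) := exists a : I -> C, f = \sum_j iota (a j) * psi j.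

Lemma spannedB f g c : spanned f -> spanned g -> spanned (f - iota c * g).
Proof.
move=> [a ->] [b ->]; exists (fun j => a j - c * b j).
rewrite mulr_sumr -sumrB; apply: eq_bigr => j _.
by rewrite rmorphB rmorphM; ring.
Qed.

(** Three quotients [Z i / f] satisfy a polynomial relation, and (c0, c1, c2) is chosen off it. The
    projection can lose [f] only at a place where each [Z i / f] is congruent to [c i], and there
    the relation would hold at (c0, c1, c2). *)
Lemma noether_step m (Z : 'I_m.+4 -> K) : (forall i, spanned (Z i)) -> dominates Z ->
  exists Z' : 'I_m.+3 -> K, (forall i, spanned (Z' i)) /\ dominates Z'.
Proof.
move=> sp dom; pose w (i : 'I_m.+3) : 'I_m.+4 := widen_ord (leqnSn _) i.
have wP (Q : 'I_m.+4 -> Prop) : (forall i, Q (w i)) -> Q ord_max -> forall i, Q i.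
  move=> h1 h2 i; case: (ltnP i m.+3) => hi; first by have := h1 (Ordinal hi);
    have -> : w (Ordinal hi) = i by exact: val_inj.
  have -> : i = ord_max by apply: val_inj => /=; have := ltn_ord i; lia.
  by [].
set f := Z ord_max; have [f0|f0] := eqVneq f 0.
  exists (fun i => Z (w i)); split=> [i|W g hW g0 h]; first exact: sp.
  apply: dom => //; apply: wP => //.
  by rewrite -/f f0 mul0r; exact: (sr0 (cval_sub hW)).
pose a0 : 'I_m.+3 := inord 0; pose a1 : 'I_m.+3 := inord 1; pose a2 : 'I_m.+3 := inord 2.
have [d Hd] := dep (Z (w a0) / f) (Z (w a1) / f) gen0.
have [P [[i0 Pi0] E]] := Hd (fun i => (Z (w a2) / f) ^+ i).
have [c0 [c1 c01]] := poly2_nz Pi0.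
pose T : {poly C} := \poly_(i < d.+1) eval2 c0 c1 (P (inord i)).
have /closed_nonrootP [c2 Tc2] : T != 0.
  apply/eqP => /(congr1 (fun q : {poly C} => q`_i0)).
  by rewrite coef_poly ltn_ord inord_val coef0; exact/eqP.
pose c (i : 'I_m.+3) : C := nth 0 [:: c0; c1; c2] i.
exists (fun i => Z (w i) - iota (c i) * f); split=> [i|W g hW g0 h].
  by apply: spannedB; exact: sp.
have sW := cval_sub hW.
suff Wf : W (f / g).
  apply: dom => //; apply: wP => // i.
  have -> : Z (w i) / g = (Z (w i) - iota (c i) * f) / g + iota (c i) * (f / g).
    by field.
  by apply: (srD sW) => //; apply: (srM sW) => //; exact: hW.2.
apply/not_notP => nW.
have mgf : mx W (g / f) by right; rewrite invf_div.
have cong i : mx W (Z (w i) / f - iota (c i)).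
  have -> : Z (w i) / f - iota (c i) = (Z (w i) - iota (c i) * f) / g * (g / f).
    by field; rewrite f0 g0.
  exact: (mxMl hW.1).
have h0 := cong a0; have h1 := cong a1; have h2 := cong a2.
rewrite /c /a0 /a1 /a2 !inordK //= in h0 h1 h2.
rewrite -/a0 -/a1 -/a2 in h0 h1 h2.
have : mx W (\sum_(i < d.+1) ev (Z (w a0) / f) (Z (w a1) / f) (P i) * (Z (w a2) / f) ^+ i - iota T.[c2]).
  rewrite /T horner_poly rmorph_sum -sumrB; apply: (mx_sum hW.1) => i _.
  rewrite rmorphM rmorphXn inord_val.
  have VZ r s : mx W (r - iota s) -> W r.
    by move=> m'; rewrite -[r](subrK (iota s)); apply: (srD sW); [exact: (mx_V hW.1)|exact: hW.2].
  apply: mx_congM => //.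
  - by apply: cval_ev => //; [exact: VZ h0|exact: VZ h1].
  - by rewrite -rmorphXn; exact: hW.2.
  - exact: ev_cong.
  - elim: (nat_of_ord i) => [|k IH]; first by rewrite !expr0 subrr; left.
    rewrite !exprS; apply: mx_congM => //; first exact: VZ h2.
    by rewrite -rmorphXn; exact: hW.2.
by rewrite E sub0r => /(mxN hW.1); rewrite opprK; apply: cval_unit.
Qed.

Lemma noether : exists Z : 'I_3 -> K, (forall i, spanned (Z i)) /\ dominates Z.
Proof.
have : exists m (Z : 'I_m -> K), (forall i, spanned (Z i)) /\ dominates Z.
  exists #|I|, (fun i => psi (enum_val i)); split=> [i|W g hW g0 h j].
    exists (fun j => (j == enum_val i)%:R); rewrite (bigD1 (enum_val i)) //= eqxx rmorph1 mul1r.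
    by rewrite big1 ?addr0 // => j /negPf ->; rewrite rmorph0 mul0r.
  by have := h (enum_rank j); rewrite enum_rankK.
case=> m; elim: m => [|m IH] [Z [sp dom]].
  exists (fun=> 0); split=> [i|W g hW g0 h]; last by apply: dom => // -[].
  by exists (fun=> 0); rewrite big1 // => j _; rewrite rmorph0 mul0r.
case: (ltnP m 3) => m3.
  exists (fun i => if (i < m.+1)%N then Z (inord i) else 0); split=> [i|W g hW g0 h].
    case: ifP => _ //; exists (fun=> 0); rewrite big1 // => j _; rewrite rmorph0 mul0r //.
  apply: dom => // i; have hi : (i < 3)%N by have := ltn_ord i; lia.
  by have := h (Ordinal hi); rewrite /= ltn_ord inord_val.
case: m IH Z sp dom m3 => [|[|[|m]]] // IH Z sp dom _.
by apply: IH; exact: noether_step dom.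
Qed.

End Normalization.

Section Local.
Variables (x0 y0 : K) (I : finType) (psi : I -> K) (Q : K).
Hypothesis cd0 : cd x0 y0.
Hypothesis Q0 : Q != 0.
(** The quotients of the [psi] generate K, as the map is birational onto its image; the form of an
    induction principle suits kernels of derivations and fields of fractions. *)
Hypothesis S1 : forall A : K -> Prop, (forall c, A (iota c)) ->
  (forall f g, A f -> A g -> A (f - g)) -> (forall f g, A f -> A g -> A (f * g)) ->
  (forall f, A f -> A f^-1) -> (forall i j, A (psi i / psi j)) -> forall f, A f.
(** O stands for the local ring of [S] at the image of the point (c1, c2), with local coordinates a
    and b. There [br a b / Q] is the inverse of the coefficient of the form with respect to da /\
    db, and its membership in O is the absence of zeros. *)
Hypothesis S2 : forall x y (r : I -> {poly {poly C}}) (lam : K), cd x y -> lam != 0 ->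
  (forall i, psi i = lam * ev x y (r i)) ->
  forall c1 c2 k, eval2 c1 c2 (r k) != 0 -> exists (O : K -> Prop) a b,
  [/\ subring O, (forall c, O (iota c)) /\ (forall i, O (psi i / psi k)),
      forall f, O f -> exists p q, eval2 c1 c2 q != 0 /\ f = ev x y p / ev x y q,
      [/\ O a, O b & br a b != 0] &
      (forall f, O f -> O (br f a / br a b) /\ O (br f b / br a b)) /\ O (br a b / Q)].

Lemma psi_neq0 : exists i, psi i != 0.
Proof.
apply/not_notP => H.
have z i : psi i = 0 by apply/eqP; apply/not_notP => /negP h; apply: H; exists i.
have : forall f, br x0 f = 0.
  apply: S1 => [c|f g hf hg|f g hf hg|f hf|i j].
  - exact: (dC (br_deriv hbr x0)).
  - by rewrite (dB (br_deriv hbr x0)) hf hg subrr.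
  - by rewrite (dM (br_deriv hbr x0)) hf hg mul0r mulr0 addr0.
  - have [->|f0] := eqVneq f 0; first by rewrite invr0 (d0 (br_deriv hbr x0)).
    by rewrite (dV (br_deriv hbr x0)) // hf oppr0 mul0r.
  - by rewrite z mul0r (d0 (br_deriv hbr x0)).
by move/(_ y0)/eqP; rewrite (negPf cd0.2).
Qed.

Lemma sum_span V g a : cval V -> (forall j, V (psi j / g)) ->
  V ((\sum_j iota (a j) * psi j) / g).
Proof.
move=> hV H; rewrite mulr_suml; apply: (sr_sum (cval_sub hV)) => j _.
by rewrite -mulrA; apply: (srM (cval_sub hV)) => //; exact: hV.2.
Qed.

(* At a general point of the curve carried by V, the local generator {a, b}
   of the two-forms on S pulls back to a generator. *)
Lemma form_at_V V x y (z1 Z1 : K) : cval V -> (exists f, ~ V f) -> cd x y -> good V x y ->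
  z1 != 0 -> spanned psi z1 -> spanned psi Z1 -> (forall j, V (psi j / z1)) ->
  trans V (Z1 / z1) -> V (br x y / Q).
Proof.
move=> hV nt hc hg z10 [a1 Ez1] [A1 EZ1] dom tZ; have vV := hV.1; have sV := cval_sub hV.
have [_ tx Vy] := hg; have Vx := tx.1.
have [i0 p0] := psi_neq0.
have [k [pk Vk]] := vr_min vV p0.
have /choice [pq Hpq] : forall i, exists pq : {poly {poly C}} * {poly {poly C}},
   ~ mx V (ev x y pq.2) /\ psi i / psi k = ev x y pq.1 / ev x y pq.2.
  by move=> i; have [p [q H]] := good_frac hV nt hg (Vk i); exists (p, q).
pose D (P : pred I) := \prod_(j | P j) (pq j).2.
have Dn P : ~ mx V (ev x y (D P)).
  rewrite /D; elim/big_ind: _ => [|p q hp hq|j _]; last exact: (Hpq j).1.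
    by rewrite ev_1; exact: (mx1 vV).
  by rewrite evM; apply: (nmxM vV) => //; exact: cval_ev.
pose r i := (pq i).1 * D (predC1 i).
have rE i : psi i = psi k / ev x y (D predT) * ev x y (r i).
  have E : ev x y (D predT) = ev x y (pq i).2 * ev x y (D (predC1 i)).
    by rewrite -evM /D (bigD1 i).
  have n1 := mx_neq0 (Dn (predC1 i)); have n2 := mx_neq0 (Hpq i).1.
  have -> : psi i = psi k * (psi i / psi k) by rewrite mulrC divfK.
  by rewrite (Hpq i).2 /r evM E; field; rewrite n1 n2.
have lam0 : psi k / ev x y (D predT) != 0.
  by rewrite mulf_neq0 // invr_eq0; exact: mx_neq0 (Dn _).
have rk : ~ mx V (ev x y (r k)).
  move=> H; apply: (Dn predT).
  have -> : ev x y (D predT) = ev x y (r k); last by [].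
  have n := mx_neq0 (Dn predT).
  by have := rE k; move=> /(congr1 (fun z => z * ev x y (D predT) / psi k));
    rewrite [in LHS]mulrAC divff // mul1r => ->; field; rewrite pk n.
have [rho [sr mr pi0 small [divr _]]] := good_pi hV nt hg.
have r0 : rho != 0 by rewrite -size_poly_gt0; lia.
have Vev p : V (ev x y p) by exact: cval_ev.
have gen := hc.1.
(* a polynomial e in x alone lying in the ideal (r k, rho) *)
have [e [e0 He]] : exists e : {poly C}, e != 0 /\ forall c1 c2,
    eval2 c1 c2 (r k) = 0 -> (forall p, mx V (ev x y p) -> eval2 c1 c2 p = 0) -> e.[c1] = 0.
  have [P [P0 mP]] := alg_mod hV gen Vx mr pi0 (Vev (r k)).
  have exn : exists n, `[< P`_n != 0 >].
    by exists (size P).-1; apply/asboolP; rewrite -/(lead_coef P) lead_coef_eq0.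
  case: (ex_minnP exn) => n /asboolP Pn nmin.
  have PE : P = drop_poly n P * 'X^n.
    rewrite -{1}(poly_take_drop n P) -[RHS]add0r; congr (_ + _).
    apply/polyP => l; rewrite coef_take_poly coef0; case: ltnP => // ln.
    apply/eqP; apply/not_notP => /negP h.
    by have := nmin l; rewrite leqNgt ln => H; have /H : `[< P`_l != 0 >] by apply/asboolP.
  exists P`_n; split=> // c1 c2 rc H.
  pose G := (map_poly polyC (drop_poly n P)).[r k].
  have EG : ev x y G = ev x (ev x y (r k)) (drop_poly n P) by exact: ev_subst.
  have mG : mx V (ev x y G).
    rewrite EG; move: mP; rewrite {1}PE evM evXn evY; case/(mx_prime vV) => //.
    - exact: cval_ev.
    - exact: (srX sV).
    - by move=> H'; case: rk; exact: (mx_exp vV (Vev _) H').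
  have := H _ mG; rewrite /G.
  rewrite eval2_subst.
  rewrite rc horner_coef0 coef_map coef_drop_poly /= add0n //.
(* A general point of the curve rho = 0: [e] keeps it off the zeros of [r k], and since the leading
   coefficient of [rho] is nonzero there, every polynomial in the maximal ideal vanishes at it.
   Hence O lies in V. *)
have /closed_nonrootP [c1 hc1] : lead_coef rho * e != 0 by rewrite mulf_neq0 ?lead_coef_eq0.
move: hc1; rewrite rootM negb_or => /andP [lc1 ec1].
have [c2 hc2] : exists c2, eval2 c1 c2 rho = 0.
  have : size (map_poly (horner_eval c1) rho) != 1%N.
    by rewrite size_map_poly_id0 //; move: sr; case: (size rho) => [|[|]].
  by case/closed_rootP => c2 /rootP H; exists c2; rewrite eval2E.
have zero p : mx V (ev x y p) -> eval2 c1 c2 p = 0.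
  move=> /divr [l [q E]]; have := congr1 (eval2 c1 c2) E.
  rewrite eval2Z eval2M hc2 mulr0 horner_exp => /eqP; rewrite mulf_eq0 => /orP [|/eqP //].
  by rewrite expf_eq0 => /andP [_ h]; case/negP: lc1; rewrite rootE.
have rkc : eval2 c1 c2 (r k) != 0.
  apply/eqP => H; case/negP: ec1; rewrite rootE; apply/eqP.
  exact: (He c1 c2 H zero).
have [O [a [b [sO [cO psO] frO [Oa Ob ab0] [dO QO]]]]] := S2 hc lam0 rE rkc.
have OV f : O f -> V f.
  move=> /frO [p [q [qc ->]]]; apply: (srM sV) => //; apply: unitV => //.
  by move/zero => E; rewrite E eqxx in qc.
have fracO f : exists g h, [/\ O g, O h, h != 0 & f = g / h].
  apply: (S1 (A := fun f => exists g h, [/\ O g, O h, h != 0 & f = g / h])).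
  - by move=> c; exists (iota c), 1; rewrite divr1 oner_neq0; split=> //; exact: (sr1 sO).
  - move=> _ _ [g [h [Og Oh h0 ->]]] [g' [h' [Og' Oh' h0' ->]]].
    exists (g * h' - g' * h), (h * h'); split.
    + by apply: (srB sO); apply: (srM sO).
    + exact: (srM sO).
    + exact: mulf_neq0.
    + by field; rewrite h0 h0'.
  - move=> _ _ [g [h [Og Oh h0 ->]]] [g' [h' [Og' Oh' h0' ->]]].
    exists (g * g'), (h * h'); split; [exact: (srM sO)|exact: (srM sO)|exact: mulf_neq0|].
    by field; rewrite h0 h0'.
  - move=> _ [g [h [Og Oh h0 ->]]]; have [->|g0] := eqVneq g 0.
      exists 0, 1; rewrite mul0r invr0 mul0r oner_neq0.
      by split=> //; [exact: (sr0 sO)|exact: (sr1 sO)].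
    by exists h, g; rewrite invf_div.
  - move=> i j; have [->|pj] := eqVneq (psi j) 0.
      exists 0, 1; rewrite invr0 mulr0 mul0r oner_neq0.
      by split=> //; [exact: (sr0 sO)|exact: (sr1 sO)].
    exists (psi i / psi k), (psi j / psi k); split=> //.
      by rewrite mulf_neq0 // invr_eq0.
    by field; rewrite pk pj.
(* If all these residues were constant, that of [Z1 / z1] would be constant too. *)
have [i ti] : exists i, trans V (psi i / psi k).
  apply/not_notP => H.
  have /choice [c Hc] : forall i, exists c, mx V (psi i / psi k - iota c).
    by move=> i; apply: (ntrans hV (Vk i)) => t; apply: H; exists i.
  have cg a' : mx V ((\sum_j iota (a' j) * psi j) / psi k - iota (\sum_j a' j * c j)).
    rewrite mulr_suml rmorph_sum -sumrB; apply: (mx_sum vV) => j _.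
    rewrite rmorphM -mulrA -mulrBr; apply: (mxMl vV) => //; exact: hV.2.
  have m1 := cg a1; have m2 := cg A1; rewrite -Ez1 -EZ1 in m1 m2.
  set c1' := \sum_j _ in m1; set c2' := \sum_j _ in m2.
  have u1 : ~ mx V (z1 / psi k).
    move=> /(mxP _ (mulf_neq0 z10 (invr_neq0 pk))); rewrite invf_div; apply; exact: dom.
  have c10 : c1' != 0.
    by apply: contra_not_neq u1 => E; move: m1; rewrite E rmorph0 subr0.
  have ic1 : iota c1' != 0 by rewrite fmorph_eq0.
  pose cc : {poly C} := 'X - (c2' / c1')%:P.
  apply: (tZ.2 cc); first by rewrite polyXsubC_eq0.
  rewrite /cc !ev1E rmorphM fmorphV.
  have -> : Z1 / z1 - iota c2' / iota c1' = (z1 / psi k)^-1 *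
     ((Z1 / psi k - iota c2') - iota c2' / iota c1' * (z1 / psi k - iota c1')).
    by field; rewrite ic1 z10 pk.
  apply: (mxMl vV); first by rewrite invf_div; exact: dom.
  apply: (mxB vV) => //; apply: (mxMl vV) => //.
  by rewrite -fmorphV -rmorphM; exact: hV.2.
have un := unramified hbr hV nt hg ti sO OV fracO (psO i) Oa Ob ab0 dO.
have -> : br x y / Q = (br x y / br a b) * (br a b / Q) by field; rewrite Q0 ab0.
by apply: (srM sV) => //; exact: OV.
Qed.

(** In characteristic 0, differentiate an equation of t of least degree whose coefficients are
    killed by d. *)
Lemma integral_ker d t : deriv_of iota d -> integral (fun f => d f = 0) t -> d t = 0.
Proof.
move=> hd [q [mq kq /rootP qt]].
have exn : exists n, `[< exists q : {poly K}, [/\ q != 0, forall i, d q`_i = 0, q.[t] = 0 & size q = n] >].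
  by exists (size q); apply/asboolP; exists q; split=> //; exact: monic_neq0.
case: (ex_minnP exn) => n /asboolP [r [r0 kr rt sr]] nmin.
have s1 : (1 < size r)%N.
  rewrite ltnNge; apply/negP => h; move: rt r0; rewrite (size1_polyC h) hornerC => ->.
  by rewrite eqxx.
have chK m : m.+1%:R != 0 :> K by exact: char0 iota m.
have [d0' sd] := deriv_neq0 chK s1.
have dh (p : {poly K}) : (forall i, d p`_i = 0) -> d p.[t] = p^`().[t] * d t.
  elim/poly_ind: p => [|p c IH] H; first by rewrite linear0 !horner0 (d0 hd) mul0r.
  have Hp i : d p`_i = 0 by have := H i.+1; rewrite coefD coefMX coefC /= addr0.
  have Hc : d c = 0 by have := H 0%N; rewrite coefD coefMX coefC /= add0r.
  rewrite derivD derivM derivX derivC !hornerE (dD hd) (dM hd) IH // Hc; ring.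
have := dh r kr; rewrite rt (d0 hd) => /esym/eqP; rewrite mulf_eq0 => /orP [/eqP h|/eqP //].
have := nmin (size r^`()); rewrite leqNgt -sr sd => H.
have : false; last by []; apply: H; apply/asboolP; exists r^`(); split=> // i.
by rewrite coef_deriv -mulr_natr (dM hd) kr mul0r add0r -(rmorph_nat iota) (dC hd) mulr0.
Qed.

(** If the bracket were zero, {z1, .} would kill z1 and z2, hence the quotients [psi j / Z i0],
    which are integral over C[z1, z2], and hence K. The same holds for {z2, .} and then for {x0, .},
    against {x0, y0} != 0. *)
Lemma normalization_indep (Z : 'I_3 -> K) i0 : dominates psi Z ->
  Z i0 != 0 -> br (Z (lift i0 0) / Z i0) (Z (lift i0 1) / Z i0) != 0.
Proof.
move=> dom Z0; set z1 := Z (lift i0 0) / Z i0; set z2 := Z (lift i0 1) / Z i0.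
apply/eqP => b0.
have kill d : deriv_of iota d -> d z1 = 0 -> d z2 = 0 -> forall f, d f = 0.
  move=> hd d1' d2'.
  have kd : subring (fun f => d f = 0).
    split; first by rewrite (d1 hd).
      by move=> f g h1 h2; rewrite (dB hd) h1 h2 subrr.
    by move=> f g h1 h2; rewrite (dM hd) h1 h2 mul0r mulr0 addr0.
  have kpsi j : d (psi j / Z i0) = 0.
    apply: integral_ker => //; apply: integral_valrings => // V vV kV.
    have hV : cval V by split=> // c; apply: kV; exact: (dC hd).
    apply: dom => // i; case: (unliftP i0 i) => [k ->|->]; last first.
      by rewrite divff //; exact: (sr1 (cval_sub hV)).
    have : k = 0 \/ k = 1.
      by case: k => [[|[|//]] hk]; [left|right]; apply: val_inj.
    by case=> ->; apply: kV.
  apply: S1 => [c|f g hf hg|f g hf hg|f hf|i j].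
  - exact: (dC hd).
  - by rewrite (dB hd) hf hg subrr.
  - by rewrite (dM hd) hf hg mul0r mulr0 addr0.
  - have [->|f0] := eqVneq f 0; first by rewrite invr0 (d0 hd).
    by rewrite (dV hd) // hf oppr0 mul0r.
  - have [->|pj] := eqVneq (psi j) 0; first by rewrite invr0 mulr0 (d0 hd).
    have -> : psi i / psi j = (psi i / Z i0) / (psi j / Z i0) by field; rewrite Z0 pj.
    rewrite (ddiv hd) ?mulf_neq0 ?invr_eq0 // !kpsi; ring.
have hb := br_deriv hbr.
have k1 := kill _ (hb z1) (brff hbr z1) b0.
have k2 : forall f, br z2 f = 0.
  by apply: kill; [exact: hb|rewrite (brN hbr) b0 oppr0|exact: (brff hbr)].
have e1 : br x0 z1 = 0 by rewrite (brN hbr) k1 oppr0.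
have e2 : br x0 z2 = 0 by rewrite (brN hbr) k2 oppr0.
by have /eqP := kill _ (hb x0) e1 e2 y0; rewrite (negPf cd0.2).
Qed.

(* On divisors that map onto curves of S the form is a generator, because it has
   no zeros on S; Hartogs over a Noether normalization of S gives all other W. *)
Theorem zero_free x y (P : I -> {poly {poly C}}) (lam : K) (N M : nat) (g : K) :
  lam != 0 -> (forall i, psi i = lam * ev x y (P i)) ->
  (forall V t h, cval V -> (exists f, ~ V f) -> trans V t ->
     (forall f1 f2, V f1 -> f1 != 0 -> mx V f2 -> f2 != 0 -> V (f1 / f2) ->
        (h (f1 / f2) < h f1)%N) ->
     exists x' y', cd x' y' /\ good V x' y' /\ exists k,
       [/\ ev x y (P k) != 0, forall l, V (ev x y (P l) / ev x y (P k))
         & V (g * (br x y / br x' y') ^+ N / ev x y (P k) ^+ M)]) ->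
  forall W, cval W -> exists k, [/\ ev x y (P k) != 0,
    forall l, W (ev x y (P l) / ev x y (P k))
    & W (g * (br x y / Q) ^+ N / ev x y (P k) ^+ M)].
Proof.
move=> lam0 EP ch W hW.
have [Z [spZ domZ]] := noether psi cd0.1.
have [j0 pj0] := psi_neq0.
have exZ : exists i, Z i != 0.
  apply/not_notP => H.
  have z i : Z i = 0 by apply/eqP; apply/not_notP => /negP h; apply: H; exists i.
  have hb := br_deriv hbr x0.
  have := cd0.2; rewrite (integral_ker hb) ?eqxx //.
  apply: integral_valrings => [|V vV kV].
    split; first by rewrite (d1 hb).
      by move=> f f' h1 h2; rewrite (dB hb) h1 h2 subrr.
    by move=> f f' h1 h2; rewrite (dM hb) h1 h2 mul0r mulr0 addr0.
  have hV : cval V by split=> // c; apply: kV; exact: (dC hb).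
  have y00 := cd_neq0 hbr (cd_swap hbr cd0).
  have := @domZ V (psi j0 / y0) hV; rewrite mulf_neq0 ?invr_eq0 // => /(_ isT) h.
  have := h _ j0; rewrite invf_div mulrCA divff // mulr1; apply=> i.
  by rewrite z mul0r; exact: (sr0 (cval_sub hV)).
case: exZ => i1 Zi1.
(* The index of the affine chart of the plane in which W has its centre. *)
have [i0 [Zi0 WZ]] := vr_min hW.1 Zi1.
pose z1 := Z (lift i0 0) / Z i0; pose z2 := Z (lift i0 1) / Z i0.
have ind12 := br_indep hbr (normalization_indep domZ Zi0).
(* [Z i0 / lam] replaces [P k], whose index depends on the valuation ring, so that a single function
   is tested on all of them. *)
pose T0 := g * (br x y / Q) ^+ N / (Z i0 / lam) ^+ M.
have core V z z' : cval V -> trans V z -> V z' -> indep iota z z' ->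
    (z = z1 /\ z' = z2) \/ (z = z2 /\ z' = z1) -> V T0.
  move=> hV tz Vz' indz zz; apply/not_notP => nT.
  have nt : exists f, ~ V f by exists T0.
  have [h hh] := val_measure hV cd0.1 indz tz Vz' nt.
  have [x' [y' [hc [hg [k [n0 Vl VT]]]]]] := ch V z h hV nt tz hh.
  have sV := cval_sub hV.
  have VZ j : V (psi j / Z i0).
    apply: domZ => // i; case: (unliftP i0 i) => [l ->|->]; last by rewrite divff //; exact: (sr1 sV).
    have [V1 V2] : V z1 /\ V z2 by case: zz => -[<- <-]; split=> //; exact: tz.1.
    have : l = 0 \/ l = 1.
      by case: l => [[|[|//]] hl]; [left|right]; apply: val_inj.
    by case=> ->.
  have VQ : V (br x' y' / Q).
    have [j Ez] : exists j, z = Z j / Z i0.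
      by case: zz => -[-> _]; [exists (lift i0 0)|exists (lift i0 1)].
    by apply: (form_at_V hV nt hc hg Zi0 (spZ _) (spZ j) VZ); rewrite -Ez.
  apply: nT; rewrite /T0.
  have -> : g * (br x y / Q) ^+ N / (Z i0 / lam) ^+ M =
     (g * (br x y / br x' y') ^+ N / ev x y (P k) ^+ M) * (br x' y' / Q) ^+ N *
     (psi k / Z i0) ^+ M.
    have c0 := hc.2.
    have -> : br x y / Q = br x y / br x' y' * (br x' y' / Q) by field; rewrite c0 Q0.
    rewrite EP exprMn; have -> : lam * ev x y (P k) / Z i0 = ev x y (P k) / (Z i0 / lam).
      by field; rewrite lam0 Zi0.
    rewrite [(ev x y (P k) / _) ^+ M]expr_div_n.
    have := expf_neq0 M n0; have : (Z i0 / lam) ^+ M != 0.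
      by rewrite expf_neq0 // mulf_neq0 // invr_eq0.
    move: ((Z i0 / lam) ^+ M) (ev x y (P k) ^+ M) => u v u0 v0; field; by rewrite u0 v0.
  apply: (srM sV); last exact: (srX sV).
  by apply: (srM sV) => //; exact: (srX sV).
have WT : W T0.
  apply: (hartogs cd0.1 ind12) hW _ _ => [V hV t1 V2|V hV t2 V1||].
  - by apply: (core V z1 z2) => //; left.
  - by apply: (core V z2 z1) => //; [exact: indep_swap|right].
  - exact: WZ.
  - exact: WZ.
have [k [pk Wk]] := vr_min hW.1 pj0.
have sW := cval_sub hW.
have ek : ev x y (P k) != 0 by apply: contraNneq pk => E; rewrite EP E mulr0.
exists k; split=> // [l|].
  have := Wk l; rewrite !EP; have -> // : lam * ev x y (P l) / (lam * ev x y (P k)) = ev x y (P l) / ev x y (P k).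
  by field; rewrite lam0 ek.
have [a Ea] := spZ i0.
have -> : g * (br x y / Q) ^+ N / ev x y (P k) ^+ M = T0 * (Z i0 / psi k) ^+ M.
  rewrite /T0; have -> : Z i0 / psi k = (Z i0 / lam) / ev x y (P k).
    by rewrite EP; field; rewrite lam0 ek.
  rewrite [(_ / ev x y (P k)) ^+ M]expr_div_n.
  have := expf_neq0 M ek; have : (Z i0 / lam) ^+ M != 0.
    by rewrite expf_neq0 // mulf_neq0 // invr_eq0.
  move: ((Z i0 / lam) ^+ M) (ev x y (P k) ^+ M) => u v u0 v0; field; by rewrite u0 v0.
by apply: (srM sW) => //; apply: (srX sW); rewrite Ea; exact: sum_span.
Qed.

End Local.
End Surface.

(** * Minimal models *)

Section Models.
Variables (C : numClosedFieldType) (K : fieldType) (iota : {rmorphism C -> K}).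
Variable br : K -> K -> K.
Hypothesis hbr : bracket iota br.
Local Notation ev := (ev iota).
Local Notation ev1 := (ev1 iota).
Local Notation cval := (cval iota).
Local Notation trans := (trans iota).
Local Notation good := (good iota).
Local Notation cd := (cd iota br).
Local Notation frac := (frac iota).
Implicit Types (V : K -> Prop) (p q : {poly {poly C}}).

(** The transform to the chart (1 / x, y / x^n) at x = infinity of a Hirzebruch surface; [revY] is
    the one at y = infinity. *)
Definition inv n e p : {poly {poly C}} :=
  \poly_(l < size p) \poly_(k < (e - n * l).+1) p`_l`_(e - n * l - k)%N.
Definition revY mu p : {poly {poly C}} := \poly_(l < mu.+1) p`_(mu - l)%N.
Definition shX (r : C) p : {poly {poly C}} := map_poly (fun c => c \Po ('X + r%:P)) p.

(* Sections of a line bundle on the Hirzebruch surface F_n: the monomials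
   x^k y^l with l <= mu and k + n l <= e. *)
Definition wt n mu e p := forall l k, p`_l`_k != 0 -> (l <= mu)%N /\ (k + n * l <= e)%N.

Lemma wt_size n mu e p : wt n mu e p -> (size p <= mu.+1)%N.
Proof.
move=> h; apply/leq_sizeP => l ml; apply/polyP => k; rewrite coef0.
by apply/eqP; apply/not_notP => /negP /h []; lia.
Qed.

Lemma wt_size_coef n mu e p l : wt n mu e p -> p`_l != 0 ->
  (l <= mu)%N /\ (size (p`_l)%R + n * l <= e.+1)%N.
Proof.
move=> h pl; have := h l (size p`_l).-1; rewrite -/(lead_coef p`_l) lead_coef_eq0.
move=> /(_ pl); rewrite -size_poly_gt0 in pl; lia.
Qed.

Lemma coef_inv n mu e p l k : wt n mu e p -> (inv n e p)`_l`_k =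
  if (k + n * l <= e)%N then p`_l`_(e - n * l - k)%N else 0.
Proof.
move=> h; rewrite coef_poly.
have p0 m : (e < n * l + m)%N -> p`_l`_m = 0.
  by move=> lt; apply/eqP; apply/not_notP => /negP /h []; lia.
case: ltnP => lp; last first.
  by rewrite coef0 [p`_l]nth_default // coef0; case: ifP.
rewrite coef_poly; case: ltnP => hk; case: ifP => hk' //; last by lia.
by apply: p0; lia.
Qed.

Lemma wt_inv n mu e p : wt n mu e p -> wt n mu e (inv n e p).
Proof.
move=> h l k; rewrite (coef_inv _ _ h); case: ifP => [hk|_]; last by rewrite eqxx.
by move=> /h []; lia.
Qed.

Lemma ev_inv n mu e p x y : wt n mu e p -> x != 0 ->
  ev x^-1 (y / x ^+ n) (inv n e p) = ev x y p / x ^+ e.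
Proof.
move=> h x0; rewrite (ev_sum_wide _ _ _ (size_poly _ _)) ev_sum mulr_suml.
apply: eq_bigr => l _; rewrite coef_poly ltn_ord.
have [pl|pl] := eqVneq p`_l 0.
  rewrite pl ev10 !mul0r; under eq_poly do rewrite coef0.
  by rewrite poly_def big1 ?ev10 ?mul0r // => k _; rewrite scale0r.
have [_ hl] := wt_size_coef h pl.
have hnl : (n * l <= e)%N by rewrite -size_poly_gt0 in pl; lia.
rewrite (ev1_sum_wide _ _ (size_poly _ _)) (@ev1_sum_wide _ _ _ _ p`_l (e - n * l).+1); last by lia.
rewrite (reindex_inj rev_ord_inj) /= !mulr_suml; apply: eq_bigr => k _.
have kl : (k <= e - n * l)%N by rewrite -ltnS.
rewrite coef_poly subSS ltnS leq_subr subKn //.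
have -> : x ^+ e = x ^+ (e - n * l - k) * x ^+ k * x ^+ (n * l).
  by rewrite -!exprD; congr (_ ^+ _); lia.
rewrite expr_div_n exprVn -exprM; field.
by rewrite !expf_neq0.
Qed.

Lemma coef_revY mu p l k : (revY mu p)`_l`_k = if (l <= mu)%N then p`_(mu - l)%N`_k else 0.
Proof. by rewrite coef_poly ltnS; case: ifP => //; rewrite coef0. Qed.

Lemma ev_revY mu p x y : (size p <= mu.+1)%N -> y != 0 ->
  ev x y^-1 (revY mu p) = ev x y p / y ^+ mu.
Proof.
move=> h y0; rewrite (ev_sum_wide _ _ _ (size_poly _ _)) (ev_sum_wide _ _ _ h).
rewrite (reindex_inj rev_ord_inj) /= mulr_suml; apply: eq_bigr => l _.
have hl : (l <= mu)%N by rewrite -ltnS.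
rewrite coef_poly subSS ltnS leq_subr subKn //.
have -> : y ^+ mu = y ^+ (mu - l) * y ^+ l by rewrite -exprD; congr (_ ^+ _); lia.
by rewrite exprVn; field; rewrite !expf_neq0.
Qed.

Lemma coef_shX r p l : (shX r p)`_l = p`_l \Po ('X + r%:P).
Proof. by rewrite coef_map_id0 // comp_poly0. Qed.

Lemma wt_shX r n mu e p : wt n mu e p -> wt n mu e (shX r p).
Proof.
move=> h l k; rewrite coef_shX => nz.
have lt : (k < size (p`_l \Po ('X + r%:P)))%N.
  by rewrite ltnNge; apply: contra nz => lt; rewrite nth_default.
rewrite size_shift in lt; have pl : p`_l != 0.
  by rewrite -size_poly_gt0; lia.
by have := wt_size_coef h pl; lia.
Qed.

Lemma ev1_shift x r (c : {poly C}) : ev1 (x - iota r) (c \Po ('X + r%:P)) = ev1 x c.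
Proof.
elim/poly_ind: c => [|c a IH]; first by rewrite comp_poly0 !ev10.
by rewrite comp_polyD comp_polyM comp_polyX comp_polyC !ev1E IH subrK.
Qed.

Lemma ev_shX x y r p : ev (x - iota r) y (shX r p) = ev x y p.
Proof.
rewrite (ev_sum_wide _ _ _ (size_poly _ _)) ev_sum; apply: eq_bigr => l _.
by rewrite coef_shX ev1_shift.
Qed.

Lemma coef_shY r p j k :
  (shY r p)`_j`_k = \sum_(l < size p) p`_l`_k * (('X + r%:P) ^+ l)`_j.
Proof.
have E : 'X + r%:P%:P = map_poly polyC ('X + r%:P) :> {poly {poly C}}.
  by rewrite rmorphD /= map_polyX map_polyC.
rewrite /shY comp_polyE E !coef_sum; apply: eq_bigr => l _.
by rewrite coefZ -rmorphXn coef_map coefMC.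
Qed.

Lemma wt_shY r n mu e p : wt n mu e p -> wt n mu e (shY r p).
Proof.
move=> h j k; rewrite coef_shY => nz.
have [l [pl xl]] : exists l : 'I_(size p), p`_l`_k != 0 /\ (('X + r%:P) ^+ l)`_j != 0.
  apply/not_notP => H; move/eqP: nz; apply; apply: big1 => l _.
  have [->|pl] := eqVneq p`_l`_k 0; first by rewrite mul0r.
  have [->|xl] := eqVneq (('X + r%:P) ^+ l)`_j 0; first by rewrite mulr0.
  by case: H; exists l.
have jl : (j <= l)%N.
  rewrite leqNgt; apply: contra xl => lt; rewrite nth_default //.
  apply: leq_trans (size_poly_exp_leq _ _) _.
  by rewrite size_XaddC mul1n.
by have [] := h l k pl; nia.
Qed.

Variables (x0 y0 : K) (I : finType) (psi : I -> K).
Hypothesis cd0 : cd x0 y0.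
Hypothesis S1 : forall A : K -> Prop, (forall c, A (iota c)) ->
  (forall f g, A f -> A g -> A (f - g)) -> (forall f g, A f -> A g -> A (f * g)) ->
  (forall f, A f -> A f^-1) -> (forall i j, A (psi i / psi j)) -> forall f, A f.

Implicit Types (P : I -> {poly {poly C}}) (lam : K).

Definition rep x y n mu e P lam := [/\ cd x y, lam != 0,
  forall i, psi i = lam * ev x y (P i) & forall i, wt n mu e (P i)].

Lemma rep_ex : exists x y n mu e P lam, rep x y n mu e P lam.
Proof.
have /choice [pq Hpq] : forall i, exists pq : {poly {poly C}} * {poly {poly C}},
   ev x0 y0 pq.2 != 0 /\ psi i = ev x0 y0 pq.1 / ev x0 y0 pq.2.
  by move=> i; have [p [q H]] := cd0.1 (psi i); exists (p, q).
pose D := \prod_j (pq j).2.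
have D0 (T : pred I) : ev x0 y0 (\prod_(j | T j) (pq j).2) != 0.
  by rewrite rmorph_prod; apply/prodf_neq0 => j _; exact: (Hpq j).1.
pose P i := (pq i).1 * \prod_(j | j != i) (pq j).2.
have [B bB] : exists B, forall i, boxed B (P i).
  have /choice [E HE] := fun i => boxed_ex (P i).
  exists (\max_i E i) => i; apply: boxedW (HE i); exact: leq_bigmax.
exists x0, y0, 0%N, B, B, P, (ev x0 y0 D)^-1; split=> //.
- by rewrite invr_eq0; exact: D0.
- move=> i; rewrite (Hpq i).2 /P /D [in RHS](bigD1 i) //= !evM.
  by field; rewrite (Hpq i).1 D0.
- move=> i l k nz; have [h1 h2] := bB i; rewrite mul0n addn0; split.
    rewrite leqNgt; apply: contra nz => lt.
    by rewrite [(P i)`_l]nth_default ?coef0 // (leq_trans h1) // ltnW.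
  rewrite leqNgt; apply: contra nz => lt.
  by rewrite nth_default // (leq_trans (h2 l)) // ltnW.
Qed.

(** Here [mu] is the degree on the rulings x = constant. For n mu <= e, mu (2 e - n mu) is twice the
    area of the trapezoid of exponents in [wt], which is the self-intersection of the class on F_n;
    so for given mu this self-intersection is made minimal. *)
Definition mrep x y n mu e P lam := [/\ rep x y n mu e P lam,
  forall x' y' n' mu' e' P' lam', rep x' y' n' mu' e' P' lam' -> (mu <= mu')%N &
  forall x' y' n' e' P' lam', rep x' y' n' mu e' P' lam' ->
     (2 * e - n * mu <= 2 * e' - n' * mu)%N].

Lemma mrep_ex : exists x y n mu e P lam, mrep x y n mu e P lam.
Proof.
have [x [y [n [mu [e [P [lam H]]]]]]] := rep_ex.
have ex1 : exists mu, `[< exists x y n e P lam, rep x y n mu e P lam >].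
  by exists mu; apply/asboolP; exists x, y, n, e, P, lam.
case: (ex_minnP ex1) => mu1 /asboolP [x1 [y1 [n1 [e1 [P1 [lam1 H1]]]]]] min1.
have ex2 : exists w, `[< exists x y n e P lam, rep x y n mu1 e P lam /\ (2 * e - n * mu1)%N = w >].
  by eexists; apply/asboolP; exists x1, y1, n1, e1, P1, lam1; split.
case: (ex_minnP ex2) => w /asboolP [x2 [y2 [n2 [e2 [P2 [lam2 [H2 <-]]]]]]] min2.
exists x2, y2, n2, mu1, e2, P2, lam2; split=> //.
- by move=> *; apply: min1; apply/asboolP; do 6 eexists; eassumption.
- by move=> *; apply: min2; apply/asboolP; do 6 eexists; split; [eassumption|].
Qed.

Lemma mrep_move x y n mu e P lam x' y' P' lam' : mrep x y n mu e P lam ->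
  rep x' y' n mu e P' lam' -> mrep x' y' n mu e P' lam'.
Proof. by case=> _ h1 h2 h; split. Qed.

Lemma rep_shY r x y n mu e P lam : rep x y n mu e P lam ->
  rep x (y - iota r) n mu e (fun i => shY r (P i)) lam.
Proof.
case=> hc l0 E h; split=> //; first exact: cd_shift.
- by move=> i; rewrite ev_shY.
- by move=> i; exact: wt_shY.
Qed.

Lemma rep_shX r x y n mu e P lam : rep x y n mu e P lam ->
  rep (x - iota r) y n mu e (fun i => shX r (P i)) lam.
Proof.
case=> hc l0 E h; split=> //.
- by apply: cd_swap => //; apply: cd_shift => //; exact: cd_swap.
- by move=> i; rewrite ev_shX.
- by move=> i; exact: wt_shX.
Qed.

Lemma cd_inv n x y : cd x y -> cd x^-1 (y / x ^+ n).
Proof.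
move=> hc; have x0' := cd_neq0 hbr hc.
have hx : frac x^-1 (y / x ^+ n) x.
  by rewrite -{3}[x]invrK; apply: fracV; exact: fracx.
apply: (cd_trans hbr hc) => //.
have {2}-> : y = y / x ^+ n * x ^+ n by rewrite divfK // expf_neq0.
by apply: fracM; [exact: fracy|exact: fracX].
Qed.

Lemma rep_inv x y n mu e P lam : rep x y n mu e P lam ->
  rep x^-1 (y / x ^+ n) n mu e (fun i => inv n e (P i)) (lam * x ^+ e).
Proof.
case=> hc l0 E h; have x0' := cd_neq0 hbr hc; split=> //; first exact: cd_inv.
- by rewrite mulf_neq0 // expf_neq0.
- move=> i; rewrite (ev_inv _ (h i)) // E; field; exact: expf_neq0.
- by move=> i; exact: wt_inv.
Qed.

Lemma cd_invY x y : cd x y -> cd x y^-1.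
Proof.
move=> hc; apply: (cd_trans hbr hc); first exact: fracx.
by rewrite -{2}[y]invrK; apply: fracV; exact: fracy.
Qed.

Lemma rep_revY x y mu e P lam : rep x y 0 mu e P lam ->
  rep x y^-1 0 mu e (fun i => revY mu (P i)) (lam * y ^+ mu).
Proof.
case=> hc l0 E h; have y0' := cd_neq0 hbr (cd_swap hbr hc); split=> //; first exact: cd_invY.
- by rewrite mulf_neq0 // expf_neq0.
- by move=> i; rewrite ev_revY ?(wt_size (h i)) // E; field; exact: expf_neq0.
- move=> i l k; rewrite coef_revY; case: ifP => [lm|]; last by rewrite eqxx.
  by move=> /h [_]; rewrite !mul0n.
Qed.

Lemma rep_swap x y mu e P lam : rep x y 0 mu e P lam ->
  rep y x 0 e mu (fun i => swapXY (P i)) lam.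
Proof.
case=> hc l0 E h; split=> //; first exact: cd_swap.
- by move=> i; rewrite ev_swap.
- by move=> i l k; rewrite coef_swapXY => /h []; lia.
Qed.

(** An elementary transformation: the origin is blown up and the ruling x = 0 contracted. The
    invariant 2 e - n mu changes by mu - 2 m. *)
Lemma rep_blow m x y n mu e P lam : rep x y n.+1 mu e P lam ->
  (forall i, mult_ge m (P i)) ->
  rep x (y / x) n mu (e - m) (fun i => bl m (P i)) (lam * x ^+ m).
Proof.
case=> hc l0 E h mg; have x0' := cd_neq0 hbr hc; split=> //; first exact: cd_div.
- by rewrite mulf_neq0 // expf_neq0.
- move=> i; rewrite -mulrA -ev_bl // E; congr (_ * ev _ _ _).
  by rewrite mulrC divfK.
- move=> i l k; rewrite coef_bl; case: ifP => [|lt]; first by rewrite eqxx.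
  by move=> /h []; rewrite mulSn; lia.
Qed.

(** The elementary transformation at the point y = infinity of the ruling x = 0. This point lies on
    the section of self-intersection -n, which is why n grows. *)
Lemma rep_blow_inf m x y n mu e P lam : rep x y n mu e P lam ->
  (forall i, mult_ge m (revY mu (P i))) ->
  rep x (x * y) n.+1 mu (e + mu - m) (fun i => revY mu (bl m (revY mu (P i))))
    (lam * x ^+ m / x ^+ mu).
Proof.
case=> hc l0 E h mg; have x0' := cd_neq0 hbr hc; have y0' := cd_neq0 hbr (cd_swap hbr hc).
split=> //.
- apply: (cd_trans hbr hc); first exact: fracx.
  rewrite -{2}[y](mulKf x0'); apply: fracM; last exact: fracy.
  by apply: fracV; exact: fracx.
- by rewrite !mulf_neq0 ?invr_eq0 // expf_neq0.
- move=> i; have sz : (size (bl m (revY mu (P i))) <= mu.+1)%N.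
    apply: leq_trans (size_poly _ _) _; exact: size_poly.
  have := ev_revY x sz (y := (x * y)^-1); rewrite invrK => -> //; last first.
    by rewrite invr_eq0 mulf_neq0.
  have -> : (x * y)^-1 = y^-1 / x by rewrite invfM mulrC.
  have := ev_bl iota x (y^-1 / x) (mg i); rewrite [x * _]mulrC divfK //.
  rewrite ev_revY ?(wt_size (h i)) // => Eb.
  rewrite E; have -> : ev x y (P i) = x ^+ m * ev x (y^-1 / x) (bl m (revY mu (P i))) * y ^+ mu.
    by rewrite -Eb divfK // expf_neq0.
  rewrite exprMn !exprVn; field.
  by rewrite !expf_neq0 ?oner_neq0.
- move=> i l k; rewrite coef_revY; case: ifP => [lm|]; last by rewrite eqxx.
  rewrite coef_bl; case: ifP => [|lt]; first by rewrite eqxx.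
  rewrite coef_revY leq_subr.
  have -> : (mu - (mu - l) = l)%N by lia.
  by move=> /h []; rewrite mulSn; lia.
Qed.

Section Minimal.
Variables (x y : K) (n mu e : nat) (P : I -> {poly {poly C}}) (lam : K).
Hypothesis hm : mrep x y n mu e P lam.

Let hr : rep x y n mu e P lam. Proof. by case: hm. Qed.
Let hc : cd x y. Proof. by case: hr. Qed.
Let hw i : wt n mu e (P i). Proof. by case: hr. Qed.

Lemma mrep_nz : exists i, P i != 0.
Proof.
have [i pi] := psi_neq0 hbr cd0 S1; exists i; apply: contraNneq pi => P0.
by have [_ _ -> _] := hr; rewrite P0 ev0 mulr0.
Qed.

Lemma mrep_top : exists i k, (P i)`_mu`_k != 0.
Proof.
apply/not_notP => H.
have z i k : (P i)`_mu`_k = 0.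
  by apply/eqP; apply/not_notP => /negP h; apply: H; exists i, k.
have [i Pi] := mrep_nz.
have [l [k nz]] : exists l k, (P i)`_l`_k != 0.
  exists (size (P i)).-1, (size (lead_coef (P i))).-1.
  by rewrite -/(lead_coef _) -/(lead_coef _) !lead_coef_eq0.
have lm := (hw nz).1.
have mu0 : (0 < mu)%N.
  rewrite lt0n; apply: contraNneq nz => m0. have -> : l = mu by lia. by rewrite z eqxx.
case: hm => _ min _; have : (mu <= mu.-1)%N; last by lia.
apply: (min x y n mu.-1 e P lam); case: hr => h1 h2 h3 h4; split=> // j l' k' nz'.
have [h5 h6] := h4 j l' k' nz'; split=> //.
by have : l' != mu; [apply: contraNneq nz' => ->; rewrite z|lia].
Qed.

Lemma mrep_e : (n * mu <= e)%N.
Proof. by have [i [k nz]] := mrep_top; have [] := hw nz; lia. Qed.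

(** For mu = 0 the quotients of the [psi] would be functions of x alone, against [S1]. *)
Lemma mrep_mu : (0 < mu)%N.
Proof.
rewrite lt0n; apply/eqP => mu0.
have hb := br_deriv hbr x.
have kp i : br x (ev x y (P i)) = 0.
  have E : P i = ((P i)`_0)%:P by apply: size1_polyC; have := wt_size (@hw i); rewrite mu0.
  by rewrite E evC (d_ev1 hb) (brff hbr) mulr0.
have : forall f, br x f = 0.
  apply: S1 => [c|f g hf hg|f g hf hg|f hf|i j].
  - exact: (dC hb).
  - by rewrite (dB hb) hf hg subrr.
  - by rewrite (dM hb) hf hg mul0r mulr0 addr0.
  - have [->|f0] := eqVneq f 0; first by rewrite invr0 (d0 hb).
    by rewrite (dV hb) // hf oppr0 mul0r.
  - have [_ l0 E _] := hr; have [->|pj] := eqVneq (psi j) 0.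
      by rewrite invr0 mulr0 (d0 hb).
    have ej : ev x y (P j) != 0 by apply: contraNneq pj => z; rewrite E z mulr0.
    have -> : psi i / psi j = ev x y (P i) / ev x y (P j) by rewrite !E; field; rewrite l0 ej.
    by rewrite (ddiv hb) // !kp !mulr0 !mul0r subrr mul0r.
by move/(_ y)/eqP; rewrite (negPf hc.2).
Qed.

Lemma mrep_exact : exists i l k, (P i)`_l`_k != 0 /\ (k + n * l = e)%N.
Proof.
apply/not_notP => H.
have lt i l k : (P i)`_l`_k != 0 -> (k + n * l < e)%N.
  move=> nz; have [_ le] := hw nz; rewrite ltn_neqAle le andbT.
  by apply/eqP => E; apply: H; exists i, l, k.
have [i [k nz]] := mrep_top; have := lt _ _ _ nz => hlt.
case: hm => _ _ min; have := min x y n e.-1 P lam.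
have E := mrep_e.
suff h : rep x y n mu e.-1 P lam by move=> /(_ h); lia.
case: hr => h1 h2 h3 h4; split=> // j l' k' nz'.
by split; [exact: (h4 _ _ _ nz').1|have := lt _ _ _ nz'; lia].
Qed.

Lemma mrep_z0 : exists i, z0 (P i) != 0.
Proof.
apply/not_notP => H.
have z i l : (P i)`_l`_0 = 0.
  have : z0 (P i) = 0 by apply/eqP; apply/not_notP => /negP h; apply: H; exists i.
  by move/(congr1 (fun c : {poly C} => c`_l)); rewrite coef_z0 coef0.
pose P' i : {poly {poly C}} := map_poly (drop_poly 1) (P i).
have cP' i l k : (P' i)`_l`_k = (P i)`_l`_k.+1.
  by rewrite coef_map_id0 ?drop_poly0r // coef_drop_poly addn1.
have x0' := cd_neq0 hbr hc.
have evP i : ev x y (P i) = x * ev x y (P' i).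
  rewrite ev_sum (ev_sum_wide _ _ _ (size_poly _ _)) mulr_sumr; apply: eq_bigr => l _.
  rewrite coef_map_id0 ?drop_poly0r // {1}(drop1E (P i)`_l) z add0r ev1M ev1X; ring.
have [i [k nz]] := mrep_top.
have e0 : (0 < e)%N.
  case: k nz => [|k] nz; first by rewrite z eqxx in nz.
  by have [] := hw nz; lia.
have E := mrep_e.
case: hm => _ _ min; have := min x y n e.-1 P' (lam * x).
suff h : rep x y n mu e.-1 P' (lam * x) by move=> /(_ h); lia.
case: hr => h1 h2 h3 h4; split=> //; first exact: mulf_neq0.
- by move=> j; rewrite h3 evP mulrA.
- by move=> j l' k'; rewrite cP' => /h4 []; lia.
Qed.

(** Otherwise the [P i] all vanish on the curve rho = 0 of V, and dividing by [rho] lowers mu. *)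
Lemma mrep_generic V : cval V -> trans V x -> V y -> exists i, ~ mx V (ev x y (P i)).
Proof.
move=> hV tx Vy; apply/not_notP => H.
have hmx i : mx V (ev x y (P i)) by apply/not_notP => h; apply: H; exists i.
have ind := (cd_coord hbr hc).1.
have [i Pi] := mrep_nz.
have [|rho [sr mr small divr _]] := unif hV ind tx Vy.
  by exists (P i).
have r0 : rho != 0 by rewrite -size_poly_gt0; lia.
have /choice [kq Hkq] : forall j, exists kq : nat * {poly {poly C}},
    lead_coef rho ^+ kq.1 *: P j = kq.2 * rho.
  by move=> j; have [k [q E]] := divr _ (hmx j); exists (k, q).
pose k := \max_j (kq j).1.
have kj j : ((kq j).1 <= k)%N by exact: leq_bigmax.
pose P' j := lead_coef rho ^+ (k - (kq j).1) *: (kq j).2.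
have EP j : lead_coef rho ^+ k *: P j = P' j * rho.
  by rewrite /P' -scalerAl -Hkq scalerA -exprD subnK.
have lc0 : lead_coef rho ^+ k != 0 by rewrite expf_neq0 // lead_coef_eq0.
have sP j : P' j != 0 -> (size (P' j) + (size rho).-1 = size (P j))%N.
  move=> Pj; have := size_mul Pj r0; rewrite -EP size_scale // => ->.
  by move: sr; case: (size rho) => // s _; rewrite addnS.
have [B bB] : exists B, forall j, boxed B (P' j).
  have /choice [E HE] := fun i => boxed_ex (P' i).
  exists (\max_i E i) => j; apply: boxedW (HE j); exact: leq_bigmax.
have elc : ev1 x (lead_coef rho ^+ k) != 0 by exact: mx_neq0 (tx.2 _ lc0).
have er : ev x y rho != 0 by apply: contra_neq r0 => /ind.
case: hm => _ min _; have mu0 := mrep_mu.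
have : (mu <= mu.-1)%N; last by lia.
(* As mu is minimal over all n and e, the quotients may be placed on F_0 with any bound B on their
   degree in x. *)
apply: (min x y 0%N mu.-1 B P' (lam * ev x y rho / ev1 x (lead_coef rho ^+ k))).
case: hr => h1 h2 h3 h4; split=> //.
- by rewrite !mulf_neq0 ?invr_eq0.
- move=> j; rewrite h3; have := congr1 (ev x y) (EP j); rewrite evZ evM => E.
  by apply: (mulfI elc); rewrite mulrCA E; move: elc; move: (ev1 x _) => u u0; field.
- move=> j l k' nz; rewrite mul0n addn0.
  have Pj : P' j != 0 by apply: contraNneq nz => ->; rewrite !coef0.
  have [h5 h6] := bB j; split.
    have := sP j Pj; have := wt_size (h4 j) => s1 s2.
    have : (l < size (P' j))%N.
      by rewrite ltnNge; apply: contra nz => s3; rewrite [(P' j)`_l]nth_default ?coef0.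
    lia.
  rewrite leqNgt; apply: contra nz => lt.
  by rewrite nth_default // (leq_trans (h6 l)) // ltnW.
Qed.

(* Elementary transformations would lower the invariant 2 e - n mu. *)
Lemma mrep_mult_inf m : (forall i, mult_ge m (revY mu (P i))) -> (2 * m <= mu)%N.
Proof.
move=> mg; case: hm => _ _ /(_ _ _ _ _ _ _ (rep_blow_inf hr mg)).
have [i [k nz]] := mrep_top; have E := mrep_e; have := mrep_mu.
have : (m <= k)%N.
  rewrite leqNgt; apply: contra nz => lt; have := mg i 0%N k.
  by rewrite coef_revY /= subn0 addn0 lt => /(_ isT) ->.
have [_] := hw nz; rewrite mulSn; lia.
Qed.

End Minimal.

(** On F_0 the transformation at the origin would need n = -1; there the point is moved to y =
    infinity and the other transformation is used. *)
Lemma mrep_mult x y n mu e P lam m : mrep x y n mu e P lam ->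
  (forall i, mult_ge m (P i)) -> (2 * m <= mu)%N.
Proof.
move=> hm mg; have [hr _ min] := hm.
have hw i : wt n mu e (P i) by case: hr.
case: n hm hr min hw => [|n] hm hr min hw.
  have hr' := rep_revY hr; apply: (mrep_mult_inf (mrep_move hm hr')) => i l k lt.
  rewrite !coef_revY; case: ifP => // lm; rewrite leq_subr.
  have -> : (mu - (mu - l) = l)%N by lia.
  exact: mg.
have := min _ _ _ _ _ _ (rep_blow hr mg).
have [i [k nz]] := mrep_top hm; have E := mrep_e hm; have := mrep_mu hm.
have : (m <= k + mu)%N.
  by rewrite leqNgt; apply: contra nz => lt; rewrite mg.
have [_] := hw _ _ _ nz; rewrite !mulSn in E *; nia.
Qed.

End Models.

(** * The discrepancy bound in all charts of the minimal model *)

Section Charts.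
Variables (C : numClosedFieldType) (K : fieldType) (iota : {rmorphism C -> K}).
Variable br : K -> K -> K.
Hypothesis hbr : bracket iota br.
Local Notation ev := (ev iota).
Local Notation ev1 := (ev1 iota).
Local Notation cval := (cval iota).
Local Notation trans := (trans iota).
Local Notation good := (good iota).
Local Notation cd := (cd iota br).
Local Notation frac := (frac iota).
Implicit Types (V : K -> Prop) (p q : {poly {poly C}}).

Lemma vr_root V f n : valring V -> (0 < n)%N -> V (f ^+ n) -> V f.
Proof.
move=> vV n0 Vfn; apply/not_notP => nV.
have f0 : f != 0 by apply: contra_notN nV => /eqP ->; exact: (sr0 vV.1).
have mf : mx V f^-1 by right; rewrite invrK.
by have := mxX vV mf n0; rewrite exprVn => /mxP; rewrite invr_eq0 expf_neq0 // invrK => /(_ isT).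
Qed.

Lemma nmx_coef V x y p : cval V -> V x -> mx V y -> mx V (ev x y p) -> mx V (ev1 x p`_0).
Proof.
move=> hV Vx my; have vV := hV.1; have Vy := mx_V vV my.
rewrite {1}(drop1E p) evD evC evM evY => h.
rewrite -[ev1 x _](addrK (ev x y (drop_poly 1 p) * y)); apply: (mxB vV) => //.
by apply: (mxMl vV) => //; exact: cval_ev.
Qed.

(** [good_chart] with a factor g that makes up for the change of chart at x = infinity. *)
Definition gchart (I : finType) (N M : nat) V g x y (P : I -> {poly {poly C}}) :=
  exists x' y', cd x' y' /\ good V x' y' /\ exists k,
    [/\ ev x y (P k) != 0, forall l, V (ev x y (P l) / ev x y (P k))
      & V (g * (br x y / br x' y') ^+ N / ev x y (P k) ^+ M)].

Lemma gchart1 (I : finType) N M V x y (P : I -> {poly {poly C}}) :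
  good_chart iota br N M V x y P -> gchart N M V 1 x y P.
Proof.
move=> [x' [y' [h1 [h2 [k [h3 h4 h5]]]]]]; exists x', y'; split=> //; split=> //.
by exists k; split=> //; rewrite mul1r.
Qed.

Lemma gchart_move (I : finType) N M V g u v x y x1 y1 (P P1 : I -> {poly {poly C}}) :
  cval V -> (forall k, ev x y (P k) = u * ev x1 y1 (P1 k)) -> u != 0 ->
  br x y = v * br x1 y1 -> V (g * v ^+ N / u ^+ M) ->
  gchart N M V 1 x1 y1 P1 -> gchart N M V g x y P.
Proof.
move=> hV E u0 Eb Vg [x' [y' [h1 [h2 [k [h3 h4 h5]]]]]].
exists x', y'; split=> //; split=> //; exists k; split.
- by rewrite E mulf_neq0.
- move=> l; rewrite !E; have -> // : u * ev x1 y1 (P1 l) / (u * ev x1 y1 (P1 k)) =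
     ev x1 y1 (P1 l) / ev x1 y1 (P1 k).
  by move: h3; move: (ev _ _ (P1 k)) => a a0; field; rewrite u0 a0.
- rewrite E Eb; have -> : g * (v * br x1 y1 / br x' y') ^+ N / (u * ev x1 y1 (P1 k)) ^+ M
    = (g * v ^+ N / u ^+ M) * (1 * (br x1 y1 / br x' y') ^+ N / ev x1 y1 (P1 k) ^+ M).
    move: h3; move: (ev _ _ (P1 k)) => a a0; rewrite -[v * _ / _]mulrA !(exprMn _ v) [(u * a) ^+ M]exprMn mul1r.
    by field; rewrite !expf_neq0.
  exact: (srM (cval_sub hV)).
Qed.

Lemma gchart_generic (I : finType) N M V x y (P : I -> {poly {poly C}}) k :
  cval V -> cd x y -> trans V x -> V y -> ~ mx V (ev x y (P k)) -> gchart N M V 1 x y P.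
Proof.
move=> hV hc tx Vy nm; have sV := cval_sub hV; have Vx := tx.1.
exists x, y; split=> //; split; first by split=> //; exact: (cd_coord hbr hc).
have Vi := unitV (cval_ev (P k) hV Vx Vy) nm.
exists k; split; first exact: mx_neq0 nm.
- by move=> l; apply: (srM sV) => //; exact: cval_ev.
- by rewrite divff ?hc.2 // expr1n !mul1r -exprVn; exact: (srX sV).
Qed.

Lemma br_invY x y : y != 0 -> br x y = - y ^+ 2 * br x y^-1.
Proof. by move=> y0; rewrite (dV (br_deriv hbr x)) //; field. Qed.

Lemma br_inv n x y : cd x y -> br x y = - x ^+ (2 + n) * br x^-1 (y / x ^+ n).
Proof.
move=> hc; have x0 := cd_neq0 hbr hc.
have hb := br_deriv hbr; have kx := brff hbr x.
have d1x f : br x^-1 f = - br x f / x ^+ 2.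
  by rewrite (brN hbr) (dV (hb f)) // (brN hbr f x); field.
rewrite d1x (ddiv (hb x)) ?expf_neq0 // (dX_ (hb x)) kx mulr0 mulr0 subr0 exprD.
by field; rewrite ?x0 ?expf_neq0.
Qed.

Variables (x0 y0 : K) (I : finType) (psi : I -> K).
Hypothesis cd0 : cd x0 y0.
Hypothesis S1 : forall A : K -> Prop, (forall c, A (iota c)) ->
  (forall f g, A f -> A g -> A (f - g)) -> (forall f g, A f -> A g -> A (f * g)) ->
  (forall f, A f -> A f^-1) -> (forall i j, A (psi i / psi j)) -> forall f, A f.
Implicit Types (P : I -> {poly {poly C}}) (lam : K).
Local Notation rep := (rep iota br psi).
Local Notation mrep := (mrep iota br psi).

Section OneV.
Variables (V : K -> Prop) (t : K) (h : K -> nat).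
Hypotheses (hV : cval V) (tt : trans V t).
Hypothesis hh : forall f g, V f -> f != 0 -> mx V g -> g != 0 ->
    V (f / g) -> (h (f / g) < h f)%N.
Let vV := hV.1.
Let sV := cval_sub hV.

Lemma shY0 p : shY 0 p = p.
Proof. by rewrite /shY addr0 comp_polyXr. Qed.

Lemma chart0 x y n mu e P lam : mrep x y n mu e P lam -> mx V x -> gchart mu 2 V 1 x y P.
Proof.
move=> hm mxx; have [hr _ _] := hm; have [hc l0 EP hw] := hr.
have y00 := cd_neq0 hbr (cd_swap hbr hc).
case: (EM (V y)) => Vy.
  apply/gchart1/(blow_chart hbr hV tt hh hc mxx Vy); first exact: mrep_z0 cd0 S1 _ _ _ _ _ _ _ hm.
  move=> r _; apply/not_notP => H.
  have := mrep_mult hbr cd0 S1 (mrep_move hm (rep_shY hbr r hr)) (m := (mu./2).+1).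
  suff hyp : forall i : I, mult_ge (mu./2).+1 (shY r (P i)) by move/(_ hyp); lia.
  move=> i l k lt; apply/eqP; apply/not_notP => /negP nz; apply: H; exists i, l, k; split=> //; lia.
have my : mx V y^-1 by right; rewrite invrK.
(* The bracket acquires y^2 and the [P] acquire y^mu, so the exponents mu and 2 make the two factors
   cancel up to sign. *)
apply: (@gchart_move _ _ _ _ _ (y ^+ mu) (- y ^+ 2) _ _ x y^-1 _ (fun i => revY mu (P i))) => //.
- by move=> k; rewrite ev_revY ?(wt_size (hw k)) // mulrC divfK // expf_neq0.
- by rewrite expf_neq0.
- exact: br_invY.
- rewrite mul1r exprNn -!exprM mulnC mulfK ?expf_neq0 //.
  by apply: (srX sV); apply: (srN sV); exact: (sr1 sV).
apply/gchart1/(blow_chart hbr hV tt hh (cd_invY hbr hc) mxx (mx_V vV my)).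
  have [i nz] := mrep_z0 hbr cd0 S1 hm; exists i; apply: contra nz => /eqP E.
  apply/eqP/polyP => l; rewrite coef0 coef_z0.
  have [lm|ml] := leqP l mu; last by rewrite [(P i)`_l]nth_default ?coef0 // (leq_trans (wt_size (hw i))).
  have := congr1 (fun c : {poly C} => c`_(mu - l)) E.
  by rewrite coef_z0 coef_revY leq_subr coef0 subKn.
move=> r mr; have -> : r = 0.
  apply/eqP; apply/not_notP => /negP r0; apply: (cval_unit hV r0).
  by rewrite -[iota r](subKr y^-1); apply: (mxB vV).
apply/not_notP => H.
have := mrep_mult_inf hbr cd0 S1 hm (m := (mu./2).+1).
suff hyp : forall i : I, mult_ge (mu./2).+1 (revY mu (P i)) by move/(_ hyp); lia.
move=> i l k lt; apply/eqP; apply/not_notP => /negP nz; apply: H; exists i, l, k.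
by rewrite shY0; split=> //; lia.
Qed.

Lemma chartX x y n mu e P lam : mrep x y n mu e P lam -> V x -> gchart mu 2 V 1 x y P.
Proof.
move=> hm Vx; have [hr _ _] := hm; have [hc l0 EP hw] := hr.
have y00 := cd_neq0 hbr (cd_swap hbr hc).
case: (EM (trans V x)) => tx; last first.
  have [r mr] := ntrans hV Vx tx.
  apply: (@gchart_move _ _ _ _ _ 1 1 _ _ (x - iota r) y _ (fun i => shX r (P i))) => //.
  - by move=> k; rewrite ev_shX mul1r.
  - exact: oner_neq0.
  - by rewrite mul1r !(brN hbr y) (dB (br_deriv hbr y)) (dC (br_deriv hbr y)) subr0.
  - by rewrite !expr1n !mul1r invr1; exact: (sr1 sV).
  exact: chart0 (mrep_move hm (rep_shX hbr r hr)) mr.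
case: (EM (V y)) => Vy.
  have [k nk] := mrep_generic hbr cd0 S1 hm hV tx Vy.
  exact: gchart_generic nk.
have my : mx V y^-1 by right; rewrite invrK.
apply: (@gchart_move _ _ _ _ _ (y ^+ mu) (- y ^+ 2) _ _ x y^-1 _ (fun i => revY mu (P i))) => //.
- by move=> k; rewrite ev_revY ?(wt_size (hw k)) // mulrC divfK // expf_neq0.
- by rewrite expf_neq0.
- exact: br_invY.
- rewrite mul1r exprNn -!exprM mulnC mulfK ?expf_neq0 //.
  by apply: (srX sV); apply: (srN sV); exact: (sr1 sV).
have [i [k nz]] := mrep_top hbr cd0 S1 hm.
apply: (@gchart_generic _ _ _ _ _ _ _ i) => //; first exact: cd_invY.
  exact: mx_V my.
move/(nmx_coef hV Vx my); apply: tx.2; rewrite coef_poly subn0 /=.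
by apply: contraNneq nz => ->; rewrite coef0.
Qed.

Lemma chart_inf x y n mu e P lam g : mrep x y n mu e P lam -> ~ V x ->
  V (g * x ^+ ((2 + n) * mu) / x ^+ (2 * e)) -> gchart mu 2 V g x y P.
Proof.
move=> hm nVx Vg; have [hr _ _] := hm; have [hc l0 EP hw] := hr.
have x00 := cd_neq0 hbr hc.
apply: (@gchart_move _ _ _ _ _ (x ^+ e) (- x ^+ (2 + n)) _ _ x^-1 (y / x ^+ n) _ (fun i => inv n e (P i))) => //.
- by move=> k; rewrite (ev_inv _ _ (hw k)) // mulrC divfK // expf_neq0.
- by rewrite expf_neq0.
- exact: br_inv.
- rewrite exprNn -!exprM mulrCA -mulrA [(e * 2)%N]mulnC; apply: (srM sV) => //.
  by apply: (srX sV); apply: (srN sV); exact: (sr1 sV).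
by apply: chart0 (mrep_move hm (rep_inv hbr hr)) _; right; rewrite invrK.
Qed.

End OneV.
End Charts.

(** * The form in adapted coordinates *)

Section Polynomial.
Variables (C : numClosedFieldType) (K : fieldType) (iota : {rmorphism C -> K}).
Variable br : K -> K -> K.
Hypothesis hbr : bracket iota br.
Local Notation ev := (ev iota).
Local Notation ev1 := (ev1 iota).
Local Notation cval := (cval iota).
Local Notation trans := (trans iota).
Local Notation cd := (cd iota br).
Local Notation frac := (frac iota).
Implicit Types (V W : K -> Prop) (p q : {poly {poly C}}).

(** The quotient lies in C(x)[1 / y] by [frac_semiloc], and the degrees in y are compared. *)
Lemma degY_bound x y p : cd x y ->
  (forall W, cval W -> trans W x -> W y^-1 -> W (ev x y p / y ^+ 2)) -> (size p <= 3)%N.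
Proof.
move=> hc H; have y0 := cd_neq0 hbr (cd_swap hbr hc).
have [ind' gen'] := cd_coord hbr (cd_invY hbr hc).
have [ind gen] := cd_coord hbr hc.
have [q [c [c0 E]]] := frac_semiloc ind' (gen' (ev x y p / y ^+ 2)) H.
have Ec : ev1 x c != 0 by exact: indep1 ind' c0.
pose m := (size q).
have Eq : ev x y^-1 q * y ^+ m = ev x y (revY m q).
  have := ev_revY iota x (leqnSn (size q)) (y := y^-1); rewrite invrK => ->; last by rewrite invr_eq0.
  by rewrite exprVn invrK.
have : ev x y (c *: p * 'X ^+ m - 'X ^+ 2 * revY m q) = 0.
  rewrite evB !evM evZ !evXn evY -Eq.
  have -> : ev x y p = ev x y p / y ^+ 2 * y ^+ 2 by rewrite divfK // expf_neq0.
  by rewrite E; move: Ec; move: (ev1 x c) => u u0; field.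
move/ind/eqP; rewrite subr_eq0 => /eqP /(congr1 (fun r : {poly {poly C}} => size r)) E2.
have [->|p0] := eqVneq p 0; first by rewrite size_poly0.
have cp0 : c *: p != 0 by rewrite scale_poly_eq0 negb_or c0.
rewrite size_mulXn // size_scale // mulrC in E2.
have h2 : (size (revY m q * 'X^2)%R <= m.+3)%N.
  apply: leq_trans (size_polyMleq _ _) _; rewrite size_polyXn addn3 !ltnS; exact: size_poly.
by move: h2; rewrite -E2 -addn3 leq_add2l.
Qed.

(** The analogue of [degY_bound] at x = infinity, in the chart (1 / x, y / x^n). *)
Lemma weight_bound n x y p : cd x y ->
  (forall W, cval W -> trans W (y / x ^+ n) -> W x^-1 -> W (ev x y p / x ^+ (2 + n))) ->
  forall l k, p`_l`_k != 0 -> (k + n * l <= 2 + n)%N.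
Proof.
move=> hc H; have x0 := cd_neq0 hbr hc.
have hc1 := cd_swap hbr (cd_inv hbr n hc).
have [ind gen] := cd_coord hbr hc1.
have [q [c [c0 E]]] := frac_semiloc ind (gen (ev x y p / x ^+ (2 + n))) H.
have Ec : ev1 (y / x ^+ n) c != 0 by exact: indep1 ind c0.
have [B bB] := boxed_ex p.
pose e := (B + n * B)%N.
have hw : wt n B e p.
  move=> l k nz; have [h1 h2] := bB.
  have lB : (l < B)%N.
    rewrite ltnNge; apply: contra nz => lt.
    by rewrite [p`_l]nth_default ?coef0 // (leq_trans h1).
  have kB : (k < B)%N.
    rewrite ltnNge; apply: contra nz => lt.
    by rewrite nth_default // (leq_trans (h2 l)).
  by split; [exact: ltnW|rewrite /e; nia].
have : ev (y / x ^+ n) x^-1 (c *: swapXY (inv n e p) * 'X ^+ (2 + n) - q * 'X ^+ e) = 0.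
  rewrite evB (evM _ _ _ (c *: _)) evZ evXn (evM _ _ _ q) evXn evY ev_swap (ev_inv _ _ hw) //.
  have Eq : ev (y / x ^+ n) x^-1 q = ev x y p / x ^+ (2 + n) * ev1 (y / x ^+ n) c.
    by rewrite E divfK.
  rewrite Eq !exprVn; move: (x ^+ e)^-1 (x ^+ (2 + n))^-1 (ev1 _ _) (ev _ _ _) => a b u w; ring.
move/ind/eqP; rewrite subr_eq0 => /eqP E2 l k nz.
have hwl := hw l k nz; rewrite leqNgt; apply/negP => lt.
have := congr1 (fun r : {poly {poly C}} => r`_((e - n * l - k) + (2 + n))) E2.
rewrite !coefMXn ltnNge leq_addl /= addnK ifT; last by lia.
move/eqP; rewrite coefZ mulf_eq0 (negPf c0) /= => /eqP /(congr1 (fun r : {poly C} => r`_l)).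
rewrite coef_swapXY (coef_inv _ _ hw) coef0 ifT; last by lia.
by rewrite subKn ?(negPf _) => [/eqP|]; [rewrite (negPf nz)|lia].
Qed.

Variables (x0 y0 : K) (I : finType) (psi : I -> K) (Q : K).
Hypothesis cd0 : cd x0 y0.
Hypothesis Q0 : Q != 0.
Hypothesis S1 : forall A : K -> Prop, (forall c, A (iota c)) ->
  (forall f g, A f -> A g -> A (f - g)) -> (forall f g, A f -> A g -> A (f * g)) ->
  (forall f, A f -> A f^-1) -> (forall i j, A (psi i / psi j)) -> forall f, A f.
Hypothesis S2 : forall x y (r : I -> {poly {poly C}}) (lam : K), cd x y -> lam != 0 ->
  (forall i, psi i = lam * ev x y (r i)) ->
  forall c1 c2 k, eval2 c1 c2 (r k) != 0 -> exists (O : K -> Prop) a b,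
  [/\ subring O, (forall c, O (iota c)) /\ (forall i, O (psi i / psi k)),
      forall f, O f -> exists p q, eval2 c1 c2 q != 0 /\ f = ev x y p / ev x y q,
      [/\ O a, O b & br a b != 0] &
      (forall f, O f -> O (br f a / br a b) /\ O (br f b / br a b)) /\ O (br a b / Q)].
Implicit Types (P : I -> {poly {poly C}}) (lam : K).
Local Notation rep := (rep iota br psi).
Local Notation mrep := (mrep iota br psi).

Lemma div_exp_split (w a b : K) m k : a != 0 -> w / b ^+ (k * m) = w / a ^+ k * (a / b ^+ m) ^+ k.
Proof.
by move=> a0; rewrite expr_div_n -exprM mulrA divfK ?expf_neq0 // [(k * m)%N]mulnC.
Qed.

(** An anticanonical section of F_n has weight 2 + n, so 2 e - mu (2 + n) is the excess in weight of
    the square of a [P k] over the power mu of such a section; g may have a pole of that order at x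
    = infinity. *)
Lemma ruled_zero_free x y n mu e P lam g : mrep x y n mu e P lam -> (mu * (2 + n) <= 2 * e)%N ->
  (forall V, cval V -> V x -> V g) ->
  (forall V, cval V -> ~ V x -> V (g / x ^+ (2 * e - mu * (2 + n)))) ->
  forall W, cval W -> exists k, [/\ ev x y (P k) != 0,
    forall l, W (ev x y (P l) / ev x y (P k)) & W (g * (br x y / Q) ^+ mu / ev x y (P k) ^+ 2)].
Proof.
move=> hm le g1 g2; have [[hc l0 EP hw] _ _] := hm.
have x00 := cd_neq0 hbr hc.
apply: (zero_free hbr cd0 Q0 S1 S2 l0 EP) => V t h hV _ tt hh.
case: (EM (V x)) => Vx.
  apply: (@gchart_move _ _ _ _ _ _ _ _ g 1 1 x y x y P P) => //.
  - by move=> k; rewrite mul1r.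
  - exact: oner_neq0.
  - by rewrite mul1r.
  - by rewrite !expr1n invr1 !mulr1; exact: g1.
  exact: (chartX hbr cd0 S1 hV tt hh hm).
apply: (chart_inf hbr cd0 S1 hV tt hh hm) => //.
have -> : g * x ^+ ((2 + n) * mu) / x ^+ (2 * e) = g / x ^+ (2 * e - mu * (2 + n)).
  have -> : x ^+ (2 * e) = x ^+ (2 * e - mu * (2 + n)) * x ^+ ((2 + n) * mu).
    by rewrite -exprD; congr (_ ^+ _); lia.
  by field; rewrite !expf_neq0.
exact: g2.
Qed.

Lemma ruled_case x y n mu e P lam : mrep x y n mu e P lam -> (mu * (2 + n) <= 2 * e)%N ->
  exists p, br x y / Q = ev x y p /\
  forall l k, p`_l`_k != 0 -> (l <= 2)%N /\ (k + n * l <= 2 + n)%N.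
Proof.
move=> hm le; have [hr _ _] := hm; have [hc l0 EP hw] := hr.
have x00 := cd_neq0 hbr hc; have y00 := cd_neq0 hbr (cd_swap hbr hc).
have mu0 := mrep_mu hbr S1 hm.
have [ind gen] := cd_coord hbr hc.
have zf1 : forall W, cval W -> exists k, [/\ ev x y (P k) != 0,
    forall l, W (ev x y (P l) / ev x y (P k)) & W ((br x y / Q) ^+ mu / ev x y (P k) ^+ 2)].
  move=> W hW; have [| |k [h1 h2 h3]] := ruled_zero_free (g := 1) hm le _ _ hW.
  - by move=> V hV _; exact: (sr1 (cval_sub hV)).
  - move=> V hV nVx; rewrite mul1r -exprVn; apply: (srX (cval_sub hV)).
    by case: (vr_tot hV.1 x).
  - by exists k; split=> //; rewrite mul1r in h3.
have reg W : cval W -> W x -> W y -> W (br x y / Q).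
  move=> hW Wx Wy; have [k [h1 _ h3]] := zf1 W hW.
  apply: (vr_root hW.1 mu0); rewrite -[_ ^+ mu](divfK (expf_neq0 2 h1)).
  apply: (srM (cval_sub hW)) => //; apply: (srX (cval_sub hW)); exact: cval_ev.
have [|W hW [Wy _] Wx|p Ep] := frac_poly ind (gen (br x y / Q)).
- by move=> W hW [Wx _]; exact: reg.
- exact: reg.
exists p; split=> // l k nz; split.
  have : (size p <= 3)%N.
    apply: (degY_bound hc) => W hW [Wx _] Wy; have [i [h1 _ h3]] := zf1 W hW.
    apply: (vr_root hW.1 mu0); rewrite -Ep [(br x y / Q / _) ^+ _]expr_div_n -exprM.
    have Eev := ev_revY iota x (wt_size (hw i)) y00.
    have -> : (br x y / Q) ^+ mu / y ^+ (2 * mu) = (br x y / Q) ^+ mu / ev x y (P i) ^+ 2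
        * ev x y^-1 (revY mu (P i)) ^+ 2.
      by rewrite Eev; exact: div_exp_split.
    apply: (srM (cval_sub hW)) => //; apply: (srX (cval_sub hW)); exact: cval_ev.
  move=> s3; rewrite leqNgt; apply: contra nz => lt.
  by rewrite [p`_l]nth_default ?coef0 // (leq_trans s3).
apply: (weight_bound hc (p := p)) nz => W hW [Wy _] Wx.
(* With the full pole allowed to g the bound is sharp at x = infinity; g = 1 sufficed elsewhere. *)
have [| |i [h1 _ h3]] := ruled_zero_free (g := x ^+ (2 * e - mu * (2 + n))) hm le _ _ hW.
- by move=> V hV Vx; exact: (srX (cval_sub hV)).
- by move=> V hV nVx; rewrite divff ?expf_neq0 //; exact: (sr1 (cval_sub hV)).
apply: (vr_root hW.1 mu0); rewrite -Ep [(br x y / Q / _) ^+ _]expr_div_n -exprM.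
have Eev := ev_inv iota y (hw i) x00.
have -> : (br x y / Q) ^+ mu / x ^+ ((2 + n) * mu) =
   x ^+ (2 * e - mu * (2 + n)) * (br x y / Q) ^+ mu / ev x y (P i) ^+ 2
        * ev x^-1 (y / x ^+ n) (inv n e (P i)) ^+ 2.
  rewrite Eev -div_exp_split //.
  have -> : x ^+ (2 * e) = x ^+ (2 * e - mu * (2 + n)) * x ^+ ((2 + n) * mu).
    by rewrite -exprD; congr (_ ^+ _); lia.
  by move: (br x y / Q) => w; field; rewrite !expf_neq0.
apply: (srM (cval_sub hW)) => //; apply: (srX (cval_sub hW)); exact: cval_ev.
Qed.

(** The lines through a point of multiplicity m form a ruling on which curves of degree e have
    degree e - m. Minimality gives mu <= e - m, and 2 e < 3 mu then gives 3 m <= e. *)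
Lemma plane_mult x y n mu e P lam x' y' P' lam' m : mrep x y n mu e P lam -> (2 * e < 3 * mu)%N ->
  rep x' y' 1 e e P' lam' -> (forall i, mult_ge m (P' i)) -> (3 * m <= e)%N.
Proof.
move=> [hr min _] lt hr' mg.
have := min _ _ _ _ _ _ _ (rep_swap hbr (rep_blow hbr hr' mg)); lia.
Qed.

Section OneV.
Variables (V : K -> Prop) (t : K) (h : K -> nat).
Hypotheses (hV : cval V) (tt : trans V t).
Hypothesis hh : forall f g, V f -> f != 0 -> mx V g -> g != 0 ->
    V (f / g) -> (h (f / g) < h f)%N.
Variables (x y : K) (mu e : nat) (P : I -> {poly {poly C}}) (lam : K).
Hypothesis hm : mrep x y 1 mu e P lam.
Hypothesis lt23 : (2 * e < 3 * mu)%N.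
Let sV := cval_sub hV.

Lemma rep_plane x' y' P' lam' : rep x' y' 1 mu e P' lam' -> rep x' y' 1 e e P' lam'.
Proof. by case=> h1 h2 h3 h4; split=> // i l k /h4; lia. Qed.

Lemma plane_chart0 x' y' P' lam' : rep x' y' 1 e e P' lam' -> mx V x' -> V y' ->
  (exists i, z0 (P' i) != 0) -> gchart iota br e 3 V 1 x' y' P'.
Proof.
move=> hr' mxx Vy hz; have hc' : cd x' y' by case: hr'.
apply/gchart1/(blow_chart hbr hV tt hh hc' mxx Vy hz) => r _; apply/not_notP => H.
have := plane_mult hm lt23 (rep_shY hbr r hr') (m := (e %/ 3).+1).
suff hyp : forall i : I, mult_ge (e %/ 3).+1 (shY r (P' i)) by move/(_ hyp); lia.
move=> i l k lt; apply/eqP; apply/not_notP => /negP nz; apply: H; exists i, l, k; split=> //; lia.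
Qed.

(** V has its centre in one of the three affine charts of the plane. A change of chart multiplies
    the bracket by a cube and the [P] by a power e of the same function, and the exponents e and 3
    cancel them up to sign. *)
Lemma plane_chart : gchart iota br e 3 V 1 x y P.
Proof.
have [hr _ _] := hm; have [hc l0 EP hw] := hr.
have x00 := cd_neq0 hbr hc; have y00 := cd_neq0 hbr (cd_swap hbr hc).
have inf x' y' P' lam' : rep x' y' 1 e e P' lam' -> mx V x'^-1 -> V (y' / x' ^+ 1) ->
  (exists i, z0 (inv 1 e (P' i)) != 0) -> gchart iota br e 3 V 1 x' y' P'.
  move=> hr' mxx Vy hz; have [hc' _ _ hw'] := hr'.
  have x0' := cd_neq0 hbr hc'.
  apply: (@gchart_move _ _ _ _ _ _ _ _ _ (x' ^+ e) (- x' ^+ 3) _ _ x'^-1 (y' / x' ^+ 1) _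
      (fun i => inv 1 e (P' i))) => //.
  - by move=> k; rewrite (ev_inv _ _ (hw' k)) // mulrC divfK // expf_neq0.
  - by rewrite expf_neq0.
  - exact: (br_inv hbr 1).
  - rewrite mul1r exprNn -!exprM mulnC mulfK ?expf_neq0 //.
    by apply: (srX sV); apply: (srN sV); exact: (sr1 sV).
  exact: plane_chart0 (rep_inv hbr hr') mxx Vy hz.
have yinf : ~ V y -> V (x / y) -> gchart iota br e 3 V 1 x y P.
  move=> nVy Vxy.
  apply: (@gchart_move _ _ _ _ _ _ _ _ _ 1 (-1) _ _ y x _ (fun i => swapXY (P i))) => //.
  - by move=> k; rewrite ev_swap mul1r.
  - exact: oner_neq0.
  - by rewrite (brN hbr y) mulN1r.
  - rewrite expr1n mul1r divr1; apply: (srX sV); apply: (srN sV); exact: (sr1 sV).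
  have hr' : rep y x 1 e e (fun i => swapXY (P i)) lam.
    have [h1 h2 h3 h4] := rep_plane hr; split=> //; first exact: cd_swap.
    - by move=> i; rewrite ev_swap.
    - by move=> i l k; rewrite coef_swapXY => /h4; lia.
  apply: (inf _ _ _ _ hr'); rewrite ?expr1 //; first by right; rewrite invrK.
  have [i [l [k [nz E]]]] := mrep_exact hbr cd0 S1 hm.
  have hw' : wt 1 e e (swapXY (P i)) by case: hr'.
  exists i; apply: contra nz => /eqP /(congr1 (fun c : {poly C} => c`_k)).
  rewrite coef_z0 (coef_inv _ _ hw') coef0 ifT; last by lia.
  have -> : (e - 1 * k - 0 = l)%N by lia.
  by rewrite coef_swapXY => ->.
case: (EM (V x)) => Vx; last first.
  have Vi : V x^-1 by case: (vr_tot hV.1 x).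
  case: (EM (V (y / x))) => Vyx; last first.
    have Vxy : V (x / y) by rewrite -invf_div; case: (vr_tot hV.1 (y / x)).
    apply: yinf => // Vy; apply: Vyx; exact: (srM sV).
  apply: (inf _ _ _ _ (rep_plane hr)); rewrite ?expr1 //; first by right; rewrite invrK.
  exact: (mrep_z0 hbr cd0 S1 (mrep_move hm (rep_inv hbr hr))).
case: (EM (V y)) => Vy; last first.
  by apply: yinf => //; apply: (srM sV) => //; case: (vr_tot hV.1 y).
case: (EM (trans V x)) => tx; last first.
  have [r mr] := ntrans hV Vx tx.
  apply: (@gchart_move _ _ _ _ _ _ _ _ _ 1 1 _ _ (x - iota r) y _ (fun i => shX r (P i))) => //.
  - by move=> k; rewrite ev_shX mul1r.
  - exact: oner_neq0.
  - by rewrite mul1r !(brN hbr y) (dB (br_deriv hbr y)) (dC (br_deriv hbr y)) subr0.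
  - by rewrite !expr1n !mul1r invr1; exact: (sr1 sV).
  apply: (plane_chart0 (rep_plane (rep_shX hbr r hr))) => //.
  exact: (mrep_z0 hbr cd0 S1 (mrep_move hm (rep_shX hbr r hr))).
have [k nk] := mrep_generic hbr cd0 S1 hm hV tx Vy.
exact: gchart_generic nk.
Qed.

End OneV.

Lemma plane_case x y mu e P lam : mrep x y 1 mu e P lam -> (2 * e < 3 * mu)%N ->
  exists p, br x y / Q = ev x y p /\ forall l k, p`_l`_k != 0 -> (k + l <= 3)%N.
Proof.
move=> hm lt; have [hr _ _] := hm; have [hc l0 EP hw] := hr.
have x00 := cd_neq0 hbr hc; have y00 := cd_neq0 hbr (cd_swap hbr hc).
have e0 : (0 < e)%N by have := mrep_mu hbr S1 hm; have := mrep_e hbr cd0 S1 hm; lia.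
have [ind gen] := cd_coord hbr hc.
have zf1 : forall W, cval W -> exists k, [/\ ev x y (P k) != 0,
    forall l, W (ev x y (P l) / ev x y (P k)) & W (1 * (br x y / Q) ^+ e / ev x y (P k) ^+ 3)].
  apply: (zero_free hbr cd0 Q0 S1 S2 l0 EP) => V t h hV _ tt hh.
  exact: (plane_chart hV tt hh hm lt).
have reg W : cval W -> W x -> W y -> W (br x y / Q).
  move=> hW Wx Wy; have [k [h1 _ h3]] := zf1 W hW; rewrite mul1r in h3.
  apply: (vr_root hW.1 e0); rewrite -[_ ^+ e](divfK (expf_neq0 3 h1)).
  apply: (srM (cval_sub hW)) => //; apply: (srX (cval_sub hW)); exact: cval_ev.
have [|W hW [Wy _] Wx|p Ep] := frac_poly ind (gen (br x y / Q)).
- by move=> W hW [Wx _]; exact: reg.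
- exact: reg.
exists p; split=> // l k nz; rewrite -[l]mul1n.
apply: (weight_bound hc (p := p)) nz => W hW [Wy _] Wx.
have [i [h1 _ h3]] := zf1 W hW; rewrite mul1r in h3.
apply: (vr_root hW.1 e0); rewrite -Ep [(br x y / Q / _) ^+ _]expr_div_n -exprM.
have Eev := ev_inv iota y (hw i) x00.
have -> : (br x y / Q) ^+ e / x ^+ ((2 + 1) * e) =
   (br x y / Q) ^+ e / ev x y (P i) ^+ 3 * ev x^-1 (y / x ^+ 1) (inv 1 e (P i)) ^+ 3.
  by rewrite Eev; exact: div_exp_split.
apply: (srM (cval_sub hW)) => //; apply: (srX (cval_sub hW)); exact: cval_ev.
Qed.

Theorem zero_free_polynomial : exists x y p, [/\ cd x y, br x y / Q = ev x y p &
  (exists n, forall l k, p`_l`_k != 0 -> (l <= 2)%N /\ (k + n * l <= 2 + n)%N) \/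
  (forall l k, p`_l`_k != 0 -> (k + l <= 3)%N)].
Proof.
have [x [y [n [mu [e [P [lam hm]]]]]]] := mrep_ex psi cd0.
have [hr min _] := hm; have [hc _ _ _] := hr.
have mu0 := mrep_mu hbr S1 hm; have he := mrep_e hbr cd0 S1 hm.
have [le|lt] := leqP (mu * (2 + n)) (2 * e).
  have [p [Ep hp]] := ruled_case hm le.
  by exists x, y, p; split=> //; left; exists n.
(* For n = 0 exchanging the two rulings would lower mu, and n >= 2 contradicts n mu <= e. On F_1 the
   condition 2 e < 3 mu means that the system belongs on the plane, where the negative section is
   contracted. *)
have n1 : n = 1%N.
  case: n hm hr he lt {min} => [|[|n]] hm hr he lt //; last by nia.
  have [_ min _] := hm; have := min _ _ _ _ _ _ _ (rep_swap hbr hr); lia.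
subst n; have [|p [Ep hp]] := plane_case hm; first by lia.
by exists x, y, p; split=> //; right.
Qed.

End Polynomial.

(** * Normal forms *)

Section Normal.
Variables (C : numClosedFieldType) (K : fieldType) (iota : {rmorphism C -> K}).
Variable br : K -> K -> K.
Hypothesis hbr : bracket iota br.
Local Notation ev := (ev iota).
Local Notation ev1 := (ev1 iota).
Local Notation cd := (cd iota br).
Local Notation frac := (frac iota).
Variable Q : K.
Hypothesis Q0 : Q != 0.

Definition normal_form := exists x y, cd x y /\
  [\/ exists h : {poly C}, [/\ size h = 4%N, forall r, h.[r] = 0 -> h^`().[r] != 0
        & br x y / Q = y ^+ 2 - ev1 x h],
      exists2 b, b != 0 & br x y / Q = iota b * (x * y) | br x y / Q = 1].

Lemma normal_const x y a : cd x y -> a != 0 -> br x y / Q = iota a -> normal_form.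
Proof.
move=> hc a0 E; have ia : iota a != 0 by rewrite iota_eq0.
exists (x / iota a), y; split; last first.
  constructor 3; have hb := br_deriv hbr y.
  rewrite (brN hbr y) (ddiv hb) // (dC hb) mulr0 subr0 -[br y x]opprK -(brN hbr y) .
  by have -> : br x y = iota a * Q; [rewrite -E divfK|field; rewrite Q0 ia].
apply: (cd_trans hbr hc); last exact: fracy.
rewrite -{2}[x](divfK ia); apply: fracM; [exact: fracx|exact: fracC].
Qed.

(** The bracket of x / y and y is {x, y} / y, which cancels the factor y. *)
Lemma normal_y x y b : cd x y -> b != 0 -> br x y / Q = iota b * y -> normal_form.
Proof.
move=> hc b0 E; have y0 := cd_neq0 hbr (cd_swap hbr hc).
apply: (@normal_const (x / y) y b) => //.
  by apply: cd_swap => //; apply: cd_div => //; exact: cd_swap.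
have hb := br_deriv hbr y.
rewrite (brN hbr y) (ddiv hb) // (brff hbr) mulr0 subr0 -[br y x]opprK -(brN hbr y).
by have -> : br x y = iota b * y * Q; [rewrite -E divfK|field; rewrite Q0 y0].
Qed.

Lemma br_scale x y a b : br x a = 0 -> br x (a * y + b) = a * br x y + br x b.
Proof.
move=> xa; have hb := br_deriv hbr x.
by rewrite (dD hb) (dM hb) xa mul0r add0r.
Qed.

Lemma br_ev1 x (c : {poly C}) : br x (ev1 x c) = 0.
Proof. by rewrite (d_ev1 (br_deriv hbr x)) (brff hbr) mulr0. Qed.

Lemma cd_affine x y (a b : {poly C}) : cd x y -> a != 0 -> cd x (ev1 x a * y + ev1 x b).
Proof.
move=> hc a0; have ea : ev1 x a != 0 by exact: indep1 (cd_coord hbr hc).1 a0.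
apply: (cd_trans hbr hc); first exact: fracx.
have {2}-> : y = (ev1 x a * y + ev1 x b - ev1 x b) / ev1 x a by rewrite addrK mulrC mulKf.
apply: frac_div; last by apply: frac_ev1; exact: fracx.
by apply: fracB; [exact: fracy|apply: frac_ev1; exact: fracx].
Qed.

Lemma normal_alpha x y (A : {poly C}) : cd x y -> br x y / Q = ev1 x A -> normal_form.
Proof.
move=> hc E; have A0 : ev1 x A != 0 by rewrite -E mulf_neq0 ?invr_eq0 // hc.2.
have hb := br_deriv hbr x.
apply: (@normal_const x (y / ev1 x A) 1); rewrite ?oner_neq0 //.
  apply: (cd_trans hbr hc); first exact: fracx.
  rewrite -{2}[y](divfK A0); apply: fracM; first exact: fracy.
  by apply: frac_ev1; exact: fracx.
rewrite (ddiv hb) // br_ev1 mulr0 subr0 rmorph1.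
by have -> : br x y = ev1 x A * Q; [rewrite -E divfK|field; rewrite Q0 A0].
Qed.

Lemma cd_shift1 x y r : cd x y -> cd (x - iota r) y.
Proof. by move=> hc; apply: cd_swap => //; apply: cd_shift => //; exact: cd_swap. Qed.

Lemma br_shift1 x y r : br (x - iota r) y = br x y.
Proof. by rewrite !(brN hbr y) (dB (br_deriv hbr y)) (dC (br_deriv hbr y)) subr0. Qed.

Lemma br_invX x y : x != 0 -> br x^-1 y = - br x y / x ^+ 2.
Proof. move=> x0; rewrite !(brN hbr y) (dV (br_deriv hbr y)) //; ring. Qed.

Lemma cd_invX x y : cd x y -> cd x^-1 y.
Proof. by move=> hc; apply: cd_swap => //; apply: cd_invY => //; exact: cd_swap. Qed.

(** Counted with infinity, B has two zeros on the projective line. A Moebius map in x moves a double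
    zero to infinity and two distinct zeros to 0 and infinity. *)
Lemma normal_beta x y (B : {poly C}) : cd x y -> B != 0 -> (size B <= 3)%N ->
  br x y / Q = ev1 x B * y -> normal_form.
Proof.
move=> hc B0 sB E.
have EQ : br x y = ev1 x B * y * Q by rewrite -E divfK.
have [s Es] := closed_field_poly_normal B.
have lc0 : lead_coef B != 0 by rewrite lead_coef_eq0.
have sz : (size s <= 2)%N.
  by move: sB; rewrite {1}Es size_scale // size_prod_XsubC.
have Eb : ev1 x B = iota (lead_coef B) * \prod_(r <- s) (x - iota r).
  rewrite {1}Es ev1Z rmorph_prod; congr (_ * _); apply: eq_bigr => r _ /=.
  by rewrite ev1B ev1X ev1C.
move: (lead_coef B) lc0 Eb => b b0 Eb {Es}.
case: s sz Eb => [|r [|s [|//]]] _ Eb.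
- apply: (@normal_y x y b) => //; by rewrite E Eb big_nil mulr1.
- exists (x - iota r), y; split; first exact: cd_shift1.
  by constructor 2; exists b => //; rewrite br_shift1 E Eb big_seq1 mulrA.
- rewrite !big_cons big_nil mulr1 in Eb.
  have xs : x - iota s != 0 by exact: (cd_neq0 hbr (cd_shift1 s hc)).
  have xr : x - iota r != 0 by exact: (cd_neq0 hbr (cd_shift1 r hc)).
  have [rs|rs] := eqVneq r s.
    apply: (@normal_y (x - iota s)^-1 y (- b)); rewrite ?oppr_eq0 //.
      by apply: cd_invX; exact: cd_shift1.
    rewrite br_invX // br_shift1 EQ Eb rs rmorphN; field; by rewrite Q0 xs.
  have hy := br_deriv hbr y.
  have ne : iota r - iota s != 0 by rewrite -rmorphB iota_eq0 subr_eq0.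
  exists ((x - iota r) / (x - iota s)), y; split; last first.
    constructor 2; exists (b * (r - s)); first by rewrite mulf_neq0 // subr_eq0.
    rewrite (brN hbr y) (ddiv hy) // !(dB hy) !(dC hy) !subr0.
    have -> : br y x = - (ev1 x B * y * Q) by rewrite (brN hbr x) EQ.
    by rewrite Eb rmorphM rmorphB; field; rewrite Q0 xs.
  apply: (cd_trans hbr hc); last exact: fracy.
  set z := _ / _.
  have z1 : 1 - z != 0.
    have -> : 1 - z = (iota r - iota s) / (x - iota s) by rewrite /z; field.
    by rewrite mulf_neq0 ?invr_eq0.
  have -> : x = (iota r - iota s * z) / (1 - z).
    have -> : 1 - z = (iota r - iota s) / (x - iota s) by rewrite /z; field.
    by rewrite /z; field; rewrite xs ne.
  apply: frac_div; apply: fracB; try exact: fracC.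
    by apply: fracM; [exact: fracC|exact: fracx].
  by rewrite -(rmorph1 iota); exact: fracC.
  exact: fracx.
Qed.

(** The new coordinate A + B y absorbs A, because its bracket with x is B {x, y}. *)
Lemma normal_linear x y (A B : {poly C}) : cd x y -> (size B <= 3)%N ->
  br x y / Q = ev1 x A + ev1 x B * y -> normal_form.
Proof.
move=> hc sB E; have [B0|B0] := eqVneq B 0.
  by apply: (@normal_alpha x y A) => //; rewrite E B0 ev10 mul0r addr0.
apply: (@normal_beta x (ev1 x B * y + ev1 x A) B) => //; first exact: cd_affine.
by rewrite br_scale ?br_ev1 // addr0 -mulrA E [ev1 x A + _]addrC.
Qed.

Lemma reverse_poly (D : {poly C}) k r (x1 : K) : (size D <= k.+1)%N -> x1 != 0 ->
  exists2 D1 : {poly C}, (size D1 <= k.+1)%N & ev1 x1 D1 = x1 ^+ k * ev1 (iota r - x1^-1) D.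
Proof.
move=> sD x10; exists (\sum_(i < k.+1) D`_i *: ('X^(k - i) * (r *: 'X - 1) ^+ i)).
  apply: leq_trans (size_sum _ _ _) _; apply/bigmax_leqP => i _.
  apply: leq_trans (size_scale_leq _ _) _; apply: leq_trans (size_polyMleq _ _) _.
  rewrite size_polyXn; have h1 : (size ((r *: 'X - 1 : {poly C}) ^+ i)%R <= i.+1)%N.
    apply: leq_trans (size_poly_exp_leq _ _) _; rewrite ltnS.
    have h2 : (size (r *: 'X - 1 : {poly C})%R <= 2)%N.
      apply: leq_trans (size_polyD _ _) _; rewrite size_polyN size_poly1 geq_max andbT.
      by apply: leq_trans (size_scale_leq _ _) _; rewrite size_polyX.
    by move: h2; nia.
  have ik := ltn_ord i; rewrite addSn /=; apply: leq_trans (leq_add (leqnn _) h1) _; lia.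
rewrite (ev1_sum_wide _ _ sD) mulr_sumr rmorph_sum; apply: eq_bigr => i _.
have ik : (i <= k)%N by rewrite -ltnS.
rewrite /= ev1Z ev1M !ev1Xn ev1X ev1B ev1Z ev1X ev11.
have -> : x1 ^+ k = x1 ^+ (k - i) * x1 ^+ i by rewrite -exprD subnK.
have -> : iota r * x1 - 1 = x1 * (iota r - x1^-1) by field.
by rewrite exprMn; ring.
Qed.

(* The roots of D form a binary quartic; r, of multiplicity m, moves to infinity. *)
Lemma mobius x y (D E : {poly C}) r m : cd x y -> (m <= 4)%N -> (size E <= 5 - m)%N ->
  D = ('X - r%:P) ^+ m * E -> br x y / Q = y ^+ 2 - ev1 x D ->
  exists x1 y1 (D1 : {poly C}), [/\ cd x1 y1, (size D1 <= 5 - m)%N &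
    br x1 y1 / Q = y1 ^+ 2 - ev1 x1 D1].
Proof.
move=> hc m4 sE DE EW.
have xr : x - iota r != 0 by exact: (cd_neq0 hbr (cd_shift1 r hc)).
have rx : iota r - x != 0 by rewrite -oppr_eq0 opprB.
pose x1 := (iota r - x)^-1; have x10 : x1 != 0 by rewrite invr_eq0.
have Ex : x = iota r - x1^-1 by rewrite /x1 invrK opprB addrC subrK.
have [|E1 sE1 HE1] := @reverse_poly E (4 - m) r x1 _ x10; first by lia.
(* D counts as a quartic form, so y has weight 2 and takes the factor x1^2; the sign comes from (x -
   r)^m against (r - x)^m. *)
exists x1, (y * x1 ^+ 2), ((-1) ^+ m *: E1); split.
- have fx : frac x1 (y * x1 ^+ 2) x.
    rewrite {1}Ex; apply: fracB; [exact: fracC|apply: fracV; exact: fracx].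
  apply: (cd_trans hbr hc) => //.
  have {2}-> : y = y * x1 ^+ 2 / x1 ^+ 2 by rewrite mulfK // expf_neq0.
  by apply: frac_div; [exact: fracy|apply: fracX; exact: fracx].
- by apply: leq_trans (size_scale_leq _ _) _; lia.
- have b1 f : br x1 f = br x f / (iota r - x) ^+ 2.
    rewrite (brN hbr f) /x1 (dV (br_deriv hbr f)) // (dB (br_deriv hbr f)) (dC (br_deriv hbr f)).
    by rewrite (brN hbr x f); field.
  have b2 : br x x1 = 0 by rewrite (brN hbr) b1 (brff hbr) mul0r oppr0.
  have hx := br_deriv hbr x.
  rewrite b1 (dM hx) (dX_ hx) b2 !mulr0 addr0.
  have -> : br x y = (y ^+ 2 - ev1 x D) * Q by rewrite -EW divfK.
  rewrite ev1Z HE1 DE ev1M ev1Xn ev1B ev1X ev1C -Ex rmorphXn rmorphN rmorph1.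
  have -> : x1 ^+ (4 - m) = x1 ^+ 4 * (iota r - x) ^+ m.
    have -> : x1 ^+ 4 = x1 ^+ (4 - m) * x1 ^+ m by rewrite -exprD subnK.
    by rewrite -mulrA -exprMn mulVf // expr1n mulr1.
  have -> : (x - iota r) ^+ m = (-1) ^+ m * (iota r - x) ^+ m.
    by rewrite -exprMn; congr (_ ^+ _); ring.
  have -> : x1 = (iota r - x)^-1 by [].
  move: ((-1) ^+ m) ((iota r - x) ^+ m) (ev1 x E) => a b c.
  by field; rewrite Q0 rx.
Qed.

(** With d^2 = c nonzero, v = (y - d) / (y + d) moves the two zeros to 0 and infinity and satisfies
    {x, v} = 2 d v Q. *)
Lemma normal_sq_const x y c : cd x y -> br x y / Q = y ^+ 2 - iota c -> normal_form.
Proof.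
move=> hc E; have y0 := cd_neq0 hbr (cd_swap hbr hc); have hx := br_deriv hbr x.
have EQ : br x y = (y ^+ 2 - iota c) * Q by rewrite -E divfK.
have [c0|c0] := eqVneq c 0.
  apply: (@normal_const x y^-1 (-1)); rewrite ?oppr_eq0 ?oner_neq0 //; first exact: cd_invY.
  by rewrite (dV hx) // EQ c0 rmorph0 rmorphN rmorph1; field; rewrite Q0 y0.
pose d := sqrtC c; have Ed : c = d ^+ 2 by rewrite sqrtCK.
have d0 : d != 0 by rewrite sqrtC_eq0.
have yd : y + iota d != 0.
  have := cd_neq0 hbr (cd_swap hbr (cd_shift hbr (- d) hc)).
  by rewrite rmorphN opprK.
have ne : iota d *+ 2 != 0 by rewrite -rmorphMn /= iota_eq0 mulrn_eq0.
have id : iota d != 0 by rewrite iota_eq0.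
have n2 : (2%:R : K) != 0 by rewrite -(rmorph_nat iota) iota_eq0 pnatr_eq0.
pose v := (y - iota d) / (y + iota d).
apply: (@normal_y x v (d *+ 2)); rewrite ?mulrn_eq0 //; last first.
  rewrite /v (ddiv hx) // (dB hx) (dD hx) (dC hx) subr0 addr0 EQ Ed rmorphXn rmorphMn /=.
  by field; rewrite Q0 yd.
have v1 : 1 - v = (iota d *+ 2) / (y + iota d) by rewrite /v; field.
have v10 : 1 - v != 0 by rewrite v1 mulf_neq0 ?invr_eq0.
apply: (cd_trans hbr hc); first exact: fracx.
have -> : y = (iota d *+ 2) / (1 - v) - iota d by rewrite v1; field; rewrite yd id n2.
apply: fracB; last exact: fracC.
apply: frac_div; first by rewrite -rmorphMn /=; exact: fracC.
by apply: fracB; [rewrite -(rmorph1 iota); exact: fracC|exact: fracy].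
Qed.

(** The equation v of the parabola becomes a coordinate, with {y, v} = a v Q. *)
Lemma normal_sq_lin x y a b : cd x y -> a != 0 ->
  br x y / Q = y ^+ 2 - (iota a * x + iota b) -> normal_form.
Proof.
move=> hc a0 E; have hy := br_deriv hbr y; have ia : iota a != 0 by rewrite iota_eq0.
have EQ : br x y = (y ^+ 2 - (iota a * x + iota b)) * Q by rewrite -E divfK.
pose v := y ^+ 2 - (iota a * x + iota b).
apply: (@normal_y y v a) => //; last first.
  rewrite /v (dB hy) (dX_ hy) (dD hy) (dM hy) !(dC hy) (brff hbr) (brN hbr x) EQ.
  by field.
apply: (cd_trans hbr (cd_swap hbr hc)); first exact: fracx.
have -> : x = (y ^+ 2 - v - iota b) / iota a by rewrite /v; field.
apply: frac_div; last exact: fracC.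
apply: fracB; last exact: fracC.
by apply: fracB; [apply: fracX; exact: fracx|exact: fracy].
Qed.

(** With b^2 = a, the equation w of the conic and that of an asymptote, u, become coordinates, with
    {u, w} = - 2 b u w Q. *)
Lemma normal_sq_quad x y a m e : cd x y -> a != 0 ->
  br x y / Q = y ^+ 2 - (iota a * (x - iota m) ^+ 2 + iota e) -> normal_form.
Proof.
move=> hc a0 E.
pose b := sqrtC a; have Eb : a = b ^+ 2 by rewrite sqrtCK.
have b0 : b != 0 by rewrite sqrtC_eq0.
have ib : iota b != 0 by rewrite iota_eq0.
have EQ : br x y = (y ^+ 2 - (iota a * (x - iota m) ^+ 2 + iota e)) * Q by rewrite -E divfK.
pose u := y - iota b * (x - iota m).
pose w := y ^+ 2 - (iota a * (x - iota m) ^+ 2 + iota e).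
have n2 : (2%:R : K) != 0 by rewrite -(rmorph_nat iota) iota_eq0 pnatr_eq0.
have Ew : w = u * (y + iota b * (x - iota m)) - iota e.
  by rewrite /w /u Eb rmorphXn; ring.
have bu f : br u f = br y f - iota b * br x f.
  have hf := br_deriv hbr f.
  rewrite (brN hbr f) /u (dB hf) (dM hf) (dB hf) !(dC hf) (brN hbr f y) (brN hbr f x); ring.
have byx : br y x = - br x y by rewrite (brN hbr x).
have bw : br u w = - (iota b *+ 2) * u * br x y.
  rewrite bu /w; have h1 := br_deriv hbr y; have h2 := br_deriv hbr x.
  rewrite !(dB h1, dD h1, dX_ h1, dM h1, dN h1, dC h1) !(dB h2, dD h2, dX_ h2, dM h2, dN h2, dC h2).
  rewrite !(brff hbr) byx.
  by rewrite /u Eb rmorphXn /=; ring.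
exists u, w; split; last first.
  constructor 2; exists (- (b *+ 2)); first by rewrite oppr_eq0 mulrn_eq0.
  by rewrite bw EQ -/w rmorphN rmorphMn /=; field.
have u0 : u != 0.
  apply/eqP => u0; have := bu y; rewrite (brff hbr) sub0r u0.
  rewrite (brN hbr y) (d0 (br_deriv hbr y)) oppr0 => /esym/eqP.
  by rewrite oppr_eq0 mulf_eq0 (negPf ib) (negPf hc.2).
have Ev : y + iota b * (x - iota m) = (w + iota e) / u by rewrite Ew subrK [RHS]mulrC mulKf.
have fv : frac u w (y + iota b * (x - iota m)).
  rewrite Ev; apply: frac_div; last exact: fracx.
  by apply: fracD; [exact: fracy|exact: fracC].
apply: (cd_trans hbr hc).
  have -> : x = (y + iota b * (x - iota m) - u) / (2%:R * iota b) + iota m.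
    by rewrite /u; field; rewrite n2 ib.
  apply: fracD; last exact: fracC.
  apply: frac_div; first by apply: fracB => //; exact: fracx.
  by rewrite -(rmorph_nat iota) -rmorphM; exact: fracC.
have -> : y = (y + iota b * (x - iota m) + u) / 2%:R by rewrite /u; field.
apply: frac_div; last by rewrite -(rmorph_nat iota); exact: fracC.
by apply: fracD => //; exact: fracx.
Qed.

Lemma normal_sq3 x y (D : {poly C}) : cd x y -> (size D <= 3)%N ->
  br x y / Q = y ^+ 2 - ev1 x D -> normal_form.
Proof.
move=> hc sD; rewrite (ev1_sum_wide _ _ sD) !big_ord_recl big_ord0 /= expr0 expr1 mulr1 addr0.
move: (D`_0) (D`_1) (D`_2) => d0 d1 d2 E.
have [d20|d20] := eqVneq d2 0.
  rewrite d20 rmorph0 mul0r addr0 in E.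
  have [d10|d10] := eqVneq d1 0.
    by apply: (normal_sq_const hc); rewrite E d10 rmorph0 mul0r addr0.
  by apply: (normal_sq_lin hc d10); rewrite E [iota d0 + _]addrC.
have i2 : iota d2 != 0 by rewrite iota_eq0.
have n2 : (2%:R : K) != 0 by rewrite -(rmorph_nat iota) iota_eq0 pnatr_eq0.
apply: (@normal_sq_quad x y d2 (- d1 / (2%:R * d2)) (d0 - d1 ^+ 2 / (4%:R * d2)) hc d20).
have n4 : (4%:R : K) != 0 by rewrite -(rmorph_nat iota) iota_eq0 pnatr_eq0.
rewrite E; congr (_ - _).
rewrite !(rmorphB, rmorphM, fmorphV, rmorphN, rmorphXn, rmorph_nat) /=.
by field; rewrite n2 n4 i2.
Qed.

(** A multiple root is moved to infinity, which leaves degree at most 2; a cubic without one is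
    already in normal form. *)
Lemma normal_sq4 x y (D : {poly C}) : cd x y -> (size D <= 4)%N ->
  br x y / Q = y ^+ 2 - ev1 x D -> normal_form.
Proof.
move=> hc sD E; have [s3|s3] := leqP (size D) 3; first exact: normal_sq3 E.
have [[r [r1 r2]]|H] := EM (exists r, D.[r] = 0 /\ D^`().[r] = 0); last first.
  exists x, y; split=> //; constructor 1; exists D; split=> //; first by apply/eqP; rewrite eqn_leq sD.
  by move=> r r1; apply/eqP => r2; apply: H; exists r.
have /factor_theorem [F EF] : root D r by apply/rootP.
have /factor_theorem [G EG] : root F r.
  apply/rootP; move: r2; rewrite EF derivM !hornerE derivXsubC !hornerE.
  by rewrite subrr !mulr0 add0r.
have ED : D = ('X - r%:P) ^+ 2 * G by rewrite EF EG; ring.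
have [|x1 [y1 [D1 [h1 h2 h3]]]] := mobius hc (isT : (2 <= 4)%N) _ ED E; last exact: normal_sq3 h3.
have [->|G0] := eqVneq G 0; first by rewrite size_poly0.
move: sD; rewrite ED size_monicM ?monic_exp ?monicXsubC // size_exp_XsubC; lia.
Qed.

Lemma normal_sq x y (D : {poly C}) : cd x y -> (size D <= 5)%N ->
  br x y / Q = y ^+ 2 - ev1 x D -> normal_form.
Proof.
move=> hc sD E; have [s3|s4] := leqP (size D) 4; first exact: normal_sq4 E.
have /closed_rootP [r rr] : size D != 1%N by apply: contraTneq s4 => ->.
have /factor_theorem [F EF] := rr.
have ED : D = ('X - r%:P) ^+ 1 * F by rewrite EF mulrC.
have [|x1 [y1 [D1 [h1 h2 h3]]]] := mobius hc (isT : (1 <= 4)%N) _ ED E; last exact: normal_sq4 h3.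
have [->|F0] := eqVneq F 0; first by rewrite size_poly0.
move: sD; rewrite EF size_Mmonic ?monicXsubC // size_XsubC; lia.
Qed.

(** The coordinate y' = G y + B / 2 completes the square: {x, y'} = (y'^2 - (B^2 / 4 - A G)) Q. *)
Lemma normal_quad x y (A B G : {poly C}) : cd x y -> (size B <= 3)%N ->
  (size (A * G)%R <= 5)%N ->
  br x y / Q = ev1 x A + ev1 x B * y + ev1 x G * y ^+ 2 -> normal_form.
Proof.
move=> hc sB sAG E; have [G0|G0] := eqVneq G 0.
  by apply: (normal_linear hc sB (A := A)); rewrite E G0 ev10 mul0r addr0.
have n2 : (2%:R : K) != 0 by rewrite -(rmorph_nat iota) iota_eq0 pnatr_eq0.
pose B2 := (2%:R)^-1 *: B.
have EB : ev1 x B2 = ev1 x B / 2%:R by rewrite ev1Z fmorphV rmorph_nat mulrC.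
apply: (@normal_sq x (ev1 x G * y + ev1 x B2) (B2 ^+ 2 - A * G)); first exact: cd_affine.
  apply: leq_trans (size_polyD _ _) _; rewrite size_polyN geq_max sAG andbT.
  apply: leq_trans (size_poly_exp_leq _ _) _.
  rewrite ltnS (@leq_mul _ _ 2 2) // -subn1 leq_subLR.
  exact: leq_trans (size_scale_leq _ _) sB.
rewrite br_scale ?br_ev1 // addr0 -mulrA E ev1B ev1Xn ev1M EB.
by field.
Qed.

Lemma coef_size (p : {poly {poly C}}) l m : (forall k, p`_l`_k != 0 -> (k < m)%N) -> (size (p`_l)%R <= m)%N.
Proof.
move=> H; apply/leq_sizeP => k mk; apply/eqP; apply/not_notP => /negP /H; lia.
Qed.

Lemma normal_ruled x y p n : cd x y -> br x y / Q = ev x y p ->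
  (forall l k, p`_l`_k != 0 -> (l <= 2)%N /\ (k + n * l <= 2 + n)%N) -> normal_form.
Proof.
move=> hc E hp.
have s3 : (size p <= 3)%N.
  apply/leq_sizeP => l hl; apply/polyP => k; rewrite coef0.
  by apply/eqP; apply/not_notP => /negP /hp [] ; lia.
apply: (@normal_quad x y p`_0 p`_1 p`_2) => //.
- by apply: coef_size => k /hp []; lia.
(* The degree bounds 2 + n and 2 - n of the outer coefficients add up to 4, whatever n is. *)
- have s0 : (size (p`_0)%R <= 3 + n)%N by apply: coef_size => k /hp []; lia.
  have s2 : (size (p`_2)%R <= 3 - n)%N by apply: coef_size => k /hp []; lia.
  have [->|G0] := eqVneq p`_2 0; first by rewrite mulr0 size_poly0.
  apply: leq_trans (size_polyMleq _ _) _.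
  by rewrite -size_poly_gt0 in G0; lia.
- by rewrite E (ev_sum_wide _ _ _ s3) !big_ord_recl big_ord0 /= expr0 expr1 mulr1 addr0 addrA.
Qed.

Definition poly4 (a b c d : C) : {poly C} := a%:P + b *: 'X + c *: 'X^2 + d *: 'X^3.

Lemma size_poly4 a b c d : (size (poly4 a b c d) <= 4)%N /\
  (d = 0 -> (size (poly4 a b c d) <= 3)%N) /\ (c = 0 -> d = 0 -> (size (poly4 a b c d) <= 2)%N).
Proof.
have cf k : (poly4 a b c d)`_k = if k is 0 then a else if k is 1 then b else if k is 2 then c else
   if k is 3 then d else 0.
  rewrite !coefD coefC !coefZ coefX !coefXn; case: k => [|[|[|[|k]]]] /=;
  by rewrite ?mulr0 ?mulr1 ?addr0 ?add0r.
split; first by apply/leq_sizeP => k; rewrite cf; case: k => [|[|[|[|]]]].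
split; first by move=> d0; apply/leq_sizeP => k; rewrite cf; case: k => [|[|[|[|]]]].
by move=> c0 d0; apply/leq_sizeP => k; rewrite cf; case: k => [|[|[|[|]]]].
Qed.

Lemma ev1_poly4 x a b c d :
  ev1 x (poly4 a b c d) = iota a + iota b * x + iota c * x ^+ 2 + iota d * x ^+ 3.
Proof. by rewrite /poly4 !ev1D !ev1Z !ev1Xn ev1X ev1C. Qed.

Lemma normal_plane_expanded x y (a : nat -> nat -> C) : cd x y -> a 0 3 = 0 ->
  br x y / Q = \sum_(k < 4) \sum_(l < 4) (if (k + l <= 3)%N then iota (a k l) * x ^+ k * y ^+ l else 0) ->
  normal_form.
Proof.
move=> hc a03 E.
apply: (@normal_quad x y (poly4 (a 0 0) (a 1 0) (a 2 0) (a 3 0))%N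
  (poly4 (a 0 1) (a 1 1) (a 2 1) 0)%N (poly4 (a 0 2) (a 1 2) 0 0)%N) => //.
- by have [_ [h _]] := size_poly4 (a 0 1)%N (a 1 1)%N (a 2 1)%N 0; exact: h.
- have [h1 _] := size_poly4 (a 0 0)%N (a 1 0)%N (a 2 0)%N (a 3 0)%N.
  have [_ [_ h2]] := size_poly4 (a 0 2)%N (a 1 2)%N 0 0.
  apply: leq_trans (size_polyMleq _ _) _.
  have := h2 erefl erefl; lia.
- rewrite E !big_ord_recl !big_ord0 /= !ev1_poly4 /bump /= a03 rmorph0; ring.
Qed.

(** A point of the cubic at infinity is moved to the common point of the lines x = constant. This
    removes y^3, and projection from that point leaves a quadratic in y. *)
Lemma normal_plane x y p : cd x y -> br x y / Q = ev x y p ->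
  (forall l k, p`_l`_k != 0 -> (k + l <= 3)%N) -> normal_form.
Proof.
move=> hc E hp.
have z k l : (3 < k + l)%N -> p`_l`_k = 0.
  by move=> lt; apply/eqP; apply/not_notP => /negP /hp; lia.
have s4 : (size p <= 4)%N.
  apply/leq_sizeP => l hl; apply/polyP => k; rewrite coef0; apply: z; lia.
have sl l : (size (p`_l)%R <= 4)%N by apply: coef_size => k /hp; lia.
have Ep : ev x y p = \sum_(l < 4) \sum_(k < 4) iota p`_l`_k * x ^+ k * y ^+ l.
  rewrite (ev_sum_wide _ _ _ s4); apply: eq_bigr => l _.
  by rewrite (ev1_sum_wide _ _ (sl l)) mulr_suml.
rewrite Ep !big_ord_recl !big_ord0 /= /bump /= in E.
move: E; rewrite (z 1 3)%N // (z 2 2)%N // (z 2 3)%N // (z 3 1)%N // (z 3 2)%N // (z 3 3)%N //.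
move: (p`_0`_0) (p`_0`_1) (p`_0`_2) (p`_0`_3) (p`_1`_0) (p`_1`_1) (p`_1`_2) (p`_2`_0) (p`_2`_1) (p`_3`_0).
move=> a00 a10 a20 a30 a01 a11 a21 a02 a12 a03 E.
(* The roots c of this polynomial are the points (c : 1) at infinity. If it is a nonzero constant,
   then x^3 is missing and exchanging x and y suffices. *)
have [|sT] := eqVneq (size (poly4 a03 a12 a21 a30)) 1%N.
  move=> /eqP /size_poly1P [c c0 Tc].
  have a30' : a30 = 0.
    have := congr1 (fun q : {poly C} => q`_3) Tc.
    by rewrite !coefD !coefC !coefZ coefX !coefXn /= !mulr0 mulr1 !add0r.
  apply: (@normal_plane_expanded y x (fun k l => (- nth 0 (nth [::]
     [:: [:: a00; a10; a20; a30]; [:: a01; a11; a21]; [:: a02; a12]; [:: a03]] k) l))) => //=.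
  - exact: cd_swap.
  - by rewrite a30' oppr0.
  - rewrite (brN hbr x) mulNr E !big_ord_recl !big_ord0 /= /bump /= a30' !rmorphN /= !rmorph0; ring.
have /closed_rootP [c /rootP rc] := sT.
have {}rc : a03 + a12 * c + a21 * c ^+ 2 + a30 * c ^+ 3 = 0.
  by rewrite -rc /poly4 !hornerE.
pose x1 := x - iota c * y; have Ex : x = x1 + iota c * y by rewrite subrK.
have hc1 : cd x1 y.
  apply: (cd_trans hbr hc); last exact: fracy.
  rewrite {1}Ex; apply: fracD; first exact: fracx.
  by apply: fracM; [exact: fracC|exact: fracy].
apply: (@normal_plane_expanded x1 y (fun k l => (nth 0 (nth [::]
  [:: [:: a00; a01 + a10 * c; a02 + a11 * c + a20 * c ^+ 2; 0];
      [:: a10; a11 + 2%:R * a20 * c; a12 + 2%:R * a21 * c + 3%:R * a30 * c ^+ 2];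
      [:: a20; a21 + 3%:R * a30 * c]; [:: a30]] k) l))) => //.
have hy := br_deriv hbr y.
have -> : br x1 y = br x y.
  by rewrite (brN hbr y) (dB hy) (dM hy) (dC hy) (brff hbr) mul0r mulr0 addr0 subr0 -(brN hbr y).
have irc := congr1 iota rc; rewrite !(rmorphD, rmorphM, rmorphXn, rmorph0) /= in irc.
rewrite E !big_ord_recl !big_ord0 /= /bump /= Ex.
rewrite !(rmorphD, rmorphM, rmorphXn, rmorph_nat) /= !rmorph0.
transitivity ((iota a03 + iota a12 * iota c + iota a21 * iota c ^+ 2 + iota a30 * iota c ^+ 3) * y ^+ 3 +
  (iota a00 + (iota a01 + iota a10 * iota c) * y + (iota a02 + iota a11 * iota c + iota a20 * iota c ^+ 2) * y ^+ 2
  + (iota a10 + (iota a11 + 2%:R * iota a20 * iota c) * y + (iota a12 + 2%:R * iota a21 * iota c + 3%:R * iota a30 * iota c ^+ 2) * y ^+ 2) * x1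
  + (iota a20 + (iota a21 + 3%:R * iota a30 * iota c) * y) * x1 ^+ 2 + iota a30 * x1 ^+ 3)); first by ring.
by rewrite irc; ring.
Qed.

End Normal.

(** * Rational functions and their derivations *)

Section Derivations.
Variables (C : numClosedFieldType) (K : fieldType) (iota : {rmorphism C -> K}).
Local Notation ev := (ev iota).
Local Notation ev1 := (ev1 iota).
Implicit Types (p q : {poly {poly C}}).

Lemma coef_dX p i : (dX p)`_i = (p`_i)^`().
Proof.
by rewrite coef_poly; case: ltnP => // h; rewrite [p`_i]nth_default // deriv0.
Qed.

Lemma dX_D p q : dX (p + q) = dX p + dX q.
Proof. by apply/polyP => i; rewrite coefD !coef_dX coefD derivD. Qed.

Lemma dX_M p q : dX (p * q) = dX p * q + p * dX q.
Proof.
apply/polyP => i; rewrite coefD coef_dX !coefM raddf_sum -big_split; apply: eq_bigr => j _.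
by rewrite /= derivM !coef_dX.
Qed.

Lemma dX_C (c : C) : dX c%:P%:P = 0.
Proof.
by apply/polyP => i; rewrite coef_dX coefC coef0; case: eqP => _; rewrite ?derivC ?deriv0.
Qed.

Lemma dX_polyC (c : {poly C}) : dX c%:P = c^`()%:P.
Proof. by apply/polyP => i; rewrite coef_dX !coefC; case: eqP => _; rewrite ?deriv0. Qed.

Lemma dX_X : dX ('X : {poly {poly C}}) = 0.
Proof.
by apply/polyP => i; rewrite coef_dX coefX coef0; case: eqP => _; rewrite ?deriv0 // -[1]/(1%:P) derivC.
Qed.

Variables x0 y0 : K.
Hypothesis ind : indep iota x0 y0.
Hypothesis gen : gens iota x0 y0.

Lemma frac_pairs : {pq : K -> {poly {poly C}} * {poly {poly C}} |
  forall f, ev x0 y0 (pq f).2 != 0 /\ f = ev x0 y0 (pq f).1 / ev x0 y0 (pq f).2}.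
Proof.
apply: cid; have /choice [F HF] : forall f, exists pq : {poly {poly C}} * {poly {poly C}},
    ev x0 y0 pq.2 != 0 /\ f = ev x0 y0 pq.1 / ev x0 y0 pq.2.
  by move=> f; have [p [q H]] := gen f; exists (p, q).
by exists F.
Qed.

Lemma ev_inj p q : ev x0 y0 p = ev x0 y0 q -> p = q.
Proof. by move=> E; apply/eqP; rewrite -subr_eq0; apply/eqP/ind; rewrite evB E subrr. Qed.

Section Extend.
Variable D : {poly {poly C}} -> {poly {poly C}}.
Hypothesis DD : forall p q, D (p + q) = D p + D q.
Hypothesis DM : forall p q, D (p * q) = D p * q + p * D q.
Hypothesis DC : forall c : C, D c%:P%:P = 0.

(** The quotient rule on a chosen fraction; [extend_frac] shows that the choice does not matter. *)
Definition extend (f : K) : K := let pq := sval frac_pairs f in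
  (ev x0 y0 (D pq.1) * ev x0 y0 pq.2 - ev x0 y0 pq.1 * ev x0 y0 (D pq.2)) / ev x0 y0 pq.2 ^+ 2.

Lemma extend_frac p q : ev x0 y0 q != 0 -> extend (ev x0 y0 p / ev x0 y0 q) =
  (ev x0 y0 (D p) * ev x0 y0 q - ev x0 y0 p * ev x0 y0 (D q)) / ev x0 y0 q ^+ 2.
Proof.
move=> q0; rewrite /extend; case: (svalP frac_pairs (ev x0 y0 p / ev x0 y0 q)).
case: (sval _ _) => p1 q1 /= q10 E.
have E1 : p1 * q = p * q1.
  by apply: ev_inj; rewrite !evM; apply: (mulIf (invr_neq0 q10)); rewrite mulrAC -E mulfK // divfK.
have := congr1 (fun r => ev x0 y0 (D r)) E1; rewrite !DM !evD !evM.
have Ep : ev x0 y0 p1 = ev x0 y0 p / ev x0 y0 q * ev x0 y0 q1 by rewrite E divfK.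
rewrite Ep; move: q0 q10; move: (ev x0 y0 p) (ev x0 y0 q) (ev x0 y0 q1) => a b b1 b0 b10.
move: (ev x0 y0 (D p)) (ev x0 y0 (D q)) (ev x0 y0 (D p1)) (ev x0 y0 (D q1)) => da db da1 db1 H.
have -> : da1 = (da * b1 + a * db1 - a / b * b1 * db) / b by rewrite -H; field.
by field; rewrite b0 b10.
Qed.

Lemma extend_ev p : extend (ev x0 y0 p) = ev x0 y0 (D p).
Proof.
have D1 : D 1 = 0 by rewrite -[1]/(1%:P%:P); exact: DC.
have := @extend_frac p 1; rewrite D1 ev_1 ev0 !divr1 mulr0 subr0 mulr1 expr1n divr1.
by apply; rewrite oner_neq0.
Qed.

Lemma extend_deriv : deriv_of iota extend.
Proof.
split.
- move=> f g; have [p [q [q0 ->]]] := gen f; have [p' [q' [q0' ->]]] := gen g.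
  have qq : ev x0 y0 (q * q') != 0 by rewrite evM mulf_neq0.
  have -> : ev x0 y0 p / ev x0 y0 q + ev x0 y0 p' / ev x0 y0 q' =
     ev x0 y0 (p * q' + p' * q) / ev x0 y0 (q * q').
    by rewrite evD !evM; move: q0 q0'; move: (ev _ _ q) (ev _ _ q') => b b' b0 b0'; field; rewrite b0 b0'.
  rewrite !extend_frac // DD !DM !(evD, evM).
  move: q0 q0'; move: (ev _ _ q) (ev _ _ q') => b b' b0 b0'.
  by field; rewrite b0 b0'.
- move=> f g; have [p [q [q0 ->]]] := gen f; have [p' [q' [q0' ->]]] := gen g.
  have qq : ev x0 y0 (q * q') != 0 by rewrite evM mulf_neq0.
  have -> : ev x0 y0 p / ev x0 y0 q * (ev x0 y0 p' / ev x0 y0 q') =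
     ev x0 y0 (p * p') / ev x0 y0 (q * q').
    by rewrite !evM; move: q0 q0'; move: (ev _ _ q) (ev _ _ q') => b b' b0 b0'; field; rewrite b0 b0'.
  rewrite !extend_frac // !DM !(evD, evM).
  move: q0 q0'; move: (ev _ _ q) (ev _ _ q') => b b' b0 b0'.
  by field; rewrite b0 b0'.
- by move=> c; rewrite -(evCC iota x0 y0) extend_ev DC ev0.
Qed.

End Extend.

Definition ddx := extend (@dX C).
Definition ddy := extend (fun p => p^`()).

Lemma ddx_deriv : deriv_of iota ddx.
Proof. by apply: extend_deriv; [exact: dX_D|exact: dX_M|exact: dX_C]. Qed.

Lemma ddy_deriv : deriv_of iota ddy.
Proof.
apply: extend_deriv; [exact: derivD|exact: derivM|move=> c; exact: derivC].
Qed.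

Lemma ddx_ev p : ddx (ev x0 y0 p) = ev x0 y0 (dX p).
Proof. by apply: extend_ev; [exact: dX_M|exact: dX_C]. Qed.

Lemma ddy_ev p : ddy (ev x0 y0 p) = ev x0 y0 p^`().
Proof. by apply: extend_ev; [exact: derivM|move=> c; exact: derivC]. Qed.

Definition jac f g := ddx f * ddy g - ddy f * ddx g.

Lemma jac_bracket : bracket iota jac.
Proof.
have hx := ddx_deriv; have hy := ddy_deriv; split.
- move=> f; split=> [g h|g h|c]; rewrite /jac.
  + by rewrite (dD hx) (dD hy); ring.
  + by rewrite (dM hx) (dM hy); ring.
  + by rewrite (dC hx) (dC hy); ring.
- by move=> f g; rewrite /jac; ring.
Qed.

Lemma jac_cd : cd iota jac x0 y0.
Proof.
split=> //; rewrite /jac.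
have := ddx_ev ('X%:P); have := ddx_ev 'X; have := ddy_ev ('X%:P); have := ddy_ev 'X.
rewrite !evC !ev1X !evY => -> -> -> ->.
rewrite dX_polyC derivX dX_X.
by rewrite derivX ev_1 ev0 mulr0 subr0 mulr1 oner_neq0.
Qed.

End Derivations.

(** * Forms evaluated at points with coordinates in the function field *)

Section Evaluation.
Variables (C : numClosedFieldType) (K : fieldType) (iota : {rmorphism C -> K}).
Variable n : nat.
Implicit Types (p q : {mpoly C[n]}) (s t : 'I_n -> K).

Lemma mpoly_ring_ind (A : {mpoly C[n]} -> Prop) :
  (forall c, A c%:MP) -> (forall i, A 'X_i) -> (forall p q, A p -> A q -> A (p + q)) ->
  (forall p q, A p -> A q -> A (p * q)) -> forall p, A p.
Proof.
move=> AC AX AD AM p; rewrite (mpolyE p).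
apply: big_ind => //; first by rewrite -mpolyC0; exact: AC.
move=> m _; rewrite -mul_mpolyC; apply: (AM) => //.
rewrite mpolyXE_id; apply: big_ind => //; first exact: (AC 1).
by move=> i _; elim: (m i) => [|k IH]; rewrite ?expr0 ?exprS; [exact: (AC 1)|exact: AM].
Qed.

Definition hev s p : K := mmap iota s p.

Lemma hevC s c : hev s c%:MP = iota c. Proof. exact: mmapC. Qed.
Lemma hevX s i : hev s 'X_i = s i. Proof. by rewrite /hev mmapX mmap1U. Qed.
Lemma hevD s p q : hev s (p + q) = hev s p + hev s q. Proof. exact: mmapD. Qed.
Lemma hevB s p q : hev s (p - q) = hev s p - hev s q. Proof. exact: mmapB. Qed.
Lemma hevM s p q : hev s (p * q) = hev s p * hev s q. Proof. exact: (rmorphM (mmap iota s)). Qed.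
Lemma hev0 s : hev s 0 = 0. Proof. exact: mmap0. Qed.

Lemma hev_scale d p (t : K) s : p \is d.-homog -> hev (fun i => t * s i) p = t ^+ d * hev s p.
Proof.
move/dhomogP => hp; rewrite /hev /mmap mulr_sumr big_seq [RHS]big_seq.
apply: eq_bigr => m /hp <-; rewrite mulrCA; congr (_ * _).
rewrite /mmap1 (eq_bigr (fun i => t ^+ m i * s i ^+ m i)) => [|i _]; last by rewrite exprMn.
by rewrite big_split /= mdegE expr_sum.
Qed.

Lemma hev_deriv d s p : deriv_of iota d -> d (hev s p) = \sum_i hev s p^`M(i) * d (s i).
Proof.
move=> hd; elim/mpoly_ring_ind: p => [c|i|p q IHp IHq|p q IHp IHq].
- by rewrite hevC (dC hd) big1 // => i _; rewrite mderivC hev0 mul0r.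
- rewrite hevX (bigD1 i) //= big1 => [|j ji].
    rewrite mderivX mnm1E eqxx scale1r (_ : (_ - _)%MM = 0%MM) ?mpolyX0; last first.
      by apply/mnmP => j; rewrite mnmBE subnn mnm0E.
    by rewrite -mpolyC1 hevC rmorph1 mul1r addr0.
  by rewrite mderivX mnm1E eq_sym (negPf ji) scale0r hev0 mul0r.
- by rewrite hevD (dD hd) IHp IHq -big_split; apply: eq_bigr => i _; rewrite mderivD hevD mulrDl.
- rewrite hevM (dM hd) IHp IHq mulr_suml mulr_sumr -big_split; apply: eq_bigr => i _.
  by rewrite mderivM hevD !hevM /=; ring.
Qed.

End Evaluation.

Lemma hev_comp (C : numClosedFieldType) (K : fieldType) (iota : {rmorphism C -> K}) n m
   (s : 'I_m -> K) (psi : n.-tuple {mpoly C[m]}) (p : {mpoly C[n]}) :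
  hev iota s (p \mPo psi) = hev iota (fun i => hev iota s (tnth psi i)) p.
Proof.
elim/mpoly_ring_ind: p => [c|i|p q IHp IHq|p q IHp IHq].
- by rewrite comp_mpolyC !hevC.
- by rewrite comp_mpolyXU hevX -tnth_nth.
- by rewrite comp_mpolyD !hevD IHp IHq.
- by rewrite rmorphM !hevM -IHp -IHq.
Qed.

(** * Values of rational functions at a point of the plane *)

Section Values.
Variables (C : numClosedFieldType) (K : fieldType) (iota : {rmorphism C -> K}).
Local Notation ev := (ev iota).
Variables (x y : K) (c1 c2 : C).
Hypothesis ind : indep iota x y.

(** Regularity at (c1, c2) and the value there in one relation, which needs no chosen fraction; it
    carries identities of K to points of the plane. *)
Definition value (f : K) (z : C) := exists p q,
  [/\ eval2 c1 c2 q != 0, f = ev x y p / ev x y q & z = eval2 c1 c2 p / eval2 c1 c2 q].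

Lemma eval2_ev q : eval2 c1 c2 q != 0 -> ev x y q != 0.
Proof. by apply: contra_neq => /ind ->; rewrite eval20. Qed.

Lemma value_ev p : value (ev x y p) (eval2 c1 c2 p).
Proof. by exists p, 1; rewrite ev_1 -[1]/(1%:P) eval2C hornerC oner_neq0 !divr1. Qed.

Lemma value_C c : value (iota c) c.
Proof. by have := value_ev c%:P%:P; rewrite evCC eval2C hornerC. Qed.

Lemma value_D f g z w : value f z -> value g w -> value (f + g) (z + w).
Proof.
move=> [p [q [q0 -> ->]]] [p' [q' [q0' -> ->]]]; exists (p * q' + p' * q), (q * q').
have e := eval2_ev q0; have e' := eval2_ev q0'.
rewrite eval2D !eval2M evD !evM mulf_neq0 //; split=> //.
  by move: e e'; move: (ev _ _ q) (ev _ _ q') => a b a0 b0; field; rewrite a0 b0.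
by field; rewrite q0 q0'.
Qed.

Lemma value_M f g z w : value f z -> value g w -> value (f * g) (z * w).
Proof.
move=> [p [q [q0 -> ->]]] [p' [q' [q0' -> ->]]]; exists (p * p'), (q * q').
have e := eval2_ev q0; have e' := eval2_ev q0'.
rewrite !eval2M !evM mulf_neq0 //; split=> //.
  by move: e e'; move: (ev _ _ q) (ev _ _ q') => a b a0 b0; field; rewrite a0 b0.
by field; rewrite q0 q0'.
Qed.

Lemma value_N f z : value f z -> value (- f) (- z).
Proof.
by move=> h; rewrite -mulN1r -[- z]mulN1r -(rmorphN1 iota); apply: value_M => //; exact: value_C.
Qed.

Lemma value_B f g z w : value f z -> value g w -> value (f - g) (z - w).
Proof. by move=> h1 h2; apply: value_D => //; exact: value_N. Qed.

Lemma value_V f z : value f z -> z != 0 -> f != 0 /\ value f^-1 z^-1.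
Proof.
move=> [p [q [q0 -> ->]]]; rewrite mulf_eq0 invr_eq0 negb_or => /andP [p0 _].
have e := eval2_ev q0; have e' := eval2_ev p0.
rewrite mulf_neq0 ?invr_eq0 //; split=> //; exists q, p; by rewrite !invf_div.
Qed.

Lemma value_div f g z w : value f z -> value g w -> w != 0 -> value (f / g) (z / w).
Proof. by move=> h1 h2 w0; apply: value_M => //; exact: (value_V h2 w0).2. Qed.

Lemma value0 z : value 0 z -> z = 0.
Proof.
move=> [p [q [q0 E ->]]]; have e := eval2_ev q0.
have /ind -> : ev x y p = 0.
  by move/esym/eqP: E; rewrite mulf_eq0 invr_eq0 (negPf e) orbF => /eqP.
by rewrite eval20 mul0r.
Qed.

Lemma value_uniq f z w : value f z -> value f w -> z = w.
Proof.
move=> h1 h2; apply/eqP; rewrite -subr_eq0; apply/eqP/value0.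
by rewrite -(subrr f); exact: value_B.
Qed.

Lemma value_sum I (r : seq I) (P : pred I) f z :
  (forall i, P i -> value (f i) (z i)) -> value (\sum_(i <- r | P i) f i) (\sum_(i <- r | P i) z i).
Proof.
move=> H; apply: (big_rec2 (fun f z => value f z)) => [|i a b Pi]; last exact: value_D (H i Pi).
by rewrite -(rmorph0 iota); exact: value_C.
Qed.

Lemma value_hev n (s : 'I_n -> K) v (p : {mpoly C[n]}) :
  (forall i, value (s i) (v i)) -> value (hev iota s p) p.@[v].
Proof.
move=> H; elim/mpoly_ring_ind: p => [c|i|p q IHp IHq|p q IHp IHq].
- by rewrite hevC mevalC; exact: value_C.
- by rewrite hevX mevalXU.
- by rewrite hevD mevalD; exact: value_D.
- by rewrite hevM mevalM; exact: value_M.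
Qed.

End Values.

(** * The function field of a rational surface *)

Lemma dhomog_comp (F : fieldType) n m d e (psi : n.-tuple {mpoly F[m]}) (p : {mpoly F[n]}) :
  (forall j, tnth psi j \is e.-homog) -> p \is d.-homog -> p \mPo psi \is (d * e).-homog.
Proof.
move=> hpsi /dhomogP hp; rewrite comp_mpolyE big_seq; apply: rpred_sum => k /hp <-.
apply: rpredZ; rewrite /= mdegE big_distrl /=.
elim/big_rec2: _ => [|i a b _ IH]; first exact: dhomog1.
by rewrite mulnC; apply: dhomogM => //; exact: dhomogMn.
Qed.

Lemma meval_scale (F : numClosedFieldType) n d (p : {mpoly F[n]}) (t : F) (s : 'I_n -> F) :
  p \is d.-homog -> p.@[fun i => t * s i] = t ^+ d * p.@[s].
Proof. exact: (@hev_scale F F idfun n d p t s). Qed.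

Lemma ishomogP (F : fieldType) n (p : {mpoly F[n]}) : p \is ishomog mdeg -> exists d, p \is d.-homog.
Proof. by move=> h; eexists; exact: h. Qed.

Lemma dhomog_ishomog (F : fieldType) n d (p : {mpoly F[n]}) : p \is d.-homog -> p \is ishomog mdeg.
Proof. exact: dhomog_msize. Qed.

Lemma mpoly_euler (F : fieldType) n d (p : {mpoly F[n]}) : p \is d.-homog ->
  \sum_i p^`M(i) * 'X_i = d%:R *: p.
Proof.
move/dhomogP => hp.
have E i : p^`M(i) * 'X_i = \sum_(m <- msupp p) (p@_m * (m i)%:R) *: 'X_[m].
  rewrite {1}(mpolyE p) raddf_sum mulr_suml; apply: eq_bigr => m _ /=.
  rewrite mderivZ mderivX -scalerA -!scalerAl -mpolyXD; congr (_ *: _).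
  case mi : (m i) => [|k]; first by rewrite !scale0r.
  rewrite submK //; apply/mnm_lepP => j; rewrite mnm1E; case: eqP => // <-; by rewrite mi.
under eq_bigr do rewrite E.
rewrite exchange_big [in RHS](mpolyE p) scaler_sumr /= big_seq [RHS]big_seq.
apply: eq_bigr => m /hp <-; rewrite -scaler_suml -mulr_sumr scalerA mulrC /= mdegE.
by rewrite natr_sum.
Qed.

Lemma euler_diff (F : fieldType) n d (p : {mpoly F[n.+1]}) v : p \is d.-homog ->
  differential p v v = d%:R * p.@[v 0].
Proof.
move/mpoly_euler/(congr1 (meval (v 0))); rewrite mevalZ raddf_sum /= => <-.
by apply: eq_bigr => i _; rewrite mevalM mevalXU.
Qed.

Section FunctionField.
Variables (C : numClosedFieldType) (K : fieldType) (iota : {rmorphism C -> K}).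
Variables x0 y0 : K.
Hypothesis ind : indep iota x0 y0.
Hypothesis gen : gens iota x0 y0.
Local Notation ev := (ev iota).
Local Notation hev := (hev iota).
Local Notation ddx := (ddx gen).
Local Notation ddy := (ddy gen).
Local Notation jac := (jac gen).
Let hbr : bracket iota jac := jac_bracket ind gen.
Let hx : deriv_of iota ddx := ddx_deriv ind gen.
Let hy : deriv_of iota ddy := ddy_deriv ind gen.

Definition pt3 (R : nzRingType) (a b : R) (i : 'I_3) : R := nth 0 [:: 1; a; b] i.

Lemma dehomog (p : {mpoly C[3]}) : exists P : {poly {poly C}},
  ev x0 y0 P = hev (pt3 x0 y0) p /\ forall a b, eval2 a b P = p.@[pt3 a b].
Proof.
elim/mpoly_ring_ind: p => [c|i|p q [P [h1 h2]] [Q [h3 h4]]|p q [P [h1 h2]] [Q [h3 h4]]].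
- by exists c%:P%:P; rewrite evCC hevC; split=> // a b; rewrite eval2C hornerC mevalC.
- exists (nth 0 [:: 1; 'X%:P; 'X] i); rewrite hevX /pt3; split=> [|a b].
    by case: i => [[|[|[|//]]] hi] /=; rewrite ?ev_1 ?evC ?ev1X ?evY.
  rewrite mevalXU; case: i => [[|[|[|//]]] hi] /=.
  + by rewrite -[1]/(1%:P) eval2C hornerC.
  + by rewrite eval2C hornerX.
  + by rewrite /eval2 hornerX hornerC.
- by exists (P + Q); rewrite evD h1 h3 hevD; split=> // a b; rewrite eval2D h2 h4 mevalD.
- by exists (P * Q); rewrite evM h1 h3 hevM; split=> // a b; rewrite eval2M h2 h4 mevalM.
Qed.

Lemma poly2_ext (p : {poly {poly C}}) : (forall a b, eval2 a b p = 0) -> p = 0.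
Proof. by move=> H; apply/eqP; apply: contraT => /poly2_nz [a [b]]; rewrite H eqxx. Qed.

Lemma hev_pt0 (p : {mpoly C[3]}) : (forall a b, p.@[pt3 a b] = 0) -> hev (pt3 x0 y0) p = 0.
Proof.
by move=> H; have [P [<- h]] := dehomog p; rewrite (poly2_ext (p := P)) ?ev0 // => a b; rewrite h.
Qed.

Lemma line_poly (p : {mpoly C[3]}) (a b : C) : exists r : {poly C},
  forall t, r.[t] = p.@[fun i => nth 0 [:: t; a; b] i].
Proof.
elim/mpoly_ring_ind: p => [c|i|p q [P h1] [Q h2]|p q [P h1] [Q h2]].
- by exists c%:P => t; rewrite hornerC mevalC.
- exists (nth 0 [:: 'X; a%:P; b%:P] i) => t; rewrite mevalXU.
  by case: i => [[|[|[|//]]] hi] /=; rewrite ?hornerX ?hornerC.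
- by exists (P + Q) => t; rewrite hornerD h1 h2 mevalD.
- by exists (P * Q) => t; rewrite hornerM h1 h2 mevalM.
Qed.

(** Independence of x0 and y0 gives vanishing on the affine plane; a point at infinity is reached
    along a line on which only the first coordinate varies. *)
Lemma hev_pt0_all d (p : {mpoly C[3]}) : p \is d.-homog -> hev (pt3 x0 y0) p = 0 ->
  forall u : 'I_3 -> C, p.@[u] = 0.
Proof.
move=> hp; have [P [<- h]] := dehomog p => /ind P0 u.
have z a b : p.@[pt3 a b] = 0 by rewrite -h P0 eval20.
pose u0 := u (inord 0); pose u1 := u (inord 1); pose u2 := u (inord 2).
have Eu : u =1 (fun i => nth 0 [:: u0; u1; u2] i).
  move=> i; have -> : i = inord i by rewrite inord_val.
  by case: i => [[|[|[|//]]] hi]; rewrite /= inordK.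
rewrite (meval_eq _ Eu); have [r hr] := line_poly p u1 u2; rewrite -hr.
suff -> : r = 0 by rewrite horner0.
apply/eqP; apply: contraT => r0.
have /closed_nonrootP [t] : r * 'X != 0 by rewrite mulf_neq0 // polyX_eq0.
rewrite rootE hornerM hornerX mulf_eq0 negb_or hr => /andP [+ t0]; case/negP; apply/eqP.
rewrite (meval_eq _ (v2 := fun i => t * pt3 (u1 / t) (u2 / t) i)); last first.
  by case=> [[|[|[|//]]] hi]; rewrite /pt3 /= ?mulr1 // mulrC divfK.
by rewrite (meval_scale _ _ hp) z mulr0.
Qed.

Variables (n : nat) (S : projset C n) (psi0 : homtuple C 2 n).
Hypothesis bir : birational (projspace C 2) S psi0.
Hypothesis irr : irreducible S.

(** Homogeneous coordinates of the generic point of [S]. *)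
Definition psi i : K := hev (pt3 x0 y0) (tnth psi0 i).

Lemma psi0_homog : exists e, forall j, tnth psi0 j \is e.-homog.
Proof. by case: bir => [[]]. Qed.

Lemma hev_psi p : hev psi p = hev (pt3 x0 y0) (p \mPo psi0).
Proof. by rewrite hev_comp. Qed.

Lemma psi_nz : exists j, psi j != 0.
Proof.
have [[_ [j nj] _] _] := bir; have [e he] := psi0_homog.
exists j; apply/eqP => z; apply: nj => v _; exact: hev_pt0_all (he j) z _.
Qed.

Lemma projspace_on m (v : 'rV[C]_m.+1) : v != 0 -> on (projspace C m) v.
Proof. by []. Qed.

Lemma on_image a b : let v := \row_i (tnth psi0 i).@[pt3 a b] in v != 0 -> on S v.
Proof.
move=> v v0; split=> // p hp; have [[_ _ /(_ p hp) H] _] := bir.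
have := H (\row_i pt3 a b i); rewrite comp_mpoly_meval => <-.
  apply: meval_eq => i; rewrite mxE; apply: meval_eq => j; by rewrite mxE.
apply: projspace_on; apply/eqP => /matrixP /(_ 0 0) /eqP.
by rewrite !mxE /pt3 /= oner_eq0.
Qed.

(** From the generic point to all of [S]: where the composite with the inverse map is defined, a
    point of [S] is the image of a point of the plane, and irreducibility takes care of the other
    points. *)
Lemma van_psi d p : p \is d.-homog -> vanishes S p <-> hev psi p = 0.
Proof.
move=> hp; have [e he] := psi0_homog; split=> [vp|z].
  have [j pj] := psi_nz.
  have : hev (pt3 x0 y0) ((p \mPo psi0) * tnth psi0 j) = 0.
    apply: hev_pt0 => a b; rewrite mevalM comp_mpoly_meval.
    pose v := \row_i (tnth psi0 i).@[pt3 a b].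
    have Ev : (fun i => (tnth psi0 i).@[pt3 a b]) =1 v 0 by move=> i; rewrite mxE.
    rewrite (meval_eq _ Ev); have [v0|v0] := eqVneq v 0.
      by rewrite (Ev j) v0 mxE mulr0.
    by rewrite (vp v (on_image v0)) mul0r.
  rewrite hevM -hev_psi => /eqP; rewrite mulf_eq0 => /orP [/eqP //|].
  by rewrite -/(psi j) (negPf pj).
have [_ [chi [[[c hc] _ _] _ [[j nj] idS]]]] := bir.
have hq : tnth psi0 j \mPo chi \is (e * c).-homog by exact: dhomog_comp.
have nj' : ~ vanishes S (tnth psi0 j \mPo chi).
  by move: nj; rewrite /ratmap_comp tnth_mktuple.
have [] := irr.2 p _ (dhomog_ishomog hp) (dhomog_ishomog hq) => // v hv.
rewrite mevalM; have [->|u0] := eqVneq (tnth psi0 j \mPo chi).@[v 0] 0; first by rewrite mulr0.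
suff -> : p.@[v 0] = 0 by rewrite mul0r.
set q := tnth psi0 j \mPo chi in u0.
have : p.@[fun i => q.@[v 0] * v 0 i] = 0.
  have E : (fun i => q.@[v 0] * v 0 i) =1 (fun i => v 0 j * (tnth psi0 i \mPo chi).@[v 0]).
    move=> i; have := idS j i v hv; rewrite /ratmap_comp !tnth_mktuple mevalB !mevalM !mevalXU.
    by move/eqP; rewrite subr_eq0 => /eqP ->; rewrite mulrC.
  rewrite (meval_eq _ E) (meval_scale _ _ hp).
  have -> : p.@[fun i => (tnth psi0 i \mPo chi).@[v 0]] = 0; last by rewrite mulr0.
  have := @hev_pt0_all _ (p \mPo psi0) (dhomog_comp he hp).
  rewrite -hev_psi => /(_ z (fun i => (tnth chi i).@[v 0])).
  rewrite comp_mpoly_meval => <-; apply: meval_eq => i; by rewrite comp_mpoly_meval.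
rewrite (meval_scale _ _ hp) => /eqP; rewrite mulf_eq0 expf_eq0 (negPf u0) andbF /=.
by move/eqP.
Qed.

(** The inverse map expresses x0 and y0 through the quotients [psi i / psi k]. *)
Lemma psi_generate (A : K -> Prop) : (forall c, A (iota c)) ->
  (forall f g, A f -> A g -> A (f - g)) -> (forall f g, A f -> A g -> A (f * g)) ->
  (forall f, A f -> A f^-1) -> (forall i j, A (psi i / psi j)) -> forall f, A f.
Proof.
move=> AC AB AM AV Apsi.
have A0 : A 0 by rewrite -(rmorph0 iota); exact: AC.
have AN f : A f -> A (- f) by move=> hf; rewrite -sub0r; exact: AB.
have AD f g : A f -> A g -> A (f + g).
  by move=> hf hg; rewrite -[g]opprK; apply: AB => //; exact: AN.
have Ahev m (s : 'I_m -> K) p : (forall i, A (s i)) -> A (hev s p).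
  move=> As; elim/mpoly_ring_ind: p => [c|i|p q IHp IHq|p q IHp IHq].
  - by rewrite hevC.
  - by rewrite hevX.
  - by rewrite hevD; exact: AD.
  - by rewrite hevM; exact: AM.
have [k pk] := psi_nz; have [e he] := psi0_homog.
have [_ [chi [[[c hc] _ _] [[j nj] idP] _]]] := bir.
pose z i := hev psi (tnth chi i).
have Ez i j' : z i * pt3 x0 y0 j' = z j' * pt3 x0 y0 i.
  have := @hev_pt0 (tnth (ratmap_comp chi psi0) i * 'X_j' - tnth (ratmap_comp chi psi0) j' * 'X_i).
  rewrite hevB !hevM !hevX !tnth_mktuple -!hev_psi => H; apply/eqP; rewrite -subr_eq0; apply/eqP.
  apply: H => a b; have := idP i j' (\row_i pt3 a b i).
  rewrite !tnth_mktuple => <-; first by apply: meval_eq => l; rewrite mxE.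
  apply: projspace_on; apply/eqP => /matrixP /(_ 0 0) /eqP.
  by rewrite !mxE /pt3 /= oner_eq0.
have zj : z j != 0.
  apply/eqP => zj; apply: nj; rewrite /ratmap_comp tnth_mktuple => v _.
  apply: hev_pt0_all; last by rewrite -hev_psi.
  exact: dhomog_comp.
have zz : z 0 != 0.
  by apply/eqP => zz; have := Ez j 0; rewrite zz mul0r /pt3 /= mulr1 => /eqP; rewrite (negPf zj).
have Az i : A (z i / z 0).
  have Es i' : z i' = psi k ^+ c * hev (fun l => psi l / psi k) (tnth chi i').
    rewrite -(hev_scale _ _ _ (hc i')); congr (mmap _ _ _); apply/funext => l.
    by rewrite mulrC divfK.
  have -> : z i / z 0 = hev (fun l => psi l / psi k) (tnth chi i) / hev (fun l => psi l / psi k) (tnth chi 0).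
    move: zz; rewrite !Es mulf_eq0 negb_or => /andP [h1 h2]; field; by rewrite h1 h2.
  by apply: (AM); [exact: Ahev|apply: AV; exact: Ahev].
have Apt i : A (pt3 x0 y0 i).
  have := Ez i 0; rewrite {2}/pt3 /= mulr1 => E; have := Az i; rewrite E mulrC mulKf //.
have Aev p : A (ev x0 y0 p).
  have Ax : A x0 by have := Apt (inord 1); rewrite /pt3 inordK.
  have Ay : A y0 by have := Apt (inord 2); rewrite /pt3 inordK.
  have AX w m : A w -> A (w ^+ m).
    by move=> Aw; elim: m => [|m IH]; rewrite ?expr0 ?exprS; [rewrite -(rmorph1 iota)|exact: AM].
  rewrite ev_sum; apply: big_ind => // i _; apply: (AM); last exact: AX.
  by rewrite ev1_sum; apply: big_ind => // l _; apply: (AM) => //; exact: AX.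
by move=> f; have [p [q [q0 ->]]] := gen f; apply: (AM) => //; exact: AV.
Qed.

Definition fval (f : ratfun C n) : K := hev psi f.1 / hev psi f.2.
(** The coefficient of the form with respect to dx0 /\ dy0. *)
Definition form_val (e : twoform C n) : K :=
  \sum_(t <- e) fval t.1.1 * jac (fval t.1.2) (fval t.2).
Definition wf_form (e : twoform C n) := forall t, t \in e ->
  [/\ hev psi t.1.1.2 != 0, hev psi t.1.2.2 != 0 & hev psi t.2.2 != 0].

Lemma wf_ratfun f : ratfun_on S f -> hev psi f.2 != 0.
Proof. by move=> [[d [_ hd]] nv]; apply/eqP => z; apply: nv; apply/(van_psi hd). Qed.

Lemma wf_twoform e : twoform_on S e -> wf_form e.
Proof. by move=> he [[h a] b] /he [h1 h2 h3]; split; exact: wf_ratfun. Qed.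

Lemma psi_polys : exists P : 'I_n.+1 -> {poly {poly C}}, (forall i, psi i = ev x0 y0 (P i)) /\
  forall i a b, eval2 a b (P i) = (tnth psi0 i).@[pt3 a b].
Proof.
have /choice [P hP] := fun i => dehomog (tnth psi0 i).
by exists P; split=> [i|i]; have [h1 h2] := hP i.
Qed.

Section GeneralPoint.
Variable P : 'I_n.+1 -> {poly {poly C}}.
Hypothesis EP : forall i, psi i = ev x0 y0 (P i).
Implicit Types (a b : C).

Definition img a b : 'rV[C]_n.+1 := \row_i eval2 a b (P i).
Definition imgx a b : 'rV[C]_n.+1 := \row_i eval2 a b (dX (P i)).
Definition imgy a b : 'rV[C]_n.+1 := \row_i eval2 a b (P i)^`().

Lemma value_img a b q : value iota x0 y0 a b (hev psi q) q.@[img a b 0].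
Proof. by apply: value_hev => // i; rewrite EP mxE; exact: value_ev. Qed.

Lemma value_imgx a b q :
  value iota x0 y0 a b (ddx (hev psi q)) (differential q (img a b) (imgx a b)).
Proof.
rewrite (hev_deriv _ _ hx); apply: value_sum => // i _; apply: value_M => //; first exact: value_img.
by rewrite EP (ddx_ev ind) mxE; exact: value_ev.
Qed.

Lemma value_imgy a b q :
  value iota x0 y0 a b (ddy (hev psi q)) (differential q (img a b) (imgy a b)).
Proof.
rewrite (hev_deriv _ _ hy); apply: value_sum => // i _; apply: value_M => //; first exact: value_img.
by rewrite EP (ddy_ev ind) mxE; exact: value_ev.
Qed.

Lemma value_ratfun a b f : f.2.@[img a b 0] != 0 ->
  [/\ value iota x0 y0 a b (fval f) (rval f (img a b)),
      value iota x0 y0 a b (ddx (fval f)) (rdiff f (img a b) (imgx a b)) &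
      value iota x0 y0 a b (ddy (fval f)) (rdiff f (img a b) (imgy a b))].
Proof.
move=> z0; have f0 : hev psi f.2 != 0.
  by apply: contra_neq z0 => z; apply: (value0 ind); rewrite -z; exact: value_img.
have v1 := value_img a b f.1; have v2 := value_img a b f.2.
split; first exact: value_div.
  rewrite (ddiv hx) //; apply: value_div; rewrite ?expf_neq0 //; last by rewrite !expr2; exact: value_M.
  rewrite [ddx _ * hev psi f.2]mulrC; apply: value_B => //; apply: value_M => //; exact: value_imgx.
rewrite (ddiv hy) //; apply: value_div; rewrite ?expf_neq0 //; last by rewrite !expr2; exact: value_M.
rewrite [ddy _ * hev psi f.2]mulrC; apply: value_B => //; apply: value_M => //; exact: value_imgy.
Qed.

Definition denominators (e : twoform C n) := \prod_(t <- e) (t.1.1.2 * (t.1.2.2 * t.2.2)).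

Lemma value_form a b e : (denominators e).@[img a b 0] != 0 ->
  value iota x0 y0 a b (form_val e) (twoform_val e (img a b) (imgx a b) (imgy a b)).
Proof.
rewrite /denominators rmorph_prod; elim: e => [|[[h f] g] e IH].
  by rewrite /form_val /twoform_val !big_nil -(rmorph0 iota) => _; exact: value_C.
rewrite big_cons /= !mevalM !mulf_eq0 !negb_or => /andP [/and3P [zh zf zg] ze].
rewrite /form_val /twoform_val !big_cons /=; apply: value_D => //; last exact: IH.
have [h1 _ _] := value_ratfun zh; have [_ h2 h3] := value_ratfun zf.
have [_ h4 h5] := value_ratfun zg.
by apply: value_M => //; apply: value_B => //; apply: value_M.
Qed.

Lemma tangent_imgx a b : tangent S (img a b) (imgx a b).
Proof.
move=> q /ishomogP [d hq] vq; apply: (@value0 _ _ iota x0 y0 a b) => //.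
by rewrite -(d0 hx); have /(van_psi hq) <- := vq; exact: value_imgx.
Qed.

Lemma tangent_imgy a b : tangent S (img a b) (imgy a b).
Proof.
move=> q /ishomogP [d hq] vq; apply: (@value0 _ _ iota x0 y0 a b) => //.
by rewrite -(d0 hy); have /(van_psi hq) <- := vq; exact: value_imgy.
Qed.

End GeneralPoint.

Lemma denominators_nz e : wf_form e -> hev psi (denominators e) != 0.
Proof.
move=> we; rewrite /denominators /hev rmorph_prod prodf_seq_neq0; apply/allP => t /we [h1 h2 h3] /=.
by rewrite -[mmap _ _ _]/(hev _ _) !hevM !mulf_neq0.
Qed.

(** The forms are compared at the images of general points (a, b), on the images of the two
    coordinate directions, which are tangent to [S]. The numerator of the difference vanishes at all
    these points, hence is zero. *)
Lemma twoform_eq_val e1 e2 : wf_form e1 -> wf_form e2 -> twoform_eq S e1 e2 ->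
  form_val e1 = form_val e2.
Proof.
move=> wf1 wf2 [p [hp np eqp]].
have [P [EP HP]] := psi_polys.
have [j pj] := psi_nz; have [dp hp'] := ishomogP hp.
have pn : hev psi p != 0 by apply/eqP => z; apply: np; apply/(van_psi hp').
apply/eqP; rewrite -subr_eq0.
have [A [B [B0 E]]] := gen (form_val e1 - form_val e2); rewrite E.
suff -> : A = 0 by rewrite ev0 mul0r.
pose q := p * (denominators e1 * (denominators e2 * 'X_j)).
have [T [T1 T2]] := dehomog (q \mPo psi0).
have T0 : T != 0.
  apply/eqP => T0; have := T1; rewrite T0 ev0 -hev_psi !hevM hevX => /esym/eqP.
  rewrite !mulf_eq0 (negPf pn) (negPf (denominators_nz wf1)) (negPf (denominators_nz wf2)).
  by rewrite (negPf pj).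
suff : A * T = 0 by move/eqP; rewrite mulf_eq0 (negPf T0) orbF => /eqP.
apply: poly2_ext => a b; rewrite eval2M; have [->|] := eqVneq (eval2 a b T) 0; first by rewrite mulr0.
have Ev : (fun i => (tnth psi0 i).@[pt3 a b]) =1 img P a b 0 by move=> i; rewrite mxE HP.
rewrite T2 comp_mpoly_meval (meval_eq _ Ev) !mevalM !mulf_eq0 !negb_or mevalXU.
move=> /and4P [zp z1 z2 zj].
have onv : on S (img P a b).
  have Er : img P a b = \row_i (tnth psi0 i).@[pt3 a b] by apply/rowP => i; rewrite !mxE HP.
  rewrite Er; apply: on_image; rewrite -Er; apply: contraNneq zj => ->; by rewrite mxE.
have := value_B ind (value_form EP z1) (value_form EP z2).
rewrite (eqp _ onv zp _ _ (tangent_imgx EP a b) (tangent_imgy EP a b)) subrr E => vAB.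
have := value_M ind vAB (value_ev _ _ _ _ _ B); rewrite divfK // mul0r => vA.
by rewrite (value_uniq ind (value_ev _ _ _ _ _ A) vA) mul0r.
Qed.

End FunctionField.

Lemma finite_row_span (F : fieldType) (T : Type) (A : T -> Prop) N (G : T -> 'rV[F]_N) :
  exists m (f : 'I_m -> T), (forall j, A (f j)) /\
    forall t, A t -> (G t <= \matrix_j G (f j))%MS.
Proof.
pose R (r : nat) := exists m (f : 'I_m -> T), (forall j, A (f j)) /\ \rank (\matrix_j G (f j)) = r.
have ex : exists r, `[< R r >].
  have f0 : 'I_0 -> T by case.
  exists 0%N; apply/asboolP; exists 0%N, f0.
  by split=> [[]//|]; apply/eqP; rewrite mxrank_eq0; apply/eqP/matrixP; case.
have bd r : `[< R r >] -> (r <= N)%N by move/asboolP => [m [f [_ <-]]]; exact: rank_leq_col.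
case: (ex_maxnP ex bd) => r /asboolP [m [f [hA hr]]] mx.
exists m, f; split=> // t At.
pose f' (i : 'I_(1 + m)) := match split i with inl _ => t | inr j => f j end.
pose M := \matrix_j G (f j); pose M' := \matrix_i G (f' i).
have sub : (M <= M')%MS.
  apply/row_subP => j; have -> : row j M = row (rshift 1 j) M'.
    by rewrite !rowK /f'; case: split_ordP => k /eqP; rewrite ?eq_rlshift // eq_rshift => /eqP ->.
  exact: row_sub.
have eqr : \rank M' = \rank M.
  apply/eqP; rewrite eqn_leq (mxrankS sub) andbT hr; apply: mx; apply/asboolP.
  by exists (1 + m)%N, f'; split=> // i; rewrite /f'; case: (split i).
have [_] := mxrank_leqif_sup sub; rewrite eqr eqxx => /esym sub'.
apply: submx_trans sub'; have -> : G t = row (lshift m 0) M'.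
  by rewrite rowK /f'; case: split_ordP => k /eqP; rewrite ?eq_lrshift.
exact: row_sub.
Qed.

Lemma dependent4 (F : fieldType) N (B : 'M[F]_(3, N)) (v : 'I_4 -> 'rV[F]_N) :
  (forall i, (v i <= B)%MS) -> exists2 u : 'I_4 -> F, (exists i, u i != 0) & \sum_i u i *: v i = 0.
Proof.
move=> vB; pose M := \matrix_i v i.
have sub : (M <= B)%MS by apply/row_subP => i; rewrite rowK.
have : kermx M != 0.
  rewrite -mxrank_eq0 mxrank_ker subn_eq0 -ltnNge.
  by apply: leq_ltn_trans (mxrankS sub) _; apply: leq_ltn_trans (rank_leq_row _) _.
case/rowV0Pn => u /sub_kermxP uM u0; exists (u 0); last first.
  by rewrite -[RHS]uM mulmx_sum_row; apply: eq_bigr => i _; rewrite rowK.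
by apply/not_notP => H; case/eqP: u0; apply/rowP => i; rewrite mxE; apply/eqP;
   apply/not_notP => /negP ui; apply: H; exists i.
Qed.

(** * Local rings of the surface and derivations that preserve them *)

Section LocalStructure.
Variables (C : numClosedFieldType) (K : fieldType) (iota : {rmorphism C -> K}).
Local Notation hev := (hev iota).
Local Notation ev := (ev iota).

Section Cramer.
Variables (n : nat) (s : 'I_n.+1 -> K) (v : 'rV[C]_n.+1).

Definition local_ring f := exists G1 G2 : {mpoly C[n.+1]},
  [/\ G2.@[v 0] != 0, hev s G2 != 0 & f = hev s G1 / hev s G2].
Hypothesis unit_nz : forall G : {mpoly C[n.+1]}, G.@[v 0] != 0 -> hev s G != 0.

Lemma local_hev G : local_ring (hev s G).
Proof. by exists G, 1; rewrite meval1 -mpolyC1 hevC rmorph1 divr1 !oner_neq0. Qed.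

Lemma local_subring : subring local_ring.
Proof.
split.
- by rewrite -(rmorph1 iota) -(hevC iota s); exact: local_hev.
- move=> _ _ [G1 [G2 [h1 h2 ->]]] [G3 [G4 [h3 h4 ->]]].
  exists (G1 * G4 - G3 * G2), (G2 * G4); rewrite mevalM hevB !hevM !mulf_neq0 //; split=> //.
  by field; rewrite h2 h4.
- move=> _ _ [G1 [G2 [h1 h2 ->]]] [G3 [G4 [h3 h4 ->]]].
  exists (G1 * G3), (G2 * G4); rewrite mevalM !hevM !mulf_neq0 //; split=> //.
  by field; rewrite h2 h4.
Qed.

Lemma local_inv G : G.@[v 0] != 0 -> local_ring (hev s G)^-1.
Proof.
move=> h; exists 1, G; rewrite -mpolyC1 hevC rmorph1 mul1r; split=> //; exact: unit_nz.
Qed.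

(* The rows in A span at v, so some combination of them is a square matrix whose
   determinant is a unit of the local ring. *)
Lemma local_cramer (D : 'I_n.+1 -> K) (A : ('I_n.+1 -> {mpoly C[n.+1]}) -> Prop) :
  (forall t, A t -> local_ring (\sum_i hev s (t i) * D i)) ->
  (forall w : 'rV[C]_n.+1, (forall t, A t -> \sum_i (t i).@[v 0] * w 0 i = 0) -> w = 0) ->
  forall i, local_ring (D i).
Proof.
move=> HD Hw.
pose G (t : 'I_n.+1 -> {mpoly C[n.+1]}) : 'rV[C]_n.+1 := \row_i (t i).@[v 0].
have [m [f [fA span]]] := finite_row_span A G.
pose Mx : 'M[{mpoly C[n.+1]}]_(m, n.+1) := \matrix_(j, i) f j i.
pose M := \matrix_j G (f j).
have EM : map_mx (meval (v 0)) Mx = M by apply/matrixP => j i; rewrite !mxE.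
have full : row_full M.
  rewrite -cokermx_eq0; apply/eqP/matrixP => a b; rewrite [RHS]mxE.
  have := Hw (\row_i cokermx M i b); suff H : forall t, A t ->
    \sum_i (t i).@[v 0] * (\row_i cokermx M i b) 0 i = 0.
    by move/(_ H)/matrixP/(_ 0 a); rewrite !mxE.
  move=> t /span; rewrite submxE => /eqP /matrixP /(_ 0 b); rewrite mxE [RHS]mxE => E; rewrite -[RHS]E.
  by apply: eq_bigr => i _; rewrite !mxE.
have /row_fullP [L LM] := full.
pose B : 'M[{mpoly C[n.+1]}]_n.+1 := map_mx (@mpolyC _ _) L *m Mx.
have dB : (\det B).@[v 0] = 1.
  rewrite -(det_map_mx (meval (v 0))) map_mxM EM -map_mx_comp.
  rewrite (_ : map_mx _ L = L) ?LM ?det1 //.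
  by apply/matrixP => a b; rewrite mxE /= mevalC.
have sL := local_subring.
pose Dc : 'cV[K]_n.+1 := \col_i D i.
pose hs : {mpoly C[n.+1]} -> K := mmap iota s.
have E1 : map_mx hs (\adj B) *m (map_mx hs B *m Dc) = (hs (\det B)) *: Dc.
  by rewrite mulmxA -map_mxM mul_adj_mx map_scalar_mx mul_scalar_mx.
have E2 j : local_ring ((map_mx hs B *m Dc) j 0).
  rewrite map_mxM -mulmxA mxE; apply: (sr_sum sL) => l _; apply: (srM sL).
    by rewrite !mxE; exact: local_hev.
  have -> : (map_mx hs Mx *m Dc) l 0 = \sum_i hev s (f l i) * D i.
    by rewrite mxE; apply: eq_bigr => i _; rewrite !mxE.
  exact: HD.
move=> i; have := congr1 (fun X : 'cV[K]_n.+1 => X i 0) E1; rewrite mxE [RHS]mxE [Dc i 0]mxE => E3.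
have dn : (\det B).@[v 0] != 0 by rewrite dB oner_neq0.
have -> : D i = (hev s (\det B))^-1 * (hs (\det B) * D i) by rewrite mulKf //; exact: unit_nz.
apply: (srM sL); first exact: local_inv.
rewrite -E3; apply: (sr_sum sL) => j _; apply: (srM sL) => //.
by rewrite mxE; exact: local_hev.
Qed.

End Cramer.
End LocalStructure.

Section Differentials.
Variables (F : fieldType) (n : nat).
Implicit Types (p : {mpoly F[n.+1]}) (f : ratfun F n) (v w : 'rV[F]_n.+1).

Lemma differential_lin p v c w w' :
  differential p v (c *: w + w') = c * differential p v w + differential p v w'.
Proof.
rewrite /differential mulr_sumr -big_split; apply: eq_bigr => i _ /=.
by rewrite !mxE; ring.
Qed.

Lemma rdiff_lin f v c w w' : rdiff f v (c *: w + w') = c * rdiff f v w + rdiff f v w'.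
Proof. by rewrite /rdiff !differential_lin; ring. Qed.

Lemma rdiff0 f v : rdiff f v 0 = 0.
Proof.
have := rdiff_lin f v 1 0 0; rewrite scaler0 addr0 mul1r => /eqP.
by rewrite -subr_eq0 opprD addNKr oppr_eq0 => /eqP.
Qed.

Lemma rdiff_self f v d : f.1 \is d.-homog -> f.2 \is d.-homog -> rdiff f v v = 0.
Proof.
by move=> h1 h2; rewrite /rdiff (euler_diff _ h1) (euler_diff _ h2); ring.
Qed.

(** Four vectors of a three-dimensional space are dependent. The differentials of f and g kill v and
    w and are independent on w1 and w2, so w1 and w2 drop out of the relation, and the coordinate k
    separates v from w. *)
Lemma rdiff_kernel (B : 'M[F]_(3, n.+1)) f g d e v w w1 w2 k :
  f.1 \is d.-homog -> f.2 \is d.-homog -> g.1 \is e.-homog -> g.2 \is e.-homog ->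
  (v <= B)%MS -> (w <= B)%MS -> (w1 <= B)%MS -> (w2 <= B)%MS ->
  v 0 k = 1 -> w 0 k = 0 -> rdiff f v w = 0 -> rdiff g v w = 0 ->
  rdiff f v w1 * rdiff g v w2 - rdiff f v w2 * rdiff g v w1 != 0 -> w = 0.
Proof.
move=> hf1 hf2 hg1 hg2 vB wB w1B w2B vk wk fw gw det.
have [|u [i ui]] := @dependent4 _ _ B (fun i : 'I_4 => nth 0 [:: v; w; w1; w2] i).
  by case=> [[|[|[|[|//]]]] hi].
rewrite !big_ord_recl big_ord0 /= addr0; set u0 := u _; set u1 := u _; set u2 := u _; set u3 := u _.
move=> E.
have lin h : rdiff h v v = 0 -> rdiff h v w = 0 -> u2 * rdiff h v w1 + u3 * rdiff h v w2 = 0.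
  move=> h0 h1; have := congr1 (rdiff h v) E.
  rewrite -[u3 *: w2]addr0 !rdiff_lin h0 h1 rdiff0 !mulr0 !add0r addr0 //.
have f3 := lin f (rdiff_self _ hf1 hf2) fw; have g3 := lin g (rdiff_self _ hg1 hg2) gw.
have u20 : u2 = 0.
  apply: (mulIf det); rewrite mul0r.
  transitivity ((u2 * rdiff f v w1 + u3 * rdiff f v w2) * rdiff g v w2 -
    (u2 * rdiff g v w1 + u3 * rdiff g v w2) * rdiff f v w2); first by ring.
  by rewrite f3 g3 !mul0r subrr.
have u30 : u3 = 0.
  apply: (mulIf det); rewrite mul0r.
  transitivity ((u2 * rdiff g v w1 + u3 * rdiff g v w2) * rdiff f v w1 -
    (u2 * rdiff f v w1 + u3 * rdiff f v w2) * rdiff g v w1); first by ring.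
  by rewrite f3 g3 !mul0r subrr.
move: E; rewrite u20 u30 !scale0r !addr0 => E.
have u00 : u0 = 0.
  by have := congr1 (fun x : 'rV[F]_n.+1 => x 0 k) E; rewrite !mxE vk wk mulr1 mulr0 addr0.
move: E; rewrite u00 scale0r add0r => /eqP; rewrite scaler_eq0 => /orP [/eqP u10|/eqP //].
case/negP: ui; apply/eqP.
by case: i => [[|[|[|[|//]]]] hi]; [rewrite -u00|rewrite -u10|rewrite -u20|rewrite -u30]; congr u; apply: val_inj.
Qed.

End Differentials.

(** * Local structure of the surface at an image point *)

Section SurfacePoint.
Variables (C : numClosedFieldType) (K : fieldType) (iota : {rmorphism C -> K}).
Variables x0 y0 : K.
Hypothesis ind : indep iota x0 y0.
Hypothesis gen : gens iota x0 y0.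
Local Notation ev := (ev iota).
Local Notation hev := (hev iota).
Local Notation jac := (jac gen).
Local Notation cd := (cd iota jac).
Let hbr : bracket iota jac := jac_bracket ind gen.
Variables (n : nat) (S : projset C n) (psi0 : homtuple C 2 n) (eta : twoform C n).
Hypothesis smooth : smooth_projective_surface S.
Hypothesis bir : birational (projspace C 2) S psi0.
Hypothesis on_eta : twoform_on S eta.
Hypothesis eff : effective S (divisor_opp (Div S eta)).
Let irr := smooth.1.
Local Notation psi := (psi iota x0 y0 psi0).
Local Notation fval := (fval iota x0 y0 psi0).
Local Notation form_val := (form_val gen psi0).

Lemma deriv_scalel d g : deriv_of iota d -> deriv_of iota (fun f => g * d f).
Proof.
move=> hd; split=> [f h|f h|c]; first by rewrite (dD hd) mulrDr.
  by rewrite (dM hd); ring.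
by rewrite (dC hd) mulr0.
Qed.

Lemma psi_deriv0 d j : deriv_of iota d -> psi j != 0 -> (forall i, d (psi i / psi j) = 0) ->
  forall f, d f = 0.
Proof.
move=> hd pj H; apply: (psi_generate ind gen bir) => [c|f g hf hg|f g hf hg|f hf|i l].
- exact: (dC hd).
- by rewrite (dB hd) hf hg subrr.
- by rewrite (dM hd) hf hg mul0r mulr0 addr0.
- have [->|f0] := eqVneq f 0; first by rewrite invr0 (d0 hd).
  by rewrite (dV hd) // hf oppr0 mul0r.
- have [->|pl] := eqVneq (psi l) 0; first by rewrite invr0 mulr0 (d0 hd).
  have -> : psi i / psi l = (psi i / psi j) / (psi l / psi j) by field; rewrite pj pl.
  by rewrite (ddiv hd) ?H ?mulr0 ?mul0r ?subrr ?mul0r // mulf_neq0 ?invr_eq0.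
Qed.

Lemma fval_eq f g : ratfun_on S f -> ratfun_on S g -> ratfun_eq S f g -> fval f = fval g.
Proof.
move=> onf ong; have f2 := wf_ratfun ind bir irr onf; have g2 := wf_ratfun ind bir irr ong.
case: onf => [[d [f1h f2h]] _]; case: ong => [[e [g1h g2h]] _].
have hh : f.1 * g.2 - g.1 * f.2 \is (d + e).-homog.
  by apply: rpredB; [exact: dhomogM|rewrite addnC; exact: dhomogM].
move/(van_psi ind bir irr hh); rewrite hevB !hevM => /eqP; rewrite subr_eq0 => /eqP E.
rewrite /fval; apply: (mulIf f2); rewrite divfK //; apply: (mulIf g2); rewrite E; field.
exact: g2.
Qed.

Section Point.
Variables (x y lam : K) (r : 'I_n.+1 -> {poly {poly C}}) (c1 c2 : C) (k : 'I_n.+1).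
Hypothesis hc : cd x y.
Hypothesis lam0 : lam != 0.
Hypothesis psiE : forall i, psi i = lam * ev x y (r i).
Hypothesis rk : eval2 c1 c2 (r k) != 0.
Let indxy : indep iota x y := (cd_coord hbr hc).1.
Let ek : ev x y (r k) != 0 := eval2_ev indxy rk.
Let s i : K := psi i / psi k.
Let v : 'rV[C]_n.+1 := \row_i (eval2 c1 c2 (r i) / eval2 c1 c2 (r k)).
Local Notation O := (local_ring iota s v).

Let pk : psi k != 0. Proof. by rewrite psiE mulf_neq0. Qed.

Let value_s i : value iota x y c1 c2 (s i) (v 0 i).
Proof.
rewrite mxE /s !psiE -mulf_div divff // mul1r; exists (r i), (r k); split=> //.
Qed.

Let value_hs G : value iota x y c1 c2 (hev s G) G.@[v 0].
Proof. exact: value_hev. Qed.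

Let unit_nz G : G.@[v 0] != 0 -> hev s G != 0.
Proof. by apply: contra_neq => z; apply: (value0 indxy); rewrite -z; exact: value_hs. Qed.

Let hev_s d p : p \is d.-homog -> hev psi p = psi k ^+ d * hev s p.
Proof.
move=> hp; rewrite -(hev_scale _ _ _ hp); congr (mmap _ _ _); apply/funext => i.
by rewrite /s mulrC divfK.
Qed.

Let van_s d p : p \is d.-homog -> vanishes S p -> hev s p = 0.
Proof.
move=> hp /(van_psi ind bir irr hp); rewrite (hev_s hp) => /eqP.
by rewrite mulf_eq0 (negPf (expf_neq0 d pk)) => /eqP.
Qed.

Let vk : v 0 k = 1. Proof. by rewrite mxE divff. Qed.

Let onSv : on S v.
Proof.
split.
  apply/eqP => v0; have := vk; rewrite v0 mxE => /esym/eqP; by rewrite oner_eq0.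
move=> p hp; have [d hd] := ishomogP (allP (eqns_homog S) p hp).
apply: (value0 indxy (c1 := c1) (c2 := c2)); rewrite -(van_s hd); last first.
  by move=> w [_ H]; exact: H.
exact: value_hs.
Qed.

Let fval_s f : ratfun_on S f -> fval f = hev s f.1 / hev s f.2.
Proof.
move=> onf; have := wf_ratfun ind bir irr onf; case: onf => [[d [h1 h2]] _].
rewrite /fval (hev_s h1) (hev_s h2) mulf_eq0 negb_or => /andP [a0 b0].
by rewrite -mulf_div divff // mul1r.
Qed.

Let local_fval f : ratfun_on S f -> f.2.@[v 0] != 0 -> O (fval f).
Proof.
by move=> onf f2; rewrite fval_s //; exists f.1, f.2; split=> //; exact: unit_nz.
Qed.

(** The unknowns [d (s i)] solve linear equations over O: the differentials of the forms vanishing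
    on [S], the equation [s k = 1], and the given derivatives of a and b. At v smoothness and the
    independence of da and db leave only the zero solution of the homogeneous system, so
    [local_cramer] applies. *)
Lemma local_derivation a b d : local_coords S v a b -> deriv_of iota d ->
  O (d (fval a)) -> O (d (fval b)) -> forall f, O f -> O (d f).
Proof.
move=> [[ona onb] a2 b2 [w1 [w2 [t1 t2 det]]]] hd Oa Ob.
have sO := local_subring iota s v.
have a2' := unit_nz a2; have b2' := unit_nz b2.
pose numer (f : ratfun C n) i := f.2 * f.1^`M(i) - f.1 * f.2^`M(i).
pose A (t : 'I_n.+1 -> {mpoly C[n.+1]}) := [\/ exists p, [/\ p \is ishomog mdeg, vanishes S p &
    t = fun i => p^`M(i)], t = (fun i => (i == k)%:R), t = numer a | t = numer b].
have num f : ratfun_on S f -> f.2.@[v 0] != 0 -> O (d (fval f)) ->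
    O (\sum_i hev s (numer f i) * d (s i)).
  move=> onf f2 Of; have f2' := unit_nz f2.
  have -> : \sum_i hev s (numer f i) * d (s i) = hev s f.2 ^+ 2 * d (fval f).
    transitivity (hev s f.2 * d (hev s f.1) - hev s f.1 * d (hev s f.2)).
      rewrite !(hev_deriv _ _ hd) !mulr_sumr -sumrB; apply: eq_bigr => i _.
      by rewrite /numer hevB !hevM; ring.
    by rewrite (fval_s onf) (ddiv hd) //; field.
  apply: (srM sO) => //; apply: (srX sO); exact: local_hev.
have Ods i : O (d (s i)).
  apply: (@local_cramer _ _ iota n s v unit_nz (fun i => d (s i)) A) => [t|w Hw].
    case=> [[p [hp vp ->]]|->|->|->]; try exact: num.
      have [e he] := ishomogP hp.
      by rewrite -(hev_deriv _ _ hd) (van_s he vp) (d0 hd); exact: (sr0 sO).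
    rewrite (bigD1 k) //= big1 => [|j jk]; last by rewrite (negPf jk) hev0 mul0r.
    by rewrite eqxx /s divff // (d1 hd) mulr0 addr0; exact: (sr0 sO).
  have tw : tangent S v w.
    by move=> p hp vp; apply: (Hw (fun i => p^`M(i))); constructor 1; exists p.
  have wk : w 0 k = 0.
    rewrite -[RHS](Hw (fun i => (i == k)%:R)); last by constructor 2.
    rewrite (bigD1 k) //= big1 => [|j jk]; last by rewrite (negPf jk) meval0 mul0r.
    by rewrite eqxx meval1 mul1r addr0.
  have rw f : (forall t, t = numer f -> A t) -> rdiff f v w = 0.
    move=> /(_ _ erefl) /Hw; rewrite /rdiff => E.
    have -> : f.2.@[v 0] * differential f.1 v w - f.1.@[v 0] * differential f.2 v w = 0.
      rewrite -[RHS]E /differential !mulr_sumr -sumrB; apply: eq_bigr => j _.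
      by rewrite /numer mevalB !mevalM; ring.
    by rewrite mul0r.
  have [B [_ hB]] := smooth.2 v onSv.
  have tv : tangent S v v.
    move=> p hp vp; have [e he] := ishomogP hp.
    by rewrite (euler_diff _ he) (vp v onSv) mulr0.
  case: (ona) => [[da [ha1 ha2]] _]; case: (onb) => [[db [hb1 hb2]] _].
  apply: (rdiff_kernel ha1 ha2 hb1 hb2 _ _ _ _ vk wk _ _ det (B := B)); try exact/hB.
    by apply: rw => t ->; constructor 3.
  by apply: rw => t ->; constructor 4.
have Oh G : O (d (hev s G)).
  rewrite (hev_deriv _ _ hd); apply: (sr_sum sO) => i _; apply: (srM sO) => //; exact: local_hev.
move=> _ [G1 [G2 [h1 h2 ->]]]; rewrite (ddiv hd) //; apply: (srM sO).
  apply: (srB sO); apply: (srM sO) => //; exact: local_hev.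
rewrite -exprVn; apply: (srX sO); exact: local_inv.
Qed.

Lemma local_value f : O f -> exists p q, eval2 c1 c2 q != 0 /\ f = ev x y p / ev x y q.
Proof.
move=> [G1 [G2 [h1 h2 ->]]].
have [p [q [q0 E _]]] := value_div indxy (value_hs G1) (value_hs G2) h1.
by exists p, q.
Qed.

(* Every multiple g d kills a and b too, hence preserves O; if d is not zero then
   O = K, but 1 / (x - c1) has no value. *)
Lemma local_derivation0 a b d : local_coords S v a b -> deriv_of iota d ->
  d (fval a) = 0 -> d (fval b) = 0 -> forall f, d f = 0.
Proof.
move=> hab hd da db; apply: (psi_deriv0 hd pk) => i.
have sO := local_subring iota s v.
apply/eqP; apply: contraT => ds.
have Oall g : O g.
  have -> : g = (g / d (s i)) * d (s i) by rewrite divfK.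
  have h := @local_derivation a b _ hab (deriv_scalel (g / d (s i)) hd).
  rewrite /= da db mulr0 in h; apply: (h (sr0 sO) (sr0 sO)).
  by rewrite -(hevX iota s i); exact: local_hev.
have [p [q [q0 E]]] := local_value (Oall (x - iota c1)^-1).
have xc : x - iota c1 != 0 by exact: (cd_neq0 hbr (cd_shift1 hbr c1 hc)).
have V1 : value iota x y c1 c2 (x - iota c1) 0.
  rewrite -(subrr c1); apply: value_B => //; last exact: value_C.
  have := value_ev iota x y c1 c2 'X%:P; by rewrite evC ev1X eval2C hornerX.
have V2 : value iota x y c1 c2 (x - iota c1)^-1 (eval2 c1 c2 p / eval2 c1 c2 q).
  by exists p, q.
have := value_M indxy V1 V2; rewrite divff // mul0r => V3.
have V4 := value_C iota x y c1 c2 1; rewrite rmorph1 in V4.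
by have /eqP := value_uniq indxy V3 V4; rewrite eq_sym oner_eq0.
Qed.

(** This provides [S2]. F is a local equation of the divisor of poles, regular because that divisor
    is effective, and the form is da /\ db divided by F. *)
Lemma local_structure : exists (O : K -> Prop) a b F,
  [/\ subring O, (forall c, O (iota c)) /\ (forall i, O (psi i / psi k)),
      forall f, O f -> exists p q, eval2 c1 c2 q != 0 /\ f = ev x y p / ev x y q,
      [/\ O a, O b & jac a b != 0] &
      (forall f, O f -> O (jac f a / jac a b) /\ O (jac f b / jac a b)) /\
      [/\ O F, F != 0 & form_val eta * F = jac a b]].
Proof.
have sO := local_subring iota s v.
have [f [[onrf [a [b [u [lc [onu [g' [ong' equ g1 g2']]] eqe]]]]] [onf [g [ong eqfg g2]]]]] := eff onSv.
have nz : jac (fval a) (fval b) != 0.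
  apply/eqP => z.
  have ja : forall f, jac (fval a) f = 0.
    by apply: (local_derivation0 lc (br_deriv hbr _)) => //; exact: (brff hbr).
  have jb : forall f, jac (fval b) f = 0.
    apply: (local_derivation0 lc (br_deriv hbr _)); last exact: (brff hbr).
    by rewrite (brN hbr) z oppr0.
  have : jac x y = 0.
    by apply: (local_derivation0 lc (br_deriv hbr _)); rewrite (brN hbr) ?ja ?jb oppr0.
  by move/eqP; rewrite (negPf hc.2).
have [[ona onb] a2 b2 _] := lc.
have f10 : hev psi f.1 != 0 := wf_ratfun ind bir irr onrf.
have f20 : hev psi f.2 != 0 := wf_ratfun ind bir irr onf.
have u20 : hev psi u.2 != 0 := wf_ratfun ind bir irr onu.
have Eu : fval u = fval g' by exact: fval_eq.
have gv1 : hev s g'.1 != 0 := unit_nz g1.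
have fu0 : fval u != 0.
  by rewrite Eu (fval_s ong') mulf_neq0 ?invr_eq0 //; exact: unit_nz.
have ff0 : fval f != 0 by rewrite /fval mulf_neq0 ?invr_eq0.
have u10 : hev psi u.1 != 0 by apply: contraNneq fu0 => z; rewrite /fval z mul0r.
exists O, (fval a), (fval b), (fval f / fval u); split=> //.
- split=> [c|i]; first by rewrite -(hevC iota s); exact: local_hev.
  by rewrite -/(s i) -(hevX iota s i); exact: local_hev.
- exact: local_value.
- by split=> //; exact: local_fval.
- split=> [h Oh|]; last split.
  + have hd c := @local_derivation a b _ lc (deriv_scalel (- (jac (fval a) (fval b))^-1) (br_deriv hbr c)).
    have E1 c h' : - (jac (fval a) (fval b))^-1 * jac c h' = jac h' c / jac (fval a) (fval b).
      by rewrite (brN hbr c h'); ring.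
    split; rewrite -E1.
      apply: (hd (fval a)) => //; rewrite E1; first by rewrite (brff hbr) mul0r; exact: (sr0 sO).
      rewrite (brN hbr (fval a)) mulNr divff //; apply: (srN sO); exact: (sr1 sO).
    apply: (hd (fval b)) => //; rewrite E1; first by rewrite divff //; exact: (sr1 sO).
    by rewrite (brff hbr) mul0r; exact: (sr0 sO).
  + apply: (srM sO); first by rewrite (fval_eq onf ong eqfg); exact: local_fval.
    rewrite Eu (fval_s ong') invf_div.
    by exists g'.2, g'.1; split.
  + by rewrite mulf_neq0 ?invr_eq0.
  + have wfe : wf_form iota x0 y0 psi0 [:: (rmul (rinv f) u, a, b)].
      move=> t; rewrite inE => /eqP -> /=; split; last 2 first.
      * exact: wf_ratfun ona.
      * exact: wf_ratfun onb.
      by rewrite hevM mulf_neq0.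
    rewrite (@twoform_eq_val _ _ _ _ _ ind gen _ _ _ bir irr _ _ (wf_twoform ind bir irr on_eta) wfe eqe).
    rewrite /form_val big_seq1 /= /fval /= !hevM.
    by field; rewrite f10 f20 u10 u20.
Qed.

End Point.
End SurfacePoint.

(** * Birational maps given by coordinates of the function field *)

Lemma tnth_ratmap_comp (F : fieldType) n m k (chi : homtuple F m k) (psi : homtuple F n m) i :
  tnth (ratmap_comp chi psi) i = tnth chi i \mPo psi.
Proof. exact: tnth_mktuple. Qed.

Section Birational.
Variables (C : numClosedFieldType) (K : fieldType) (iota : {rmorphism C -> K}).
Local Notation ev := (ev iota).
Local Notation hev := (hev iota).
Implicit Types (p : {poly {poly C}}).

Definition homogenize d p : {mpoly C[3]} :=
  \sum_(l < d.+1) \sum_(k < d.+1 | (k + l <= d)%N)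
    p`_l`_k *: ('X_0 ^+ (d - k - l) * 'X_(inord 1) ^+ k * 'X_(inord 2) ^+ l).

Lemma dhomog_Xn m (i : 'I_m) k : ('X_i ^+ k : {mpoly C[m]}) \is k.-homog.
Proof.
rewrite -[X in X.-homog]mul1n; apply: dhomogMn.
by rewrite dhomogX /= mdeg1.
Qed.

Lemma dhomog_homogenize d p : homogenize d p \is d.-homog.
Proof.
apply: rpred_sum => l _; apply: rpred_sum => k kl; apply: rpredZ.
have H : ('X_0 ^+ (d - k - l) * 'X_(inord 1) ^+ k * 'X_(inord 2) ^+ l : {mpoly C[3]})
    \is (d - k - l + k + l).-homog by do 2?[apply: dhomogM]; exact: dhomog_Xn.
have E : (d - k - l + k + l = d)%N by lia.
by rewrite E in H.
Qed.

Lemma hevXn m (s : 'I_m -> K) (q : {mpoly C[m]}) k : hev s (q ^+ k) = hev s q ^+ k.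
Proof. exact: (rmorphXn (mmap iota s)). Qed.

Lemma hevZ m (s : 'I_m -> K) c (q : {mpoly C[m]}) : hev s (c *: q) = iota c * hev s q.
Proof. exact: mmapZ. Qed.

Lemma hev_sum m (s : 'I_m -> K) J (r : seq J) (P : pred J) F :
  hev s (\sum_(j <- r | P j) F j) = \sum_(j <- r | P j) hev s (F j).
Proof. exact: (raddf_sum (mmap iota s)). Qed.

Lemma pt3_0 (R : nzRingType) (a b : R) : pt3 a b 0 = 1. Proof. by []. Qed.
Lemma pt3_1 (R : nzRingType) (a b : R) : pt3 a b (inord 1) = a.
Proof. by rewrite /pt3 inordK. Qed.
Lemma pt3_2 (R : nzRingType) (a b : R) : pt3 a b (inord 2) = b.
Proof. by rewrite /pt3 inordK. Qed.

Lemma hev_homogenize d p x y : boxed d p ->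
  (forall l k, p`_l`_k != 0 -> (k + l <= d)%N) -> hev (pt3 x y) (homogenize d p) = ev x y p.
Proof.
move=> [b1 b2] hd; rewrite hev_sum (ev_sum_wide _ _ _ (leqW b1)); apply: eq_bigr => l _.
rewrite hev_sum (ev1_sum_wide _ _ (leqW (b2 l))) mulr_suml [RHS](bigID (fun k : 'I_d.+1 => (k + l <= d)%N)) /=.
rewrite [X in _ + X]big1 ?addr0 => [|k nk]; last first.
  have -> : p`_l`_k = 0 by apply/eqP; apply: contraNT nk => /hd.
  by rewrite rmorph0 !mul0r.
apply: eq_bigr => k _; rewrite hevZ !hevM !hevXn !hevX pt3_0 pt3_1 pt3_2 expr1n mul1r.
by rewrite mulrA.
Qed.

Lemma homogenize_ex x y p : exists d0, forall d, (d0 <= d)%N ->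
  hev (pt3 x y) (homogenize d p) = ev x y p.
Proof.
have [D bD] := boxed_ex p; exists (D + D)%N => d le.
apply: hev_homogenize; first by apply: boxedW bD; lia.
move=> l k; apply: contraR; rewrite -ltnNge => lt; have [b1 b2] := bD.
have [lD|Dl] := ltnP l D; last by rewrite [p`_l]nth_default ?coef0 // (leq_trans b1).
by rewrite nth_default // (leq_trans (b2 l)) //; lia.
Qed.

Variables x0 y0 : K.
Hypothesis ind : indep iota x0 y0.
Hypothesis gen : gens iota x0 y0.
Variables (n : nat) (S : projset C n) (psi0 : homtuple C 2 n).
Hypothesis irr : irreducible S.
Hypothesis bir : birational (projspace C 2) S psi0.
Local Notation psi := (psi iota x0 y0 psi0).
Variables x y : K.
Hypothesis indxy : indep iota x y.
Hypothesis genxy : gens iota x y.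

Lemma common_denominator m (f : 'I_m -> K) : exists t (A : 'I_m -> {poly {poly C}}),
  t != 0 /\ forall i, t * f i = ev x y (A i).
Proof.
have /choice [pq hpq] : forall i, exists pq : {poly {poly C}} * {poly {poly C}},
    ev x y pq.2 != 0 /\ f i = ev x y pq.1 / ev x y pq.2.
  by move=> i; have [p [q H]] := genxy (f i); exists (p, q).
exists (ev x y (\prod_i (pq i).2)), (fun i => (pq i).1 * \prod_(j | j != i) (pq j).2); split.
  by rewrite rmorph_prod; apply/prodf_neq0 => i _; exact: (hpq i).1.
move=> i; rewrite (bigD1 i) //= !evM (hpq i).2; field; exact: (hpq i).1.
Qed.

Lemma homogeneous_coords : exists (d : nat) (psi1 : homtuple C 2 n) (t : K),
  [/\ t != 0, forall j, tnth psi1 j \is d.-homog &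
      forall j, hev (pt3 x y) (tnth psi1 j) = t * psi j].
Proof.
have [t [A [t0 tA]]] := common_denominator psi.
have /choice [d0 hd0] := fun i => homogenize_ex x y (A i).
exists (\max_i d0 i), [tuple homogenize (\max_i d0 i) (A i) | i < n.+1], t; split=> //.
- by move=> j; rewrite tnth_mktuple; exact: dhomog_homogenize.
- by move=> j; rewrite tnth_mktuple tA; apply: hd0; exact: leq_bigmax.
Qed.

Lemma psi_frac f : exists d (p q : {mpoly C[n.+1]}),
  [/\ p \is d.-homog, q \is d.-homog, hev psi q != 0 & f = hev psi p / hev psi q].
Proof.
apply: (psi_generate ind gen bir (A := fun f => exists d (p q : {mpoly C[n.+1]}),
  [/\ p \is d.-homog, q \is d.-homog, hev psi q != 0 & f = hev psi p / hev psi q])) => {f}.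
- move=> c; exists 0%N, (c *: 1), 1; rewrite rpredZ ?dhomog1 // hevZ.
  by rewrite -mpolyC1 hevC rmorph1 oner_neq0 mulr1 divr1.
- move=> _ _ [d [p [q [hp hq q0 ->]]]] [d' [p' [q' [hp' hq' q0' ->]]]].
  exists (d + d')%N, (p * q' - p' * q), (q * q'); rewrite hevB !hevM mulf_neq0 //; split=> //.
  + by apply: rpredB; [exact: dhomogM|rewrite addnC; exact: dhomogM].
  + exact: dhomogM.
  + by field; rewrite q0 q0'.
- move=> _ _ [d [p [q [hp hq q0 ->]]]] [d' [p' [q' [hp' hq' q0' ->]]]].
  exists (d + d')%N, (p * p'), (q * q'); rewrite !hevM mulf_neq0 //; split=> //; try exact: dhomogM.
  by field; rewrite q0 q0'.
- move=> _ [d [p [q [hp hq q0 ->]]]]; have [p0|p0] := eqVneq (hev psi p) 0.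
    exists d, p, q; split=> //; by rewrite p0 mul0r invr0.
  by exists d, q, p; rewrite invf_div.
- move=> i j; have [e he] := psi0_homog bir; have [pj|pj] := eqVneq (psi j) 0.
    have [l pl] := psi_nz ind bir; exists 1%N, 0, 'X_l.
    rewrite hev0 hevX pl pj invr0 mulr0 mul0r rpred0; split=> //.
    by rewrite dhomogX /= mdeg1.
  by exists 1%N, 'X_i, 'X_j; rewrite !hevX !dhomogX /= !mdeg1 pj.
Qed.

Lemma hev_scaled d (p : {mpoly C[n.+1]}) (psi1 : homtuple C 2 n) t : p \is d.-homog ->
  (forall j, hev (pt3 x y) (tnth psi1 j) = t * psi j) ->
  hev (pt3 x y) (p \mPo psi1) = t ^+ d * hev psi p.
Proof.
move=> hp E; rewrite hev_comp -(hev_scale _ _ _ hp); congr (mmap _ _ _); exact/funext.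
Qed.

(** The inverse [chi] writes x and y as fractions of forms in the [psi] over the common denominator
    [qx * qy]; all identities are checked at the generic point. *)
Lemma new_birational d (psi1 : homtuple C 2 n) t : t != 0 ->
  (forall j, tnth psi1 j \is d.-homog) ->
  (forall j, hev (pt3 x y) (tnth psi1 j) = t * psi j) -> birational (projspace C 2) S psi1.
Proof.
move=> t0 h1 E1.
have van2 e (p : {mpoly C[3]}) : p \is e.-homog ->
    vanishes (projspace C 2) p <-> hev (pt3 x y) p = 0.
  move=> hp; split=> [vp|z v _]; last exact: (hev_pt0_all indxy hp z).
  apply: hev_pt0 => a b; rewrite -(vp (\row_i pt3 a b i)).
    by apply: meval_eq => i; rewrite mxE.
  split=> //; apply/eqP => /matrixP /(_ 0 0) /eqP; by rewrite !mxE /pt3 /= oner_eq0.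
split.
  split; first by exists d.
    have [j pj] := psi_nz ind bir; exists j => /(van2 _ _ (h1 j)) /eqP.
    by rewrite E1 mulf_eq0 (negPf t0) (negPf pj).
  move=> p hp; have [e he] := ishomogP (allP (eqns_homog S) p hp).
  apply/(van2 _ _ (dhomog_comp h1 he)); rewrite (hev_scaled he E1).
  have /(van_psi ind bir irr he) -> : vanishes S p by move=> v [_ H]; exact: H.
  by rewrite mulr0.
have [dx [px [qx [hpx hqx qx0 Ex]]]] := psi_frac x.
have [dy [py [qy [hpy hqy qy0 Ey]]]] := psi_frac y.
pose chi : homtuple C n 2 := [tuple nth 0 [:: qx * qy; px * qy; qx * py] i | i < 3].
have hchi i : tnth chi i \is (dx + dy).-homog.
  by rewrite tnth_mktuple; case: i => [[|[|[|//]]] hi] /=; exact: dhomogM.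
pose w := hev psi (qx * qy).
have w0 : w != 0 by rewrite /w hevM mulf_neq0.
have Echi i : hev psi (tnth chi i) = w * pt3 x y i.
  rewrite tnth_mktuple /w hevM /pt3; case: i => [[|[|[|//]]] hi] /=; rewrite hevM ?mulr1 //.
    by rewrite Ex; field.
  by rewrite Ey; field.
exists chi; split.
- split; first by exists (dx + dy)%N.
    by exists 0 => /(van_psi ind bir irr (hchi _)) /eqP; rewrite Echi pt3_0 mulr1 (negPf w0).
  by move=> p.
- split.
    exists 0; rewrite tnth_ratmap_comp => /(van2 _ _ (dhomog_comp h1 (hchi _))) /eqP.
    by rewrite (hev_scaled (hchi _) E1) Echi pt3_0 mulr1 mulf_eq0 expf_eq0 (negPf t0) (negPf w0) andbF.
  move=> i j; apply/(van2 ((dx + dy) * d + 1)%N).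
    by rewrite !tnth_ratmap_comp; apply: rpredB; apply: dhomogM;
      rewrite ?dhomogX /= ?mdeg1 //; exact: dhomog_comp.
  by rewrite hevB !hevM !hevX !tnth_ratmap_comp !(hev_scaled (hchi _) E1) !Echi; ring.
- have Ec (p : {mpoly C[3]}) : p \is d.-homog -> hev psi (p \mPo chi) = w ^+ d * hev (pt3 x y) p.
    by move=> hp; rewrite hev_comp -(hev_scale _ _ _ hp); congr (mmap _ _ _); exact/funext.
  split.
    have [j pj] := psi_nz ind bir; exists j; rewrite tnth_ratmap_comp.
    move=> /(van_psi ind bir irr (dhomog_comp hchi (h1 _))) /eqP.
    by rewrite Ec // E1 !mulf_eq0 expf_eq0 (negPf w0) andbF (negPf t0) (negPf pj).
  move=> i j; apply/(van_psi ind bir irr (d := d * (dx + dy) + 1)%N).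
    by rewrite !tnth_ratmap_comp; apply: rpredB; apply: dhomogM;
      rewrite ?dhomogX /= ?mdeg1 //; exact: dhomog_comp.
  by rewrite hevB !hevM !hevX !tnth_ratmap_comp !Ec // !E1; ring.
Qed.

End Birational.

(** * Two-forms on the plane *)

Section Scaling.
Variables (F : numClosedFieldType) (n : nat).
Implicit Types (p : {mpoly F[n.+1]}) (f : ratfun F n) (v w : 'rV[F]_n.+1).

Lemma dhomog_mderiv d p i : p \is d.-homog -> p^`M(i) \is (d.-1).-homog.
Proof.
move/dhomogP => hp; rewrite (mpolyE p) raddf_sum big_seq; apply: rpred_sum => m /hp /= md.
rewrite mderivZ mderivX; apply: rpredZ.
case mi : (m i) => [|k]; first by rewrite scale0r rpred0.
apply: rpredZ; rewrite dhomogX /= -md -[m in X in _ == X](submK (m := U_(i)) (m' := m)); last first.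
  by apply/mnm_lepP => j; rewrite mnm1E; case: eqP => // <-; rewrite mi.
by rewrite mdegD mdeg1 addn1.
Qed.

Lemma mderiv_homog0 p i : p \is 0.-homog -> p^`M(i) = 0.
Proof.
move/dhomogP => hp; rewrite (mpolyE p) raddf_sum big_seq big1 //= => m /hp /= /eqP.
by rewrite mdeg_eq0 => /eqP ->; rewrite mderivZ mderivX mnm0E scale0r scaler0.
Qed.

Lemma meval_scalev d p c v : p \is d.-homog -> p.@[(c *: v) 0] = c ^+ d * p.@[v 0].
Proof.
by move=> hp; rewrite -(meval_scale _ _ hp); apply: meval_eq => i; rewrite mxE.
Qed.

(** The factor c on the left avoids the exponent d - 1, which would be truncated for d = 0. *)
Lemma differential_scale d p c v w : p \is d.-homog ->
  c * differential p (c *: v) w = c ^+ d * differential p v w.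
Proof.
move=> hp; rewrite /differential !mulr_sumr; apply: eq_bigr => i _.
rewrite (meval_scalev c v (dhomog_mderiv i hp)).
case: d hp => [|d] hp; first by rewrite (mderiv_homog0 i hp) meval0 !mul0r !mulr0 mul0r mulr0.
by rewrite exprS; ring.
Qed.

Lemma rval_scale d f c v : f.1 \is d.-homog -> f.2 \is d.-homog -> c != 0 ->
  rval f (c *: v) = rval f v.
Proof.
move=> h1 h2 c0; rewrite /rval !(meval_scalev _ _ h1) !(meval_scalev _ _ h2).
by rewrite -mulf_div divff ?expf_neq0 // mul1r.
Qed.

Lemma rdiff_scale d f c v w : f.1 \is d.-homog -> f.2 \is d.-homog -> c != 0 ->
  rdiff f (c *: v) w = c^-1 * rdiff f v w.
Proof.
move=> h1 h2 c0; rewrite /rdiff !(meval_scalev _ _ h1) !(meval_scalev _ _ h2).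
have D p : p \is d.-homog -> differential p (c *: v) w = c^-1 * c ^+ d * differential p v w.
  by move=> hp; rewrite -mulrA -(differential_scale c v w hp) mulKf.
rewrite !D // exprMn.
have -> : c ^+ d * f.2.@[v 0] * (c^-1 * c ^+ d * differential f.1 v w) -
   c ^+ d * f.1.@[v 0] * (c^-1 * c ^+ d * differential f.2 v w) =
   (c ^+ d) ^+ 2 * (c^-1 * (f.2.@[v 0] * differential f.1 v w - f.1.@[v 0] * differential f.2 v w)).
  by ring.
by rewrite -mulf_div divff ?expf_neq0 // mul1r mulrA.
Qed.

End Scaling.

Section Plane.
Variables (C : numClosedFieldType) (K : fieldType) (iota : {rmorphism C -> K}).
Local Notation ev := (ev iota).
Local Notation hev := (hev iota).
Variables x y : K.
Hypothesis ind : indep iota x y.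
Hypothesis gen : gens iota x y.
Local Notation ddx := (ddx gen).
Local Notation ddy := (ddy gen).
Local Notation jac := (jac gen).
Local Notation P2 := (projspace C 2).

Definition idmap : homtuple C 2 2 := [tuple 'X_i | i < 3].
Local Notation fval := (fval iota x y idmap).
Local Notation form_val := (form_val gen idmap).

Lemma psi_idmap : psi iota x y idmap = pt3 x y.
Proof. by apply/funext => i; rewrite /psi tnth_mktuple hevX. Qed.

Lemma vanish_plane d p : p \is d.-homog -> vanishes P2 p <-> hev (pt3 x y) p = 0.
Proof.
move=> hp; split=> [vp|z v _]; last exact: (hev_pt0_all ind hp z).
apply: hev_pt0 => a b; rewrite -(vp (\row_i pt3 a b i)).
  by apply: meval_eq => i; rewrite mxE.
split=> //; apply/eqP => /matrixP /(_ 0 0) /eqP; by rewrite !mxE /pt3 /= oner_eq0.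
Qed.

Lemma plane_irreducible : irreducible P2.
Proof.
split.
  exists (const_mx 1); split=> //; apply/eqP => /matrixP /(_ 0 0) /eqP.
  by rewrite !mxE oner_eq0.
move=> p q /ishomogP [d hp] /ishomogP [e hq] /(vanish_plane (dhomogM hp hq)) /eqP.
by rewrite hevM mulf_eq0 => /orP [] /eqP; [left; apply/(vanish_plane hp)|right; apply/(vanish_plane hq)].
Qed.

Lemma idmap_birational : birational P2 P2 idmap.
Proof.
have hom j : tnth idmap j \is 1.-homog by rewrite tnth_mktuple dhomogX /= mdeg1.
have rat : ratmap P2 P2 idmap.
  split=> //; first by exists 1%N.
  by exists 0 => /(vanish_plane (hom 0)) /eqP; rewrite tnth_mktuple hevX oner_eq0.
have idc i : tnth (ratmap_comp idmap idmap) i = 'X_i.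
  by rewrite tnth_ratmap_comp tnth_mktuple comp_mpolyXU -tnth_nth tnth_mktuple.
have isid : is_identity P2 (ratmap_comp idmap idmap).
  split; first by exists 0; have [_ [j]] := rat; rewrite idc => _ _ /(vanish_plane (d := 1%N)); rewrite dhomogX /= mdeg1 hevX => /(_ isT) /eqP; rewrite oner_eq0.
  by move=> i j v _; rewrite !idc mevalB !mevalM !mevalXU mulrC subrr.
by split=> //; exists idmap.
Qed.

Definition affP (i : 'I_3) : {poly {poly C}} := nth 0 [:: 1; 'X%:P; 'X] i.

Lemma psi_affP i : psi iota x y idmap i = ev x y (affP i).
Proof.
rewrite psi_idmap /pt3 /affP; case: i => [[|[|[|//]]] hi] /=;
by rewrite ?ev_1 ?evC ?ev1X ?evY.
Qed.

Lemma img_affP a b i : img affP a b 0 i = pt3 a b i.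
Proof.
rewrite mxE /affP /pt3; case: i => [[|[|[|//]]] hi] /=.
- by rewrite -[1]/(1%:P) eval2C hornerC.
- by rewrite eval2C hornerX.
- by rewrite /eval2 hornerX hornerC.
Qed.

Lemma imgx_affP a b i : imgx affP a b 0 i = nth 0 [:: 0; 1; 0] i.
Proof.
rewrite mxE /affP; case: i => [[|[|[|//]]] hi] /=.
- by rewrite -[1]/(1%:P%:P) dX_C eval20.
- by rewrite dX_polyC derivX -[1]/(1%:P) eval2C hornerC.
- by rewrite dX_X eval20.
Qed.

Lemma imgy_affP a b i : imgy affP a b 0 i = nth 0 [:: 0; 0; 1] i.
Proof.
rewrite mxE /affP; case: i => [[|[|[|//]]] hi] /=.
- by rewrite -[1]/(1%:P) derivC eval20.
- by rewrite derivC eval20.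
- by rewrite derivX -[1]/(1%:P) eval2C hornerC.
Qed.

Lemma ord3P (A : 'I_3 -> Prop) : A 0 -> A (inord 1) -> A (inord 2) -> forall i, A i.
Proof.
move=> h0 h1 h2 [[|[|[|//]]] hi].
- by have -> : Ordinal hi = 0 by exact: val_inj.
- by have -> : Ordinal hi = inord 1 by apply: val_inj; rewrite /= inordK.
- by have -> : Ordinal hi = inord 2 by apply: val_inj; rewrite /= inordK.
Qed.

Lemma affine_point (v : 'rV[C]_3) : v 0 0 != 0 ->
  v = v 0 0 *: img affP (v 0 (inord 1) / v 0 0) (v 0 (inord 2) / v 0 0).
Proof.
move=> v0; apply/rowP; apply: ord3P; rewrite mxE img_affP /pt3 ?inordK //= ?mulr1 //.
  by rewrite mulrC divfK.
by rewrite mulrC divfK.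
Qed.

Lemma affine_tangent a b (w : 'rV[C]_3) : w = w 0 0 *: img affP a b +
  ((w 0 (inord 1) - a * w 0 0) *: imgx affP a b + (w 0 (inord 2) - b * w 0 0) *: imgy affP a b).
Proof.
have lin (u u' u'' : 'rV[C]_3) (r r' r'' : C) i :
  (r *: u + (r' *: u' + r'' *: u'')) 0 i = r * u 0 i + (r' * u' 0 i + r'' * u'' 0 i).
  by rewrite !mxE.
by apply/rowP; apply: ord3P; rewrite lin img_affP imgx_affP imgy_affP /pt3 ?inordK //=; ring.
Qed.

Lemma rdiff_affine d f (v w : 'rV[C]_3) : f.1 \is d.-homog -> f.2 \is d.-homog -> v 0 0 != 0 ->
  let a := v 0 (inord 1) / v 0 0 in let b := v 0 (inord 2) / v 0 0 in
  rdiff f v w = (v 0 0)^-1 * ((w 0 (inord 1) - a * w 0 0) * rdiff f (img affP a b) (imgx affP a b)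
    + (w 0 (inord 2) - b * w 0 0) * rdiff f (img affP a b) (imgy affP a b)).
Proof.
move=> h1 h2 v0 a b; rewrite {1}(affine_point v0) -/a -/b (rdiff_scale _ _ h1 h2) //.
congr (_ * _); rewrite {1}(affine_tangent a b w) rdiff_lin (rdiff_self _ h1 h2) mulr0 add0r.
(* A zero summand gives the remaining multiple the shape that [rdiff_lin] expects. *)
rewrite rdiff_lin -[imgy affP a b in LHS]addr0 -[X in X *: (_ + 0)]mulr1.
by rewrite -[_ *: (_ + 0)]addr0 mulr1 rdiff_lin rdiff0 !addr0.
Qed.

(** Differentials of functions of degree 0 kill the direction of v. What remains of w1 and w2 are
    their components along the two affine directions, whose determinant appears as the factor. *)
Lemma twoform_affine e (v w1 w2 : 'rV[C]_3) : twoform_on P2 e -> v 0 0 != 0 ->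
  let a := v 0 (inord 1) / v 0 0 in let b := v 0 (inord 2) / v 0 0 in
  twoform_val e v w1 w2 = (v 0 0)^-2 *
    ((w1 0 (inord 1) - a * w1 0 0) * (w2 0 (inord 2) - b * w2 0 0)
     - (w2 0 (inord 1) - a * w2 0 0) * (w1 0 (inord 2) - b * w1 0 0)) *
    twoform_val e (img affP a b) (imgx affP a b) (imgy affP a b).
Proof.
move=> he v0 a b; rewrite /twoform_val mulr_sumr big_seq [RHS]big_seq.
apply: eq_bigr => -[[h f] g] /he [/= [[dh [h1 h2]] _] [[df [f1 f2]] _] [[dg [g1 g2]] _]].
rewrite !(rdiff_affine _ f1 f2 v0) !(rdiff_affine _ g1 g2 v0) -/a -/b.
rewrite {1}(affine_point v0) (rval_scale _ h1 h2) // -/a -/b.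
rewrite -exprVn; ring.
Qed.

Lemma denominators_homog e : twoform_on P2 e -> exists d, denominators e \is d.-homog.
Proof.
rewrite /denominators; elim: e => [|[[h f] g] e IH] he.
  by exists 0%N; rewrite big_nil dhomog1.
have [|d hd] := IH; first by move=> h' f' g' te; apply: he; rewrite inE te orbT.
have [/= [[dh [_ h2]] _] [[df [_ f2]] _] [[dg [_ g2]] _]] := he h f g (mem_head _ _).
exists (dh + (df + dg) + d)%N; rewrite big_cons; apply: dhomogM => //.
by apply: dhomogM => //; exact: dhomogM.
Qed.

(** The converse of [twoform_eq_val] on the plane; the open set is the affine plane without the
    zeros of the denominators. *)
Lemma plane_twoform_eq e1 e2 : twoform_on P2 e1 -> twoform_on P2 e2 ->
  form_val e1 = form_val e2 -> twoform_eq P2 e1 e2.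
Proof.
move=> on1 on2 E; have [d1 h1] := denominators_homog on1; have [d2 h2] := denominators_homog on2.
have hp : 'X_0 * (denominators e1 * denominators e2) \is (1 + (d1 + d2)).-homog.
  apply: dhomogM; first by rewrite dhomogX /= mdeg1.
  exact: dhomogM.
exists ('X_0 * (denominators e1 * denominators e2)); split.
- exact: dhomog_ishomog hp.
- move=> /(vanish_plane hp) /eqP; rewrite !hevM hevX !mulf_eq0 -psi_idmap.
  rewrite (negPf (denominators_nz (wf_twoform ind idmap_birational plane_irreducible on1))).
  rewrite (negPf (denominators_nz (wf_twoform ind idmap_birational plane_irreducible on2))).
  by rewrite psi_idmap pt3_0 oner_eq0.
- move=> v _; rewrite !mevalM mevalXU !mulf_eq0 !negb_or => /and3P [v0 z1 z2] w1 w2 _ _.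
  rewrite (twoform_affine _ _ on1 v0) (twoform_affine _ _ on2 v0); congr (_ * _).
  have nz d p : p \is d.-homog -> p.@[v 0] != 0 ->
      p.@[img affP (v 0 (inord 1) / v 0 0) (v 0 (inord 2) / v 0 0) 0] != 0.
    by move=> hh; rewrite {1}(affine_point v0) (meval_scalev _ _ hh) mulf_eq0 negb_or => /andP [].
  move: z1 z2 => /(nz _ _ h1) z1 /(nz _ _ h2) z2.
  have V1 := value_form ind gen psi_affP z1; have V2 := value_form ind gen psi_affP z2.
  by rewrite -E in V2; exact: value_uniq V1 V2.
Qed.

Lemma deriv_chain d f : deriv_of iota d -> d f = ddx f * d x + ddy f * d y.
Proof.
move=> hd; have hx := ddx_deriv ind gen; have hy := ddy_deriv ind gen.
have [p [q [q0 ->]]] := gen f.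
rewrite (ddiv hd) // (ddiv hx) // (ddiv hy) // !(d_ev hd) !(ddx_ev ind) !(ddy_ev ind).
move: q0; move: (ev x y q) => u u0; field; exact: u0.
Qed.

Lemma bracket_jac br f g : bracket iota br -> br f g = jac f g * br x y.
Proof.
move=> hb; rewrite (deriv_chain g (br_deriv hb f)) (brN hb x f) (brN hb y f).
rewrite (deriv_chain f (br_deriv hb x)) (deriv_chain f (br_deriv hb y)) !(brff hb) (brN hb x y).
rewrite /jac; ring.
Qed.

Lemma jac_xy : jac x y = 1.
Proof.
have := bracket_jac x y (jac_bracket ind gen) => /eqP.
by rewrite -subr_eq0 -{1}[jac x y]mul1r -mulrBl mulf_eq0 (negPf (jac_cd ind gen).2) orbF
  subr_eq0 => /eqP.
Qed.

End Plane.

(** * Pulling the form back along the new parametrization *)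

Section Pullback.
Variables (C : numClosedFieldType) (K : fieldType) (iota : {rmorphism C -> K}).
Local Notation hev := (hev iota).
Variables x0 y0 : K.
Hypothesis ind : indep iota x0 y0.
Hypothesis gen : gens iota x0 y0.
Variables (n : nat) (S : projset C n) (psi0 : homtuple C 2 n) (eta : twoform C n).
Hypothesis irr : irreducible S.
Hypothesis bir : birational (projspace C 2) S psi0.
Hypothesis on_eta : twoform_on S eta.
Local Notation psi := (psi iota x0 y0 psi0).
Variables x y : K.
Hypothesis indxy : indep iota x y.
Hypothesis genxy : gens iota x y.
Variables (d : nat) (psi1 : homtuple C 2 n) (t : K).
Hypothesis t0 : t != 0.
Hypothesis h1 : forall j, tnth psi1 j \is d.-homog.
Hypothesis E1 : forall j, hev (pt3 x y) (tnth psi1 j) = t * psi j.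

Lemma ratfun_pullback_on f : ratfun_on S f -> ratfun_on (projspace C 2) (ratfun_pullback psi1 f).
Proof.
move=> onf; have f20 := wf_ratfun ind bir irr onf.
case: onf => [[e [f1 f2]] _]; split.
  by exists (e * d)%N; split; exact: dhomog_comp.
move=> /(vanish_plane indxy (dhomog_comp h1 f2)) /eqP.
by rewrite (hev_scaled f2 E1) mulf_eq0 expf_eq0 (negPf t0) (negPf f20) andbF.
Qed.

Lemma fval_pullback f : ratfun_on S f ->
  fval iota x y (idmap C) (ratfun_pullback psi1 f) = fval iota x0 y0 psi0 f.
Proof.
move=> [[e [f1 f2]] _]; rewrite /fval psi_idmap /= (hev_scaled f1 E1) (hev_scaled f2 E1).
by rewrite -mulf_div divff ?mul1r // expf_neq0.
Qed.

Lemma twoform_pullback_on : twoform_on (projspace C 2) (twoform_pullback psi1 eta).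
Proof.
move=> h a b /mapP [[[h' a'] b'] /on_eta [oh oa ob] [-> -> ->]].
by split; exact: ratfun_pullback_on.
Qed.

Lemma form_val_pullback : form_val gen psi0 eta =
  form_val genxy (idmap C) (twoform_pullback psi1 eta) * jac gen x y.
Proof.
rewrite /form_val big_map mulr_suml big_seq [RHS]big_seq.
apply: eq_bigr => -[[h a] b] /on_eta [oh oa ob] /=.
rewrite !fval_pullback // -mulrA -(bracket_jac indxy genxy) //.
exact: jac_bracket.
Qed.

End Pullback.

(** * Divisors on the plane *)

(** The cyclic successor: with it the three components of a cross product share one formula. *)
Definition nx (i : 'I_3) : 'I_3 := inord (i.+1 %% 3).

Lemma nx0 : nx 0 = inord 1. Proof. by []. Qed.
Lemma nx1 : nx (inord 1) = inord 2. Proof. by rewrite /nx inordK. Qed.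
Lemma nx2 : nx (inord 2) = 0. Proof. by rewrite /nx inordK //; apply: val_inj; rewrite /= inordK. Qed.

Lemma sum_nx (V : nmodType) (f : 'I_3 -> V) i : \sum_j f j = f i + f (nx i) + f (nx (nx i)).
Proof.
have E : \sum_j f j = f 0 + f (inord 1) + f (inord 2).
  rewrite !big_ord_recl big_ord0 addr0 addrA; congr (_ + f _ + f _); apply: val_inj;
  by rewrite /= inordK.
rewrite E; move: i; apply: ord3P; rewrite ?nx0 ?nx1 ?nx2 //.
  by rewrite -addrA addrC.
by rewrite addrC addrA.
Qed.

Lemma nx_cases (i : 'I_3) (A : 'I_3 -> Prop) : A i -> A (nx i) -> A (nx (nx i)) -> forall j, A j.
Proof.
move=> h0 h1 h2; apply: ord3P; move: i h0 h1 h2; apply: ord3P; rewrite ?nx0 ?nx1 ?nx2 ?nx0 ?nx1 //.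
Qed.

Lemma nxK i : nx (nx (nx i)) = i.
Proof. by move: i; apply: ord3P; rewrite ?nx0 ?nx1 ?nx2 ?nx0 ?nx1 ?nx2. Qed.

Definition cross (R : comNzRingType) (A B : 'I_3 -> R) i : R :=
  A (nx i) * B (nx (nx i)) - A (nx (nx i)) * B (nx i).

(** A vector orthogonal to A and B is proportional to their cross product; cross-multiplying keeps
    this valid in any commutative ring. *)
Lemma cross_prop (R : comNzRingType) (A B X : 'I_3 -> R) i j :
  \sum_i A i * X i = 0 -> \sum_i B i * X i = 0 -> cross A B i * X j = cross A B j * X i.
Proof.
move=> hA hB.
have step k : cross A B k * X (nx k) = cross A B (nx k) * X k.
  apply/eqP; rewrite -subr_eq0; apply/eqP.
  transitivity (B (nx (nx k)) * \sum_i A i * X i - A (nx (nx k)) * \sum_i B i * X i).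
    by rewrite !(sum_nx _ k) /cross nxK; ring.
  by rewrite hA hB !mulr0 subrr.
by move: j; apply: (nx_cases (i := i)) => //; have := step (nx (nx i)); rewrite nxK => <-.
Qed.

Lemma lagrange (R : comNzRingType) (A B w1 w2 : 'I_3 -> R) :
  (\sum_i A i * w1 i) * (\sum_i B i * w2 i) - (\sum_i A i * w2 i) * (\sum_i B i * w1 i) =
  \sum_i cross A B i * cross w1 w2 i.
Proof. by rewrite !(sum_nx _ 0) /cross !nxK; ring. Qed.

Lemma mderivXU (F : fieldType) m (i j : 'I_m) : ('X_j : {mpoly F[m]})^`M(i) = (i == j)%:R%:MP.
Proof.
rewrite mderivX mnm1E eq_sym; case: eqP => [->|_]; last by rewrite scale0r mpolyC0.
rewrite scale1r (_ : (_ - _)%MM = 0%MM) ?mpolyX0 ?mpolyC1 //.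
by apply/mnmP => k; rewrite mnmBE subnn mnm0E.
Qed.

Section PlaneDivisors.
Variables (C : numClosedFieldType) (K : fieldType) (iota : {rmorphism C -> K}).
Local Notation hev := (hev iota).
Variables x y : K.
Hypothesis ind : indep iota x y.
Hypothesis gen : gens iota x y.
Local Notation ddx := (ddx gen).
Local Notation ddy := (ddy gen).
Local Notation jac := (jac gen).
Local Notation P2 := (projspace C 2).
Local Notation fval := (fval iota x y (idmap C)).
Local Notation form_val := (form_val gen (idmap C)).
Implicit Types (f g u : ratfun C 2) (v w : 'rV[C]_3).

Lemma fvalE f : fval f = hev (pt3 x y) f.1 / hev (pt3 x y) f.2.
Proof. by rewrite /fval psi_idmap. Qed.

Lemma plane_on f : ratfun_on P2 f -> hev (pt3 x y) f.2 != 0.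
Proof.
by move=> [[d [_ hd]] nv]; apply/eqP => z; apply: nv; apply/(vanish_plane ind hd).
Qed.

Lemma plane_onI d f : f.1 \is d.-homog -> f.2 \is d.-homog -> hev (pt3 x y) f.2 != 0 ->
  ratfun_on P2 f.
Proof.
by move=> h1 h2 z; split; [exists d|move/(vanish_plane ind h2)/eqP; rewrite (negPf z)].
Qed.

Lemma plane_eq f g : ratfun_on P2 f -> ratfun_on P2 g -> ratfun_eq P2 f g <-> fval f = fval g.
Proof.
move=> onf ong; have f2 := plane_on onf; have g2 := plane_on ong.
case: onf => [[d [f1h f2h]] _]; case: ong => [[e [g1h g2h]] _].
have hh : f.1 * g.2 - g.1 * f.2 \is (d + e).-homog.
  by apply: rpredB; [exact: dhomogM|rewrite addnC; exact: dhomogM].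
rewrite /ratfun_eq; split=> [/(vanish_plane ind hh)|E].
  rewrite hevB !hevM => /eqP; rewrite subr_eq0 => /eqP E.
  rewrite !fvalE; apply: (mulIf f2); rewrite divfK //; apply: (mulIf g2); rewrite E; field.
  exact: g2.
apply/(vanish_plane ind hh); move: E; rewrite !fvalE hevB !hevM => E.
apply/eqP; rewrite subr_eq0 -[hev _ f.1](divfK f2) E; apply/eqP; field; exact: g2.
Qed.

Lemma rmul_on f g : ratfun_on P2 f -> ratfun_on P2 g -> ratfun_on P2 (rmul f g).
Proof.
move=> onf ong; have f2 := plane_on onf; have g2 := plane_on ong.
case: onf => [[d [f1h f2h]] _]; case: ong => [[e [g1h g2h]] _].
by apply: (@plane_onI (d + e)); rewrite /= ?hevM ?mulf_neq0 //; exact: dhomogM.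
Qed.

Lemma rinv_on f : ratfun_on P2 f -> fval f != 0 -> ratfun_on P2 (rinv f).
Proof.
move=> [[d [h1 h2]] _]; rewrite fvalE mulf_eq0 negb_or => /andP [z _].
exact: (plane_onI (d := d)).
Qed.

Lemma fvalM f g : fval (rmul f g) = fval f * fval g.
Proof. by rewrite !fvalE /= !hevM mulf_div. Qed.

Lemma fvalV f : fval (rinv f) = (fval f)^-1.
Proof. by rewrite !fvalE invf_div. Qed.

Lemma hev_at (p : {mpoly C[3]}) d v : p \is d.-homog -> p.@[v 0] != 0 -> hev (pt3 x y) p != 0.
Proof. by move=> hp; apply: contra_neq => z; exact: (hev_pt0_all ind hp z). Qed.

Lemma unit_ratio d v (p q : {mpoly C[3]}) : p \is d.-homog -> q \is d.-homog ->
  p.@[v 0] != 0 -> q.@[v 0] != 0 -> unit_at P2 v (p, q).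
Proof.
move=> hp hq pv qv; have on1 : ratfun_on P2 (p, q).
  by apply: (@plane_onI d) => //=; exact: (hev_at hq qv).
by split=> //; exists (p, q); split=> //; apply/plane_eq.
Qed.

Lemma unit_fval v u : unit_at P2 v u -> fval u != 0.
Proof.
move=> [onu [g [ong E g1 g2]]]; have /(plane_eq onu ong) -> := E.
case: ong => [[d [h1 h2]] _]; rewrite fvalE mulf_neq0 ?invr_eq0 //; first exact: (hev_at h1 g1).
exact: (hev_at h2 g2).
Qed.

Lemma unit_mul v f g : unit_at P2 v f -> unit_at P2 v g -> unit_at P2 v (rmul f g).
Proof.
move=> [onf [f' [onf' Ef f1 f2]]] [ong [g' [ong' Eg g1 g2]]].
split; first exact: rmul_on.
exists (rmul f' g'); split; rewrite /= ?mevalM ?mulf_neq0 //; first exact: rmul_on.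
apply/plane_eq; try exact: rmul_on.
by rewrite !fvalM; have /(plane_eq onf onf') -> := Ef; have /(plane_eq ong ong') -> := Eg.
Qed.

Lemma unit_inv v f : unit_at P2 v f -> unit_at P2 v (rinv f).
Proof.
move=> hu; have fz := unit_fval hu; move: hu => [onf [f' [onf' Ef f1 f2]]].
have Ev : fval f = fval f' by apply/plane_eq.
have on1 : ratfun_on P2 (rinv f) by exact: rinv_on.
have on2 : ratfun_on P2 (rinv f') by apply: rinv_on => //; rewrite -Ev.
by split=> //; exists (rinv f'); split=> //; apply/plane_eq => //; rewrite !fvalV Ev.
Qed.

Definition numer f i : {mpoly C[3]} := f.2 * f.1^`M(i) - f.1 * f.2^`M(i).

Lemma numer_orth d f : f.1 \is d.-homog -> f.2 \is d.-homog -> \sum_i numer f i * 'X_i = 0.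
Proof.
move=> h1 h2.
transitivity (f.2 * \sum_i f.1^`M(i) * 'X_i - f.1 * \sum_i f.2^`M(i) * 'X_i).
  by rewrite !mulr_sumr -sumrB; apply: eq_bigr => i _; rewrite /numer; ring.
by rewrite (mpoly_euler h1) (mpoly_euler h2) -!scalerAr [f.2 * _]mulrC subrr.
Qed.

Lemma rdiff_numer f v w : rdiff f v w = (\sum_i (numer f i).@[v 0] * w 0 i) / f.2.@[v 0] ^+ 2.
Proof.
rewrite /rdiff /differential !mulr_sumr -sumrB; congr (_ / _); apply: eq_bigr => i _.
by rewrite /numer mevalB !mevalM; ring.
Qed.

Lemma ddx_hev p : ddx (hev (pt3 x y) p) = hev (pt3 x y) p^`M(inord 1).
Proof.
have hx := ddx_deriv ind gen.
have Ex : ddx x = 1.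
  by have := ddx_ev ind gen 'X%:P; rewrite evC ev1X dX_polyC derivX ev_1.
have Ey : ddx y = 0 by have := ddx_ev ind gen 'X; rewrite evY dX_X ev0.
by rewrite (hev_deriv _ _ hx) (sum_nx _ 0) nx0 nx1 pt3_0 pt3_1 pt3_2 (d1 hx) Ex Ey !mulr0 mulr1 add0r addr0.
Qed.

Lemma ddy_hev p : ddy (hev (pt3 x y) p) = hev (pt3 x y) p^`M(inord 2).
Proof.
have hy := ddy_deriv ind gen.
have Ex : ddy x = 0.
  by have := ddy_ev ind gen 'X%:P; rewrite evC ev1X derivC ev0.
have Ey : ddy y = 1.
  by have := ddy_ev ind gen 'X; rewrite evY derivX ev_1.
by rewrite (hev_deriv _ _ hy) (sum_nx _ 0) nx0 nx1 pt3_0 pt3_1 pt3_2 (d1 hy) Ex Ey !mulr0 mulr1 !add0r.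
Qed.

Lemma hev_cross (A B : 'I_3 -> {mpoly C[3]}) i :
  hev (pt3 x y) (cross A B i) = cross (fun j => hev (pt3 x y) (A j)) (fun j => hev (pt3 x y) (B j)) i.
Proof. by rewrite /cross hevB !hevM. Qed.

(* {a, b} X_i^3: by Euler's relation the cross product of the gradients of a and
   b is proportional to X. *)
Definition jac_unit a b i : ratfun C 2 :=
  (cross (numer a) (numer b) i * 'X_i ^+ 2, (a.2 * b.2) ^+ 2).

Lemma fval_jac_unit a b i : ratfun_on P2 a -> ratfun_on P2 b ->
  fval (jac_unit a b i) = jac (fval a) (fval b) * pt3 x y i ^+ 3.
Proof.
move=> ona onb; have a2 := plane_on ona; have b2 := plane_on onb.
case: ona => [[da [ha1 ha2]] _]; case: onb => [[db [hb1 hb2]] _].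
have hx := ddx_deriv ind gen; have hy := ddy_deriv ind gen.
have orth f d : f.1 \is d.-homog -> f.2 \is d.-homog ->
    \sum_j hev (pt3 x y) (numer f j) * pt3 x y j = 0.
  move=> h1 h2; have := congr1 (hev (pt3 x y)) (numer_orth h1 h2).
  rewrite hev_sum hev0 => E; rewrite -[RHS]E; apply: eq_bigr => j _; by rewrite hevM hevX.
have cp := cross_prop i 0 (orth _ _ ha1 ha2) (orth _ _ hb1 hb2).
rewrite pt3_0 mulr1 in cp.
rewrite [LHS]fvalE /= !(hevXn, hevM) hev_cross hevX cp /cross nx0 nx1 /jac.
rewrite !fvalE !(ddiv hx) // !(ddiv hy) // !ddx_hev !ddy_hev /numer !hevB !hevM.
move: a2 b2; move: (hev _ a.2) (hev _ b.2) => u w u0 w0; field; by rewrite u0 w0.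
Qed.

(** The cross product of the gradients is proportional to v, so if its component i were zero it
    would vanish altogether, and with it, by [lagrange], the Jacobian of the local coordinates. *)
Lemma jac_unit_at v a b i : local_coords P2 v a b -> v 0 i != 0 -> unit_at P2 v (jac_unit a b i).
Proof.
move=> [[ona onb] a2 b2 [w1 [w2 [_ _ det]]]] vi.
case: ona => [[da [ha1 ha2]] _]; case: onb => [[db [hb1 hb2]] _].
pose A j := (numer a j).@[v 0]; pose B j := (numer b j).@[v 0].
have orth f d : f.1 \is d.-homog -> f.2 \is d.-homog ->
    \sum_j (numer f j).@[v 0] * v 0 j = 0.
  move=> h1 h2; have := congr1 (meval (v 0)) (numer_orth h1 h2).
  rewrite raddf_sum meval0 => E; rewrite -[RHS]E; apply: eq_bigr => j _; by rewrite /= mevalM mevalXU.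
have ci : cross A B i != 0.
  apply: contraNneq det => z.
  have z' j : cross A B j = 0.
    apply: (mulIf vi); rewrite mul0r (cross_prop j i (orth _ _ ha1 ha2) (orth _ _ hb1 hb2)).
    by rewrite z mul0r.
  have := lagrange A B (w1 0) (w2 0); rewrite [RHS]big1 => [L|j _]; last by rewrite z' mul0r.
  by rewrite !rdiff_numer !mulf_div [_.@[_] ^+ 2 * _]mulrC -mulrBl L mul0r.
have Ec : (cross (numer a) (numer b) i).@[v 0] = cross A B i.
  by rewrite /cross mevalB !mevalM.
have hn f d j : f.1 \is d.+1.-homog -> f.2 \is d.+1.-homog -> numer f j \is (d.+1 + d).-homog.
  by move=> h1 h2; apply: rpredB; apply: dhomogM => //; exact: (@dhomog_mderiv _ _ d.+1).
have n0 f j : f.1 \is 0.-homog -> f.2 \is 0.-homog -> numer f j = 0.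
  by move=> h1 h2; rewrite /numer (mderiv_homog0 _ h1) (mderiv_homog0 _ h2) !mulr0 subrr.
(* Degree 0 is separated because a partial derivative then has no degree one lower; constants have
   zero gradient anyway. *)
case: da ha1 ha2 => [|da] ha1 ha2.
  by move: ci; rewrite -Ec /cross !(n0 _ _ ha1 ha2) !mul0r subrr meval0 eqxx.
case: db hb1 hb2 => [|db] hb1 hb2.
  by move: ci; rewrite -Ec /cross !(n0 _ _ hb1 hb2) !mulr0 subrr meval0 eqxx.
apply: (@unit_ratio ((da.+1 + db.+1) * 2)).
- have -> : ((da.+1 + db.+1) * 2 = (da.+1 + da + (db.+1 + db)) + 2)%N by lia.
  apply: dhomogM; last exact: dhomog_Xn.
  by apply: rpredB; apply: dhomogM; exact: hn.
- by apply: dhomogMn; exact: dhomogM.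
- by rewrite mevalM Ec rmorphXn /= mevalXU mulf_neq0 ?expf_neq0.
- by rewrite rmorphXn /= mevalM expf_neq0 ?mulf_neq0.
Qed.

Lemma plane_tangent v w : tangent P2 v w.
Proof.
move=> p /ishomogP [d hp] /(vanish_plane ind hp) z; rewrite /differential big1 // => i _.
suff h : hev (pt3 x y) p^`M(i) = 0 by rewrite (hev_pt0_all ind (dhomog_mderiv i hp) h) mul0r.
have z1 : hev (pt3 x y) p^`M(inord 1) = 0 by rewrite -ddx_hev z (d0 (ddx_deriv ind gen)).
have z2 : hev (pt3 x y) p^`M(inord 2) = 0 by rewrite -ddy_hev z (d0 (ddy_deriv ind gen)).
move: i; apply: ord3P => //.
have := congr1 (hev (pt3 x y)) (mpoly_euler hp); rewrite hev_sum hevZ z mulr0 (sum_nx _ 0) nx0 nx1.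
by rewrite !hevM z1 z2 !mul0r !addr0 hevX pt3_0 mulr1.
Qed.

Lemma nx_neq i : [/\ nx i != i, nx (nx i) != i & nx (nx i) != nx i].
Proof.
by move: i; apply: ord3P; rewrite ?nx0 ?nx1 ?nx2 ?nx0 ?nx1; split; rewrite -val_eqE /= ?inordK.
Qed.

Lemma standard_coords v i : v 0 i != 0 ->
  local_coords P2 v ('X_(nx i), 'X_i) ('X_(nx (nx i)), 'X_i).
Proof.
move=> vi; have hX j : ('X_j : {mpoly C[3]}) \is 1.-homog by rewrite dhomogX /= mdeg1.
have Xi : hev (pt3 x y) 'X_i != 0 by apply: (hev_at (hX i) (v := v)); rewrite mevalXU.
split; rewrite /= ?mevalXU //.
  by split; apply: (plane_onI (d := 1%N)) => //=; exact: hX.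
exists (delta_mx 0 (nx i)), (delta_mx 0 (nx (nx i))); split; try exact: plane_tangent.
have [n1 n2 n3] := nx_neq i.
have D j k : differential ('X_j : {mpoly C[3]}) v (delta_mx 0 k) = (k == j)%:R.
  rewrite /differential (bigD1 k) //= big1 => [|l lk].
    by rewrite mderivXU mevalC mxE !eqxx mulr1 addr0.
  by rewrite mxE (negPf lk) andbF mulr0.
rewrite /rdiff /= !D !mevalXU !eqxx (negPf n1) (negPf n2) (negPf n3) [nx i == _]eq_sym (negPf n3).
rewrite !mulr0 !mulr1 !subr0 !mul0r subr0 mulf_neq0 // mulf_neq0 ?invr_eq0 ?expf_neq0 //.
Qed.

Lemma form_val1 h a b : form_val [:: (h, a, b)] = fval h * jac (fval a) (fval b).
Proof. by rewrite /form_val big_seq1. Qed.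

(** The form is dx /\ dy / G(1, x, y). By [jac_unit] the bracket of local coordinates at v is a unit
    divided by X_i^3, so its local equations of poles are G / X_i^3 up to units: the degree 3 is the
    anticanonical degree of the plane. *)
Lemma plane_divisor e (G : {mpoly C[3]}) : twoform_on P2 e -> G \is 3.-homog ->
  form_val e * hev (pt3 x y) G = 1 ->
  divisor_eq P2 (divisor_opp (Div P2 e)) (form_divisor P2 3 G).
Proof.
move=> one hG EG v onv f onf.
have [i vi] : exists i, v 0 i != 0.
  apply/not_notP => H; case/eqP: onv.1; apply/rowP => j; rewrite mxE; apply/eqP.
  by apply/not_notP => /negP vj; apply: H; exists j.
have G0 : hev (pt3 x y) G != 0 by apply: contra_eq_neq EG => ->; rewrite mulr0 eq_sym oner_neq0.
have bP := idmap_birational ind; have iP := plane_irreducible ind.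
have Xi : pt3 x y i != 0.
  by rewrite -(hevX iota); apply: (hev_at (d := 1%N) (v := v)); rewrite ?dhomogX /= ?mdeg1 ?mevalXU.
split.
- move=> [onrf [a [b [u [lc uu eqe]]]]]; split=> //.
  have [[ona onb] _ _ _] := lc.
  have onu : ratfun_on P2 u by case: uu.
  have onh : twoform_on P2 [:: (rmul (rinv f) u, a, b)].
    by move=> h a' b'; rewrite inE => /eqP [-> -> ->]; split=> //; exact: rmul_on.
  have := twoform_eq_val ind gen bP iP (wf_twoform ind bP iP one) (wf_twoform ind bP iP onh) eqe.
  rewrite form_val1 fvalM fvalV => Ee.
  have f0 : fval f != 0.
    rewrite fvalE mulf_neq0 ?invr_eq0 //; [exact: (plane_on onrf)|exact: plane_on].
  have uU := jac_unit_at lc vi.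
  exists ('X_i ^+ 3), (rmul u (jac_unit a b i)); split.
  + exact: dhomog_Xn.
  + by rewrite rmorphXn /= mevalXU expf_neq0.
  + exact: unit_mul.
  + have onU : ratfun_on P2 (jac_unit a b i) by case: uU.
    have onG : ratfun_on P2 (G, 'X_i ^+ 3).
      by apply: (plane_onI (d := 3)) => //=; rewrite ?hevXn ?hevX ?expf_neq0 //; exact: dhomog_Xn.
    apply/plane_eq => //; first by apply: rmul_on => //; exact: rmul_on.
    rewrite !fvalM fval_jac_unit // [fval (G, _)]fvalE /= hevXn hevX.
    have Ej : fval u * jac (fval a) (fval b) * hev (pt3 x y) G = fval f.
      have := EG; rewrite Ee => E1; apply: (mulfI (invr_neq0 f0)); rewrite mulVf // -E1; ring.
    rewrite -[LHS]Ej; field; exact: Xi.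
- move=> [_ [q [u [hq qv uu eqf]]]].
  have onu : ratfun_on P2 u by case: uu.
  have q0 : hev (pt3 x y) q != 0 by exact: (hev_at hq qv).
  have onG : ratfun_on P2 (G, q) by exact: (plane_onI (d := 3)).
  have u0 := unit_fval uu.
  have Ef : fval f = hev (pt3 x y) G / hev (pt3 x y) q * fval u.
    have /(plane_eq onf (rmul_on onG onu)) -> := eqf.
    by rewrite fvalM fvalE.
  have f0 : fval f != 0 by rewrite Ef; apply: mulf_neq0 => //; rewrite mulf_neq0 ?invr_eq0.
  have onrf := rinv_on onf f0.
  have lc := standard_coords vi; set a := (_, _) in lc; set b := (_, _) in lc.
  have [[ona onb] _ _ _] := lc.
  have uU := jac_unit_at lc vi.
  have u1 : unit_at P2 v ('X_i ^+ 3, q).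
    by apply: (unit_ratio (d := 3)) => //; [exact: dhomog_Xn|rewrite rmorphXn /= mevalXU expf_neq0].
  have uw := unit_mul uu (unit_mul u1 (unit_inv uU)).
  split=> //; exists a, b, (rmul u (rmul ('X_i ^+ 3, q) (rinv (jac_unit a b i)))); split=> //.
  apply: (plane_twoform_eq ind (gen := gen)) => //.
    by move=> h a' b'; rewrite inE => /eqP [-> -> ->]; split=> //; apply: rmul_on => //; case: uw.
  rewrite form_val1 !fvalM !fvalV fval_jac_unit // [fval (_ ^+ 3, _)]fvalE /= hevXn hevX Ef.
  have J0 : jac (fval a) (fval b) != 0.
    by have := unit_fval uU; rewrite fval_jac_unit // mulf_eq0 negb_or => /andP [].
  have -> : form_val e = (hev (pt3 x y) G)^-1 by rewrite -[RHS]mul1r -EG mulfK.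
  by field; rewrite G0 q0 u0 J0 Xi.
Qed.

Definition cubic (h : {poly C}) : {mpoly C[3]} :=
  'X_0 * 'X_(inord 2) * 'X_(inord 2) - ((h`_0)%:MP * 'X_0 * 'X_0 * 'X_0 + (h`_1)%:MP * 'X_0 * 'X_0 * 'X_(inord 1)
   + (h`_2)%:MP * 'X_0 * 'X_(inord 1) * 'X_(inord 1) + (h`_3)%:MP * 'X_(inord 1) * 'X_(inord 1) * 'X_(inord 1)).

Lemma cubic_homog h : cubic h \is 3.-homog.
Proof.
have hX j : ('X_j : {mpoly C[3]}) \is 1.-homog by rewrite dhomogX /= mdeg1.
have H (a b c : 'I_3) : ('X_a * 'X_b * 'X_c : {mpoly C[3]}) \is 3.-homog.
  exact: (dhomogM (dhomogM (hX a) (hX b)) (hX c)).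
have Hc (z : C) (a b c : 'I_3) : (z%:MP * 'X_a * 'X_b * 'X_c : {mpoly C[3]}) \is 3.-homog.
  by rewrite -mulrA -mulrA mul_mpolyC mulrA; apply: rpredZ.
by rewrite /cubic; apply: rpredB => //; apply: rpredD => //; apply: rpredD => //; apply: rpredD.
Qed.

Lemma hev_cubic (h : {poly C}) : (size h <= 4)%N -> hev (pt3 x y) (cubic h) = y ^+ 2 - ev1 iota x h.
Proof.
move=> sh; rewrite (ev1_sum_wide _ _ sh) !big_ord_recl big_ord0 /= /cubic.
rewrite !(hevB, hevD, hevM, hevX, hevC) pt3_0 pt3_1 pt3_2 /bump /=; ring.
Qed.

(** The only point at infinity is (0 : 0 : 1), where the derivative in X_0 does not vanish; a
    singular affine point would lie on y = 0 over a double root of h. *)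
Lemma cubic_smooth (h : {poly C}) : size h = 4%N -> (forall r, h.[r] = 0 -> h^`().[r] != 0) ->
  smooth_form (cubic h).
Proof.
move=> sh sq v v0.
have h3 : h`_3 != 0 by have := lead_coef_eq0 h; rewrite /lead_coef sh -size_poly_eq0 sh /= => ->.
have Eh r : h.[r] = h`_0 + h`_1 * r + h`_2 * r ^+ 2 + h`_3 * r ^+ 3.
  by rewrite (@horner_coef_wide _ 4) ?sh // !big_ord_recl big_ord0 /= /bump /=; ring.
have Ed r : h^`().[r] = h`_1 + h`_2 * 2%:R * r + h`_3 * 3%:R * r ^+ 2.
  rewrite (@horner_coef_wide _ 3) ?size_deriv ?sh //; last by have := lt_size_deriv (p := h); rewrite -size_poly_eq0 sh; move/(_ isT).
  by rewrite !big_ord_recl big_ord0 /= /bump /= !coef_deriv /= !mulr_natr !mulr1n expr0 expr1; ring.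
pose a := v 0 0; pose b := v 0 (inord 1); pose c := v 0 (inord 2).
have e01 : (0 == inord 1 :> 'I_3) = false by rewrite -val_eqE /= inordK.
have e02 : (0 == inord 2 :> 'I_3) = false by rewrite -val_eqE /= inordK.
have e12 : (inord 1 == inord 2 :> 'I_3) = false by rewrite -val_eqE /= !inordK.
have e10 : (inord 1 == 0 :> 'I_3) = false by rewrite eq_sym.
have e20 : (inord 2 == 0 :> 'I_3) = false by rewrite eq_sym.
have e21 : (inord 2 == inord 1 :> 'I_3) = false by rewrite eq_sym.
have D0 : (cubic h)^`M(0).@[v 0] = c ^+ 2 - (3%:R * h`_0 * a ^+ 2 + 2%:R * h`_1 * a * b + h`_2 * b ^+ 2).
  rewrite /cubic !(mderivB, mderivD, mderivM, mderivC, mderivXU) !eqxx ?e01 ?e02.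
  rewrite !(mevalB, mevalD, mevalM, mevalC, mevalXU, meval0) /= -/a -/b -/c; ring.
have D1 : (cubic h)^`M(inord 1).@[v 0] = - (h`_1 * a ^+ 2 + 2%:R * h`_2 * a * b + 3%:R * h`_3 * b ^+ 2).
  rewrite /cubic !(mderivB, mderivD, mderivM, mderivC, mderivXU) !eqxx ?e10 ?e12.
  rewrite !(mevalB, mevalD, mevalM, mevalC, mevalXU, meval0) /= -/a -/b -/c; ring.
have D2 : (cubic h)^`M(inord 2).@[v 0] = 2%:R * a * c.
  rewrite /cubic !(mderivB, mderivD, mderivM, mderivC, mderivXU) !eqxx ?e20 ?e21.
  rewrite !(mevalB, mevalD, mevalM, mevalC, mevalXU, meval0) /= -/a -/b -/c; ring.
have E : (cubic h).@[v 0] = a * c ^+ 2 - (h`_0 * a ^+ 3 + h`_1 * a ^+ 2 * b + h`_2 * a * b ^+ 2 + h`_3 * b ^+ 3).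
  by rewrite /cubic !(mevalB, mevalD, mevalM, mevalC, mevalXU) -/a -/b -/c; ring.
rewrite E => Ez; have [az|an] := eqVneq a 0.
  have b0 : b = 0.
    rewrite az in Ez; have : h`_3 * b ^+ 3 = 0 by rewrite -[RHS]oppr0 -[in RHS]Ez; ring.
    by move/eqP; rewrite mulf_eq0 (negPf h3) expf_eq0 /= => /eqP.
  have cn : c != 0.
    apply: contraNneq v0 => cz; apply/eqP/rowP; apply: ord3P; rewrite mxE //.
  by exists 0; rewrite D0 az b0 !expr0n /= !mulr0 !addr0 subr0 expf_neq0.
have [cz|cn] := eqVneq c 0; last first.
  by exists (inord 2); rewrite D2 !mulf_neq0 ?pnatr_eq0.
have hr : h.[b / a] = 0.
  rewrite Eh; apply: (mulIf (expf_neq0 3 an)); rewrite mul0r.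
  transitivity (h`_0 * a ^+ 3 + h`_1 * a ^+ 2 * b + h`_2 * a * b ^+ 2 + h`_3 * b ^+ 3).
    by field.
  by rewrite -[RHS]oppr0 -[in RHS]Ez cz; ring.
exists (inord 1); rewrite D1 oppr_eq0; apply: contra_neq (sq _ hr) => z.
rewrite Ed; apply: (mulIf (expf_neq0 2 an)); rewrite mul0r -[RHS]z; field.
exact: an.
Qed.

End PlaneDivisors.

(** * Classification *)

Lemma tofrac_ratio (R : idomainType) (f : {fraction R}) :
  exists p q : R, q != 0 /\ f = FracField.tofrac p / FracField.tofrac q.
Proof.
elim/quotW: f => r.
exists (\n_r), (\d_r); have d0 := denom_ratioP r; split=> //.
have td : FracField.tofrac \d_r != 0 by rewrite tofrac_eq0.
apply: (mulIf td); rewrite divfK // -[LHS]/(FracField.mul _ _).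
unlock FracField.tofrac; rewrite -[LHS]FracField.pi_mul.
apply/eqmodP; rewrite /= FracField.equivfE /FracField.mulf !numden_Ratio ?mulf_neq0 ?oner_neq0 //.
by rewrite !mulr1 mulrC.
Qed.

(** * The function field of the plane as a field of fractions *)

Section RationalFunctionField.
Variable C : numClosedFieldType.

Let K : fieldType := {fraction {poly {poly C}}}.

Definition const_frac (c : C) : K := FracField.tofrac c%:P%:P.

Lemma const_frac_zmod : zmod_morphism const_frac.
Proof. by move=> a b; rewrite /const_frac !rmorphB. Qed.
Lemma const_frac_monoid : monoid_morphism const_frac.
Proof. by split=> [|a b]; rewrite /const_frac ?rmorph1 // !rmorphM. Qed.
HB.instance Definition _ := GRing.isZmodMorphism.Build C K const_frac const_frac_zmod.
HB.instance Definition _ := GRing.isMonoidMorphism.Build C K const_frac const_frac_monoid.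

Definition frac_x : K := FracField.tofrac ('X%:P : {poly {poly C}}).
Definition frac_y : K := FracField.tofrac ('X : {poly {poly C}}).
Definition frac_iota : {rmorphism C -> K} := const_frac.

Lemma ev_tofrac p : ev frac_iota frac_x frac_y p = FracField.tofrac p.
Proof.
elim/poly_ind: p => [|p c IH]; first by rewrite ev0 rmorph0.
rewrite evD evM evY evC IH rmorphD rmorphM; congr (_ + _).
elim/poly_ind: c => [|c a IHc]; first by rewrite ev10 !rmorph0.
by rewrite ev1D ev1M ev1X ev1C IHc !rmorphD !rmorphM.
Qed.

Lemma frac_indep : indep frac_iota frac_x frac_y.
Proof. by move=> p; rewrite ev_tofrac => /eqP; rewrite tofrac_eq0 => /eqP. Qed.

Lemma frac_gens : gens frac_iota frac_x frac_y.
Proof.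
by move=> f; have [p [q [q0 E]]] := tofrac_ratio f; exists p, q; rewrite !ev_tofrac tofrac_eq0.
Qed.

End RationalFunctionField.

(** * From the normal form in K to a parametrization of the surface *)

Section Main.
Variables (C : numClosedFieldType) (n : nat) (S : projset C n) (psi0 : homtuple C 2 n).
Variable eta : twoform C n.
Hypothesis smooth : smooth_projective_surface S.
Hypothesis bir : birational (projspace C 2) S psi0.
Hypothesis on_eta : twoform_on S eta.
Hypothesis eff : effective S (divisor_opp (Div S eta)).
Let irr := smooth.1.
Variables (K : fieldType) (iota : {rmorphism C -> K}) (x0 y0 : K).
Hypothesis ind : indep iota x0 y0.
Hypothesis gen : gens iota x0 y0.
Local Notation jac := (jac gen).
Local Notation Q := (form_val gen psi0 eta).
Let hbr : bracket iota jac := jac_bracket ind gen.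

(** One point of the surface suffices: there Q F is the bracket of local coordinates, which is
    nonzero. *)
Lemma form_val_neq0 : Q != 0.
Proof.
have [P [EP _]] := psi_polys iota x0 y0 psi0.
have [k pk] := psi_nz ind bir.
have /poly2_nz [c1 [c2 hc]] : P k != 0 by apply: contraNneq pk => z; rewrite EP z ev0.
have [|i||O [a [b [F [_ _ _ [_ _ ab0] [_ [_ _ E]]]]]]] :=
  @local_structure _ _ _ _ _ ind gen _ _ _ _ smooth bir on_eta eff _ _ 1 P c1 c2 k (jac_cd ind gen).
- exact: oner_neq0.
- by rewrite mul1r.
- exact: hc.
- by apply: contra_neq ab0 => z; rewrite -E z mul0r.
Qed.

Lemma surface_normal_form : normal_form iota jac Q.
Proof.
have Q0 := form_val_neq0.
have [|x [y [p [hc E [[m hp]|hp]]]]] := zero_free_polynomial hbr (jac_cd ind gen) Q0 (psi_generate ind gen bir).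
- move=> x y r lam hc lam0 Er c1 c2 k rk.
  have [O [a [b [F [h1 h2 h3 h4 [h5 [OF F0 EF]]]]]]] :=
    @local_structure _ _ _ _ _ ind gen _ _ _ _ smooth bir on_eta eff _ _ lam r c1 c2 k hc lam0 Er rk.
  exists O, a, b; split=> //; split=> //.
  by rewrite -EF mulrC mulKf.
- exact: (normal_ruled hbr Q0 hc E hp).
- exact: (normal_plane hbr Q0 hc E hp).
Qed.

Lemma aff_x_on : ratfun_on (projspace C 2) (aff_x C).
Proof.
apply: (plane_onI ind (d := 1%N)); rewrite ?dhomogX /= ?mdeg1 //.
by rewrite hevX pt3_0 oner_neq0.
Qed.

Lemma aff_y_on : ratfun_on (projspace C 2) (aff_y C).
Proof.
apply: (plane_onI ind (d := 1%N)); rewrite ?dhomogX /= ?mdeg1 //.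
by rewrite hevX pt3_0 oner_neq0.
Qed.

Lemma aff_const_on c : ratfun_on (projspace C 2) (aff_const c).
Proof.
apply: (plane_onI ind (d := 0%N)); rewrite /= ?dhomog1 //.
  by rewrite -[c%:MP]mulr1 mul_mpolyC rpredZ ?dhomog1.
by rewrite -mpolyC1 hevC rmorph1 oner_neq0.
Qed.

Lemma zero_free_pullback : exists psi1 : homtuple C 2 n,
  birational (projspace C 2) S psi1 /\
  [\/ exists F : {mpoly C[3]}, [/\ F \is 3.-homog, smooth_form F &
        divisor_eq (projspace C 2)
          (divisor_opp (Div (projspace C 2) (twoform_pullback psi1 eta)))
          (form_divisor (projspace C 2) 3 F)],
      exists c : C, c != 0 /\
        twoform_eq (projspace C 2) (twoform_pullback psi1 eta) (dxdy_over_xy c)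
    | twoform_eq (projspace C 2) (twoform_pullback psi1 eta) dxdy].
Proof.
have Q0 := form_val_neq0.
have [x [y [hc nf]]] := surface_normal_form.
have [indxy genxy] := cd_coord hbr hc.
have [d [psi1 [t [t0 h1 E1]]]] := homogeneous_coords x0 y0 psi0 genxy.
have onE := twoform_pullback_on ind irr bir on_eta indxy t0 h1 E1.
have EQ := form_val_pullback ind gen on_eta indxy genxy t0 E1.
exists psi1; split; first exact: (new_birational ind gen irr bir indxy t0 h1 E1).
set e := twoform_pullback psi1 eta in onE EQ *.
have W : form_val genxy (idmap C) e * (jac x y / Q) = 1.
  by rewrite mulrA -EQ divff.
have fx : fval iota x y (idmap C) (aff_x C) = x.
  by rewrite fvalE /= !hevX pt3_1 pt3_0 divr1.
have fy : fval iota x y (idmap C) (aff_y C) = y.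
  by rewrite fvalE /= !hevX pt3_2 pt3_0 divr1.
have fc c : fval iota x y (idmap C) (aff_const c) = iota c.
  by rewrite fvalE /= -mpolyC1 !hevC rmorph1 divr1.
have jxy := jac_xy indxy genxy.
have xn := cd_neq0 hbr hc; have yn := cd_neq0 hbr (cd_swap hbr hc).
case: nf => [[h [sh sq Eh]]|[b b0 Eb]|E].
- constructor 1; exists (cubic h); split.
  + exact: cubic_homog.
  + exact: cubic_smooth.
  + apply: (plane_divisor indxy (gen := genxy)) => //; first exact: cubic_homog.
    by rewrite hev_cubic ?sh // -Eh.
(* The form is dx /\ dy divided by b x y, whence the constant 1 / b. *)
- constructor 2; exists b^-1; split; first by rewrite invr_eq0.
  have onxy : ratfun_on (projspace C 2) (rinv (rmul (aff_x C) (aff_y C))).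
    apply: (rinv_on indxy); first exact: (rmul_on indxy aff_x_on aff_y_on).
    by rewrite fvalM fx fy mulf_neq0.
  apply: (plane_twoform_eq indxy (gen := genxy)) => //.
    move=> h a b'; rewrite inE => /eqP [-> -> ->]; split; [|exact: aff_x_on|exact: aff_y_on].
    by apply: (rmul_on indxy) => //; exact: aff_const_on.
  rewrite form_val1 fvalM fvalV fvalM fx fy fc jxy mulr1 fmorphV.
  have ib : iota b != 0 by rewrite iota_eq0.
  have n0 : iota b * (x * y) != 0 by rewrite !mulf_neq0.
  by apply: (mulIf n0); rewrite -{1}Eb W; field; rewrite ib xn yn.
- constructor 3; apply: (plane_twoform_eq indxy (gen := genxy)) => //.
    move=> h a b'; rewrite inE => /eqP [-> -> ->].
    by split; [exact: aff_const_on|exact: aff_x_on|exact: aff_y_on].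
  by rewrite form_val1 fx fy fc jxy rmorph1 !mulr1; have := W; rewrite E mulr1.
Qed.

End Main.
Local Open Scope complex_scope.

Theorem propositionB (R : realType) (n : nat) (S : projset R[i] n)
    (eta : twoform R[i] n) :
  smooth_projective_surface S ->
  rational_surface S ->
  twoform_on S eta ->
  ~ twoform_eq S eta [::] ->
  effective S (divisor_opp (Div S eta)) ->
  exists psi : homtuple R[i] 2 n,
    birational (projspace R[i] 2) S psi /\
    [\/ exists F : {mpoly R[i][3]},
          [/\ F \is 3.-homog, smooth_form F &
            divisor_eq (projspace R[i] 2)
              (divisor_opp (Div (projspace R[i] 2) (twoform_pullback psi eta)))
              (form_divisor (projspace R[i] 2) 3 F)],
        exists c : R[i], c != 0 /\
          twoform_eq (projspace R[i] 2) (twoform_pullback psi eta)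
            (dxdy_over_xy c)
      | twoform_eq (projspace R[i] 2) (twoform_pullback psi eta) dxdy].
Proof.
move=> smooth [psi0 bir] on_eta _ eff.
exact: (zero_free_pullback smooth bir on_eta eff (@frac_indep R[i]) (@frac_gens R[i])).
Qed.
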